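(* For each integer $N\ge 1$ let $x_1<\dots<x_N$ be distinct real numbers (depending on $N$), and let $(\lambda^i)_{1\le i\le N}$ be the solution of $$d\lambda^i_t=\frac1N\sum_{j\neq i}\frac{1}{\lambda^i_t-\lambda^j_t}\,dt+\frac{2}{\sqrt N}\,dB^i_t,\qquad \lambda^i_0=x_i,\qquad 1\le i\le N,$$ where $(B^i)_{1\le i\le N}$ are independent Brownian motions on a standard filtered probability space $(\Omega,\mathcal A,\mathcal F,\mathbb P)$. Let $$F_N(t,x)=N^{-1}\,\#\{i:\ \lambda^i_t\le x\}.$$ Assume that the empirical measure of initial conditions $\mu_N^0=\frac1N\sum_{i=1}^N\delta_{x_i}$ converges, almost surely, weakly toward a measure $\mu_0$ as $N\to\infty$. Then, almost surely, the sequence $(F_N)_{N\ge1}$ converges almost everywhere toward the unique viscosity solution $F$ of $$\partial_tF+(\partial_xF)\,\tilde H[F]=0\quad\text{in }(0,\infty)\times\mathbb R$$ which satisfies $F(0,x)=\mu_0((-\infty,x])$ for almost every $x$.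
   Context: The operator $\tilde H$ is defined on bounded functions $\phi:\mathbb R\to\mathbb R$ with bounded second order derivative by $\tilde H[\phi](x)=\int_{\mathbb R}\frac{\phi(x)-\phi(y)}{(x-y)^2}\,dy$, understood in the sense of principal value. Write $a_+=\max(a,0)$. $\mathcal C^{1,1}_b$ is the space of bounded functions with bounded second order derivatives. Viscosity solutions. Consider the equation (E+): $\partial_tF+(\partial_xF)_+\tilde H[F]=0$ in $(0,\infty)\times\mathbb R$, for functions $F:[0,\infty)\times\mathbb R\to\mathbb R$. - An upper semicontinuous (usc) $F$ is a viscosity subsolution of (E+) if for every smooth $\phi\in\mathcal C^{1,1}_b$ and every point $(t_0,x_0)\in(0,\infty)\times\mathbb R$ of strict maximum of $F-\phi$, $\partial_t\phi(t_0,x_0)+(\partial_x\phi(t_0,x_0))_+\tilde H[\phi(t_0)](x_0)\le0$. - A lower semicontinuous (lsc) $F$ is a viscosity supersolution of (E+) if for every smooth $\phi\in\mathcal C^{1,1}_b$ and every point $(t_0,x_0)\in(0,\infty)\times\mathbb R$ of strict minimum of $F-\phi$, the same expression is $\ge0$. - A viscosity solution of (E+) is a usc viscosity subsolution $F$ such that $F_*$ is a viscosity supersolution, where $F_*(t,x)=\liminf_{0\le s\to t,\,y\to x}F(s,y)$. - A function $F$ such that $F(t)=F(t,\cdot)$ is non-decreasing for all $t\ge0$ is a viscosity solution of $\partial_tF+(\partial_xF)\tilde H[F]=0$ if it is a viscosity solution of (E+).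
   Formalization: ''Unique viscosity solution'' means unique among functions bounded on [0,∞)×R for which both F(0,·) and F_*(0,·) equal μ_0((-∞,x]) for almost every x; without boundedness and the condition on F_*, uniqueness fails. The limit F is shown to satisfy both. *)

(* Defs.v *)
From HB Require Import structures.
From mathcomp Require Export all_boot all_order all_algebra.
From mathcomp Require Export all_classical all_reals all_analysis.
Export Order.TTheory GRing.Theory Num.Theory.
Export numFieldNormedType.Exports.

Set Implicit Arguments.
Unset Strict Implicit.
Unset Printing Implicit Defensive.

Global Open Scope classical_set_scope.
Global Open Scope ring_scope.

Section viscosity.
Context {R : realType}.
Local Notation mu := (@lebesgue_measure R).
Implicit Types (phi F : R * R -> R) (z : R * R).

(* Points of the plane are pairs (t, x) of a time and a position; functions on
   [0, +oo) x R are represented by functions on the plane whose values at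
   negative times are irrelevant. *)
Definition halfplane : set (R * R) := [set z | 0 <= z.1].

Definition Htilde (f : R -> R) (x : R) : R :=
  lim ((fun e : R =>
    \int[mu]_(y in [set y | e < `|x - y|]) ((f x - f y) / (x - y) ^+ 2))
    @ 0^'+).

Definition smooth phi :=
  forall (s : seq (R * R)) z, differentiable (foldr (fun v g => 'D_v g) phi s) z.

Definition C11b phi :=
  bounded_fun phi /\ forall u v : R * R, bounded_fun ('D_u ('D_v phi)).

(* The left-hand side of (E+), evaluated on a test function. *)
Definition Eplus phi z : R :=
  'D_(1, 0) phi z
  + Num.max ('D_(0, 1) phi z) 0 * Htilde (fun y => phi (z.1, y)) z.2.

(* The operator is nonlocal, so the extremum is over the whole half-plane. *)
Definition strict_max (g : R * R -> R) z0 :=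
  forall z, halfplane z -> z <> z0 -> g z < g z0.

Definition strict_min (g : R * R -> R) z0 :=
  forall z, halfplane z -> z <> z0 -> g z0 < g z.

Definition lsc F :=
  @lower_semicontinuous (subspace halfplane) R (fun z => (F z)%:E).

Definition usc F := lsc (fun z => - F z).

Definition subsolution F :=
  usc F /\
  forall phi, smooth phi -> C11b phi ->
  forall z0, 0 < z0.1 -> strict_max (fun z => F z - phi z) z0 ->
  Eplus phi z0 <= 0.

Definition supersolution F :=
  lsc F /\
  forall phi, smooth phi -> C11b phi ->
  forall z0, 0 < z0.1 -> strict_min (fun z => F z - phi z) z0 ->
  0 <= Eplus phi z0.

(* F_*; the liminf is finite when F is bounded on the half-plane, the only case
   in which this definition is used. *)
Definition lsc_env F z : R :=
  fine (limf_einf (fun z => (F z)%:E) (within halfplane (nbhs z))).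

Definition viscosity_solution_Eplus F :=
  subsolution F /\ supersolution (lsc_env F).

Definition viscosity_solution F :=
  (forall t, 0 <= t -> {homo (fun x => F (t, x)) : x y / x <= y}) /\
  viscosity_solution_Eplus F.

(* The initial datum is attained by the subsolution F and by the supersolution
   F_*.  Prescribing F(0, .) alone would not determine F: a usc function may
   jump down right after time 0 (for instance F(t, .) = 0 for all t > 0). *)
Definition initial_condition (mu0 : set R -> \bar R) F :=
  {ae mu, forall x, (F (0, x))%:E = mu0 `]-oo, x]%classic} /\
  {ae mu, forall x, (lsc_env F (0, x))%:E = mu0 `]-oo, x]%classic}.

(* Boundedness is part of the solution class: test functions being bounded, the
   extremum conditions are void for a function that is unbounded above and
   below on the half-plane. *)
Definition solves_Cauchy (mu0 : set R -> \bar R) F :=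
  [/\ [bounded F z | z in halfplane], viscosity_solution F &
      initial_condition mu0 F].

End viscosity.

Section empirical.
Context {R : realType} {N : nat}.
Implicit Types x : 'I_N -> R.

Definition empirical_measure x (A : set R) : \bar R :=
  ((N%:R^-1)%:E * \sum_(i < N) \d_(x i) A)%E.

Definition empirical_cdf x (y : R) : R := N%:R^-1 * #|[pred i | x i <= y]|%:R.

Section measure.
Variable x : 'I_N -> R.

Let emp0 : empirical_measure x set0 = 0%E.
Proof. by rewrite /empirical_measure big1 ?mule0. Qed.

Let emp_ge0 A : (0 <= empirical_measure x A)%E.
Proof. by rewrite mule_ge0 ?lee_fin ?invr_ge0 ?sume_ge0. Qed.

Let emp_sigma_additive : semi_sigma_additive (empirical_measure x).
Proof.
move=> F mF tF mUF; rewrite [X in X @ _](_ : _ = (fun n =>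
  (N%:R^-1)%:E * \sum_(i < N) \sum_(0 <= k < n) \d_(x i) (F k))%E); last first.
  apply/funext => n; rewrite exchange_big/= ge0_sume_distrr//.
  by move=> i _; rewrite sume_ge0.
apply: cvgeZl => //; apply: cvg_nnesum => [i _|i _].
  by apply: nearW => n; exact: sume_ge0.
exact: measure_semi_sigma_additive.
Qed.

HB.instance Definition _ := isMeasure.Build _ _ _ (empirical_measure x)
  emp0 emp_ge0 emp_sigma_additive.

End measure.
End empirical.

Definition weakly_converges {R : realType}
    (nu : nat -> {measure set R -> \bar R}) (mu0 : {measure set R -> \bar R}) :=
  forall f : R -> R, continuous f -> bounded_fun f ->
  (\int[nu N]_x (f x)%:E)%E @[N --> \oo] --> (\int[mu0]_x (f x)%:E)%E.

Section stochastic.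
Context {R : realType} {d : measure_display} {T : measurableType d}.
Variables (P : probability T R) (Fil : R -> set (set T)).

(* The usual conditions: completeness and right-continuity. *)
Definition standard_filtration :=
  [/\ forall t, 0 <= t -> sigma_algebra setT (Fil t) /\ Fil t `<=` measurable,
      forall s t, 0 <= s -> s <= t -> Fil s `<=` Fil t,
      forall t, 0 <= t -> \bigcap_(s in `]t, +oo[) Fil s `<=` Fil t &
      forall A, P.-negligible A -> Fil 0 A].

Definition adapted (X : R -> T -> R) :=
  forall t, 0 <= t -> forall Y : set R, measurable Y -> Fil t (X t @^-1` Y).

Definition continuous_paths (X : R -> T -> R) :=
  {ae P, forall w, {within `[0, +oo[, continuous (fun t => X t w)}}.

Definition increment (X : R -> T -> R) (s t : R) (w : T) : R := X t w - X s w.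

Definition brownian_motion (B : R -> T -> R) :=
  [/\ adapted B, continuous_paths B, {ae P, forall w, B 0 w = 0},
      forall s t, 0 <= s -> s < t -> forall Y : set R, measurable Y ->
        P (increment B s t @^-1` Y) = normal_prob 0 (Num.sqrt (t - s)) Y &
      forall s t, 0 <= s -> s < t -> forall A (Y : set R), Fil s A ->
        measurable Y ->
        P (A `&` increment B s t @^-1` Y) = (P A * P (increment B s t @^-1` Y))%E].

Definition sigma_process (X : R -> T -> R) : set (set T) :=
  <<s [set A | exists t (Y : set R),
         [/\ 0 <= t, measurable Y & A = X t @^-1` Y] ] >>.

(* Subfamilies are covered by taking some of the events equal to setT. *)
Definition independent_processes {N : nat} (X : 'I_N -> R -> T -> R) :=
  forall E : 'I_N -> set T, (forall i, sigma_process (X i) (E i)) ->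
  P (\bigcap_i E i) = (\prod_(i < N) P (E i))%E.

Definition dyson_drift {N : nat} (lam : 'I_N -> R -> T -> R) (i : 'I_N) w s :=
  N%:R^-1 * \sum_(j < N | j != i) (lam i s w - lam j s w)^-1.

(* Since the noise is additive, the integral form of the equation involves no
   stochastic integral.  Particles may collide, but almost surely only at a null
   set of times, so the convention 0^-1 = 0 does not matter. *)
Definition dyson_solution {N : nat} (x : 'I_N -> R) (B lam : 'I_N -> R -> T -> R) :=
  [/\ forall i, adapted (lam i), forall i, continuous_paths (lam i) &
      {ae P, forall w, forall (i : 'I_N) (t : R), 0 <= t ->
        lebesgue_measure.-integrable `[0, t]
          (fun s => (dyson_drift lam i w s)%:E) /\
        lam i t w = x i
          + \int[lebesgue_measure]_(s in `[0, t]) dyson_drift lam i w s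
          + 2 / Num.sqrt N%:R * B i t w}].

End stochastic.

(* Main.v *)
(** Smooth the empirical distribution functions at scale [eta] with the Poisson
    kernel: [F_N^eta(t, x)] is the mean over [i] of [Theta eta (x - lambda^i_t)],
    where [Theta eta w = 1/2 + atan(w/eta)/pi].  The limit equation is the trace on
    the real line of a complex Burgers equation, which is invariant under imaginary
    translations; so the smoothing preserves it exactly, without a commutator error.
    Pathwise second-order expansions, moment bounds for the noise and the
    Borel-Cantelli lemma show that almost surely [F_N^eta] solves the equation up to
    an error that vanishes as [N] grows.  Hence its limit [h] along any ultrafilter
    on [N] is a bounded classical solution.

    As [Theta eta (w - d) - eta/d <= 1_{w >= 0} <= Theta eta (w + d) + eta/d], the
    infimum [F] of the functions [h(t, x + d) + eta/d] and the supremum [V] of the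
    functions [h(t, x - d) - eta/d] enclose every limit point of [F_N].  Moreover
    [F] is usc, [V = F_*], and the two agree almost everywhere.  Stability under
    such approximations makes [F] a viscosity solution.  Comparing an arbitrary
    solution with the functions [h(t, x +- d) +- eta/d], which are smooth for
    positive times, identifies it with [F].  So [F] depends neither on the
    ultrafilter nor on the sample point, and the whole sequence converges wherever
    [V = F]. *)

Require Import Defs.
From HB Require Import structures.
From mathcomp Require Import measurable_realfun.
From mathcomp Require Import ring lra.

Set Implicit Arguments.
Unset Strict Implicit.
Unset Printing Implicit Defensive.

(** * Smooth bounded functions of the plane *)

(** At a fixed sample point everything is deterministic: the random input is a countable list of
    almost sure bounds, and an ultrafilter gives limits to all bounded averages and their products
    at once, so no tightness argument is made. The limit in [N] is taken at fixed [eta], since the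
    constants blow up as [eta] tends to 0; different scales are compared only through the empirical
    distribution function, in which [eta] does not occur. Exactness comes from an identity for
    [A = eta / (w^2 + eta^2)] and [Q = w / (w^2 + eta^2)]: [A(w) - A(w') = (w' - w) (Q(w) A(w') +
    A(w) Q(w'))]. After symmetrization the factor [w' - w] cancels the singular interaction and
    leaves products of averages, up to diagonal terms of order [1/N]. This cancellation requires
    distinct positions, whereas the equation only provides an integrable drift; hence a separate
    proof that collision times are almost surely Lebesgue-null. The noise coefficient is
    [2 / sqrt N], so crude moment constants suffice: sums over meshes replace stochastic integrals,
    and fourth moments give probabilities of order [N^-2], which are summable. *)

Section smooth_class.
Context {R : realType}.
Implicit Types g h : R * R -> R.

(* Uniform first-order expansions with quadratic remainder are stable under sums
   and products; [smooth_bounded n] iterates them. *)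
Definition quad_expansion g gt gx := exists C : R, forall z v : R * R,
  `|v.1| <= 1 -> `|v.2| <= 1 ->
  `|g (z + v) - g z - (v.1 * gt z + v.2 * gx z)| <= C * (`|v.1| + `|v.2|) ^+ 2.

Definition plane_bounded g := exists M : R, forall z, `|g z| <= M.

Fixpoint smooth_bounded (n : nat) g : Prop :=
  plane_bounded g /\ if n is m.+1 then exists gt gx, [/\ quad_expansion g gt gx, smooth_bounded m
    gt & smooth_bounded m gx]
           else True.

Lemma smooth_bounded_plane n g : smooth_bounded n g -> plane_bounded g.
Proof. by case: n => [|n] []. Qed.

Lemma plane_boundedP g : plane_bounded g -> exists2 M : R, 0 <= M & forall z, `|g z| <= M.
Proof. by move=> [M hM]; exists M => //; exact: le_trans (hM 0). Qed.

Lemma smooth_boundedS n g : smooth_bounded n.+1 g -> smooth_bounded n g.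
Proof.
elim: n g => [g [b _]//|n IH g [b [gt [gx [q st sx]]]]]; split => //.
by exists gt, gx; split => //; exact: IH.
Qed.

Lemma plane_boundedD g h : plane_bounded g -> plane_bounded h -> plane_bounded (fun z => g z + h z).
Proof.
move=> [M hM] [K hK]; exists (M + K) => z.
by rewrite (le_trans (ler_normD _ _))// lerD.
Qed.

Lemma plane_boundedM g h : plane_bounded g -> plane_bounded h -> plane_bounded (fun z => g z * h z).
Proof.
move=> [M hM] [K hK]; exists (M * K) => z.
by rewrite normrM ler_pM.
Qed.

Lemma quad_expansionD g gt gx h ht hx : quad_expansion g gt gx -> quad_expansion h ht hx ->
  quad_expansion (fun z => g z + h z) (fun z => gt z + ht z) (fun z => gx z + hx z).
Proof.
move=> [C hC] [D hD]; exists (C + D) => z v v1 v2.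
rewrite mulrDl; apply: le_trans _ (lerD (hC z v v1 v2) (hD z v v1 v2)).
apply: le_trans _ (ler_normD _ _); rewrite le_eqVlt; apply/orP; left; apply/eqP.
by congr (`| _ |); ring.
Qed.

Lemma quad_expansion_lip g gt gx : plane_bounded gt -> plane_bounded gx -> quad_expansion g gt gx ->
  exists2 L : R, 0 <= L & forall z v, `|v.1| <= 1 -> `|v.2| <= 1 ->
    `|g (z + v) - g z| <= L * (`|v.1| + `|v.2|).
Proof.
move=> /plane_boundedP[M M0 hM] /plane_boundedP[K K0 hK] [C hC].
exists (`|C| * 2 + (M + K)); first by rewrite !addr_ge0// mulr_ge0.
move=> z v v1 v2.
have -> : g (z + v) - g z = (g (z + v) - g z - (v.1 * gt z + v.2 * gx z)) +
  (v.1 * gt z + v.2 * gx z) by ring.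
apply: (le_trans (ler_normD _ _)); rewrite mulrDl lerD//.
  apply: (le_trans (hC z v v1 v2)).
  rewrite expr2 mulrA ler_wpM2r ?addr_ge0//.
  apply: le_trans (_ : `|C| * (`|v.1| + `|v.2|) <= _).
    by rewrite ler_wpM2r ?addr_ge0// ler_norm.
  by rewrite ler_wpM2l//; lra.
apply: (le_trans (ler_normD _ _)); rewrite !normrM.
have h1 := hM z; have h2 := hK z.
have a1 := normr_ge0 v.1; have a2 := normr_ge0 v.2.
have h3 : `|v.1| * `|gt z| <= `|v.1| * M by rewrite ler_wpM2l.
have h4 : `|v.2| * `|gx z| <= `|v.2| * K by rewrite ler_wpM2l.
nra.
Qed.

Lemma quad_expansionM g gt gx h ht hx : plane_bounded g -> plane_bounded gt -> plane_bounded gx ->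
  plane_bounded h -> plane_bounded ht ->
  plane_bounded hx -> quad_expansion g gt gx -> quad_expansion h ht hx ->
  quad_expansion (fun z => g z * h z) (fun z => gt z * h z + g z * ht z)
     (fun z => gx z * h z + g z * hx z).
Proof.
move=> /plane_boundedP[M M0 hM] bgt bgx /plane_boundedP[K K0 hK] bht bhx qg qh.
have [L L0 hL] := quad_expansion_lip bgt bgx qg; have [N N0 hN] := quad_expansion_lip bht bhx qh.
case: qg => C hC; case: qh => D hD.
exists (L * N + M * D + K * C) => z v v1 v2.
have -> : g (z + v) * h (z + v) - g z * h z -
   (v.1 * (gt z * h z + g z * ht z) + v.2 * (gx z * h z + g z * hx z)) =
   (g (z + v) - g z) * (h (z + v) - h z)
   + g z * (h (z + v) - h z - (v.1 * ht z + v.2 * hx z))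
   + h z * (g (z + v) - g z - (v.1 * gt z + v.2 * gx z)) by ring.
have [a b] := (hL z v v1 v2, hN z v v1 v2).
have [c d] := (hC z v v1 v2, hD z v v1 v2).
apply: (le_trans (ler_normD _ _)); rewrite [leRHS]mulrDl lerD//;
  first (apply: (le_trans (ler_normD _ _)); rewrite [leRHS]mulrDl lerD//).
- rewrite normrM; apply: (le_trans (ler_pM _ _ a b)) => //.
  by rewrite le_eqVlt; apply/orP; left; apply/eqP; ring.
- by rewrite normrM -mulrA ler_pM.
- by rewrite normrM -mulrA ler_pM.
Qed.

Lemma smooth_boundedD n g h : smooth_bounded n g -> smooth_bounded n h -> smooth_bounded n (fun z
  => g z + h z).
Proof.
elim: n g h => [g h [bg _] [bh _]|n IH g h [bg [gt [gx [qg sg sgx]]]]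
  [bh [ht [hx [qh sh shx]]]]].
  by split => //; exact: plane_boundedD.
split; first exact: plane_boundedD.
exists (fun z => gt z + ht z), (fun z => gx z + hx z).
by split; [exact: quad_expansionD|exact: IH|exact: IH].
Qed.

Lemma smooth_boundedM n g h : smooth_bounded n g -> smooth_bounded n h -> smooth_bounded n (fun z
  => g z * h z).
Proof.
elim: n g h => [g h [bg _] [bh _]|n IH g h sg sh].
  by split => //; exact: plane_boundedM.
have [sg' sh'] := (smooth_boundedS sg, smooth_boundedS sh).
case: sg => bg [gt [gx [qg sgt sgx]]].
case: sh => bh [ht [hx [qh sht shx]]].
split; first exact: plane_boundedM.
exists (fun z => gt z * h z + g z * ht z), (fun z => gx z * h z + g z * hx z).
split.
- exact: (quad_expansionM bg (smooth_bounded_plane sgt) (smooth_bounded_plane sgx) bh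
  (smooth_bounded_plane sht) (smooth_bounded_plane shx)).
- by apply: smooth_boundedD; exact: IH.
- by apply: smooth_boundedD; exact: IH.
Qed.

Lemma quad_expansion_cst (c : R) : quad_expansion (fun=> c) (fun=> 0) (fun=> 0).
Proof.
by exists 0 => z v _ _; rewrite !mulr0 addr0 mul0r subrr subr0 normr0.
Qed.

Lemma smooth_bounded_cst n (c : R) : smooth_bounded n (fun=> c).
Proof.
elim: n c => [|n IH] c; first by split => //; exists `|c|.
split; first by exists `|c|.
by exists (fun=> 0), (fun=> 0); split; [exact: quad_expansion_cst|exact: IH|exact: IH].
Qed.

Lemma smooth_boundedZ n (c : R) g : smooth_bounded n g -> smooth_bounded n (fun z => c * g z).
Proof. by apply: smooth_boundedM; exact: smooth_bounded_cst. Qed.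

Definition linear_form (a b : R) (v : R * R) : R := v.1 * a + v.2 * b.

Fact linear_form_is_linear a b : linear (linear_form a b).
Proof. by move=> k u v; rewrite /linear_form/= /GRing.scale/=; ring. Qed.

HB.instance Definition _ a b := GRing.isLinear.Build _ _ _ _ (linear_form a b)
  (linear_form_is_linear a b).

Lemma quad_expansion_differentiable g gt gx : quad_expansion g gt gx -> forall z, differentiable g
  z /\
  forall v, 'D_v g z = v.1 * gt z + v.2 * gx z.
Proof.
move=> [C hC] z.
pose dfl : {linear (R * R)%type -> R} := linear_form (gt z) (gx z).
have cdf : continuous dfl.
  move=> u; apply: (@continuousD _ _ _ (fun v : R * R => v.1 * gt z)
    (fun v => v.2 * gx z)).
    by apply: cvgMl; exact: cvg_fst.
  by apply: cvgMl; exact: cvg_snd.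
have E : g \o shift z = cst (g z) + dfl +o_ (0 : R * R) id.
  apply/eqaddoP => _/posnumP[e]; near=> v => /=.
  have nv1 : `|v.1| <= `|v| by rewrite prod_normE/= le_max lexx.
  have nv2 : `|v.2| <= `|v| by rewrite prod_normE/= le_max lexx orbT.
  have v1 : `|v| <= 1 by near: v; apply: (@nbhs0_le _ (R * R)%type 1 ltr01).
  have ve : 4 * (`|C| + 1) * `|v| <= e%:num.
    rewrite mulrC -ler_pdivlMr; last by rewrite mulr_gt0// ltr_wpDl.
    near: v; apply: (@nbhs0_le _ (R * R)%type).
    by rewrite divr_gt0// mulr_gt0// ltr_wpDl.
  rewrite !fctE/=.
  have -> : g (v + z) - (g z + dfl v) =
     g (z + v) - g z - (v.1 * gt z + v.2 * gx z).
    by rewrite /dfl/= /linear_form [z + v]addrC; ring.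
  apply: (le_trans (hC z v (le_trans nv1 v1) (le_trans nv2 v1))).
  apply: (@le_trans _ _ (4 * (`|C| + 1) * `|v| * `|v|)); last first.
    by rewrite ler_wpM2r.
  have s0 : 0 <= `|v.1| + `|v.2| by rewrite addr_ge0.
  have s1 : `|v.1| + `|v.2| <= 2 * `|v| by lra.
  have -> : 4 * (`|C| + 1) * `|v| * `|v| = (`|C| + 1) * (2 * `|v|) ^+ 2.
    by ring.
  apply: (@le_trans _ _ ((`|C| + 1) * (`|v.1| + `|v.2|) ^+ 2)).
    by rewrite ler_wpM2r ?sqr_ge0// (le_trans (ler_norm _))// lerDl.
  by rewrite ler_wpM2l ?addr_ge0// ler_sqr ?nnegrE// mulr_ge0.
have dE : 'd g z = dfl :> (R * R -> R) by exact: diff_unique.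
have dg : differentiable g z.
  by apply/diff_locallyP; rewrite dE; split.
by split => // v; rewrite deriveE// dE.
Unshelve. all: by end_near. Qed.

(** Bounds of every order, uniform over the plane. This is stronger than [smooth] together with
    [C11b], but it is stable under sums, products and derivatives, which makes test functions easy
    to assemble. *)
Definition Cinfb g := forall n, smooth_bounded n g.

Lemma Cinfb_D g v : Cinfb g -> Cinfb ('D_v g).
Proof.
move=> sg n; have [_ [gt [gx [q st sx]]]] := sg n.+1.
rewrite (_ : 'D_v g = fun z => v.1 * gt z + v.2 * gx z); last first.
  by apply/funext => z; have [_ ->] := quad_expansion_differentiable q z.
by apply: smooth_boundedD; exact: smooth_boundedZ.
Qed.

Lemma Cinfb_smooth g : Cinfb g -> smooth g.
Proof.
move=> sg s z; have : Cinfb (foldr (fun v h => 'D_v h) g s).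
  by elim: s => //= v s; exact: Cinfb_D.
move=> /(_ 1%N)[_ [gt [gx [q _ _]]]].
by have [] := quad_expansion_differentiable q z.
Qed.

Lemma Cinfb_bounded g : Cinfb g -> bounded_fun g.
Proof.
move=> /(_ 0%N)[[M hM] _]; exists M; split; first exact: num_real.
by move=> x Mx z _/=; rewrite (le_trans (hM z))// ltW.
Qed.

Lemma Cinfb_C11b g : Cinfb g -> C11b g.
Proof.
move=> sg; split; first exact: Cinfb_bounded.
by move=> u v; apply: Cinfb_bounded; do 2 apply: Cinfb_D.
Qed.

End smooth_class.

(** * The nonlocal operator *)
Section folding.
Context {R : realType}.
Local Notation mu := (@lebesgue_measure R).
Implicit Types f : R -> R.

Lemma Rintegral_subst (phi : measurableTypeR R -> measurableTypeR R)
    (D : set (measurableTypeR R)) (g : measurableTypeR R -> R) :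
  measurable_fun setT phi ->
  (forall A : set (measurableTypeR R), measurable A -> mu (phi @^-1` A) = mu A) ->
  measurable D -> measurable_fun setT g ->
  mu.-integrable (phi @^-1` D) (EFin \o (g \o phi)) ->
  mu.-integrable D (EFin \o g) /\
  \int[mu]_(y in D) g y = \int[mu]_(h in phi @^-1` D) g (phi h).
Proof.
move=> mphi phiE mD mg itv_int.
have E : forall F : measurableTypeR R -> \bar R,
    (\int[pushforward mu phi]_(y in D) F y = \int[mu]_(y in D) F y)%E.
  pose p : {mfun measurableTypeR R >-> measurableTypeR R} :=
    HB.pack phi (isMeasurableFun.Build _ _ _ _ _ mphi).
  move=> F; apply: (@eq_measure_integral _ _ _ D mu (pushforward mu p)).
  by move=> A mA _; exact: phiE.
have mEg : measurable_fun setT (EFin \o g) by exact/measurable_EFinP.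
split.
  apply/integrableP; split; first exact: measurable_funS mEg.
  rewrite -E ge0_integral_pushforward//; last first.
    by apply: measurableT_comp => //; exact: measurable_funS mEg.
  by move/integrableP : itv_int => [].
by rewrite /Rintegral -E integral_pushforward.
Qed.

Lemma lebesgue_measure_shift (x : R) (A : set R) : measurable A ->
  mu ((fun h => x + h) @^-1` A) = mu A.
Proof.
move=> mA; apply/esym.
have mphi : measurable_fun [set: R] (fun h : R => x + h : measurableTypeR R).
  exact: measurable_funD.
apply: (@lebesgue_measure_unique R (pushforward mu (fun h : R => x + h : measurableTypeR R))) => //.
move=> _ [[a b]] _ <-; rewrite /pushforward.
rewrite [X in _ = mu X](_ : _ = `]a - x, b - x]%classic); last first.
  by apply/seteqP; split => y /=; rewrite !in_itv/=; lra.
rewrite !lebesgue_measure_itv/= !lte_fin ltrD2r.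
by case: ifP => // _; rewrite -!EFinB; congr EFin; ring.
Qed.

Lemma lebesgue_measure_reflect (x : R) (A : set R) : measurable A ->
  mu ((fun h => x - h) @^-1` A) = mu A.
Proof.
move=> mA; apply/esym.
have mphi : measurable_fun [set: R] (fun h : R => x - h : measurableTypeR R).
  by apply: measurable_funB.
apply: (@lebesgue_measure_unique R (pushforward mu (fun h : R => x - h : measurableTypeR R))) => //.
move=> _ [[a b]] _ <-; rewrite /pushforward.
rewrite [X in _ = mu X](_ : _ = `[x - b, x - a[%classic); last first.
  by apply/seteqP; split => y /=; rewrite !in_itv/=; lra.
rewrite !lebesgue_measure_itv/= !lte_fin.
rewrite (_ : (x - b < x - a) = (a < b)); last by apply/idP/idP; lra.
by case: ifP => // _; rewrite -!EFinB; congr EFin; ring.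
Qed.

(** A single integrable majorant for quotients by [h ^+ 2]: it is comparable with [h ^- 2] at
    infinity, where second differences are bounded, and with a constant near 0, where they are
    quadratic. *)
Definition cauchy_weight (h : R) : R := (1 + h ^+ 2)^-1.

Lemma cauchy_weight_gt0 h : 0 < cauchy_weight h.
Proof. by rewrite invr_gt0 ltr_pwDl// sqr_ge0. Qed.

Lemma continuous_cauchy_weight : continuous cauchy_weight.
Proof. exact: continuous_oneDsqrV. Qed.

Lemma integrable_cauchy_weight : mu.-integrable `]0, +oo[ (EFin \o cauchy_weight).
Proof.
apply: (@integrableS _ _ _ mu `[0, +oo[%classic) => //.
  by move=> y /=; rewrite !in_itv/= !andbT => /ltW.
apply/integrableP; split.
  apply/measurable_EFinP; apply: measurable_funTS.
  by apply: continuous_measurable_fun; exact: continuous_cauchy_weight.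
rewrite (_ : (\int[_]_(_ in _) _ = (pi / 2)%:E)%E) ?ltry//.
rewrite -integral0y_oneDsqr; apply: eq_integral => h _ /=.
by rewrite ger0_norm// ltW// cauchy_weight_gt0.
Qed.

Lemma integrable_cauchy_dominated (D : set R) (s : R -> R) (C : R) : measurable D ->
  D `<=` `]0, +oo[ ->
  measurable_fun setT s -> (forall h, D h -> `|s h| <= C * cauchy_weight h) ->
  mu.-integrable D (EFin \o s).
Proof.
move=> mD D0 ms sC.
apply: (@le_integrable _ _ _ mu _ _ _ (fun h => (C%:E * (cauchy_weight h)%:E)%E)) => //.
- by apply/measurable_EFinP; exact: measurable_funTS.
- move=> h Dh; rewrite lee_fin.
  by apply: le_trans (sC _ Dh) _; exact: ler_norm.
- apply: integrableZl => //.
  by apply: (@integrableS _ _ _ mu `]0, +oo[%classic) => //; exact: integrable_cauchy_weight.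
Qed.

Lemma div_le_cauchy_weight (a C h : R) : 0 < h -> a * (1 + h ^+ 2) <= C * h ^+ 2 ->
  a / h ^+ 2 <= C * cauchy_weight h.
Proof.
move=> h0 H; rewrite ler_pdivrMr ?exprn_gt0// /cauchy_weight mulrAC ler_pdivlMr//.
by rewrite ltr_pwDl// sqr_ge0.
Qed.

(* Folding [y = x - h] onto [y = x + h] turns the principal value into an
   absolutely convergent integral over [h > 0] (see [Htilde_foldE]). *)
Definition sdiff f (x h : R) : R := 2 * f x - f (x + h) - f (x - h).

Definition fold_Htilde f (x : R) : R := \int[mu]_(h in `]0, +oo[) (sdiff f x h / h ^+ 2).

Lemma sdiff_cauchy_weight (M K : R) (u : R -> R) h : 0 < h ->
  `|u h| <= 4 * M -> `|u h| <= K * h ^+ 2 ->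
  `|u h / h ^+ 2| <= (K + 4 * M) * cauchy_weight h.
Proof.
move=> h0 u1 u2; have hh : 0 < h ^+ 2 by rewrite exprn_gt0.
rewrite normrM normfV [`|h ^+ 2|]ger0_norm ?(ltW hh)//.
by apply: div_le_cauchy_weight => //; nra.
Qed.

Lemma measurable_invr : measurable_fun setT (@GRing.inv R).
Proof.
rewrite -(setUv [set (0 : R)]); apply/measurable_funU => //.
  exact: measurableC.
split; first exact: measurable_fun_set1.
apply: open_continuous_measurable_fun => [|x].
  by apply: closed_openC; apply: accessible_closed_set1; apply: hausdorff_accessible;
    exact: Rhausdorff.
by rewrite inE/= => /eqP x0; exact: inv_continuous.
Qed.

Lemma measurable_divX2 (u : R -> R) : measurable_fun setT u ->
  measurable_fun setT (fun h => u h / h ^+ 2).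
Proof.
move=> mu_; apply: measurable_funM => //.
apply: (@measurableT_comp _ _ _ _ _ _ (@GRing.inv R) _ (fun h : R => h ^+ 2)).
  exact: measurable_invr.
exact: measurable_funX.
Qed.

Lemma measurable_sdiff f x : continuous f -> measurable_fun setT (sdiff f x).
Proof.
move=> cf; have mf : measurable_fun setT f by exact: continuous_measurable_fun.
apply: measurable_funB; first apply: measurable_funB => //.
  by apply: (measurableT_comp mf); exact: measurable_funD.
by apply: (measurableT_comp mf); exact: measurable_funB.
Qed.

Lemma sdiff_le4 f x (M : R) h : (forall y, `|f y| <= M) -> `|sdiff f x h| <= 4 * M.
Proof.
move=> fM; have := fM x; have := fM (x + h); have := fM (x - h).
by rewrite /sdiff !ler_norml => /andP[? ?] /andP[? ?] /andP[? ?]; apply/andP; lra.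
Qed.

Section fold.
Variables (f : R -> R) (x M K : R).
Hypotheses (cf : continuous f) (fM : forall y, `|f y| <= M)
  (fK : forall h, `|sdiff f x h| <= K * h ^+ 2).

Let K0 : 0 <= K.
Proof. by have := fK 1; rewrite expr1n mulr1; apply: le_trans. Qed.

Let M0 : 0 <= M. Proof. exact: le_trans (fM 0). Qed.

Lemma integrable_sdiff (D : set R) : measurable D -> D `<=` `]0, +oo[ ->
  mu.-integrable D (EFin \o (fun h => sdiff f x h / h ^+ 2)).
Proof.
move=> mD D0; apply: (@integrable_cauchy_dominated D _ (K + 4 * M)) => //.
  by apply: measurable_divX2; exact: measurable_sdiff.
by move=> h /D0; rewrite /= in_itv/= andbT => h0; apply: sdiff_cauchy_weight => //;
  exact: sdiff_le4.
Qed.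

Lemma fold_Htilde_near0 (e : R) : 0 < e ->
  `|\int[mu]_(h in `]e, +oo[) (sdiff f x h / h ^+ 2) - fold_Htilde f x| <= K * e.
Proof.
move=> e0; rewrite /fold_Htilde.
have eE : `]0, +oo[%classic = `]0, e] `|` `]e, +oo[ :> set R.
  by apply/seteqP; split => y/=; rewrite !in_itv/= ?andbT; lra.
have sub1 : `]0, e]%classic `<=` (`]0, +oo[%classic : set R).
  by move=> y/=; rewrite !in_itv/= andbT => /andP[].
rewrite [X in _ - Rintegral _ X _]eE Rintegral_setU//; last 2 first.
- by rewrite -eE; exact: integrable_sdiff.
- by apply/disj_setPS => y/= []; rewrite !in_itv/= andbT; lra.
rewrite opprD addrCA subrr addr0 normrN.
apply: (le_trans (le_normr_Rintegral _ (integrable_sdiff _ _))) => //.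
have me : mu `]0%R, e]%classic = e%:E.
  by rewrite lebesgue_measure_itv/= lte_fin e0 -EFinB subr0.
have -> : K * e = \int[mu]_(h in `]0, e]) K.
  rewrite Rintegral_cst//= lebesgue_measure_itv/= lte_fin e0.
  by rewrite -EFinB/= subr0.
apply: le_Rintegral => //.
- exact: (integrable_abse (integrable_sdiff _ _)).
- apply: measurable_bounded_integrable => //.
  + by have := ltry e; rewrite -me.
  + exists K; split; first exact: num_real.
    by move=> y Ky ? _; rewrite ger0_norm// ltW.
- move=> h; rewrite /= in_itv/= => /andP[h0 _].
  have hh : 0 < h ^+ 2 by rewrite exprn_gt0.
  by rewrite normrM normfV [`|h ^+ 2|]ger0_norm ?(ltW hh)// ler_pdivrMr.
Qed.

Lemma Htilde_cut (e : R) : 0 < e ->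
  \int[mu]_(y in [set y | e < `|x - y|]) ((f x - f y) / (x - y) ^+ 2) =
  \int[mu]_(h in `]e, +oo[) (sdiff f x h / h ^+ 2).
Proof.
move=> e0.
pose g y := (f x - f y) / (x - y) ^+ 2.
have mf : measurable_fun setT f by exact: continuous_measurable_fun.
have mg : measurable_fun setT g.
  apply: (measurable_funM (f := fun y => f x - f y)).
    exact: measurable_funB.
  apply: (@measurableT_comp _ _ _ _ _ _ (@GRing.inv R) _ (fun y : R => (x - y) ^+ 2)).
    exact: measurable_invr.
  by apply: measurable_funX; exact: measurable_funB.
have gb s h : h != 0 -> s = h \/ s = - h -> g (x + s) = (f x - f (x + s)) / h ^+ 2.
  move=> h0 hs; rewrite /g; congr (_ / _).
  by case: hs => ->; ring.
have bnd12 y h : 0 < h -> e < h -> `|(f x - f y) / h ^+ 2| <=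
    (2 * M / e ^+ 2 + 2 * M) * cauchy_weight h.
  move=> h0 eh; have hh : 0 < h ^+ 2 by rewrite exprn_gt0.
  have ee : 0 < e ^+ 2 by rewrite exprn_gt0.
  have h2 : `|f x - f y| <= 2 * M.
    by have := fM x; have := fM y; rewrite !ler_norml; lra.
  rewrite normrM normfV [`|h ^+ 2|]ger0_norm ?(ltW hh)//.
  apply: div_le_cauchy_weight => //.
  rewrite mulrDr mulr1 mulrDl lerD//; last by rewrite ler_wpM2r// ltW.
  apply: (le_trans h2); rewrite mulrAC ler_pdivlMr// ler_wpM2l ?mulr_ge0//.
  by rewrite ler_sqr ?nnegrE ltW.
have mD : measurable (`]e, +oo[%classic : set R) by [].
have D0 : `]e, +oo[%classic `<=` (`]0, +oo[%classic : set R).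
  by move=> y/=; rewrite !in_itv/= !andbT; lra.
have mp : measurable_fun setT (fun h : R => x + h) by exact: measurable_funD.
have mm : measurable_fun setT (fun h : R => x - h) by exact: measurable_funB.
have ip : mu.-integrable `]e, +oo[ (EFin \o (g \o (fun h => x + h))).
  apply: (@integrable_cauchy_dominated _ _ (2 * M / e ^+ 2 + 2 * M)) => //.
    exact: measurableT_comp mg mp.
  move=> h; rewrite /= in_itv/= andbT => eh; have h0 := lt_trans e0 eh.
  by rewrite (gb h h) ?gt_eqF//; [exact: bnd12|left].
have im : mu.-integrable `]e, +oo[ (EFin \o (g \o (fun h => x - h))).
  apply: (@integrable_cauchy_dominated _ _ (2 * M / e ^+ 2 + 2 * M)) => //.
    exact: measurableT_comp mg mm.
  move=> h; rewrite /= in_itv/= andbT => eh; have h0 := lt_trans e0 eh.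
  by rewrite /= (gb (- h) h) ?gt_eqF//; [exact: bnd12|right].
have prep : (fun h => x + h) @^-1` `]x + e, +oo[%classic = `]e, +oo[%classic :> set R.
  by apply/seteqP; split => y/=; rewrite !in_itv/= !andbT; lra.
have prem : (fun h => x - h) @^-1` `]-oo, x - e[%classic = `]e, +oo[%classic :> set R.
  by apply/seteqP; split => y/=; rewrite !in_itv/= !andbT; lra.
have [] := @Rintegral_subst (fun h => x + h) `]x + e, +oo[%classic g mp
  (@lebesgue_measure_shift x) _ mg; [by []|by rewrite prep|].
rewrite prep => i1 E1.
have [] := @Rintegral_subst (fun h => x - h) `]-oo, x - e[%classic g mm
  (@lebesgue_measure_reflect x) _ mg; [by []|by rewrite prem|].
rewrite prem => i2 E2.
have -> : [set y | e < `|x - y|] = `]x + e, +oo[ `|` `]-oo, x - e[ :> set R.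
  apply/seteqP; split => y/=; rewrite !in_itv/= !andbT.
    by rewrite ltr_normr => /orP[]; [right|left]; lra.
  by rewrite ltr_normr => -[] ?; apply/orP; [right|left]; lra.
rewrite -/g Rintegral_setU//; last 2 first.
- apply/integrableP; split; first by apply/measurable_EFinP; exact: measurable_funTS.
  move/integrableP : i1 => [_ i1]; move/integrableP : i2 => [_ i2].
  rewrite ge0_integral_setU//=; first exact: lte_add_pinfty.
  + by apply/measurable_EFinP; apply: measurableT_comp => //; exact: measurable_funTS.
  + by apply/disj_setPS => y/= []; rewrite !in_itv/= andbT; lra.
- by apply/disj_setPS => y/= []; rewrite !in_itv/= andbT; lra.
rewrite E1 E2 -RintegralD//; apply: eq_Rintegral => h.
rewrite inE/= in_itv/= andbT => eh; have h0 := lt_trans e0 eh.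
rewrite (gb h h) ?gt_eqF//; last by left.
rewrite (gb (- h) h) ?gt_eqF//; last by right.
by rewrite /sdiff -mulrDl; congr (_ / _); ring.
Qed.

Lemma Htilde_foldE : Htilde f x = fold_Htilde f x.
Proof.
apply: cvg_lim => //; apply/cvgrPdist_le => e e0.
near=> h; rewrite Htilde_cut//; rewrite distrC.
apply: (le_trans (fold_Htilde_near0 _)) => //.
have h1 : h <= e / (K + 1).
  by near: h; apply: nbhs_right_le; rewrite divr_gt0// ltr_wpDl.
rewrite ler_pdivlMr ?ltr_wpDl// in h1; apply: le_trans h1.
by rewrite mulrC ler_wpM2l// ltW//; lra.
Unshelve. all: by end_near. Qed.

End fold.

(* Otherwise a sequence of counterexamples contradicts dominated convergence. *)
Lemma small_fold (M K e : R) : 0 < e -> exists2 d, 0 < d &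
  forall u : R -> R, measurable_fun setT u ->
  (forall h, `|u h| <= 4 * M) -> (forall h, `|u h| <= K * h ^+ 2) ->
  (forall h, 0 < h -> h <= d^-1 -> `|u h| <= d) ->
  `|\int[mu]_(h in `]0, +oo[) (u h / h ^+ 2)| <= e.
Proof.
move=> e0; apply: contrapT => H.
have {}H (n : nat) : exists u : R -> R, [/\ measurable_fun setT u,
    forall h, `|u h| <= 4 * M, forall h, `|u h| <= K * h ^+ 2,
    forall h, 0 < h -> h <= n.+1%:R -> `|u h| <= n.+1%:R^-1 &
    e < `|\int[mu]_(h in `]0, +oo[) (u h / h ^+ 2)|].
  apply: contrapT => Hn; apply: H; exists n.+1%:R^-1; first by rewrite invr_gt0.
  move=> u mu_ u1 u2 u3; rewrite leNgt; apply/negP => eu; apply: Hn; exists u.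
  by split => // h h0 hn; apply: u3 => //; rewrite invrK.
have [u hu] := choice H.
have dom n h : 0 < h -> `|u n h / h ^+ 2| <= (K + 4 * M) * cauchy_weight h.
  by move=> h0; have [_ u1 u2 _ _] := hu n; exact: sdiff_cauchy_weight.
pose D : set (measurableTypeR R) := `]0, +oo[%classic.
have P1 n : measurable_fun D (fun h => (u n h / h ^+ 2)%:E).
  apply/measurable_EFinP; apply: measurable_funTS; apply: measurable_divX2.
  by have [] := hu n.
have P2 : {ae mu, forall h, D h ->
    (fun n => (u n h / h ^+ 2)%:E) @ \oo --> (0%R)%:E}.
  apply: aeW => h; rewrite /D/= in_itv/= andbT => h0.
  apply: cvg_EFin; first by near=> n.
  have hh : 0 < h ^+ 2 by rewrite exprn_gt0.
  apply/cvgrPdist_le => r r0; near=> n.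
  rewrite /= sub0r normrN normrM normfV [`|h ^+ 2|]ger0_norm ?(ltW hh)//.
  rewrite ler_pdivrMr//; have [_ _ _ u3 _] := hu n.
  apply: (@le_trans _ _ n.+1%:R^-1).
    apply: u3 => //; apply: le_trans (ltW (archi_boundP (ltW h0))) _.
    by rewrite ler_nat; apply: leqW; near: n; exact: nbhs_infty_ge.
  rewrite invf_ple ?posrE ?mulr_gt0//.
  have rh : 0 <= (r * h ^+ 2)^-1 by rewrite invr_ge0 ltW// mulr_gt0.
  apply: le_trans (ltW (archi_boundP rh)) _.
  by rewrite ler_nat; apply: leqW; near: n; exact: nbhs_infty_ge.
have P3 : mu.-integrable D (EFin \o (fun h => (K + 4 * M) * cauchy_weight h)).
  apply: (@integrableZl _ _ _ mu _ _ (K + 4 * M) (EFin \o cauchy_weight)) => //.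
    exact: measurable_itv.
  exact: integrable_cauchy_weight.
have P4 : {ae mu, forall h, forall n, D h ->
    (`|(u n h / h ^+ 2)%:E| <= ((K + 4 * M) * cauchy_weight h)%:E)%E}.
  apply: aeW => h n; rewrite /D/= in_itv/= andbT => h0.
  by rewrite lee_fin; exact: dom.
have [_ _ C] := @dominated_convergence _ _ _ mu D (measurable_itv _) _ _ _ P1
  (measurable_cst _) P2 P3 P4.
have {}C : (fun n => \int[mu]_(h in `]0, +oo[) (u n h / h ^+ 2)) @ \oo --> (0 : R).
  by rewrite integral0 in C; exact: fine_cvg C.
move/cvgrPdist_lt : C => /(_ e e0)[n _ /(_ n (leqnn n))].
rewrite sub0r normrN; have [_ _ _ _] := hu n.
by move=> /lt_trans/[apply]; rewrite ltxx.
Unshelve. all: by end_near. Qed.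

End folding.

(** * Derivatives and Taylor bounds on the line *)

Section calculus.
Context {R : realType}.
Implicit Types (f g : R -> R) (x a b c l : R).

Lemma is_derive1D f g x a b : is_derive x 1 f a -> is_derive x 1 g b ->
  is_derive x 1 (fun y => f y + g y) (a + b).
Proof. exact: is_deriveD. Qed.

Lemma is_derive1B f g x a b : is_derive x 1 f a -> is_derive x 1 g b ->
  is_derive x 1 (fun y => f y - g y) (a - b).
Proof. exact: is_deriveB. Qed.

Lemma is_derive1N f x a : is_derive x 1 f a -> is_derive x 1 (fun y => - f y) (- a).
Proof. exact: is_deriveN. Qed.

Lemma is_derive1M f g x a b : is_derive x 1 f a -> is_derive x 1 g b ->
  is_derive x 1 (fun y => f y * g y) (a * g x + f x * b).
Proof.
move=> df dg; apply: (is_derive_eq (is_deriveM df dg)).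
by rewrite /GRing.scale/=; ring.
Qed.

Lemma is_derive1_cst c x : is_derive x 1 (fun=> c : R) (0 : R).
Proof. exact: is_derive_cst. Qed.

Lemma is_derive1_id x : is_derive x 1 (fun y : R => y) (1 : R).
Proof. exact: is_derive_id. Qed.

Lemma is_derive1Z f x a c : is_derive x 1 f a -> is_derive x 1 (fun y => c * f y) (c * a).
Proof. by move=> df; apply: (is_derive_eq (is_derive1M (is_derive1_cst c x) df));
  rewrite mul0r add0r. Qed.

Lemma is_derive1_compose f g x a b : is_derive x 1 g b -> is_derive (g x) 1 f a ->
  is_derive x 1 (fun y => f (g y)) (a * b).
Proof. by move=> dg df; exact: is_derive1_comp. Qed.

Lemma is_derive1V g x b : g x != 0 -> is_derive x 1 g b ->
  is_derive x 1 (fun y => (g y)^-1) (- b / g x ^+ 2).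
Proof.
move=> g0 dg; apply: (is_derive_eq (is_deriveV g0 dg)).
by rewrite /GRing.scale/= mulNr mulrC mulNr.
Qed.

Lemma is_derive_continuous f x a : is_derive x 1 f a -> {for x, continuous f}.
Proof.
by move=> df; apply: differentiable_continuous; apply/derivable1_diffP.
Qed.

Lemma mvt f f' (a b : R) : (forall x : R, is_derive x 1 f (f' x)) ->
  exists2 c, (a <= c <= b) || (b <= c <= a) & f b - f a = f' c * (b - a).
Proof.
move=> df; have cf : continuous f by move=> x; exact: is_derive_continuous.
have key u v : u < v -> exists2 c, (u <= c <= v) & f v - f u = f' c * (v - u).
  move=> uv; have [|c] := @MVT R f f' u v uv (fun x _ => df x).
    exact: continuous_subspaceT.
  by rewrite in_itv/= => /andP[uc cv] E; exists c; rewrite // (ltW uc) (ltW cv).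
have [ab|ba|->] := ltgtP a b.
- by have [c cab E] := key _ _ ab; exists c; rewrite ?cab.
- have [c cab E] := key _ _ ba; exists c; rewrite ?cab ?orbT//.
  by rewrite -opprB E; ring.
- by exists b; rewrite ?lexx// !subrr mulr0.
Qed.

Lemma mvt_lip f f' (K : R) : (forall x : R, is_derive x 1 f (f' x)) ->
  (forall x, `|f' x| <= K) -> forall a b, `|f b - f a| <= K * `|b - a|.
Proof.
move=> df fK a b; have [c _ ->] := mvt a b df.
by rewrite normrM ler_wpM2r.
Qed.

Lemma taylor2 f f' f'' (K : R) : (forall x : R, is_derive x 1 f (f' x)) ->
  (forall x : R, is_derive x 1 f' (f'' x)) -> (forall x, `|f'' x| <= K) ->
  forall x h, `|f (x + h) - f x - h * f' x| <= K * h ^+ 2.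
Proof.
move=> df df' fK x h; have [c hc E] := mvt x (x + h) df.
rewrite E addrAC subrr add0r mulrC -mulrBr normrM.
rewrite -real_normK ?num_real// expr2 mulrCA ler_wpM2l//.
apply: (le_trans (mvt_lip df' fK x c)).
rewrite ler_wpM2l//; first exact: le_trans (fK 0).
case/orP: hc => /andP[c1 c2].
  by rewrite !ger0_norm; lra.
by rewrite !ler0_norm; lra.
Qed.

Lemma is_derive_quad f x l (C : R) :
  (forall h, `|h| <= 1 -> `|f (x + h) - f x - h * l| <= C * h ^+ 2) ->
  is_derive x 1 f l.
Proof.
move=> H.
have cv : (fun h => h^-1 *: ((f \o shift x) (h *: 1) - f x)) @ 0^' --> l.
  apply/cvgrPdist_le => e e0; near=> h.
  have h0 : h != 0 by near: h; exact: nbhs_dnbhs_neq.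
  have h1 : `|h| <= 1 by near: h; apply: dnbhs0_le.
  have he : `|h| <= e / (`|C| + 1).
    by near: h; apply: dnbhs0_le; rewrite divr_gt0// ltr_wpDl.
  have hp : 0 < `|h| by rewrite normr_gt0.
  rewrite distrC /= /GRing.scale/= mulr1 (addrC h).
  have -> : h^-1 * (f (x + h) - f x) - l = h^-1 * (f (x + h) - f x - h * l).
    by field.
  rewrite normrM normfV ler_pdivrMl//; apply: le_trans (H h h1) _.
  rewrite -real_normK ?num_real// expr2 mulrCA ler_wpM2l//.
  rewrite ler_pdivlMr ?ltr_wpDl// in he; apply: le_trans he.
  by rewrite mulrC ler_wpM2l// (le_trans (ler_norm C))// lerDl.
split; first by apply/cvg_ex; exists l.
exact: cvg_lim.
Unshelve. all: by end_near. Qed.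

End calculus.

(** * The arctangent profile and the exact value of the operator on it *)

Section theta.
Context {R : realType}.
Local Notation mu := (@lebesgue_measure R).
Implicit Types eta w h : R.

(** With [conj_poisson], the imaginary and real parts of [1 / (w - i * eta)]. The usual factor
    [pi^-1] is left to [Theta], so that the algebra of the two kernels has integer coefficients. *)
Definition poisson eta w : R := eta / (w ^+ 2 + eta ^+ 2).
Definition conj_poisson eta w : R := w / (w ^+ 2 + eta ^+ 2).
Definition Theta eta w : R := 2^-1 + pi^-1 * atan (w / eta).

Lemma den_gt0 eta w : 0 < eta -> 0 < w ^+ 2 + eta ^+ 2.
Proof. by move=> e0; rewrite ltr_wpDl ?sqr_ge0// exprn_gt0. Qed.

Lemma is_derive_Theta eta w : 0 < eta -> is_derive w 1 (Theta eta) (pi^-1 * poisson eta w).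
Proof.
move=> e0.
have d1 : is_derive w 1 (fun y : R => y / eta) (eta^-1).
  by apply: (is_derive_eq (is_derive1M (is_derive1_id w) (is_derive1_cst eta^-1 w)));
    rewrite mulr0 addr0 mul1r.
have d2 := is_derive1_compose d1 (is_derive1_atan (w / eta)).
apply: (is_derive_eq (is_derive1D (is_derive1_cst 2^-1 w) (is_derive1Z pi^-1 d2))).
rewrite add0r; congr (_ * _); rewrite /poisson; have := den_gt0 w e0.
move=> D; field; rewrite !gt_eqF//=.
Qed.

Lemma Theta_sdE eta c x h : sdiff (fun y => Theta eta (y - c)) x h =
  sdiff (Theta eta) (x - c) h.
Proof. by rewrite /sdiff (addrAC x h) (addrAC x (- h)). Qed.

Lemma dThetaS eta w s h : 0 < eta ->
  is_derive h 1 (fun h => Theta eta (w + s * h)) (pi^-1 * poisson eta (w + s * h) * s).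
Proof.
move=> e0.
have d1 : is_derive h 1 (fun h : R => w + s * h) s.
  by apply: (is_derive_eq (is_derive1D (is_derive1_cst w h) (is_derive1Z s (is_derive1_id h))));
    rewrite add0r mulr1.
exact: is_derive1_compose d1 (is_derive_Theta _ e0).
Qed.

Lemma is_derive_sdiff eta w h : 0 < eta ->
  is_derive h 1 (sdiff (Theta eta) w)
   (pi^-1 * (4 * eta * w * h) / (((w + h) ^+ 2 + eta ^+ 2) * ((w - h) ^+ 2 + eta ^+ 2))).
Proof.
move=> e0.
have -> : sdiff (Theta eta) w = fun h => 2 * Theta eta w - Theta eta (w + 1 * h)
    - Theta eta (w + (- 1) * h).
  by apply/funext => k; rewrite /sdiff mul1r mulN1r.
apply: (is_derive_eq (is_derive1B (is_derive1B (is_derive1_cst _ h) (dThetaS w 1 h e0)) (dThetaS w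
  (-1) h e0))).
rewrite /poisson mul1r mulN1r; have D1 := den_gt0 (w + h) e0.
have D2 := den_gt0 (w - h) e0.
move: (pi : R) (@pi_gt0 R) => p p0; field.
by rewrite !gt_eqF.
Qed.

Lemma sdiff_Theta0 eta w : sdiff (Theta eta) w 0 = 0.
Proof. by rewrite /sdiff addr0 subr0; ring. Qed.

(** The second difference vanishes at [h = 0], and its derivative in [h] has the sign of [w * h].
    The sign is what the fundamental theorem of calculus on a half-line asks of the integrand in
    [fold_Htilde_Theta_ge0]. *)
Lemma sdiff_Theta_ge0 eta w h : 0 < eta -> 0 <= w -> 0 <= h -> 0 <= sdiff (Theta eta) w h.
Proof.
move=> e0 w0 h0; have -> : sdiff (Theta eta) w h = sdiff (Theta eta) w h - sdiff (Theta eta) w 0.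
  by rewrite sdiff_Theta0 subr0.
have [c hc ->] := mvt 0 h (fun h => is_derive_sdiff w h e0).
rewrite subr0; have c0 : 0 <= c.
  by case/orP: hc => /andP[]// h1 h2; apply: le_trans h1.
rewrite mulr_ge0// mulr_ge0//; last first.
  by rewrite invr_ge0 mulr_ge0// ltW// den_gt0.
by rewrite !mulr_ge0// ?invr_ge0 ?pi_ge0// ltW.
Qed.

Lemma Theta_bound eta w : 0 <= Theta eta w <= 1.
Proof.
have p0 : 0 < pi :> R by exact: pi_gt0.
have h1 := atan_gtNpi2 (w / eta); have h2 := atan_ltpi2 (w / eta).
rewrite /Theta; apply/andP; split.
  rewrite -lerBlDl sub0r -ler_pdivrMl ?invr_gt0// invrK mulrN.
  by apply: ltW.
rewrite -lerBrDl -ler_pdivlMl ?invr_gt0// invrK; apply: le_trans (ltW h2) _.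
by rewrite (_ : 1 - 2^-1 = 2^-1 :> R)//; field.
Qed.

(* Found by partial fractions from [is_derive_log_primitive]; subtracting
   [sdiff / h] then yields a primitive of [sdiff (Theta eta) w h / h^2], whence
   the exact value of the operator at [Theta] in [fold_Htilde_Theta]. *)
Definition sdiff_Theta_log_primitive eta w h : R := pi^-1 * (eta / (w ^+ 2 + eta ^+ 2)) *
  (2^-1 * (ln ((w + h) ^+ 2 + eta ^+ 2) - ln ((w - h) ^+ 2 + eta ^+ 2))
  + w / eta * (atan ((w + h) / eta) - atan ((w - h) / eta))).

Lemma is_derive_log_primitive eta w h : 0 < eta -> is_derive h 1 (sdiff_Theta_log_primitive eta w)
   (pi^-1 * (4 * eta * w) / (((w + h) ^+ 2 + eta ^+ 2) * ((w - h) ^+ 2 + eta ^+ 2))).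
Proof.
move=> e0.
have dl s : is_derive h 1 (fun h : R => w + s * h) s.
  by apply: (is_derive_eq (is_derive1D (is_derive1_cst w h) (is_derive1Z s (is_derive1_id h))));
    rewrite add0r mulr1.
have dq s : is_derive h 1 (fun h : R => (w + s * h) ^+ 2 + eta ^+ 2)
    (2 * s * (w + s * h)).
  have := is_derive1D (is_derive1M (dl s) (dl s)) (is_derive1_cst (eta ^+ 2) h).
  under eq_fun do rewrite -expr2.
  by move=> H; apply: (is_derive_eq H); ring.
have dL s := is_derive1_compose (dq s) (is_derive1_ln (den_gt0 (w + s * h) e0)).
have da s : is_derive h 1 (fun h : R => (w + s * h) / eta) (s / eta).
  by apply: (is_derive_eq (is_derive1M (dl s) (is_derive1_cst eta^-1 h))); rewrite mulr0 addr0.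
have dA s := is_derive1_compose (da s) (is_derive1_atan ((w + s * h) / eta)).
have -> : sdiff_Theta_log_primitive eta w = fun h => pi^-1 * (eta / (w ^+ 2 + eta ^+ 2)) *
  (2^-1 * (ln ((w + 1 * h) ^+ 2 + eta ^+ 2) - ln ((w + (-1) * h) ^+ 2 + eta ^+ 2))
  + w / eta * (atan ((w + 1 * h) / eta) - atan ((w + (-1) * h) / eta))).
  by apply/funext => k; rewrite /sdiff_Theta_log_primitive mul1r mulN1r.
apply: (is_derive_eq (is_derive1Z _ (is_derive1D (is_derive1Z 2^-1 (is_derive1B (dL 1) (dL (-1))))
  (is_derive1Z (w / eta) (is_derive1B (dA 1) (dA (-1))))))).
have D1 := den_gt0 (w + h) e0.
have D2 := den_gt0 (w - h) e0; have D := den_gt0 w e0.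
rewrite mul1r mulN1r; move: (pi : R) (@pi_gt0 R) => p p0; field.
by rewrite !gt_eqF.
Qed.

Lemma log_primitive0 eta w : sdiff_Theta_log_primitive eta w 0 = 0.
Proof. by rewrite /sdiff_Theta_log_primitive addr0 subr0 !subrr !mulr0 addr0 mulr0. Qed.

Definition sdiff_Theta_primitive eta w h : R := sdiff_Theta_log_primitive eta w h - sdiff (Theta
  eta) w h / h.

Lemma is_derive_primitive eta w h : 0 < eta -> 0 < h ->
  is_derive h 1 (sdiff_Theta_primitive eta w) (sdiff (Theta eta) w h / h ^+ 2).
Proof.
move=> e0 h0; have hn : h != 0 by rewrite gt_eqF.
apply: (is_derive_eq (is_derive1B (is_derive_log_primitive w h e0) (is_derive1M (is_derive_sdiff w
  h e0) (is_derive1V hn (is_derive1_id h))))).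
have D1 := den_gt0 (w + h) e0; have D2 := den_gt0 (w - h) e0.
move: (sdiff _ _ h) => S; move: (pi : R) (@pi_gt0 R) => p p0.
by field; rewrite hn !gt_eqF.
Qed.

(** At infinity the logarithms cancel and the two arctangents differ by [pi], so only [pi^-1 * (eta
    / (w ^+ 2 + eta ^+ 2)) * (w / eta * pi)] survives. *)
Lemma primitive_lim eta w : 0 < eta -> 0 <= w ->
  sdiff_Theta_primitive eta w h @[h --> +oo] --> conj_poisson eta w.
Proof.
move=> e0 w0; rewrite (_ : conj_poisson eta w = pi^-1 * (eta / (w ^+ 2 + eta ^+ 2)) *
   (2^-1 * 0 + w / eta * (pi / 2 - - (pi / 2))) - 0); last first.
  rewrite /conj_poisson; have D := den_gt0 w e0.
  move: (pi : R) (@pi_gt0 R) => p p0; field.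
  by rewrite !gt_eqF.
apply: cvgB; last first.
  apply/cvgrPdist_le => e ep; near=> h.
  have h0 : 0 < h by near: h; apply: nbhs_pinfty_gt; exact: num_real.
  rewrite sub0r normrN normrM normfV [`|h|]ger0_norm ?(ltW h0)//.
  rewrite ler_pdivrMr//.
  apply: (@le_trans _ _ (4 * 1)).
    apply: sdiff_le4 => y; have /andP[? ?] := Theta_bound eta y.
    by rewrite ger0_norm.
  by rewrite mulr1 mulrC -ler_pdivrMr.
apply: cvgM; first exact: cvg_cst.
apply: cvgD; (apply: cvgM; first exact: cvg_cst).
  apply/cvgrPdist_le => e ep; near=> h.
  have h0 : 0 < h by near: h; apply: nbhs_pinfty_gt; exact: num_real.
  have hw : 2 * w <= h by near: h; apply: nbhs_pinfty_ge; exact: num_real.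
  have he : 16 * w / e <= h by near: h; apply: nbhs_pinfty_ge; exact: num_real.
  have D1 := den_gt0 (w + h) e0; have D2 := den_gt0 (w - h) e0.
  rewrite sub0r normrN -ln_div ?posrE//.
  have -> : ((w + h) ^+ 2 + eta ^+ 2) / ((w - h) ^+ 2 + eta ^+ 2) =
     1 + 4 * w * h / ((w - h) ^+ 2 + eta ^+ 2).
    by field; rewrite gt_eqF.
  have q0 : 0 <= 4 * w * h / ((w - h) ^+ 2 + eta ^+ 2).
    by rewrite divr_ge0 ?mulr_ge0// ltW.
  rewrite ger0_norm ?ln_ge0 ?lerDl//.
  apply: (le_trans (le_ln1Dx _)); first by rewrite (lt_le_trans _ q0)// ltrN10.
  rewrite ler_pdivrMr// ler_pdivrMr// in he *.
  have q1 : (h / 2) ^+ 2 <= (w - h) ^+ 2 by nra.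
  have q2 : 4 * w * h <= e * (h / 2) ^+ 2 by nra.
  apply: (le_trans q2); rewrite ler_wpM2l ?(ltW ep)//.
  by rewrite (le_trans q1)// lerDl sqr_ge0.
apply: cvgB.
  apply: (@cvg_comp _ _ _ (fun h => (w + h) / eta) atan _ +oo); last exact: cvgy_atan.
  apply/cvgryPge => A; near=> h; rewrite ler_pdivlMr//.
  rewrite -lerBlDl; near: h; apply: nbhs_pinfty_ge; exact: num_real.
rewrite (_ : (fun h => atan ((w - h) / eta)) = fun h => - atan ((h - w) / eta)).
  apply: cvgN.
  apply: (@cvg_comp _ _ _ (fun h => (h - w) / eta) atan _ +oo); last exact: cvgy_atan.
  apply/cvgryPge => A; near=> h; rewrite ler_pdivlMr//.
  rewrite lerBrDr; near: h; apply: nbhs_pinfty_ge; exact: num_real.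
by apply/funext => h; rewrite -atanN -mulNr opprB.
Unshelve. all: by end_near. Qed.

Lemma poisson_conj_poisson_den eta w : 0 < eta ->
  [/\ `|poisson eta w| <= eta^-1, `|conj_poisson eta w| <= eta^-1 & 0 < poisson eta w].
Proof.
move=> e0; have D := den_gt0 w e0.
rewrite /poisson /conj_poisson !normrM !normfV (ger0_norm (ltW D)) (ger0_norm (ltW e0)).
rewrite !ler_pdivrMr// !ler_pdivlMl//; split; last by rewrite divr_gt0.
  by rewrite expr2 lerDr sqr_ge0.
have [h1 h2] := (sqr_ge0 (`|w| - eta), real_normK (num_real w)); nra.
Qed.

Lemma is_derive_poisson eta w : 0 < eta -> is_derive w 1 (poisson eta) (- (2 * (poisson eta w *
  conj_poisson eta w))).
Proof.
move=> e0; have D := den_gt0 w e0; have D' := lt0r_neq0 D.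
have dq := is_derive1D (is_derive1M (is_derive1_id w) (is_derive1_id w)) (is_derive1_cst (eta ^+
  2) w).
have -> : poisson eta = fun w => eta * (w * w + eta ^+ 2)^-1.
  by apply/funext => y; rewrite /poisson expr2.
rewrite expr2 in D'; apply: (is_derive_eq (is_derive1Z eta (@is_derive1V _ (fun y => y * y + eta
  ^+ 2) _ _ D' dq))).
by rewrite /poisson /conj_poisson; field.
Qed.

Lemma is_derive_conj_poisson eta w : 0 < eta -> is_derive w 1 (conj_poisson eta) (poisson eta w ^+
  2 - conj_poisson eta w ^+ 2).
Proof.
move=> e0; have D := den_gt0 w e0; have D' := lt0r_neq0 D.
have dq := is_derive1D (is_derive1M (is_derive1_id w) (is_derive1_id w)) (is_derive1_cst (eta ^+
  2) w).
have -> : conj_poisson eta = fun w => w * (w * w + eta ^+ 2)^-1.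
  by apply/funext => y; rewrite /conj_poisson expr2.
rewrite expr2 in D'; apply: (is_derive_eq (is_derive1M (is_derive1_id w) (@is_derive1V _ (fun y =>
  y * y + eta ^+ 2) _ _ D' dq))).
by rewrite /poisson /conj_poisson; field.
Qed.

Lemma Theta_quad eta : 0 < eta -> forall w h,
  `|Theta eta (w + h) - Theta eta w - h * (pi^-1 * poisson eta w)|
    <= pi^-1 * 2 * eta ^- 2 * h ^+ 2.
Proof.
move=> e0; apply: (taylor2 (fun w => is_derive_Theta w e0) (fun w => is_derive1Z pi^-1
  (is_derive_poisson w e0))).
move=> w; have [a q _] := poisson_conj_poisson_den w e0.
move: (poisson eta w) (conj_poisson eta w) a q => A Q a q.
rewrite normrM ger0_norm ?invr_ge0 ?pi_ge0// -mulrA ler_wpM2l ?invr_ge0 ?pi_ge0//.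
rewrite normrN normrM ger0_norm// ler_wpM2l// normrM expr2 invfM ler_pM//.
Qed.

Lemma sdiff_quad (f : R -> R) x l C : (forall h, `|f (x + h) - f x - h * l| <= C * h ^+ 2) ->
  forall h, `|sdiff f x h| <= 2 * C * h ^+ 2.
Proof.
move=> H h; have := H h; have := H (- h); rewrite sqrrN /sdiff !ler_norml.
by move=> /andP[? ?] /andP[? ?]; apply/andP; lra.
Qed.

Lemma continuous_Theta eta : 0 < eta -> continuous (Theta eta).
Proof. by move=> e0 w; exact: is_derive_continuous (is_derive_Theta w e0). Qed.

Lemma Theta_norm eta w : `|Theta eta w| <= 1.
Proof. by have /andP[? ?] := Theta_bound eta w; rewrite ger0_norm. Qed.

(** The integral over []e, +oo[] is the limit of the primitive at infinity minus its value at [e].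
    Both terms of the primitive tend to 0 with [e], the second one because second differences are
    quadratic. *)
Lemma fold_Htilde_Theta_ge0 eta w : 0 < eta -> 0 <= w -> fold_Htilde (Theta eta) w = conj_poisson
  eta w.
Proof.
move=> e0 w0; set K := 2 * (pi^-1 * 2 * eta ^- 2).
have K0 : 0 <= K by rewrite !mulr_ge0 ?invr_ge0 ?pi_ge0 ?sqr_ge0.
have cT := continuous_Theta e0.
have sK := sdiff_quad (Theta_quad e0 w).
have I (e : R) : 0 < e -> \int[mu]_(h in `]e, +oo[) (sdiff (Theta eta) w h / h ^+ 2) =
    conj_poisson eta w - sdiff_Theta_primitive eta w e.
  move=> ep.
  have ii : mu.-integrable `]e, +oo[ (EFin \o (fun h => sdiff (Theta eta) w h / h ^+ 2)).
    apply: (integrable_sdiff cT (@Theta_norm eta) sK) => //.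
    by move=> y/=; rewrite !in_itv/= !andbT; lra.
  rewrite Rintegral_itv_obnd_cbnd// /Rintegral.
  have cf y : 0 < y -> {for y, continuous (fun h => sdiff (Theta eta) w h / h ^+ 2)}.
    move=> y0; apply: cvgM; first exact: is_derive_continuous (is_derive_sdiff w y e0).
    apply: cvgV; first by rewrite gt_eqF// exprn_gt0.
    exact: exprn_continuous.
  have A1 y : e <= y -> 0 <= sdiff (Theta eta) w y / y ^+ 2.
    move=> ey; have h0 := lt_le_trans ep ey.
    by rewrite divr_ge0 ?sqr_ge0// sdiff_Theta_ge0// ltW.
  have A2 : {within `[e, +oo[, continuous (fun h => sdiff (Theta eta) w h / h ^+ 2)}.
    apply: continuous_in_subspaceT => y; rewrite inE/= in_itv/= andbT => ey.
    exact/cf/(lt_le_trans ep ey).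
  have A4 y : e < y -> derivable (sdiff_Theta_primitive eta w) y 1.
    by move=> eh; have [] := is_derive_primitive w e0 (lt_trans ep eh).
  have A5 : sdiff_Theta_primitive eta w y @[y --> e^'+] --> sdiff_Theta_primitive eta w e.
    exact/cvg_at_right_filter/(is_derive_continuous (is_derive_primitive w e0 ep)).
  have A6 : {in `]e, +oo[, (sdiff_Theta_primitive eta w)^`()%classic =1 (fun h => sdiff (Theta
    eta) w h / h ^+ 2)}.
    move=> y; rewrite in_itv/= andbT => eh.
    by rewrite derive1E; have [] := is_derive_primitive w e0 (lt_trans ep eh).
  by rewrite (ge0_continuous_FTC2y A1 A2 (primitive_lim e0 w0) A4 A5 A6).
have Jc : sdiff_Theta_log_primitive eta w h @[h --> 0] --> (0 : R).
  by have := is_derive_continuous (is_derive_log_primitive w 0 e0);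
    rewrite -[X in _ --> X](log_primitive0 eta w).
apply/eqP; rewrite -subr_eq0 -normr_le0; apply/ler_addgt0Pr => r r0.
rewrite add0r.
have /cvgrPdist_le/(_ _ (divr_gt0 r0 (ltr0Sn R 1))) := Jc.
rewrite near_simpl => Jr; near (0 : R)^'+ => h.
have h0 : 0 < h by [].
have Kh : (K + K) * h <= r / 2.
  apply: (@le_trans _ _ ((K + K + 1) * h)); first by rewrite ler_wpM2r ?lerDl// ltW.
  rewrite mulrC -ler_pdivlMr ?ltr_wpDl ?addr_ge0//.
  near: h; apply: nbhs_right_le; rewrite !divr_gt0 ?ltr_wpDl ?addr_ge0//.
have J2 : `|sdiff_Theta_log_primitive eta w h| <= r / 2.
  rewrite -normrN -sub0r; near: h; apply: cvg_within; exact: Jr.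
have := fold_Htilde_near0 cT (@Theta_norm eta) sK h0; rewrite I// /sdiff_Theta_primitive -/K.
have S : `|sdiff (Theta eta) w h / h| <= K * h.
  rewrite normrM normfV (ger0_norm (ltW h0)) ler_pdivrMr// -mulrA -expr2.
  exact: sK.
move: J2 S Kh; rewrite !ler_norml => /andP[a1 a2] /andP[b1 b2] c /andP[d1 d2].
by apply/andP; split; lra.
Unshelve. all: by end_near. Qed.

(** As [Theta eta - 2^-1] is odd, both sides are odd in [x - c], which reduces to the nonnegative
    case. *)
Lemma fold_Htilde_Theta eta c x : 0 < eta ->
  fold_Htilde (fun y => Theta eta (y - c)) x = conj_poisson eta (x - c).
Proof.
move=> e0; rewrite /fold_Htilde; under eq_Rintegral do rewrite Theta_sdE.
rewrite -/(fold_Htilde (Theta eta) (x - c)); move: (x - c) => w.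
have [w0|w0] := leP 0 w; first exact: fold_Htilde_Theta_ge0.
have := @fold_Htilde_Theta_ge0 eta (- w) e0; rewrite oppr_ge0 => /(_ (ltW w0)).
have cT := continuous_Theta e0.
have -> : fold_Htilde (Theta eta) (- w) = - fold_Htilde (Theta eta) w.
  have ii : mu.-integrable `]0, +oo[ (EFin \o (fun h => sdiff (Theta eta) w h / h ^+ 2)).
    exact: (integrable_sdiff cT (@Theta_norm eta) (sdiff_quad (Theta_quad e0 w))).
  rewrite -[RHS]mulN1r; have <- := @RintegralZl _ _ _ mu `]0, +oo[%classic _ (-1) (measurable_itv
    _) ii.
  apply: eq_Rintegral => h _; rewrite mulrA; congr (_ / _).
  rewrite /sdiff /Theta (_ : - w - h = - (w + h)); last by ring.
  rewrite (_ : - w + h = - (w - h)); last by ring.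
  by rewrite !mulNr !atanN; lra.
by rewrite /conj_poisson sqrrN mulNr => /oppr_inj.
Qed.

End theta.

(** * Bounded functions of one variable with bounded derivatives of all orders *)

Section one_dim.
Context {R : realType}.

Variable P : (R -> R) -> Prop.
Hypothesis Pd : forall f, P f -> exists2 f', P f' & forall x : R, is_derive x 1 f (f' x).
Hypothesis Pb : forall f, P f -> exists M, forall x, `|f x| <= M.

Lemma quad_expansion_snd f f' f'' (K : R) : (forall x : R, is_derive x 1 f (f' x)) ->
  (forall x : R, is_derive x 1 f' (f'' x)) -> (forall x, `|f'' x| <= K) ->
  quad_expansion (fun z => f z.2) (fun=> 0) (fun z => f' z.2).
Proof.
move=> d1 d2 fK; exists K => -[t x] [a b] /= _ _; rewrite mulr0 add0r.
apply: (le_trans (taylor2 d1 d2 fK x b)); rewrite ler_wpM2l//.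
  exact: le_trans (fK 0).
by rewrite -[b ^+ 2]real_normK ?num_real// ler_sqr ?nnegrE ?addr_ge0// lerDr.
Qed.

Lemma quad_expansion_fst f f' f'' (K : R) : (forall x : R, is_derive x 1 f (f' x)) ->
  (forall x : R, is_derive x 1 f' (f'' x)) -> (forall x, `|f'' x| <= K) ->
  quad_expansion (fun z => f z.1) (fun z => f' z.1) (fun=> 0).
Proof.
move=> d1 d2 fK; exists K => -[t x] [a b] /= _ _; rewrite mulr0 addr0.
apply: (le_trans (taylor2 d1 d2 fK t a)); rewrite ler_wpM2l//.
  exact: le_trans (fK 0).
by rewrite -[a ^+ 2]real_normK ?num_real// ler_sqr ?nnegrE ?addr_ge0// lerDl.
Qed.

Lemma Cinfb_snd f : P f -> Cinfb (fun z => f z.2).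
Proof.
move=> Pf n; elim: n f Pf => [|n IH] f Pf; have [M hM] := Pb Pf.
  by split => //; exists M.
split; first by exists M.
have [f' Pf' df] := Pd Pf; have [f'' Pf'' df'] := Pd Pf'; have [K hK] := Pb Pf''.
exists (fun=> 0), (fun z => f' z.2); split.
- exact: quad_expansion_snd df df' hK.
- exact: smooth_bounded_cst.
- exact: IH.
Qed.

Lemma Cinfb_fst f : P f -> Cinfb (fun z => f z.1).
Proof.
move=> Pf n; elim: n f Pf => [|n IH] f Pf; have [M hM] := Pb Pf.
  by split => //; exists M.
split; first by exists M.
have [f' Pf' df] := Pd Pf; have [f'' Pf'' df'] := Pd Pf'; have [K hK] := Pb Pf''.
exists (fun z => f' z.1), (fun=> 0); split.
- exact: quad_expansion_fst df df' hK.
- exact: IH.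
- exact: smooth_bounded_cst.
Qed.

End one_dim.

(* The algebra generated by [EA = eta / (w^2 + eta^2)] and
   [EQ = w / (w^2 + eta^2)] is closed under differentiation and countable, so
   almost sure statements hold for all its members at once. *)
Inductive expr := EA | EQ | E1 | EN of expr | EP of expr & expr | EM of expr & expr.

Section expr.
Context {R : realType}.
Variable eta : R.
Hypothesis eta0 : 0 < eta.

Fixpoint expr_eval (e : expr) (w : R) : R :=
  match e with
  | EA => poisson eta w | EQ => conj_poisson eta w | E1 => 1 | EN a => - expr_eval a w
  | EP a b => expr_eval a w + expr_eval b w | EM a b => expr_eval a w * expr_eval b w
  end.

Fixpoint expr_deriv (e : expr) : expr :=
  match e with
  | EA => EN (EP (EM EA EQ) (EM EA EQ)) | EQ => EP (EM EA EA) (EN (EM EQ EQ))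
  | E1 => EP E1 (EN E1) | EN a => EN (expr_deriv a) | EP a b => EP (expr_deriv a) (expr_deriv b)
  | EM a b => EP (EM (expr_deriv a) b) (EM a (expr_deriv b))
  end.

Lemma is_derive_expr_eval e (w : R) : is_derive w 1 (expr_eval e) (expr_eval (expr_deriv e) w).
Proof.
elim: e => [||| a IH| a IHa b IHb| a IHa b IHb] /=.
- by apply: (is_derive_eq (is_derive_poisson w eta0)); ring.
- by apply: (is_derive_eq (is_derive_conj_poisson w eta0)); rewrite !expr2.
- by apply: (is_derive_eq (is_derive1_cst 1 w)); rewrite subrr.
- exact: is_derive1N.
- exact: is_derive1D.
- exact: is_derive1M.
Qed.

Lemma expr_eval_bound e : exists2 M, 0 <= M & forall w, `|expr_eval e w| <= M.
Proof.
elim: e => [||| a [M M0 hM]| a [M M0 hM] b [N N0 hN]| a [M M0 hM] b [N N0 hN]] /=.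
- exists eta^-1 => [|w]; first by rewrite invr_ge0 ltW.
  by have [] := poisson_conj_poisson_den w eta0.
- exists eta^-1 => [|w]; first by rewrite invr_ge0 ltW.
  by have [] := poisson_conj_poisson_den w eta0.
- by exists 1 => // w; rewrite normr1.
- by exists M => // w; rewrite normrN.
- exists (M + N) => [|w]; first exact: addr_ge0.
  by rewrite (le_trans (ler_normD _ _))// lerD.
- exists (M * N) => [|w]; first exact: mulr_ge0.
  by rewrite normrM ler_pM.
Qed.

Let Pev (f : R -> R) := exists e c, f = fun x => expr_eval e (x - c).

Let Pev_d f : Pev f -> exists2 f', Pev f' & forall x : R, is_derive x 1 f (f' x).
Proof.
move=> [e [c ->]]; exists (fun x => expr_eval (expr_deriv e) (x - c));
  first by exists (expr_deriv e), c.
move=> x; have d : is_derive x 1 (fun x : R => x - c) (1 : R).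
  by apply: (is_derive_eq (is_derive1B (is_derive1_id x) (is_derive1_cst c x))); rewrite subr0.
by apply: (is_derive_eq (is_derive1_compose d (is_derive_expr_eval e (x - c)))); rewrite mulr1.
Qed.

Let Pev_b f : Pev f -> exists M, forall x, `|f x| <= M.
Proof. by move=> [e [c ->]]; have [M _ hM] := expr_eval_bound e; exists M. Qed.

Lemma Cinfb_expr_snd e c : Cinfb (fun z => expr_eval e (z.2 - c)).
Proof. by apply: (@Cinfb_snd _ _ Pev_d Pev_b (fun x => expr_eval e (x - c))); exists e, c. Qed.

Lemma Cinfb_expr_fst e c : Cinfb (fun z => expr_eval e (z.1 - c)).
Proof. by apply: (@Cinfb_fst _ _ Pev_d Pev_b (fun x => expr_eval e (x - c))); exists e, c. Qed.

End expr.

Section logistic.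
Context {R : realType}.

Definition sigmoid (x : R) : R := (1 + expR (- x))^-1.

Lemma sigmoid_bound (x : R) : 0 < sigmoid x < 1.
Proof.
by rewrite invr_gt0 addr_gt0 ?expR_gt0//= invf_lt1 ?addr_gt0 ?expR_gt0// ltrDl expR_gt0.
Qed.

Lemma is_derive_sigmoid (x : R) : is_derive x 1 sigmoid (sigmoid x * (1 - sigmoid x)).
Proof.
have d1 := is_derive1D (is_derive1_cst 1 x) (is_derive1_compose (is_derive1N (is_derive1_id x))
  (is_derive_expR (- x))).
have n0 : 1 + expR (- x) != 0 by rewrite gt_eqF// addr_gt0 ?expR_gt0.
apply: (is_derive_eq (@is_derive1V _ (fun x => 1 + expR (- x)) _ _ n0 d1)).
by rewrite /sigmoid; field.
Qed.

Lemma sigmoid_ge2 (x : R) : 0 <= x -> 2^-1 <= sigmoid x.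
Proof.
move=> x0; rewrite lef_pV2 ?posrE ?addr_gt0 ?expR_gt0// (natrD _ 1 1) lerD2l.
by rewrite -expR0 ler_expR oppr_le0.
Qed.

Lemma sigmoid_le (x : R) : sigmoid x <= expR x.
Proof.
rewrite -[expR x]invrK -expRN lef_pV2 ?posrE ?addr_gt0 ?expR_gt0//.
by rewrite lerDr.
Qed.

Lemma is_derive_sigmoid_affine (k c t : R) : is_derive t 1 (fun t => sigmoid (k * t + c))
  (k * (sigmoid (k * t + c) * (1 - sigmoid (k * t + c)))).
Proof.
have d1 : is_derive t 1 (fun t : R => k * t + c) k.
  by apply: (is_derive_eq (is_derive1D (is_derive1Z k (is_derive1_id t)) (is_derive1_cst c t)));
    rewrite mulr1 addr0.
by apply: (is_derive_eq (is_derive1_compose d1 (is_derive_sigmoid (k * t + c)))); rewrite mulrC.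
Qed.

(** The logistic equation makes the derivative a polynomial in the function itself, so each order
    follows from the previous one by the algebra of [smooth_bounded]. *)
Lemma Cinfb_sigmoid (k c : R) : Cinfb (fun z => sigmoid (k * z.1 + c)).
Proof.
have b : plane_bounded (fun z : R * R => sigmoid (k * z.1 + c)).
  exists 1 => z; have /andP[h1 h2] := sigmoid_bound (k * z.1 + c).
  by rewrite ger0_norm ltW.
elim => [|n IH]; first by split.
split => //; exists (fun z => k * (sigmoid (k * z.1 + c) * (1 + -1 * sigmoid (k * z.1 +
  c)))), (fun=> 0).
split; last exact: smooth_bounded_cst; last first.
  by apply: smooth_boundedZ; apply: smooth_boundedM => //; apply: smooth_boundedD;
    [exact: smooth_bounded_cst|exact: smooth_boundedZ].
have D1 (t : R) := is_derive_sigmoid_affine k c t.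
have D2 (t : R) : is_derive t 1 (fun t => k * (sigmoid (k * t + c) * (1 + -1 * sigmoid (k * t +
  c))))
  (k ^+ 2 * (sigmoid (k * t + c) * (1 - sigmoid (k * t + c)) * (1 - 2 * sigmoid (k * t + c)))).
  apply: (is_derive_eq (is_derive1Z k (is_derive1M (D1 t) (is_derive1D (is_derive1_cst 1 t)
    (is_derive1Z (-1) (D1 t)))))).
  by ring.
have D1' (t : R) : is_derive t 1 (fun t => sigmoid (k * t + c))
    (k * (sigmoid (k * t + c) * (1 + -1 * sigmoid (k * t + c)))).
  by apply: (is_derive_eq (D1 t)); ring.
apply: (quad_expansion_fst D1' D2 (K := k ^+ 2)) => t.
have /andP[h1 h2] := sigmoid_bound (k * t + c); move: (sigmoid _) h1 h2 => s h1 h2.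
rewrite normrM ger0_norm ?sqr_ge0// ler_piMr ?sqr_ge0// ler_norml; apply/andP.
by split; nra.
Qed.

End logistic.

(** * Test functions and the continuity of the operator on them *)

Section test_functions.
Context {R : realType}.
Implicit Types (phi : R * R -> R) (z : R * R).
Local Notation mu := (@lebesgue_measure R).

(** The derivatives [pt] and [px] are parameters, so that those of sums and multiples are computed
    without returning to directional derivatives. A bound on second differences is all the
    second-order information that the operator requires. *)
Record test_function phi pt px : Prop := TestFunction {
  test_function_bounded : exists2 M, 0 <= M & forall z, `|phi z| <= M;
  test_function_lip : exists2 L, 0 <= L &
    forall z v, `|phi (z + v) - phi z| <= L * (`|v.1| + `|v.2|);
  test_function_sdiff : exists2 K, 0 <= K &
    forall z h, `|sdiff (fun x => phi (z.1, x)) z.2 h| <= K * h ^+ 2;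
  test_function_dt : forall z, is_derive z.1 1 (fun t => phi (t, z.2)) (pt z);
  test_function_dx : forall z, is_derive z.2 1 (fun x => phi (z.1, x)) (px z);
  tf_ct : continuous pt;
  tf_cx : continuous px }.

Definition fold_Htilde_x phi z := fold_Htilde (fun x => phi (z.1, x)) z.2.

Definition fold_Eplus phi pt px z : R := pt z + Num.max (px z) 0 * fold_Htilde_x phi z.

Lemma test_function_continuous_snd phi pt px : test_function phi pt px -> forall t, continuous
  (fun x => phi (t, x)).
Proof.
by move=> T t x; exact: is_derive_continuous (test_function_dx T (t, x)).
Qed.

Lemma test_function_continuous phi pt px : test_function phi pt px -> continuous phi.
Proof.
move=> T z; have [L L0 hL] := test_function_lip T.
apply/cvgrPdist_le => e e0; near=> y.
have := hL z (y - z); rewrite [z + _]addrC subrK => hLz.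
rewrite distrC; apply: (le_trans hLz).
have h : `|y - z| <= e / (2 * L + 1).
  rewrite distrC; near: y; apply: (@cvgr_dist_le _ (R * R)%type) => //.
  by rewrite divr_gt0// ltr_wpDl// mulr_ge0.
rewrite ler_pdivlMr ?ltr_wpDl ?mulr_ge0// in h.
have n1 : `|(y - z).1| <= `|y - z| by rewrite [leRHS]prod_normE/= le_max lexx.
have n2 : `|(y - z).2| <= `|y - z| by rewrite [leRHS]prod_normE/= le_max lexx orbT.
have h2 : L * (`|(y - z).1| + `|(y - z).2|) <= L * (2 * `|y - z|).
  by rewrite ler_wpM2l//; lra.
by apply: (le_trans h2); have := normr_ge0 (y - z); lra.
Unshelve. all: by end_near. Qed.

Lemma test_functionD phi pt px psi qt qx : test_function phi pt px -> test_function psi qt qx ->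
  test_function (fun z => phi z + psi z) (fun z => pt z + qt z) (fun z => px z + qx z).
Proof.
move=> [[M M0 hM] [L L0 hL] [K K0 hK] dt dx ct cx].
move=> [[M' M'0 hM'] [L' L'0 hL'] [K' K'0 hK'] dt' dx' ct' cx'].
split.
- exists (M + M') => [|z]; first exact: addr_ge0.
  by rewrite (le_trans (ler_normD _ _))// lerD.
- exists (L + L') => [|z v]; first exact: addr_ge0.
  rewrite mulrDl; apply: le_trans _ (lerD (hL z v) (hL' z v)).
  by rewrite opprD addrACA; exact: ler_normD.
- exists (K + K') => [|z h]; first exact: addr_ge0.
  rewrite mulrDl; apply: le_trans _ (lerD (hK z h) (hK' z h)).
  apply: le_trans _ (ler_normD _ _).
  by rewrite le_eqVlt; apply/orP; left; apply/eqP; congr (`|_|); rewrite /sdiff; ring.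
- by move=> z; exact: is_derive1D.
- by move=> z; exact: is_derive1D.
- by move=> z; apply: cvgD; [exact: ct|exact: ct'].
- by move=> z; apply: cvgD; [exact: cx|exact: cx'].
Qed.

Lemma test_functionZ phi pt px (c : R) : test_function phi pt px ->
  test_function (fun z => c * phi z) (fun z => c * pt z) (fun z => c * px z).
Proof.
move=> [[M M0 hM] [L L0 hL] [K K0 hK] dt dx ct cx]; split.
- exists (`|c| * M) => [|z]; first exact: mulr_ge0.
  by rewrite normrM ler_wpM2l.
- exists (`|c| * L) => [|z v]; first exact: mulr_ge0.
  by rewrite -mulrBr normrM -mulrA ler_wpM2l.
- exists (`|c| * K) => [|z h]; first exact: mulr_ge0.
  rewrite -mulrA; apply: le_trans _ (ler_wpM2l (normr_ge0 c) (hK z h)).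
  rewrite -normrM.
  by rewrite le_eqVlt; apply/orP; left; apply/eqP; congr (`|_|); rewrite /sdiff; ring.
- by move=> z; exact: is_derive1Z.
- by move=> z; exact: is_derive1Z.
- by move=> z; apply: cvgM; [exact: cvg_cst|exact: ct].
- by move=> z; apply: cvgM; [exact: cvg_cst|exact: cx].
Qed.

(** [small_fold] needs the difference of two second differences to be small only for bounded [h].
    The Lipschitz bound gives [8 * L] times the distance: four values, counted with multiplicity,
    each moving by [2 * L] times the distance. *)
Lemma fold_Htilde_x_continuous phi pt px : test_function phi pt px -> continuous (fold_Htilde_x
  phi).
Proof.
move=> T z0; have [M M0 hM] := test_function_bounded T; have [L L0 hL] := test_function_lip T.
have [K K0 hK] := test_function_sdiff T.
apply/cvgrPdist_le => e e0.
have [d d0 hd] := small_fold (2 * M) (2 * K) e0.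
near=> z.
have cc t := test_function_continuous_snd T (t := t).
have ii y : mu.-integrable `]0, +oo[
    (EFin \o (fun h => sdiff (fun x => phi (y.1, x)) y.2 h / h ^+ 2)).
  exact: (integrable_sdiff (cc y.1) (fun x => hM (y.1, x)) (hK y)).
rewrite /fold_Htilde_x /fold_Htilde -RintegralB//.
under eq_Rintegral do rewrite -mulrBl.
apply: hd.
- by apply: measurable_funB; apply: measurable_sdiff; exact: cc.
- move=> h; apply: (le_trans (ler_normB _ _)).
  have a y : `|sdiff (fun x => phi (y.1, x)) y.2 h| <= 4 * M by exact: sdiff_le4.
  by have := a z0; have := a z; lra.
- move=> h; apply: (le_trans (ler_normB _ _)).
  by have := hK z0 h; have := hK z h; lra.
- move=> h h0 hh.
  have b : `|z0 - z| <= d / (8 * L + 1).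
    near: z; apply: (@cvgr_dist_le _ (R * R)%type) => //.
    by rewrite divr_gt0// ltr_wpDl// mulr_ge0.
  rewrite ler_pdivlMr ?ltr_wpDl ?mulr_ge0// in b.
  have n1 : `|z0.1 - z.1| <= `|z0 - z| by rewrite [leRHS]prod_normE/= le_max lexx.
  have n2 : `|z0.2 - z.2| <= `|z0 - z| by rewrite [leRHS]prod_normE/= le_max lexx orbT.
  have D k : `|phi (z0.1, z0.2 + k) - phi (z.1, z.2 + k)| <= L * (2 * `|z0 - z|).
    have -> : (z0.1, z0.2 + k) = (z.1, z.2 + k) + (z0.1 - z.1, z0.2 - z.2).
      by congr (_, _) => /=; ring.
    by apply: (le_trans (hL _ _)); rewrite ler_wpM2l//=; lra.
  have [[D0 D1] D2] := (D 0, D h, D (- h)); rewrite !addr0 in D0.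
  apply: le_trans b; rewrite /sdiff; move: D0 D1 D2; rewrite !ler_norml.
  move: (`|z0 - z|) (normr_ge0 (z0 - z)) => q q0 /andP[? ?] /andP[? ?] /andP[? ?].
  by apply/andP; split; lra.
Unshelve. all: by end_near. Qed.

Lemma fold_Eplus_continuous phi pt px : test_function phi pt px -> continuous (fold_Eplus phi pt
  px).
Proof.
move=> T z; apply: cvgD; first exact: tf_ct T z.
apply: cvgM; last exact: (fold_Htilde_x_continuous T).
by apply: continuous_max => //; [exact: tf_cx T z|exact: cvg_cst].
Qed.

Lemma dir_derive phi z v (k : R) : derivable phi (z + k *: v) v ->
  is_derive k 1 (fun k => phi (z + k *: v)) ('D_v phi (z + k *: v)).
Proof.
move=> d.
have E : (fun h => h^-1 *: (((fun k => phi (z + k *: v)) \o shift k) (h *: 1) -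
    phi (z + k *: v))) =
  (fun h => h^-1 *: ((phi \o shift (z + k *: v)) (h *: v) - phi (z + k *: v))).
  apply/funext => h /=; congr (_ *: (phi _ - _)).
  have -> : (h *: 1 : R) = h by exact: mulr1.
  by rewrite scalerDl addrCA.
by split; [rewrite /derivable E|rewrite /derive E].
Qed.

Lemma bounded_funP phi : bounded_fun phi -> exists2 M, 0 <= M & forall z, `|phi z| <= M.
Proof.
move=> [M [_ hM]]; exists (`|M| + 1); first by rewrite addr_ge0.
by move=> z; apply: hM => //; rewrite ltr_pwDr// ler_norm.
Qed.

Lemma test_function_of_smooth phi : smooth phi -> C11b phi ->
  test_function phi ('D_(1, 0) phi) ('D_(0, 1) phi).
Proof.
move=> softplus [/bounded_funP[M M0 hM] bK].
have d0 z : differentiable phi z := softplus [::] z.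
have d1 v z : differentiable ('D_v phi) z := softplus [:: v] z.
have key v z (k : R) : is_derive k 1 (fun k => phi (z + k *: v)) ('D_v phi (z + k *: v)).
  by apply: dir_derive; exact: diff_derivable.
have key2 v z (k : R) : is_derive k 1 (fun k => 'D_v phi (z + k *: v))
    ('D_v ('D_v phi) (z + k *: v)).
  by apply: dir_derive; exact: diff_derivable.
have dt z : is_derive z.1 1 (fun t => phi (t, z.2)) ('D_(1, 0) phi z).
  have E t : (t, z.2) = (0, z.2) + t *: (1, 0) :> R * R.
    by congr (_, _); rewrite /= /GRing.scale/= ?mulr1 ?mulr0 ?addr0 ?add0r.
  have := key (1, 0) (0, z.2) z.1; rewrite -E -surjective_pairing.
  by under eq_fun do rewrite -E.
have dx z : is_derive z.2 1 (fun x => phi (z.1, x)) ('D_(0, 1) phi z).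
  have E x : (z.1, x) = (z.1, 0) + x *: (0, 1) :> R * R.
    by congr (_, _); rewrite /= /GRing.scale/= ?mulr1 ?mulr0 ?addr0 ?add0r.
  have := key (0, 1) (z.1, 0) z.2; rewrite -E -surjective_pairing.
  by under eq_fun do rewrite -E.
(* [C11b] bounds the function and its second derivatives only; a Taylor expansion with step 1
   interpolates a bound on the first derivatives. *)
have gb v : exists2 L, 0 <= L & forall z, `|'D_v phi z| <= L.
  have [K K0 hK] := bounded_funP (bK v v).
  exists (K + 2 * M) => [|z]; first by rewrite addr_ge0// mulr_ge0.
  have := taylor2 (key v z) (key2 v z) (fun k => hK _) 0 1.
  rewrite scale0r addr0 add0r mul1r expr1n mulr1.
  have := hM z; have := hM (z + 1 *: v); rewrite !ler_norml.
  by move=> /andP[? ?] /andP[? ?] /andP[? ?]; apply/andP; split; lra.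
split => //.
- by exists M.
- have [L L0 hL] := gb (1, 0); have [N N0 hN] := gb (0, 1).
  exists (L + N) => [|[t x] [a b]/=]; first exact: addr_ge0.
  have A := @mvt_lip _ (fun y => phi (y, x + b)) (fun y => 'D_(1, 0) phi (y, x + b)) L
    (fun y => dt (y, x + b)) (fun y => hL (y, x + b)) t (t + a).
  have B := @mvt_lip _ (fun y => phi (t, y)) (fun y => 'D_(0, 1) phi (t, y)) N
    (fun y => dx (t, y)) (fun y => hN (t, y)) x (x + b).
  have -> : phi ((t, x) + (a, b)) - phi (t, x) =
    (phi (t + a, x + b) - phi (t, x + b)) + (phi (t, x + b) - phi (t, x)).
    by rewrite addrA subrK.
  apply: (le_trans (ler_normD _ _)).
  rewrite addrAC subrr add0r /= in A; rewrite addrAC subrr add0r /= in B.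
  apply: (le_trans (lerD A B)); rewrite mulrDr lerD// ler_wpM2r//.
    by rewrite lerDl.
  by rewrite lerDr.
- have [K K0 hK] := bounded_funP (bK (0, 1) (0, 1)).
  exists (2 * K) => [|z h]; first by rewrite mulr_ge0.
  apply: (@sdiff_quad _ (fun x => phi (z.1, x)) z.2 ('D_(0, 1) phi z)) => {}h.
  have := taylor2 (key (0, 1) z) (key2 (0, 1) z) (fun k => hK _) 0 h.
  rewrite scale0r addr0 add0r.
  suff -> : z + h *: (0, 1) = (z.1, z.2 + h) by rewrite -surjective_pairing.
  case: z => t x; congr (_, _); rewrite /= /GRing.scale/=.
    by rewrite mulr0 addr0.
  by rewrite mulr1.
- by move=> z; exact: differentiable_continuous.
- by move=> z; exact: differentiable_continuous.
Qed.

Lemma fold_Htilde_xE phi pt px : test_function phi pt px -> forall z,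
  Htilde (fun y => phi (z.1, y)) z.2 = fold_Htilde_x phi z.
Proof.
move=> T z; have [M M0 hM] := test_function_bounded T; have [K K0 hK] := test_function_sdiff T.
exact: (Htilde_foldE (test_function_continuous_snd T (t := z.1)) (fun x => hM (z.1, x)) (hK z)).
Qed.

Lemma Eplus_foldE phi : smooth phi -> C11b phi -> forall z,
  Eplus phi z = fold_Eplus phi ('D_(1, 0) phi) ('D_(0, 1) phi) z.
Proof.
by move=> softplus cp z; rewrite /Eplus /fold_Eplus (fold_Htilde_xE (test_function_of_smooth
  softplus cp)).
Qed.

Lemma test_function_integrable phi pt px z : test_function phi pt px -> mu.-integrable `]0, +oo[
    (EFin \o (fun h => sdiff (fun x => phi (z.1, x)) z.2 h / h ^+ 2)).
Proof.
move=> T; have [M M0 hM] := test_function_bounded T; have [K K0 hK] := test_function_sdiff T.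
exact: (integrable_sdiff (test_function_continuous_snd T (t := z.1)) (fun x => hM (z.1, x)) (hK z)).
Qed.

Lemma fold_Htilde_xD phi pt px psi qt qx : test_function phi pt px -> test_function psi qt qx ->
  forall z,
  fold_Htilde_x (fun z => phi z + psi z) z = fold_Htilde_x phi z + fold_Htilde_x psi z.
Proof.
move=> T T' z; rewrite /fold_Htilde_x /fold_Htilde -RintegralD//.
- by apply: eq_Rintegral => h _; rewrite -mulrDl; congr (_ / _); rewrite /sdiff; ring.
- exact: test_function_integrable T.
- exact: test_function_integrable T'.
Qed.

Lemma fold_Htilde_xZ phi pt px (c : R) : test_function phi pt px -> forall z,
  fold_Htilde_x (fun z => c * phi z) z = c * fold_Htilde_x phi z.
Proof.
move=> T z.
have <- := @RintegralZl _ _ _ mu `]0, +oo[%classic _ c (measurable_itv _)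
  (test_function_integrable z T).
by apply: eq_Rintegral => h _; rewrite mulrA; congr (_ / _); rewrite /sdiff; ring.
Qed.

Lemma test_function_unique phi pt px qt qx : test_function phi pt px -> test_function phi qt qx ->
  forall z, pt z = qt z /\ px z = qx z.
Proof.
move=> T T' z; split.
  by have [_ <-] := test_function_dt T z; have [_ <-] := test_function_dt T' z.
by have [_ <-] := test_function_dx T z; have [_ <-] := test_function_dx T' z.
Qed.

Lemma Cinfb_test_function phi : Cinfb phi -> test_function phi ('D_(1, 0) phi) ('D_(0, 1) phi).
Proof. by move=> softplus; apply: test_function_of_smooth; [exact: Cinfb_smooth|exact:
  Cinfb_C11b]. Qed.

Lemma CinfbD phi psi : Cinfb phi -> Cinfb psi -> Cinfb (fun z => phi z + psi z).
Proof. by move=> a b n; exact: smooth_boundedD. Qed.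

Lemma CinfbZ (c : R) phi : Cinfb phi -> Cinfb (fun z => c * phi z).
Proof. by move=> a n; exact: smooth_boundedZ. Qed.

End test_functions.

(** * Stability and comparison *)
Section penal.
Context {R : realType}.
Implicit Types (z : R * R).

(** It vanishes to second order at [c] and tends to 1 at infinity (see [bumpE]). Written through
    [poisson], it belongs to the algebra of [expr_eval], hence to [Cinfb]. *)
Definition bump (eta c y : R) : R := 1 - eta * poisson eta (y - c).

Lemma bumpE eta c y : 0 < eta -> bump eta c y = (y - c) ^+ 2 / ((y - c) ^+ 2 + eta ^+ 2).
Proof.
move=> e0; have D := lt0r_neq0 (den_gt0 (y - c) e0).
by rewrite /bump /poisson; field.
Qed.

Lemma bump_bound eta c y : 0 < eta -> 0 <= bump eta c y <= 1.
Proof.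
move=> e0; have D := den_gt0 (y - c) e0; rewrite bumpE//.
by rewrite divr_ge0 ?sqr_ge0 ?(ltW D)//= ler_pdivrMr// mul1r lerDl sqr_ge0.
Qed.

Lemma bump_ge eta c y r : 0 < eta -> 0 < r -> r <= `|y - c| ->
  r ^+ 2 / (r ^+ 2 + eta ^+ 2) <= bump eta c y.
Proof.
move=> e0 r0 ry; have D := den_gt0 (y - c) e0; have D' := den_gt0 r e0.
have q : r ^+ 2 <= (y - c) ^+ 2.
  by rewrite -[leRHS]real_normK ?num_real// ler_sqr// nnegrE ltW.
rewrite bumpE// ler_pdivrMr// mulrAC ler_pdivlMr//.
by have e2 := sqr_ge0 eta; nra.
Qed.

(* A bounded substitute for [|z - z0|^2], since test functions are bounded. *)
Definition psi z0 z : R := bump 1 z0.1 z.1 + bump 1 z0.2 z.2.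

Lemma psi0 z0 : psi z0 z0 = 0.
Proof. by rewrite /psi !bumpE// !subrr expr0n/= mul0r addr0. Qed.

Lemma psi_ge z0 z r : 0 < r -> (r <= `|z.1 - z0.1|) || (r <= `|z.2 - z0.2|) ->
  r ^+ 2 / (r ^+ 2 + 1) <= psi z0 z.
Proof.
have /andP[a _] := bump_bound z0.1 z.1 (@ltr01 R).
have /andP[b _] := bump_bound z0.2 z.2 (@ltr01 R).
move=> r0 /orP[] h; have := bump_ge (@ltr01 R) r0 h; rewrite expr1n /psi => h'.
  by rewrite (le_trans h')// lerDl.
by rewrite (le_trans h')// lerDr.
Qed.

Lemma psi_gt0 z0 z : z <> z0 -> 0 < psi z0 z.
Proof.
move=> zz; have [E1|N1] := eqVneq z.1 z0.1; last first.
  have r0 : 0 < `|z.1 - z0.1| by rewrite normr_gt0 subr_eq0.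
  apply: lt_le_trans (psi_ge r0 _); last by rewrite lexx.
  by rewrite divr_gt0 ?exprn_gt0// ltr_wpDl ?sqr_ge0.
have r0 : 0 < `|z.2 - z0.2|.
  rewrite normr_gt0 subr_eq0; apply/eqP => E2; apply: zz.
  by rewrite (surjective_pairing z) E1 E2 -surjective_pairing.
apply: lt_le_trans (psi_ge r0 _); last by rewrite lexx orbT.
by rewrite divr_gt0 ?exprn_gt0// ltr_wpDl ?sqr_ge0.
Qed.

Lemma Cinfb_bump_snd eta c : 0 < eta -> Cinfb (fun z => bump eta c z.2).
Proof.
move=> e0; rewrite (_ : (fun z => _) = fun z : R * R => 1 + (- eta) * expr_eval eta EA (z.2 - c)).
  by apply: CinfbD; [move=> n; exact: smooth_bounded_cst|apply: CinfbZ; exact: Cinfb_expr_snd].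
by apply/funext => z; rewrite /bump mulNr.
Qed.

Lemma Cinfb_bump_fst eta c : 0 < eta -> Cinfb (fun z => bump eta c z.1).
Proof.
move=> e0; rewrite (_ : (fun z => _) = fun z : R * R => 1 + (- eta) * expr_eval eta EA (z.1 - c)).
  by apply: CinfbD; [move=> n; exact: smooth_bounded_cst|apply: CinfbZ; exact: Cinfb_expr_fst].
by apply/funext => z; rewrite /bump mulNr.
Qed.

Lemma Cinfb_psi z0 : Cinfb (psi z0).
Proof. by apply: CinfbD; [exact: Cinfb_bump_fst|exact: Cinfb_bump_snd]. Qed.

Lemma is_derive_bump (eta c y : R) : 0 < eta -> is_derive y 1 (bump eta c)
  (2 * eta * (poisson eta (y - c) * conj_poisson eta (y - c))).
Proof.
move=> e0; have d : is_derive y 1 (fun x : R => x - c) (1 : R).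
  by apply: (is_derive_eq (is_derive1B (is_derive1_id y) (is_derive1_cst c y))); rewrite subr0.
apply: (is_derive_eq (is_derive1B (is_derive1_cst 1 y) (is_derive1Z eta (is_derive1_compose d
  (is_derive_poisson (y - c) e0))))).
by ring.
Qed.

(** Thus adding a multiple of [psi z0] to a test function alters [fold_Eplus] at [z0] only through
    the nonlocal term. *)
Lemma psi_grad z0 : 'D_(1, 0) (psi z0) z0 = 0 /\ 'D_(0, 1) (psi z0) z0 = 0.
Proof.
have T := Cinfb_test_function (Cinfb_psi z0).
split.
  have [_ <-] := test_function_dt T z0.
  have := is_derive1D (is_derive_bump z0.1 z0.1 (@ltr01 R)) (is_derive1_cst (bump 1 z0.2 z0.2)
    z0.1).
  by move=> [_ ->]; rewrite subrr /conj_poisson mul0r mulr0 mulr0 addr0.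
have [_ <-] := test_function_dx T z0.
have := is_derive1D (is_derive1_cst (bump 1 z0.1 z0.1) z0.2) (is_derive_bump z0.2 z0.2 (@ltr01 R)).
by move=> [_ ->]; rewrite subrr /conj_poisson mul0r mulr0 mulr0 addr0.
Qed.

End penal.

Section stability.
Context {R : realType}.
Implicit Types (phi u F : R * R -> R) (z : R * R).
Local Notation mu := (@lebesgue_measure R).

(** The positive part in (E+) disappears because [ux] is nonnegative. Derivatives and equation
    concern positive times only, since contact points with test functions have positive time. *)
Record classical_solution u ut ux : Prop := ClassicalSolution {
  classical_dt : forall z, 0 < z.1 -> is_derive z.1 1 (fun t => u (t, z.2)) (ut z);
  classical_dx : forall z, 0 < z.1 -> is_derive z.2 1 (fun x => u (z.1, x)) (ux z);
  classical_dx_ge0 : forall z, 0 < z.1 -> 0 <= ux z;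
  classical_bounded : exists2 M, 0 <= M & forall z, 0 <= z.1 -> `|u z| <= M;
  classical_sdiff : exists2 K, 0 <= K &
    forall z h, 0 < z.1 -> `|sdiff (fun x => u (z.1, x)) z.2 h| <= K * h ^+ 2;
  classical_continuous : forall z, 0 < z.1 -> {for z, continuous u};
  classical_eqn : forall z, 0 < z.1 -> ut z + ux z * fold_Htilde_x u z = 0 }.

Lemma cs_integrable u ut ux z : classical_solution u ut ux -> 0 < z.1 -> mu.-integrable `]0, +oo[
    (EFin \o (fun h => sdiff (fun x => u (z.1, x)) z.2 h / h ^+ 2)).
Proof.
move=> T z0; have [M M0 hM] := classical_bounded T; have [K K0 hK] := classical_sdiff T.
apply: (integrable_sdiff (M := M) (K := K)) => //.
- by move=> x; exact: is_derive_continuous (classical_dx T (z := (z.1, x)) z0).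
- by move=> y; apply: hM; exact: ltW.
- by move=> h; exact: hK.
Qed.

Lemma max_derive (f : R -> R) (c a r : R) : 0 < r ->
  (forall y, `|y - c| < r -> exists l, is_derive y 1 f l) ->
  is_derive c 1 f a -> (forall y, `|y - c| < r -> f y <= f c) -> a = 0.
Proof.
move=> r0 df da adapted_fun; have [_ <-] := da.
have E y : y \in `](c - r), (c + r)[ -> `|y - c| < r.
  by rewrite in_itv/= ltr_norml => /andP[? ?]; apply/andP; split; lra.
have := @derive1_at_max _ f (c - r) (c + r) c _ _ _ _.
have h1 : c - r <= c + r by lra.
move=> /(_ h1); case.
- by move=> y /E /df[l []].
- by rewrite in_itv/=; apply/andP; split; lra.
- by move=> y /E /adapted_fun.
- by move=> _ ->.
Qed.

(** At a global extremum of [u - phi] the first derivatives agree, and the second differences are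
    ordered for every [h], hence so are the nonlocal terms. The factor [ux] being nonnegative, the
    order passes to the whole expression. *)
Lemma touching (s : R) u ut ux phi pt px z1 : s = 1 \/ s = -1 -> classical_solution u ut ux ->
  test_function phi pt px -> 0 < z1.1 ->
  (forall z, 0 <= z.1 -> s * (u z - phi z) <= s * (u z1 - phi z1)) ->
  s * fold_Eplus phi pt px z1 <= 0.
Proof.
move=> hs Cu T z10 hmax.
have s0 : s != 0 by case: hs => ->; rewrite ?oppr_eq0 oner_eq0.
have Et : ut z1 = pt z1.
  have d := is_derive1Z s (is_derive1B (classical_dt Cu z10) (test_function_dt T z1)).
  have : s * (ut z1 - pt z1) = 0.
    apply: (max_derive z10 _ d).
      move=> y; rewrite ltr_norml => /andP[h _].
      have y0 : 0 < y by lra.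
      exists (s * (ut (y, z1.2) - pt (y, z1.2))).
      exact: is_derive1Z s (is_derive1B (classical_dt Cu (z := (y, z1.2)) y0) (test_function_dt T
        (y, z1.2))).
    move=> y; rewrite ltr_norml => /andP[h _].
    by rewrite -surjective_pairing; apply: hmax => /=; lra.
  by move/eqP; rewrite mulf_eq0 (negbTE s0)/= subr_eq0 => /eqP.
have Ex : ux z1 = px z1.
  have d := is_derive1Z s (is_derive1B (classical_dx Cu z10) (test_function_dx T z1)).
  have : s * (ux z1 - px z1) = 0.
    apply: (max_derive z10 _ d).
      move=> y _; exists (s * (ux (z1.1, y) - px (z1.1, y))).
      exact: is_derive1Z s (is_derive1B (classical_dx Cu (z := (z1.1, y)) z10) (test_function_dx T
        (z1.1, y))).
    move=> y _.
    by rewrite -surjective_pairing; apply: hmax => /=; exact: ltW.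
  by move/eqP; rewrite mulf_eq0 (negbTE s0)/= subr_eq0 => /eqP.
have H : s * fold_Htilde_x phi z1 <= s * fold_Htilde_x u z1.
  rewrite /fold_Htilde_x /fold_Htilde.
  have i1 := test_function_integrable z1 T; have i2 := cs_integrable Cu z10.
  have D : measurable (`]0, +oo[%classic : set (measurableTypeR R)) by exact: measurable_itv.
  have <- := @RintegralZl _ _ _ mu `]0, +oo[%classic _ s D i1.
  have <- := @RintegralZl _ _ _ mu `]0, +oo[%classic _ s D i2.
  apply: le_Rintegral => //.
  - exact: (@integrableZl _ _ _ mu _ D s _ i1).
  - exact: (@integrableZl _ _ _ mu _ D s _ i2).
  - move=> h; rewrite /= in_itv/= andbT => h0.
    rewrite !mulrA ler_pM2r ?invr_gt0 ?exprn_gt0// /sdiff.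
    have A k := hmax (z1.1, z1.2 + k) (ltW z10).
    have := A h; have := A (- h); rewrite -!surjective_pairing.
    by case: hs => ->; rewrite ?mul1r ?mulN1r; lra.
rewrite /fold_Eplus -Et -Ex (max_l (classical_dx_ge0 Cu z10)) mulrDr mulrCA.
have := classical_eqn Cu z10 => E; have p := classical_dx_ge0 Cu z10.
have : s * (ut z1 + ux z1 * fold_Htilde_x u z1) = 0 by rewrite E mulr0.
rewrite mulrDr mulrCA => <-; rewrite lerD2l.
by rewrite mulrCA [leRHS]mulrCA; exact: ler_wpM2l.
Qed.

(* The sign [s = 1] is for subsolutions, [s = -1] for supersolutions: it is
   enough to approximate [F] from the right side by classical solutions, up to an
   error [C * dl] and a spatial shift [2 * dl]. *)
Lemma viscosity_stability (s C : R) F phi z0 : s = 1 \/ s = -1 -> 0 <= C -> smooth phi -> C11b phi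
  ->
  0 < z0.1 ->
  (forall z, halfplane z -> z <> z0 -> s * (F z - phi z) < s * (F z0 - phi z0)) ->
  (forall dl, 0 < dl -> dl <= 1 -> exists u ut ux, [/\ classical_solution u ut ux,
     forall z, halfplane z -> s * F z <= s * u z &
     forall z, halfplane z -> s * u z <= s * F (z.1, z.2 + 2 * s * dl) + C * dl]) ->
  s * Eplus phi z0 <= 0.
Proof.
move=> hs C0 softplus cp z00 hmax hu; rewrite (Eplus_foldE softplus cp).
have ss : s * s = 1 by case: hs => ->; rewrite ?mulr1 ?mulrNN ?mulr1.
have T := test_function_of_smooth softplus cp; set pt := 'D_(1, 0) phi in T *;
  set px := 'D_(0, 1) phi in T *.
have T' := Cinfb_test_function (Cinfb_psi z0); have [g1 g2] := psi_grad z0.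
set qt := 'D_(1, 0) (psi z0) in T' g1; set qx := 'D_(0, 1) (psi z0) in T' g2.
rewrite leNgt; apply/negP => E0.
(* Adding [s * k * psi z0] to [phi] makes the strict maximum quantitative away from [z0]; [k] is so
   small that the expression at [z0], changed by [k * P], keeps its sign. *)
pose P := Num.max (px z0) 0 * fold_Htilde_x (psi z0) z0.
have [k k0 kE] : exists2 k, 0 < k & 0 < s * fold_Eplus phi pt px z0 + k * P.
  exists (s * fold_Eplus phi pt px z0 / (`|P| + 1)); first by rewrite divr_gt0// ltr_wpDl.
  have b0 : 0 < `|P| + 1 by rewrite ltr_wpDl.
  have h : - P <= `|P| by rewrite -normrN ler_norm.
  move: E0 h b0; move: (s * _) (`|P|) => X N X0 h b0.
  have -> : X + X / (N + 1) * P = X / (N + 1) * (N + 1 + P).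
    by field; rewrite gt_eqF.
  rewrite mulr_gt0 ?divr_gt0// addrAC ltr_wpDl//.
  by rewrite -lerBlDr sub0r.
pose ph z := phi z + s * k * psi z0 z.
pose ht z := pt z + s * k * qt z.
pose hx z := px z + s * k * qx z.
have Tk : test_function ph ht hx := test_functionD T (test_functionZ (s * k) T').
have half_lt (e : R) : 0 < e -> e / 2 < e by move=> e0; rewrite ltr_pdivrMr// ltr_pMr// ltr1n.
have Ek : 0 < s * fold_Eplus ph ht hx z0.
  rewrite /fold_Eplus /ht /hx (g1 : qt z0 = 0) (g2 : qx z0 = 0) !mulr0 !addr0 (fold_Htilde_xD T
    (test_functionZ (s * k) T')) (fold_Htilde_xZ _ T').
  move: kE; rewrite /fold_Eplus /P => h.
  rewrite (_ : s * _ = s * (pt z0 + Num.max (px z0) 0 * fold_Htilde_x phi z0) +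
    k * (Num.max (px z0) 0 * fold_Htilde_x (psi z0) z0))//.
  transitivity (s * (pt z0 + Num.max (px z0) 0 * fold_Htilde_x phi z0) +
    (s * s) * k * (Num.max (px z0) 0 * fold_Htilde_x (psi z0) z0)); first by ring.
  by rewrite ss mul1r.
have [r r0 hr] : exists2 r, 0 < r & forall z, `|z.1 - z0.1| <= r ->
    `|z.2 - z0.2| <= r -> 0 < s * fold_Eplus ph ht hx z.
  have cE : continuous (fun z => s * fold_Eplus ph ht hx z).
    by move=> z; apply: cvgM; [exact: cvg_cst|exact: fold_Eplus_continuous Tk z].
  have /cvgrPdist_lt/(_ _ Ek) := cE z0.
  rewrite near_simpl => /(@nbhs_normP _ (R * R)%type)[e /= e0 he].
  exists (e / 2); first by rewrite divr_gt0.
  move=> z h1 h2; have : `|z0 - z| < e.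
    by rewrite prod_normE/= gt_max !(distrC z0.1) !(distrC z0.2) (le_lt_trans h1) ?(le_lt_trans
      h2)// half_lt.
  by move=> /he/= /ltr_distlBl; rewrite subrr.
wlog rt : r r0 hr / r < z0.1.
  move=> W; apply: (W (Num.min r (z0.1 / 2))).
  - by rewrite lt_min r0 divr_gt0.
  - by move=> z; rewrite !le_min => /andP[? _] /andP[? _]; exact: hr.
  - by rewrite gt_min half_lt ?orbT.
have [L L0 hL] := test_function_lip T.
pose m := r ^+ 2 / (r ^+ 2 + 1).
have m0 : 0 < m by rewrite divr_gt0 ?exprn_gt0// ltr_wpDl ?sqr_ge0.
(* The approximation error [C * dl] and the variation [2 * L * dl] of [phi] over the spatial shift
   must stay below [k * m], the gain of the penalization outside the box of radius [r]. *)
pose dl := Num.min 1 (k * m / (C + 2 * L + 1)).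
have CL : 0 < C + 2 * L + 1 by rewrite ltr_wpDl// addr_ge0// mulr_ge0.
have dl0 : 0 < dl by rewrite lt_min ltr01 divr_gt0// mulr_gt0.
have dl1 : dl <= 1 by rewrite ge_min lexx.
have dl2 : dl * (C + 2 * L + 1) <= k * m by rewrite -ler_pdivlMr// ge_min lexx orbT.
have [u [ut [ux [Cu Fu uF]]]] := hu _ dl0 dl1.
pose g z := s * (u z - ph z).
pose K : set (R * R) := `[z0.1 - r, z0.1 + r]%classic `*` `[z0.2 - r, z0.2 + r]%classic.
have Kc : compact K by apply: compact_setX; exact: segment_compact.
have K0 : K z0 by split => /=; rewrite in_itv/= -ler_distl subrr normr0 ltW.
have cg : {within K, continuous g}.
  apply: continuous_in_subspaceT => z; rewrite inE => -[/=]; rewrite !in_itv/= => /andP[h _] _.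
  apply: cvgM; first exact: cvg_cst.
  apply: cvgB; last exact: test_function_continuous Tk z.
  by apply: (classical_continuous Cu); apply: lt_le_trans h; rewrite subr_gt0.
have [z1 Kz1 z1m] := compact_EVT_max (ex_intro _ z0 K0) Kc cg.
have z1K : `|z1.1 - z0.1| <= r /\ `|z1.2 - z0.2| <= r.
  by move: Kz1; rewrite inE => -[/=]; rewrite !in_itv/= -!ler_distl.
have z10 : 0 < z1.1.
  by move: z1K => [+ _]; rewrite ler_distl => /andP[h _]; apply: lt_le_trans h; rewrite subr_gt0.
have g0 : s * (F z0 - phi z0) <= g z0.
  by rewrite /g /ph psi0 mulr0 addr0 !mulrBr lerD2r; apply: Fu; exact: ltW.
(* [touching] requires a global maximum. Outside the box, [uF] compares [u] with [F] at a shifted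
   point, where [hmax] applies, and the penalization absorbs the cost of the shift. *)
have gm z : 0 <= z.1 -> g z <= g z1.
  move=> hz; have [Kz|nKz] := pselect (K z); first by apply: z1m; rewrite inE.
  have z0m : g z0 <= g z1 by apply: z1m; rewrite inE.
  apply: le_trans z0m; apply: le_trans g0.
  have pm : m <= psi z0 z.
    apply: psi_ge => //; apply/negbNE/negP; rewrite negb_or -!ltNge => /andP[h1 h2].
    by apply: nKz; split => /=; rewrite in_itv/= -ler_distl ltW.
  pose z' := (z.1, z.2 + 2 * s * dl).
  have h1 : s * (F z' - phi z') <= s * (F z0 - phi z0).
    by have [->|] := pselect (z' = z0); [exact: lexx|move=> ne; exact/ltW/hmax].
  have h2 : s * (phi z' - phi z) <= L * (2 * dl).
    have -> : z' = z + (0, 2 * s * dl).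
      by rewrite /z'; case: (z) => a b; congr (_, _); rewrite /= addr0.
    have := hL z (0, 2 * s * dl); rewrite /= normr0 add0r.
    have -> : `|2 * s * dl| = 2 * dl.
      by case: hs => ->; rewrite ?mulr1 ?mulrN1 ?mulNr ?normrN ger0_norm// mulr_ge0// ltW.
    move: (phi (z + _)) => X; rewrite ler_norml => /andP[a b].
    by case: hs => ->; rewrite ?mul1r// mulN1r lerNl.
  have h3 := uF z hz.
  have h4 : k * m <= k * psi z0 z by rewrite ler_pM2l.
  have -> : g z = s * u z - s * phi z - (s * s) * (k * psi z0 z).
    by rewrite /g /ph; ring.
  by rewrite ss; rewrite -/z' in h3; lra.
have z1E := touching hs Cu Tk z10 gm.
have [a b] := z1K; have := hr z1 a b.
by rewrite ltNge z1E.
Qed.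

End stability.

Section smoothed_time.
Context {R : realType}.

(** A smooth map of all times into the positive ones, within [s] of the identity at nonnegative
    times. Composing with it turns a function that is regular at positive times into one that is
    regular on the whole plane. *)
Definition softplus (s t : R) : R := s * ln (1 + expR (t / s)).

Let pos (y : R) : 0 < 1 + expR y.
Proof. by rewrite addr_gt0 ?expR_gt0. Qed.

Lemma is_derive_softplus (s t : R) : 0 < s -> is_derive t 1 (softplus s) (sigmoid (s^-1 * t + 0)).
Proof.
move=> s0.
have d1 : is_derive t 1 (fun y : R => y / s) (s^-1).
  by apply: (is_derive_eq (is_derive1M (is_derive1_id t) (is_derive1_cst s^-1 t)));
    rewrite mulr0 addr0 mul1r.
have d2 := is_derive1D (is_derive1_cst 1 t) (is_derive1_compose d1 (is_derive_expR (t / s))).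
apply: (is_derive_eq (is_derive1Z s (is_derive1_compose d2 (is_derive1_ln (pos (t / s)))))).
rewrite addr0 add0r /sigmoid (mulrC s^-1) expRN; have := expR_gt0 (t / s).
move: (expR _) => E E0; field; rewrite !gt_eqF// ?addr_gt0//.
Qed.

Lemma softplus_gt0 (s t : R) : 0 < s -> 0 < softplus s t.
Proof. by move=> s0; rewrite mulr_gt0// ln_gt0// ltrDl expR_gt0. Qed.

Lemma softplus_bound (s t : R) : 0 < s -> 0 <= t -> t <= softplus s t <= t + s.
Proof.
move=> s0 t0; rewrite /softplus.
have -> : ln (1 + expR (t / s)) = t / s + ln (1 + expR (- (t / s))).
  have -> : 1 + expR (t / s) = expR (t / s) * (1 + expR (- (t / s))).
    by rewrite expRN mulrDr mulr1 mulfV ?gt_eqF ?expR_gt0// addrC.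
  by rewrite lnM ?posrE ?expR_gt0 ?pos// expRK.
rewrite mulrDr (_ : s * (t / s) = t); last by field; rewrite gt_eqF.
have l0 : 0 <= ln (1 + expR (- (t / s))) by rewrite ln_ge0// lerDl expR_ge0.
have l1 : ln (1 + expR (- (t / s))) <= 1.
  apply: (le_trans (le_ln1Dx _)); first by rewrite (lt_le_trans (ltrN10 _))// expR_ge0.
  by rewrite -[leRHS]expR0 ler_expR oppr_le0 divr_ge0// ltW.
rewrite lerDl mulr_ge0//= ?(ltW s0)// lerD2l.
by rewrite -[leRHS]mulr1 ler_wpM2l// ltW.
Qed.

Lemma sigmoid_mono (x y : R) : x <= y -> sigmoid x <= sigmoid y.
Proof. by move=> xy; rewrite lef_pV2 ?posrE ?pos// lerD2l ler_expR lerN2. Qed.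

Lemma sigmoid_le2 (x : R) : x <= 0 -> sigmoid x <= 2^-1.
Proof.
move=> x0; rewrite lef_pV2 ?posrE ?pos// (natrD _ 1 1) lerD2l.
by rewrite -expR0 ler_expR oppr_ge0.
Qed.

End smoothed_time.

Section usc_max.
Context {R : realType} {T : topologicalType}.

(** The superlevel sets at heights below the supremum generate a filter on [K]; semicontinuity shows
    that any cluster point of this filter is a maximizer. *)
Lemma usc_max (K : set T) (g : T -> R) (z0 : T) (M : R) : compact K -> K z0 ->
  (forall z, K z -> g z <= M) ->
  (forall z a, K z -> g z < a -> exists2 V, nbhs z V & forall y, V y -> K y -> g y < a) ->
  exists2 z, K z & forall y, K y -> g y <= g z.
Proof.
move=> cK Kz0 gM gu.
have hS : has_sup (g @` K).
  by split; [exists (g z0), z0|exists M => _ [z Kz <-]; exact: gM].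
pose S := sup (g @` K).
pose F := filter_from [set a | a < S] (fun a => [set z | K z /\ a < g z]).
have FF : ProperFilter F.
  apply: filter_from_proper.
    apply: filter_from_filter; first by exists (S - 1); rewrite /= ltrBlDr ltrDl.
    move=> a b /= aS bS; exists (Num.max a b); first by rewrite /= gt_max aS.
    by move=> z /= [Kz]; rewrite gt_max => /andP[].
  move=> a /= aS; have Sa : 0 < S - a by rewrite subr_gt0.
  have [_ [z Kz <-] ez] := sup_adherent Sa hS.
  by exists z; split => //; rewrite -/S in ez; lra.
have [|z [Kz cz]] := cK F FF.
  by exists (S - 1); [rewrite /= ltrBlDr ltrDl|move=> z /= []].
exists z => // y Ky; rewrite leNgt; apply/negP => gzy.
have yS : g y <= S by apply: ub_le_sup; [by case: hS|exists y].
have gm : g z < (g z + g y) / 2 by lra.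
have [V Vz hV] := gu z _ Kz gm.
have FV : F [set z' | K z' /\ (g z + g y) / 2 < g z'].
  by exists ((g z + g y) / 2) => //=; lra.
have [w [[Kw h1] Vw]] := cz _ _ FV Vz.
by have := lt_trans h1 (hV w Vw Kw); rewrite ltxx.
Qed.

End usc_max.

(** * Comparison of viscosity solutions with smooth ones *)

Section comparison.
Context {R : realType}.
Implicit Types (phi u F G f : R * R -> R) (z : R * R).
Local Notation mu := (@lebesgue_measure R).

(** What a barrier in the comparison has to offer: it is a legitimate test function once its time is
    smoothed, and its slope, its nonlocal term and its Lipschitz constant in time are bounded
    uniformly down to time 0. *)
Record smooth_solution f ft fx : Prop := SmoothSolution {
  smooth_classical : classical_solution f ft fx;
  smooth_softplus : forall s0, 0 < s0 -> Cinfb (fun z => f (softplus s0 z.1, z.2));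
  smooth_solution_bound : exists2 C, 0 <= C & (forall z, 0 < z.1 -> fx z <= C /\ `|fold_Htilde_x f
    z| <= C) /\
    (forall t t' x, 0 <= t -> 0 <= t' -> `|f (t, x) - f (t', x)| <= C * `|t - t'|) }.

Lemma Eplus_test_functionE phi pt px z : smooth phi -> C11b phi -> test_function phi pt px ->
  Eplus phi z = fold_Eplus phi pt px z.
Proof.
move=> softplus cp T; rewrite (Eplus_foldE softplus cp) /fold_Eplus.
by have [-> ->] := test_function_unique (test_function_of_smooth softplus cp) T z.
Qed.

Lemma bump_quad (eta c : R) : 0 < eta -> forall y h,
  `|sdiff (bump eta c) y h| <= 16 * eta ^- 2 * h ^+ 2.
Proof.
move=> e0 y; rewrite (_ : 16 * _ = 2 * (8 * eta ^- 2)); last by ring.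
apply: (@sdiff_quad _ (bump eta c) y (2 * eta * (poisson eta (y - c) * conj_poisson eta (y - c)))).
move: y; apply: (@taylor2 _ (bump eta c) (fun y => 2 * eta * (poisson eta (y - c) * conj_poisson
  eta (y - c)))
  (fun y => 2 * eta * (- (2 * (poisson eta (y - c) * conj_poisson eta (y - c))) * conj_poisson eta
    (y - c)
    + poisson eta (y - c) * (poisson eta (y - c) ^+ 2 - conj_poisson eta (y - c) ^+ 2)))).
- by move=> y; exact: is_derive_bump.
- move=> y; have d : is_derive y 1 (fun x : R => x - c) (1 : R).
    by apply: (is_derive_eq (is_derive1B (is_derive1_id y) (is_derive1_cst c y))); rewrite subr0.
  have d1 := is_derive1_compose d (is_derive_poisson (y - c) e0);
    have d2 := is_derive1_compose d (is_derive_conj_poisson (y - c) e0).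
  by apply: (is_derive_eq (is_derive1Z _ (is_derive1M d1 d2))); ring.
- move=> y; have [a q _] := poisson_conj_poisson_den (y - c) e0.
  move: (poisson eta _) (conj_poisson eta _) a q => P Q a q.
  have i0 : 0 <= eta^-1 by rewrite invr_ge0 ltW.
  rewrite normrM (ger0_norm (_ : 0 <= 2 * eta)) ?mulr_ge0 ?(ltW e0)//.
  have H : `|- (2 * (P * Q)) * Q + P * (P ^+ 2 - Q ^+ 2)| <= 4 * eta^-1 ^+ 3.
    apply: (le_trans (ler_normD _ _)).
    have -> : 4 * eta^-1 ^+ 3 = 2 * (eta^-1 * eta^-1) * eta^-1 +
        eta^-1 * (eta^-1 ^+ 2 + eta^-1 ^+ 2) by ring.
    apply: lerD; rewrite normrM.
      by rewrite normrN normrM ger0_norm// ler_pM// ler_wpM2l// normrM ler_pM.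
    rewrite ler_pM//; apply: (le_trans (ler_normB _ _)); rewrite !normrX.
    by rewrite lerD// ler_sqr// nnegrE.
  apply: (le_trans (ler_wpM2l _ H)); first by rewrite mulr_ge0// ltW.
  by rewrite le_eqVlt; apply/orP; left; apply/eqP; field; rewrite gt_eqF.
Qed.

(** Smoothing time multiplies [Ft] by [S], which leaves a defect [(1 - S) * Ft], at most
    [C ^+ 2 * (1 - S)] in absolute value. The lower bound on [wt] pays for it and leaves [b], of
    which the spatial terms consume at most 5/8. *)
Lemma strictness_arith (s C b wt wx Ft Fx Hf S Hw kc : R) : s = 1 \/ s = -1 -> 0 <= C ->
  0 < b -> Fx <= C -> `|Hf| <= C -> 0 <= Fx -> Ft + Fx * Hf = 0 ->
  2^-1 <= S -> S < 1 -> C ^+ 2 * (1 - S) + b <= wt -> `|wx| <= 1 ->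
  `|wx| * C <= b / 4 -> (C + 1) * `|kc| <= b / 8 -> (C + 1) * `|Hw| <= b / 4 ->
  0 < s * (Ft * S + s * wt + Num.max (Fx + s * wx) 0 * (Hf + s * (Hw + kc))).
Proof.
move=> hs C0 b0 FxC HfC Fx0 Feq S1 S2 wtb wx1 wxC k1 e2E.
have ss : s * s = 1 by case: hs => ->; rewrite ?mulr1 ?mulrNN ?mulr1.
have sn y : `|s * y| = `|y| by case: hs => ->; rewrite ?mul1r ?mulN1r ?normrN.
set P := Num.max _ _.
have P0 : 0 <= P by rewrite le_max lexx orbT.
have Pd : `|P - Fx| <= `|wx|.
  rewrite /P; have h1 := sn wx; move: (s * wx) h1 => W h1.
  rewrite -h1; case: (leP (Fx + W) 0) => hW.
    rewrite sub0r normrN ger0_norm// -normrN.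
    by apply: le_trans (ler_norm _); lra.
  by rewrite addrAC subrr add0r.
have PC : P <= C + 1.
  by move: Pd; rewrite ler_norml => /andP[_ ?]; lra.
have t1 : `|P * (Hw + kc)| <= b / 4 + b / 8.
  rewrite normrM (ger0_norm P0).
  apply: (@le_trans _ _ ((C + 1) * (`|Hw| + `|kc|))).
    by apply: ler_pM => //; exact: ler_normD.
  by rewrite mulrDr lerD.
have t2 : `|s * Hf * (P - Fx)| <= b / 4.
  by rewrite normrM sn; apply: le_trans wxC; rewrite mulrC ler_pM.
have t3 : `|s * Hf * Fx| <= C ^+ 2.
  by rewrite normrM sn expr2 (ger0_norm Fx0) ler_pM.
have FtE : Ft = - (Fx * Hf) by apply/eqP; rewrite -subr_eq0 opprK Feq.
rewrite (_ : s * _ = (s * s) * (wt + P * (Hw + kc)) + s * Hf * (P - Fx) +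
  (1 - S) * (s * Hf * Fx)); last by rewrite FtE; ring.
rewrite ss mul1r; move: t1 t2 t3; rewrite !ler_norml.
move=> /andP[a1 _] /andP[a2 _] /andP[a3 _].
have a4 : - ((1 - S) * C ^+ 2) <= (1 - S) * (s * Hf * Fx).
  by rewrite -mulrN ler_wpM2l//; lra.
lra.
Qed.

(* Since [f] becomes a test function once its time is smoothed by [softplus], the
   doubling of variables is not needed. *)
Lemma viscosity_comparison (s M : R) (G f ft fx : R * R -> R) :
  s = 1 \/ s = -1 -> smooth_solution f ft fx ->
  (forall z, halfplane z -> `|G z| <= M) ->
  (forall z a, halfplane z -> s * G z < a ->
     exists2 V, nbhs z V & forall y, V y -> halfplane y -> s * G y < a) ->
  (forall phi, smooth phi -> C11b phi -> forall z0, 0 < z0.1 ->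
     (forall z, halfplane z -> z <> z0 -> s * (G z - phi z) < s * (G z0 - phi z0)) ->
     s * Eplus phi z0 <= 0) ->
  (forall x, s * G (0, x) <= s * f (0, x)) ->
  forall t x, 0 <= t -> s * G (t, x) <= s * f (t, x).
Proof.
move=> hs Nf GM Gu Gv G0 t x t0.
have ss : s * s = 1 by case: hs => ->; rewrite ?mulr1 ?mulrNN ?mulr1.
have sn y : `|s * y| = `|y| by case: hs => ->; rewrite ?mul1r ?mulN1r ?normrN.
rewrite leNgt; apply/negP => lt.
pose e := s * (G (t, x) - f (t, x)) / 4.
have e0 : 0 < e by rewrite divr_gt0// mulrBr subr_gt0.
have [C C0 [CC CL]] := smooth_solution_bound Nf; have [Mf Mf0 hMf] := classical_bounded
  (smooth_classical Nf).
have M0 : 0 <= M by exact: le_trans (normr_ge0 _) (GM (t, x) t0).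
pose s0 := e / (4 * (C + 2 * C ^+ 2 + 1)).
have q0 : 0 < C + 2 * C ^+ 2 + 1 by rewrite ltr_wpDl// addr_ge0// mulr_ge0 ?sqr_ge0.
have s00 : 0 < s0 by rewrite divr_gt0// mulr_gt0.
have s0E : 4 * (s0 * (C + 2 * C ^+ 2 + 1)) = e by rewrite /s0; field; rewrite gt_eqF.
have C2 : 0 <= C ^+ 2 by exact: sqr_ge0.
(* The time derivative of [A * sigmoid (s0^-1 * t)] is [2 * C ^+ 2 * S * (1 - S)], at least
   [C ^+ 2 * (1 - S)] since [S >= 1/2] at nonnegative times. It compensates the defect of the
   smoothed time, although [A] itself is small with [s0]. *)
pose A := 2 * s0 * C ^+ 2.
have A0 : 0 <= A by apply: mulr_ge0 => //; apply: mulr_ge0 => //; exact: ltW.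
have [AE CE] : A <= e / 4 /\ C * s0 <= e / 4.
  by rewrite /A; split; have := mulr_ge0 (ltW s00) C0; have := mulr_ge0 (ltW s00) C2; lra.
pose B := 2 * (M + Mf) + 2.
have B0 : 0 < B by rewrite /B; lra.
(* [B / 2] exceeds [M + Mf], so the term [B * sigmoid (t - m)] forbids a maximum later than [m]. As
   [sigmoid (- B / e) <= expR (- B / e) <= e / B], the same term costs at most [e] at the time [t]
   of the assumed violation. *)
pose m := t + B / e.
have Be : 0 < B / e by rewrite divr_gt0.
have m0 : 0 < m by rewrite ltr_wpDl.
have sm : B * sigmoid (1 * t + - m) <= e.
  have := sigmoid_le (1 * t + - m); rewrite mul1r /m opprD addrA subrr add0r expRN => h.
  have h2 := expR_ge1Dx (B / e).
  rewrite -ler_pdivlMl//; apply: (le_trans h).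
  apply: (@le_trans _ _ (B / e)^-1); last by rewrite invf_div mulrC.
  by rewrite lef_pV2 ?posrE ?expR_gt0//; lra.
have sgp (y : R) := sigmoid_bound y.
(* A lower bound for the time derivative of [B * sigmoid (t - m)] on [[0, m]], where the sigmoid
   lies between [sigmoid (- m)] and [1/2]: this is the strictness of the final inequality. *)
pose b := B * sigmoid (- m) / 2.
have b0 : 0 < b by rewrite divr_gt0// mulr_gt0//; have /andP[] := sgp (- m).
pose e1 := b / (4 * (C + 1)).
have C1 : 0 < C + 1 by lra.
have e10 : 0 < e1 by rewrite divr_gt0// mulr_gt0.
have e1E : (C + 1) * e1 = b / 4 by rewrite /e1; field; rewrite gt_eqF.
have [d d0 hd] := small_fold B (B * 16) e10.
(* The spatial bump is taken very wide. The summands after 1 serve, in order, its value at [x], its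
   slope, its slope times [C], and the smallness condition of [small_fold]. *)
pose eta := 1 + 2 * B * x ^+ 2 / e + 2 * B + 8 * B * C / b + 16 * B / d ^+ 3.
have [et0 et1 et2 et3 et4] : [/\ 1 <= eta, 2 * B * x ^+ 2 / e <= eta, 2 * B <= eta,
    8 * B * C / b <= eta & 16 * B / d ^+ 3 <= eta].
  have B2 : 0 <= 2 * B by rewrite mulr_ge0// ltW.
  have p1 : 0 <= 2 * B * x ^+ 2 / e.
    by rewrite divr_ge0 ?(ltW e0)// mulr_ge0// sqr_ge0.
  have p2 : 0 <= 8 * B * C / b.
    by rewrite divr_ge0 ?(ltW b0)// mulr_ge0// mulr_ge0// ltW.
  have p3 : 0 <= 16 * B / d ^+ 3.
    by rewrite divr_ge0 ?exprn_ge0 ?(ltW d0)// mulr_ge0// ltW.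
  by clear -p1 p2 p3 B2; rewrite /eta; split; lra.
have eta0 : 0 < eta by exact: lt_le_trans ltr01 et0.
clearbody eta.
pose w z := (A * sigmoid (s0^-1 * z.1 + 0) + B * sigmoid (1 * z.1 + - m)) + B * bump eta 0 z.2.
have sw : Cinfb w.
  by apply: CinfbD; [apply: CinfbD; apply: CinfbZ; exact: Cinfb_sigmoid|
    apply: CinfbZ; exact: Cinfb_bump_snd].
have Tw := Cinfb_test_function sw.
pose fs z := f (softplus s0 z.1, z.2).
have sf : Cinfb fs by exact: smooth_softplus Nf _ s00.
have Tf := Cinfb_test_function sf.
have sp0 y := softplus_gt0 y s00.
have fsM z : `|fs z| <= Mf by apply: hMf; exact/ltW/sp0.
have bb y := bump_bound 0 y eta0.
have w0 z : 0 <= w z.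
  have /andP[? _] := sgp (s0^-1 * z.1 + 0); have /andP[? _] := sgp (1 * z.1 + - m).
  by have /andP[? _] := bb z.2; rewrite /w !addr_ge0// mulr_ge0// ltW.
pose Psi z := s * (G z - fs z) - w z.
have near z : halfplane z -> s * (G z - fs z) <= s * (G z - f z) + C * s0.
  move=> hz; have /andP[h1 h2] := softplus_bound s00 hz.
  have := CL z.1 (softplus s0 z.1) z.2 hz (ltW (sp0 _)).
  rewrite -surjective_pairing -[f z - _]opprB normrN -/(fs z) => h3.
  have h4 : C * `|z.1 - softplus s0 z.1| <= C * s0.
    by rewrite ler_wpM2l// distrC ger0_norm; clear -h1 h2; lra.
  by move: (le_trans h3 h4); rewrite -sn ler_norml => /andP[h5 h6]; clear -h5 h6; lra.
have near' z : halfplane z -> s * (G z - f z) - C * s0 <= s * (G z - fs z).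
  move=> hz; have /andP[h1 h2] := softplus_bound s00 hz.
  have := CL z.1 (softplus s0 z.1) z.2 hz (ltW (sp0 _)).
  rewrite -surjective_pairing -[f z - _]opprB normrN -/(fs z) => h3.
  have h4 : C * `|z.1 - softplus s0 z.1| <= C * s0.
    by rewrite ler_wpM2l// distrC ger0_norm; clear -h1 h2; lra.
  by move: (le_trans h3 h4); rewrite -sn ler_norml => /andP[h5 h6]; clear -h5 h6; lra.
have Pt : e <= Psi (t, x).
  have h1 := near' (t, x) t0.
  have E4 : s * (G (t, x) - f (t, x)) = 4 * e by clear; rewrite /e; lra.
  have w1 : A * sigmoid (s0^-1 * t + 0) <= A.
    by rewrite ler_piMr//; have /andP[_ /ltW] := sgp (s0^-1 * t + 0).
  have w2 : B * bump eta 0 x <= e / 2.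
    rewrite bumpE// subr0 mulrA ler_pdivrMr; last by rewrite ltr_wpDl ?sqr_ge0// exprn_gt0.
    rewrite ler_pdivrMr// in et1.
    have x2 := mulr_ge0 (ltW e0) (sqr_ge0 x).
    have ee : e * eta <= e * eta ^+ 2 by rewrite expr2 ler_wpM2l ?(ltW e0)// ler_peMl// ltW.
    by clear -et1 x2 ee; lra.
  by rewrite /Psi /w/=; clear -h1 E4 w1 w2 AE CE sm e0; lra.
pose K : set (R * R) := `[0, m]%classic `*` `[- eta, eta]%classic.
have Kc : compact K by apply: compact_setX; exact: segment_compact.
have PsiB z : halfplane z -> s * (G z - fs z) <= M + Mf.
  move=> hz; have h1 : `|s * (G z - fs z)| <= M + Mf.
    by rewrite sn (le_trans (ler_normB _ _))// lerD// GM.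
  by apply: le_trans h1; exact: ler_norm.
have Kout z : halfplane z -> ~ K z -> Psi z < 0.
  move=> hz nK; have h1 := PsiB z hz.
  have /andP[a1 a2] := sgp (s0^-1 * z.1 + 0); have /andP[a3 a4] := sgp (1 * z.1 + - m).
  have /andP[a5 a6] := bb z.2.
  have a7 := mulr_ge0 A0 (ltW a1); have a8 := mulr_ge0 (ltW B0) (ltW a3).
  have a9 := mulr_ge0 (ltW B0) a5.
  suff h9 : M + Mf < w z by rewrite /Psi; clear -h1 h9; lra.
  have BE : B = 2 * (M + Mf) + 2 by [].
  have [zm|mz] := leP z.1 m.
    have zx : eta <= `|z.2 - 0|.
      rewrite subr0 leNgt; apply/negP => /ltW; rewrite ler_norml => zx; apply: nK.
      by split; rewrite /= in_itv/= ?zx// zm andbT.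
    have := bump_ge eta0 eta0 zx.
    have -> : eta ^+ 2 / (eta ^+ 2 + eta ^+ 2) = 2^-1.
      by field; rewrite gt_eqF// addr_gt0// exprn_gt0.
    move=> /(ler_wpM2l (ltW B0)) h8.
    by rewrite /w; clear -a7 a8 h8 BE; lra.
  have := @sigmoid_ge2 R (1 * z.1 + - m) _; rewrite mul1r subr_ge0 => /(_ (ltW mz)).
  move=> /(ler_wpM2l (ltW B0)) h8.
  by rewrite /w mul1r; clear -a7 a9 h8 BE; lra.
have Ktx : K (t, x).
  apply: contrapT => /(Kout (t, x) t0); rewrite ltNge => /negP; apply.
  by apply: le_trans Pt; exact: ltW.
have cw : continuous (fun z => s * fs z + w z).
  move=> z; apply: cvgD; last exact: test_function_continuous Tw z.
  by apply: cvgM; [exact: cvg_cst|exact: test_function_continuous Tf z].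
have Khalf z : K z -> halfplane z by move=> [/=]; rewrite in_itv/= => /andP[].
have PsiE z : Psi z = s * G z - (s * fs z + w z) by rewrite /Psi; ring.
have [z1 Kz1 z1m] : exists2 z, K z & forall y, K y -> Psi y <= Psi z.
  apply: (usc_max Kc Ktx (M := M + Mf)) => [z Kz|z a Kz].
    have h1 := PsiB z (Khalf z Kz); have h2 := w0 z.
    by rewrite /Psi; clear -h1 h2; lra.
  rewrite PsiE => za; pose r := (a - (s * G z - (s * fs z + w z))) / 2.
  have r0 : 0 < r by rewrite divr_gt0// subr_gt0.
  have [|V Vz hV] := @Gu z (s * G z + r) (Khalf z Kz); first by rewrite ltrDl.
  have /cvgrPdist_lt/(_ r r0) W := cw z.
  exists (V `&` [set y | `|s * fs z + w z - (s * fs y + w y)| < r]).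
    by apply: filterI.
  move=> y [Vy /=]; rewrite ltr_norml => /andP[h1 h2] Ky.
  have h3 := hV y Vy (Khalf y Ky); rewrite PsiE.
  by rewrite /r in h1 h2 h3; clear -h1 h2 h3; lra.
have z1g z : halfplane z -> Psi z <= Psi z1.
  move=> hz; have [Kz|nK] := pselect (K z); first exact: z1m.
  by apply: le_trans (z1m _ Ktx); apply: le_trans Pt; apply/ltW/(lt_trans (Kout _ hz nK)).
have Pz1 : e <= Psi z1 by apply: le_trans (z1m _ Ktx).
have hz1 := Khalf z1 Kz1.
have z10 : 0 < z1.1.
  rewrite lt_neqAle (hz1 : 0 <= z1.1) andbT; apply/eqP => E.
  have h1 := near z1 hz1; have h2 := G0 z1.2; rewrite E -surjective_pairing in h2.
  move: Pz1; rewrite /Psi; have h3 := w0 z1; rewrite mulrBr in h1 => h4.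
  by rewrite mulrBr in h4 h1 *; clear -h1 h2 h3 h4 CE e0; lra.
have z1m' : z1.1 <= m by case: Kz1 => /=; rewrite in_itv/= => /andP[].
pose wt := A * (s0^-1 * (sigmoid (s0^-1 * z1.1 + 0) * (1 - sigmoid (s0^-1 * z1.1 + 0)))) +
  B * (1 * (sigmoid (1 * z1.1 + - m) * (1 - sigmoid (1 * z1.1 + - m)))).
pose wx := B * (2 * eta * (poisson eta (z1.2 - 0) * conj_poisson eta (z1.2 - 0))).
have wtE : 'D_(1, 0) w z1 = wt.
  have [_ <-] := test_function_dt Tw z1.
  have D := is_derive1D (is_derive1D (is_derive1Z A (is_derive_sigmoid_affine s0^-1 0 z1.1))
    (is_derive1Z B (is_derive_sigmoid_affine 1 (- m) z1.1)))
    (is_derive1_cst (B * bump eta 0 z1.2) z1.1).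
  by have [_ ->] := D; rewrite addr0.
have wxE : 'D_(0, 1) w z1 = wx.
  have [_ <-] := test_function_dx Tw z1.
  have D := is_derive1D (is_derive1_cst (A * sigmoid (s0^-1 * z1.1 + 0) + B * sigmoid (1 * z1.1 +
    - m)) z1.2)
    (is_derive1Z B (is_derive_bump 0 z1.2 eta0)).
  by have [_ ->] := D; rewrite add0r.
have ftE : 'D_(1, 0) fs z1 = ft (softplus s0 z1.1, z1.2) * sigmoid (s0^-1 * z1.1 + 0).
  have [_ <-] := test_function_dt Tf z1.
  by have [_ <-] := is_derive1_compose (is_derive_softplus z1.1 s00) (classical_dt
    (smooth_classical Nf) (z := (softplus s0 z1.1, z1.2)) (sp0 _)).
have fxE : 'D_(0, 1) fs z1 = fx (softplus s0 z1.1, z1.2).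
  have [_ <-] := test_function_dx Tf z1.
  by have [_ <-] := classical_dx (smooth_classical Nf) (z := (softplus s0 z1.1, z1.2)) (sp0 _).
have wxb : `|wx| <= 2 * B / eta.
  have [a q _] := poisson_conj_poisson_den (z1.2 - 0) eta0.
  rewrite /wx normrM (ger0_norm (ltW B0)) normrM (ger0_norm (_ : 0 <= 2 * eta)); last first.
    by rewrite mulr_ge0// ltW.
  rewrite normrM (_ : 2 * B / eta = B * (2 * eta * (eta^-1 * eta^-1))); last first.
    by field; rewrite gt_eqF.
  by rewrite ler_wpM2l ?(ltW B0)// ler_wpM2l ?ler_pM// mulr_ge0// ltW.
have sdw h : sdiff (fun x => w (z1.1, x)) z1.2 h = B * sdiff (bump eta 0) z1.2 h.
  by rewrite /sdiff /w/=; ring.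
have Hwb : `|fold_Htilde_x w z1| <= e1.
  apply: hd.
  - by apply: measurable_sdiff; exact: test_function_continuous_snd Tw _.
  - move=> h; rewrite sdw normrM (ger0_norm (ltW B0)) mulrC ler_wpM2r ?(ltW B0)//.
    rewrite -[leRHS]mulr1; apply: sdiff_le4 => y.
    by have /andP[? ?] := bb y; rewrite ger0_norm.
  - move=> h; rewrite sdw normrM (ger0_norm (ltW B0)) -mulrA ler_wpM2l ?(ltW B0)//.
    apply: (le_trans (bump_quad 0 eta0 _ _)); rewrite ler_wpM2r ?sqr_ge0//.
    by rewrite ler_piMr// invf_le1 ?exprn_gt0// expr_ge1// ltW.
  - move=> h h0 hdd; rewrite sdw normrM (ger0_norm (ltW B0)).
    apply: (@le_trans _ _ (B * (16 * eta ^- 2 * d^-1 ^+ 2))).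
      rewrite ler_wpM2l ?(ltW B0)//; apply: (le_trans (bump_quad 0 eta0 _ _)).
      rewrite ler_wpM2l ?mulr_ge0 ?invr_ge0 ?sqr_ge0//.
      by rewrite ler_sqr ?nnegrE ?(ltW h0)// invr_ge0 ltW.
    have d3 : 0 < d ^+ 3 by rewrite exprn_gt0.
    rewrite ler_pdivrMr// in et4.
    have e2 : eta <= eta ^+ 2 by rewrite expr2 ler_peMr// ltW.
    have := ler_wpM2r (ltW d3) e2 => e3.
    rewrite (_ : B * _ = 16 * B / (eta ^+ 2 * d ^+ 2)); last first.
      by field; rewrite !gt_eqF.
    rewrite ler_pdivrMr ?mulr_gt0 ?exprn_gt0//.
    by move: e3; rewrite (_ : d * _ = eta ^+ 2 * d ^+ 3); last ring; clear -et4; lra.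
(* The maximum of [Psi] at [z1] may fail to be strict; [k * psi z1] makes it so, with [k] small
   enough for its nonlocal contribution to cost at most [b / 8]. *)
pose c := fold_Htilde_x (psi z1) z1.
pose k := b / (8 * ((C + 1) * (`|c| + 1))).
have c1 : 0 < `|c| + 1 by rewrite ltr_wpDl.
have k0 : 0 < k by rewrite divr_gt0// mulr_gt0// mulr_gt0.
have kE : (C + 1) * (k * `|c|) <= b / 8.
  have : (C + 1) * (k * (`|c| + 1)) = b / 8 by rewrite /k; field; rewrite !gt_eqF.
  by move=> <-; rewrite ler_wpM2l ?(ltW C1)// ler_wpM2l ?(ltW k0)// lerDl.
have Tp := Cinfb_test_function (Cinfb_psi z1); have [g1 g2] := psi_grad z1.
have Tk := test_functionZ k Tp; have Twk := test_functionD Tw Tk;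
  have Tall := test_functionD Tf (test_functionZ s Twk).
set phi := (fun z => fs z + _) in Tall.
have sphi : Cinfb phi.
  apply: CinfbD => //; apply: CinfbZ; apply: CinfbD => //; apply: CinfbZ.
  exact: Cinfb_psi.
have V : s * Eplus phi z1 <= 0.
  apply: Gv => //; [exact: Cinfb_smooth|exact: Cinfb_C11b|].
  have E z : s * (G z - phi z) = Psi z - k * psi z1 z.
    transitivity (s * G z - s * fs z - (s * s) * (w z + k * psi z1 z)).
      by rewrite /phi; ring.
    by rewrite ss /Psi; ring.
  move=> z hz zz; rewrite !E psi0 mulr0 subr0.
  by move: (z1g z hz) (mulr_gt0 k0 (psi_gt0 zz)); clear; lra.
move: V; rewrite leNgt => /negP; apply; rewrite (Eplus_test_functionE _ (Cinfb_smooth sphi)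
  (Cinfb_C11b sphi) Tall) /fold_Eplus.
rewrite (fold_Htilde_xD Tf (test_functionZ s Twk)) (fold_Htilde_xZ _ Twk) (fold_Htilde_xD Tw Tk)
  (fold_Htilde_xZ _ Tp) -/c.
rewrite ftE fxE wtE wxE (g1 : 'D_(1, 0) (psi z1) z1 = 0) (g2 : 'D_(0, 1) (psi z1) z1 = 0).
rewrite !mulr0 !addr0 (_ : sigmoid (s0^-1 * z1.1) = sigmoid (s0^-1 * z1.1 + 0));
  last by rewrite addr0.
have -> : fold_Htilde_x fs z1 = fold_Htilde_x f (softplus s0 z1.1, z1.2) by [].
have [FxC HfC] := CC (softplus s0 z1.1, z1.2) (sp0 _).
have Fx0 := classical_dx_ge0 (smooth_classical Nf) (z := (softplus s0 z1.1, z1.2)) (sp0 _).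
have Feq := classical_eqn (smooth_classical Nf) (z := (softplus s0 z1.1, z1.2)) (sp0 _).
have sig1 : 2^-1 <= sigmoid (s0^-1 * z1.1 + 0).
  by apply: sigmoid_ge2; rewrite addr0 mulr_ge0// ?invr_ge0; exact: ltW.
have /andP[_ sig2] := sgp (s0^-1 * z1.1 + 0).
have wtb : C ^+ 2 * (1 - sigmoid (s0^-1 * z1.1 + 0)) + b <= wt.
  rewrite /wt; apply: lerD.
    rewrite (_ : A * _ = 2 * C ^+ 2 * (sigmoid (s0^-1 * z1.1 + 0) * (1 - sigmoid (s0^-1 * z1.1 +
      0)))).
      move: (sigmoid _) sig1 sig2 => S sig1 sig2.
      rewrite -subr_ge0 (_ : _ - _ = C ^+ 2 * ((1 - S) * (2 * S - 1))); last by ring.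
      by rewrite mulr_ge0// mulr_ge0//; clear -sig1 sig2; lra.
    by rewrite /A; field; rewrite gt_eqF.
  have i1 : sigmoid (- m) <= sigmoid (1 * z1.1 + - m).
    by apply: sigmoid_mono; rewrite mul1r lerDr ltW.
  have i2 : sigmoid (1 * z1.1 + - m) <= 2^-1.
    by apply: sigmoid_le2; rewrite mul1r; clear -z1m'; lra.
  have /andP[i3 _] := sgp (- m).
  by rewrite /b mul1r -mulrA ler_wpM2l ?(ltW B0)//; clear -i1 i2 i3; nra.
have wx1 : `|wx| <= 1.
  by apply: (le_trans wxb); rewrite ler_pdivrMr// mul1r.
have wxC : `|wx| * C <= b / 4.
  rewrite ler_pdivrMr// in et3.
  have h := ler_wpM2r C0 wxb; apply: (le_trans h).
  by rewrite mulrAC ler_pdivrMr//; clear -et3; lra.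
have k1 : (C + 1) * `|k * c| <= b / 8 by rewrite normrM (ger0_norm (ltW k0)).
have e2E : (C + 1) * `|fold_Htilde_x w z1| <= b / 4 by rewrite -e1E ler_wpM2l// ltW.
exact: (strictness_arith hs C0 b0 FxC HfC Fx0 Feq sig1 sig2 wtb wx1 wxC k1 e2E).
Qed.

End comparison.

Lemma ultra_bounded_cvg {R : realType} (U : set_system nat) {UU : UltraFilter U}
  (a : nat -> R) (M : R) : (forall n, `|a n| <= M) -> cvg (a n @[n --> U]).
Proof.
move=> aM; have cK := @segment_compact R (- M) M.
have [|l [Kl cl]] := cK (a n @[n --> U]) _.
  suff : U (a @^-1` `[- M, M]%classic) by [].
  by apply: filterE => n /=; rewrite in_itv/= -ler_norml.
apply/cvg_ex; exists l => B Bl.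
have [//|UC] := in_ultra_setVsetC (a @^-1` B) UU.
have [y [/= nBy By]] := cl (~` B) B UC Bl.
by [].
Qed.

Lemma is_derive_quad_loc {R : realType} (f : R -> R) (x l C r : R) : 0 < r ->
  (forall h, `|h| <= r -> `|f (x + h) - f x - h * l| <= C * h ^+ 2) ->
  is_derive x 1 f l.
Proof.
move=> r0 H; pose g y := f (x + r * (y - x)).
have dg : is_derive x 1 g (r * l).
  apply: (@is_derive_quad _ g x (r * l) (`|C| * r ^+ 2)) => h h1.
  rewrite /g [x + h]addrC addrK subrr mulr0 addr0 mulrCA mulrA.
  apply: (le_trans (H (r * h) _)).
    by rewrite normrM (ger0_norm (ltW r0)) ler_piMr// ltW.
  rewrite exprMn -[leRHS]mulrA; apply: ler_wpM2r; last exact: ler_norm.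
  by rewrite mulr_ge0// sqr_ge0.
have d1 : is_derive x 1 (fun y : R => x + r^-1 * (y - x)) (r^-1).
  have := is_derive1D (is_derive1_cst x x) (is_derive1Z r^-1 (is_derive1B (is_derive1_id x)
    (is_derive1_cst x x))).
  by rewrite subr0 mulr1 add0r.
have E : f = fun y => g (x + r^-1 * (y - x)).
  apply/funext => y; rewrite /g; congr f.
  by field; rewrite gt_eqF.
rewrite E; have dg' : is_derive (x + r^-1 * (x - x)) 1 g (r * l).
  by rewrite subrr mulr0 addr0.
by apply: (is_derive_eq (is_derive1_compose d1 dg')); rewrite mulrAC mulfV ?mul1r// gt_eqF.
Qed.

(** * Limits of the particle averages *)

(* [TT] stands for [Theta] itself, whose derivative is [pi^-1] times [EA]. *)
Inductive observable := TE of expr | TT.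

(* Divided differences as sums of products [a(w) b(w')] (see [expr_diffqE]): after
   symmetrization they absorb the singularity of the interaction. *)
Fixpoint expr_diffq (e : expr) : seq (expr * expr) :=
  match e with
  | EA => [:: (EQ, EA); (EA, EQ)]
  | EQ => [:: (EQ, EQ); (EN EA, EA)]
  | E1 => [::]
  | EN a => [seq (EN p.1, p.2) | p <- expr_diffq a]
  | EP a b => expr_diffq a ++ expr_diffq b
  | EM a b => [seq (EM a p.1, p.2) | p <- expr_diffq b] ++
              [seq (p.1, EM b p.2) | p <- expr_diffq a]
  end.

Section expr_diffq.
Context {R : realType}.
Variable eta : R.
Hypothesis eta0 : 0 < eta.

Lemma expr_diffqE e (w w' : R) : expr_eval eta e w - expr_eval eta e w' =
  (w' - w) * \sum_(p <- expr_diffq e) expr_eval eta p.1 w * expr_eval eta p.2 w'.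
Proof.
elim: e => [||| a IH| a IHa b IHb| a IHa b IHb] /=.
- rewrite !big_cons big_nil /= /poisson /conj_poisson.
  have D := lt0r_neq0 (den_gt0 w eta0); have D' := lt0r_neq0 (den_gt0 w' eta0).
  by field; rewrite D D'.
- rewrite !big_cons big_nil /= /poisson /conj_poisson.
  have D := lt0r_neq0 (den_gt0 w eta0); have D' := lt0r_neq0 (den_gt0 w' eta0).
  by field; rewrite D D'.
- by rewrite big_nil subrr mulr0.
- rewrite big_map /= -opprD IH.
  by under [in RHS]eq_bigr do rewrite mulNr; rewrite sumrN mulrN.
- by rewrite big_cat /= mulrDr -IHa -IHb; ring.
- rewrite big_cat !big_map /= mulrDr.
  under eq_bigr do rewrite -mulrA.
  under [X in _ = _ + _ * X]eq_bigr do rewrite mulrCA.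
  rewrite -!mulr_sumr mulrCA -IHb [X in _ = _ + X]mulrCA -IHa; ring.
Qed.

Definition obs_val (tau : observable) (w : R) : R :=
  match tau with TE e => expr_eval eta e w | TT => Theta eta w end.
Definition obs_deriv tau : expr := match tau with TE e => expr_deriv e | TT => EA end.
Definition obs_coef tau : R := match tau with TE _ => 1 | TT => pi^-1 end.

Lemma is_derive_obs_val tau (w : R) : is_derive w 1 (obs_val tau) (obs_coef tau * expr_eval eta
  (obs_deriv tau) w).
Proof.
case: tau => [e|] /=; last exact: is_derive_Theta.
by rewrite mul1r; exact: is_derive_expr_eval.
Qed.

Lemma obs_coef_ge0 tau : 0 <= obs_coef tau.
Proof. by case: tau => [e|] /=; rewrite ?ler01// invr_ge0 pi_ge0. Qed.

Lemma obs_val_bound tau : exists2 M, 0 <= M & forall w, `|obs_val tau w| <= M.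
Proof.
case: tau => [e|] /=; first exact: expr_eval_bound.
by exists 1 => // w; exact: Theta_norm.
Qed.

Lemma obs_val_quad tau : exists2 K, 0 <= K & forall w h,
  `|obs_val tau (w + h) - obs_val tau w - h * (obs_coef tau * expr_eval eta (obs_deriv tau) w)| <=
    K * h ^+ 2.
Proof.
have [M M0 hM] := expr_eval_bound eta0 (expr_deriv (obs_deriv tau)).
exists (obs_coef tau * M); first by rewrite mulr_ge0// obs_coef_ge0.
apply: (@taylor2 _ _ (fun w => obs_coef tau * expr_eval eta (obs_deriv tau) w)
  (fun w => obs_coef tau * expr_eval eta (expr_deriv (obs_deriv tau)) w)).
- exact: is_derive_obs_val.
- by move=> w; apply: is_derive1Z; exact: is_derive_expr_eval.
- by move=> w; rewrite normrM (ger0_norm (obs_coef_ge0 tau)) ler_wpM2l// obs_coef_ge0.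
Qed.

Lemma obs_val_lip tau : exists2 K, 0 <= K & forall w w',
  `|obs_val tau w - obs_val tau w'| <= K * `|w - w'|.
Proof.
have [M M0 hM] := expr_eval_bound eta0 (obs_deriv tau).
exists (obs_coef tau * M); first by rewrite mulr_ge0// obs_coef_ge0.
move=> w w'; apply: (mvt_lip (is_derive_obs_val tau)) => y.
by rewrite normrM (ger0_norm (obs_coef_ge0 tau)) ler_wpM2l// obs_coef_ge0.
Qed.

End expr_diffq.

Section averages.
Context {R : realType}.
Variable lam : forall N : nat, 'I_N -> R -> R.

Definition part_avg N (t : R) (f : R -> R) : R := N%:R^-1 * \sum_(i < N) f (lam i t).

Definition obs_avg (eta : R) tau x N t := part_avg N t (fun y => obs_val eta tau (x - y)).

(** The limiting drift, a polynomial in averages. The sign comes from differentiating a function of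
    [x - lam i] in [lam i], the factor 1/2 from the symmetrization over ordered pairs. *)
Definition obs_drift (eta : R) tau x N t : R := - (obs_coef tau / 2) *
  \sum_(p <- expr_diffq (obs_deriv tau)) obs_avg eta (TE p.1) x N t * obs_avg eta (TE p.2) x N t.

Lemma part_avg_bound N t f (M : R) : 0 <= M -> (forall y, `|f y| <= M) -> `|part_avg N t f| <= M.
Proof.
move=> M0 fM; rewrite /part_avg normrM ger0_norm ?invr_ge0//.
case: N => [|n]; first by rewrite invr0 mul0r.
rewrite ler_pdivrMl//; apply: (le_trans (ler_norm_sum _ _ _)).
apply: (le_trans (ler_sum _ (fun i _ => fM _))).
by rewrite sumr_const card_ord -[M *+ _]mulr_natl.
Qed.

Lemma part_avgB N t f g : part_avg N t f - part_avg N t g = part_avg N t (fun y => f y - g y).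
Proof. by rewrite /part_avg -mulrBr -sumrB. Qed.

Lemma part_avgZ N t c f : c * part_avg N t f = part_avg N t (fun y => c * f y).
Proof. by rewrite /part_avg mulrCA -mulr_sumr. Qed.

(* [eps] absorbs the martingale part and the second-order correction. Positions are
   rational so that countably many almost sure events suffice. *)
Definition limit_dynamics (eta : R) := forall tau, exists2 C, 0 <= C &
  forall (q : rat) (T eps : R), 0 < eps -> \forall N \near \oo,
  forall s t, 0 <= s <= T -> 0 <= t <= T ->
   `|obs_avg eta tau (ratr q) N t - obs_avg eta tau (ratr q) N s| <= C * `|t - s| + eps /\
   `|obs_avg eta tau (ratr q) N t - obs_avg eta tau (ratr q) N s -
     (t - s) * obs_drift eta tau (ratr q) N s| <= C * (t - s) ^+ 2 + eps.

End averages.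

(** * Limits along an ultrafilter are smooth solutions *)

Section limit.
Context {R : realType}.
Local Notation mu := (@lebesgue_measure R).
Variable lam : forall N : nat, 'I_N -> R -> R.
Variables (U : set_system nat) (UU : UltraFilter U) (Uoo : \oo `<=` U).
Variable eta : R.
Hypotheses (eta0 : 0 < eta) (HI : limit_dynamics lam eta).

Local Notation aN := (obs_avg lam eta).
Local Notation bN := (obs_drift lam eta).

Definition ulim tau (t x : R) : R := lim (aN tau x N t @[N --> U]).

Let pU : ProperFilter U := ultra_proper.

Lemma ulim_cvg tau t x : aN tau x N t @[N --> U] --> ulim tau t x.
Proof.
have [M M0 hM] := obs_val_bound eta0 tau.
by apply: (ultra_bounded_cvg (M := M)) => n; exact: part_avg_bound.
Qed.

Definition ulim_drift tau t x : R := - (obs_coef tau / 2) *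
  \sum_(p <- expr_diffq (obs_deriv tau)) ulim (TE p.1) t x * ulim (TE p.2) t x.

Lemma ulim_drift_cvg tau t x : bN tau x N t @[N --> U] --> ulim_drift tau t x.
Proof.
apply: cvgM; first exact: cvg_cst.
elim: (expr_diffq _) => [|p s IH].
  by under eq_cvg do rewrite big_nil; rewrite big_nil; exact: cvg_cst.
under eq_cvg do rewrite big_cons; rewrite big_cons.
by apply: cvgD; [apply: cvgM; exact: ulim_cvg|exact: IH].
Qed.

Lemma limU_le (a b : nat -> R) l l' : a N @[N --> U] --> l -> b N @[N --> U] --> l' ->
  (\forall N \near \oo, a N <= b N) -> l <= l'.
Proof. by move=> al bl /Uoo ab; exact: ler_cvg_to al bl ab. Qed.

Lemma limU_norm (a : nat -> R) l c : a N @[N --> U] --> l ->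
  (forall e, 0 < e -> \forall N \near \oo, `|a N| <= c + e) -> `|l| <= c.
Proof.
move=> al ac; apply/ler_addgt0Pr => e e0.
apply: (limU_le (a := fun N => `|a N|) (b := fun=> c + e)); last exact: ac.
  exact: cvg_norm al.
exact: cvg_cst.
Qed.

Lemma ulim_bound tau : exists2 M, 0 <= M & forall t x, `|ulim tau t x| <= M.
Proof.
have [M M0 hM] := obs_val_bound eta0 tau; exists M => // t x.
apply: (limU_norm (a := fun N => aN tau x N t)); first exact: ulim_cvg.
move=> e e0; near=> N.
by apply: (@le_trans _ _ M); [exact: part_avg_bound|rewrite lerDl ltW].
Unshelve. all: by end_near. Qed.

Lemma ulim_quad_x tau : exists2 K, 0 <= K & forall t x h,
  `|ulim tau t (x + h) - ulim tau t x - h * (obs_coef tau * ulim (TE (obs_deriv tau)) t x)| <= K *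
    h ^+ 2.
Proof.
have [K K0 hK] := obs_val_quad eta0 tau; exists K => // t x h.
apply: (limU_norm (a := fun N => aN tau (x + h) N t - aN tau x N t -
    h * (obs_coef tau * aN (TE (obs_deriv tau)) x N t))).
  apply: cvgB; first by apply: cvgB; exact: ulim_cvg.
  by apply: cvgM; [exact: cvg_cst|apply: cvgM; [exact: cvg_cst|exact: ulim_cvg]].
move=> e e0; near=> N.
rewrite /obs_avg part_avgB !part_avgZ part_avgB.
apply: (@le_trans _ _ (K * h ^+ 2)); last by rewrite lerDl ltW.
apply: part_avg_bound; first by rewrite mulr_ge0// sqr_ge0.
by move=> y; rewrite (_ : x + h - y = x - y + h); [exact: hK|ring].
Unshelve. all: by end_near. Qed.

Lemma ulim_lip_x tau : exists2 K, 0 <= K & forall t x y,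
  `|ulim tau t x - ulim tau t y| <= K * `|x - y|.
Proof.
have [K K0 hK] := obs_val_lip eta0 tau; exists K => // t x y.
apply: (limU_norm (a := fun N => aN tau x N t - aN tau y N t)).
  by apply: cvgB; exact: ulim_cvg.
move=> e e0; near=> N; rewrite /obs_avg part_avgB.
apply: (@le_trans _ _ (K * `|x - y|)); last by rewrite lerDl ltW.
apply: part_avg_bound; first by rewrite mulr_ge0.
by move=> z; apply: (le_trans (hK _ _)); rewrite opprB addrA subrK.
Unshelve. all: by end_near. Qed.

Let S (l : seq (expr * expr)) t x : R :=
  \sum_(p <- l) ulim (TE p.1) t x * ulim (TE p.2) t x.

Let S_bound l : exists2 M, 0 <= M & forall t x, `|S l t x| <= M.
Proof.
elim: l => [|p l [M M0 hM]]; first by exists 0 => // t x; rewrite /S big_nil normr0.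
have [A A0 hA] := ulim_bound (TE p.1); have [B B0 hB] := ulim_bound (TE p.2).
exists (A * B + M) => [|t x]; first by rewrite addr_ge0// mulr_ge0.
rewrite /S big_cons (le_trans (ler_normD _ _))// lerD//; last exact: hM.
by rewrite normrM ler_pM.
Qed.

Let S_lip l : exists2 K, 0 <= K & forall t x y, `|S l t x - S l t y| <= K * `|x - y|.
Proof.
elim: l => [|p l [M M0 hM]].
  by exists 0 => // t x y; rewrite /S !big_nil subrr normr0 mul0r.
have [A A0 hA] := ulim_bound (TE p.1); have [B B0 hB] := ulim_bound (TE p.2).
have [A' A'0 hA'] := ulim_lip_x (TE p.1); have [B' B'0 hB'] := ulim_lip_x (TE p.2).
exists (A' * B + A * B' + M) => [|t x y]; first by rewrite !addr_ge0// mulr_ge0.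
rewrite /S !big_cons opprD addrACA [leRHS]mulrDl (le_trans (ler_normD _ _))// lerD//;
  last exact: hM.
set a := ulim (TE p.1) t; set b := ulim (TE p.2) t.
have -> : a x * b x - a y * b y = (a x - a y) * b x + a y * (b x - b y) by ring.
rewrite [leRHS]mulrDl (le_trans (ler_normD _ _))// !normrM lerD//.
  by rewrite [leRHS]mulrAC; apply: ler_pM => //; [exact: hA'|exact: hB].
by rewrite -[leRHS]mulrA; apply: ler_pM => //; [exact: hA|exact: hB'].
Qed.

Lemma ulim_drift_bound tau : exists2 M, 0 <= M & forall t x, `|ulim_drift tau t x| <= M.
Proof.
have [M M0 hM] := S_bound (expr_diffq (obs_deriv tau)).
exists (`|obs_coef tau / 2| * M) => [|t x]; first by rewrite mulr_ge0.
by rewrite /ulim_drift normrM normrN; apply: ler_wpM2l => //; exact: hM.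
Qed.

Lemma ulim_drift_lip tau : exists2 K, 0 <= K & forall t x y,
  `|ulim_drift tau t x - ulim_drift tau t y| <= K * `|x - y|.
Proof.
have [M M0 hM] := S_lip (expr_diffq (obs_deriv tau)).
exists (`|obs_coef tau / 2| * M) => [|t x y]; first by rewrite mulr_ge0.
by rewrite /ulim_drift -mulrBr normrM normrN -mulrA; apply: ler_wpM2l => //; exact: hM.
Qed.

Lemma rat_dense_le (g : R -> R) (L c : R) : 0 <= L ->
  (forall x y, `|g x - g y| <= L * `|x - y|) -> (forall q, `|g (ratr q)| <= c) ->
  forall x, `|g x| <= c.
Proof.
move=> L0 gL gq x; apply/ler_addgt0Pr => e e0.
have d0 : 0 < e / (L + 1) by rewrite divr_gt0// ltr_wpDl.
have [|q] := @rat_in_itvoo R x (x + e / (L + 1)); first by rewrite ltrDl.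
rewrite in_itv/= => /andP[q1 q2].
have h : `|x - ratr q| <= e / (L + 1) by rewrite distrC ger0_norm; lra.
rewrite ler_pdivlMr ?ltr_wpDl// in h.
have -> : g x = g (ratr q) + (g x - g (ratr q)) by ring.
apply: (le_trans (ler_normD _ _)); apply: lerD => //.
apply: (le_trans (gL _ _)); have := normr_ge0 (x - ratr q); nra.
Qed.

Lemma ulim_time tau : exists2 C, 0 <= C & forall s t x, 0 <= s -> 0 <= t ->
  `|ulim tau t x - ulim tau s x| <= C * `|t - s| /\
  `|ulim tau t x - ulim tau s x - (t - s) * ulim_drift tau s x| <= C * (t - s) ^+ 2.
Proof.
have [C C0 hC] := HI tau; exists C => // s t x s0 t0.
have [K K0 hK] := ulim_lip_x tau; have [K' K'0 hK'] := ulim_drift_lip tau.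
have sT : 0 <= s <= Num.max s t by rewrite s0 le_max lexx.
have tT : 0 <= t <= Num.max s t by rewrite t0 le_max lexx orbT.
split.
  move: x; apply: (@rat_dense_le _ (K + K)); first exact: addr_ge0.
    move=> x y; rewrite (_ : _ - _ = (ulim tau t x - ulim tau t y) - (ulim tau s x - ulim tau s y)).
      by rewrite (le_trans (ler_normB _ _))// mulrDl lerD.
    by ring.
  move=> q; apply: (limU_norm (a := fun N => aN tau (ratr q) N t - aN tau (ratr q) N s)).
    by apply: cvgB; exact: ulim_cvg.
  move=> e e0; have := hC q (Num.max s t) e e0; apply: filterS => N.
  by move=> /(_ s t sT tT)[].
move: x; apply: (@rat_dense_le _ (K + K + `|t - s| * K')).
- by rewrite !addr_ge0// mulr_ge0.
- move=> x y; rewrite (_ : _ - _ = (ulim tau t x - ulim tau t y) - (ulim tau s x - ulim tau s y)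
    - (t - s) * (ulim_drift tau s x - ulim_drift tau s y)); last by ring.
  rewrite [leRHS]mulrDl [X in _ <= X + _]mulrDl (le_trans (ler_normB _ _))// lerD//.
    by rewrite (le_trans (ler_normB _ _))// lerD.
  by rewrite normrM -[leRHS]mulrA ler_wpM2l.
- move=> q; apply: (limU_norm (a := fun N => aN tau (ratr q) N t - aN tau (ratr q) N s
    - (t - s) * bN tau (ratr q) N s)).
    apply: cvgB; first by apply: cvgB; exact: ulim_cvg.
    by apply: cvgM; [exact: cvg_cst|exact: ulim_drift_cvg].
  move=> e e0; have := hC q (Num.max s t) e e0; apply: filterS => N.
  by move=> /(_ s t sT tT)[].
Qed.

(** Move in time at the point [x'], then in space at the time [t]; the mixed term is controlled
    because the drift is Lipschitz in space. *)
Lemma ulim_quad tau : exists2 C, 0 <= C & forall t t' x x', 0 <= t -> 0 <= t' ->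
  `|ulim tau t' x' - ulim tau t x - ((t' - t) * ulim_drift tau t x +
     (x' - x) * (obs_coef tau * ulim (TE (obs_deriv tau)) t x))| <= C * (`|t' - t| + `|x' - x|) ^+
       2.
Proof.
have [C C0 hC] := ulim_time tau; have [K K0 hK] := ulim_quad_x tau.
have [L L0 hL] := ulim_drift_lip tau.
exists (C + K + L) => [|t t' x x' t0 t'0]; first by rewrite !addr_ge0.
rewrite (_ : _ - _ - _ = (ulim tau t' x' - ulim tau t x' - (t' - t) * ulim_drift tau t x')
  + (ulim tau t (x + (x' - x)) - ulim tau t x - (x' - x) * (obs_coef tau * ulim (TE (obs_deriv
    tau)) t x))
  + (t' - t) * (ulim_drift tau t x' - ulim_drift tau t x)); last first.
  by rewrite (addrC x) subrK; ring.
have [_ h1] := hC t t' x' t0 t'0.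
have h2 := hK t x (x' - x); have h3 := hL t x' x.
rewrite [leRHS]mulrDl [X in _ <= X + _]mulrDl.
have a0 := normr_ge0 (t' - t); have b0 := normr_ge0 (x' - x).
have q1 : (t' - t) ^+ 2 <= (`|t' - t| + `|x' - x|) ^+ 2.
  by rewrite -[X in X <= _]real_normK ?num_real// ler_sqr ?nnegrE ?addr_ge0// lerDl.
have q2 : (x' - x) ^+ 2 <= (`|t' - t| + `|x' - x|) ^+ 2.
  by rewrite -[X in X <= _]real_normK ?num_real// ler_sqr ?nnegrE ?addr_ge0// lerDr.
have q3 : `|t' - t| * `|x' - x| <= (`|t' - t| + `|x' - x|) ^+ 2 by nra.
apply: (le_trans (ler_normD _ _)); apply: lerD.
  apply: (le_trans (ler_normD _ _)); apply: lerD.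
    by apply: (le_trans h1); rewrite ler_wpM2l.
  by apply: (le_trans h2); rewrite ler_wpM2l.
rewrite normrM; apply: (@le_trans _ _ (L * (`|t' - t| * `|x' - x|))).
  by rewrite mulrCA ler_wpM2l.
by rewrite ler_wpM2l.
Qed.

Lemma softplus_quad (s0 : R) : 0 < s0 -> forall t a,
  `|softplus s0 (t + a) - softplus s0 t - a * sigmoid (s0^-1 * t + 0)| <= s0^-1 * a ^+ 2.
Proof.
move=> s00; apply: (taylor2 (fun t => is_derive_softplus t s00) (fun t => is_derive_sigmoid_affine
  s0^-1 0 t)).
move=> t; have /andP[h1 h2] := sigmoid_bound (s0^-1 * t + 0).
have i0 : 0 < s0^-1 by rewrite invr_gt0.
rewrite normrM ger0_norm ?(ltW i0)// ler_piMr ?(ltW i0)//.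
by rewrite ger0_norm; nra.
Qed.

Lemma softplus_lip (s0 : R) : 0 < s0 -> forall t a, `|softplus s0 (t + a) - softplus s0 t| <= `|a|.
Proof.
move=> s00 t a; have := mvt_lip (K := 1) (fun t => is_derive_softplus t s00) _ t (t + a).
rewrite mul1r (addrC t) addrK; apply => y.
by have /andP[h1 h2] := sigmoid_bound (s0^-1 * y + 0); rewrite ger0_norm ltW.
Qed.

(** The space derivative of a limit observable is a multiple of a limit observable, and its time
    derivative is a polynomial in such limits. Hence the induction on [n] must treat all [tau]
    together. *)
Lemma smooth_bounded_ulim s0 : 0 < s0 -> forall n tau, smooth_bounded n (fun z => ulim tau
  (softplus s0 z.1) z.2).
Proof.
move=> s00; have spp t := ltW (softplus_gt0 t s00).
elim=> [|n IH] tau.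
  by split => //; have [M _ hM] := ulim_bound tau; exists M => z; exact: hM.
split; first by have [M _ hM] := ulim_bound tau; exists M => z; exact: hM.
exists (fun z => sigmoid (s0^-1 * z.1 + 0) * ulim_drift tau (softplus s0 z.1) z.2),
  (fun z => obs_coef tau * ulim (TE (obs_deriv tau)) (softplus s0 z.1) z.2); split.
- have [C C0 hC] := ulim_quad tau; have [M M0 hM] := ulim_drift_bound tau.
  exists (C + s0^-1 * M) => -[t x] [a b]/= _ _.
  have h := hC (softplus s0 t) (softplus s0 (t + a)) x (x + b) (spp _) (spp _).
  have l := softplus_lip s00 t a; have q := softplus_quad s00 t a.
  rewrite (addrC x b) addrK in h.
  rewrite (addrC x b).
  have rid (X Y D k s L c G : R) : X - Y - (k * (s * L) + c * G) =
    X - Y - (D * L + c * G) + (D - k * s) * L by ring.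
  rewrite (rid _ _ (softplus s0 (t + a) - softplus s0 t)).
  rewrite [leRHS]mulrDl; apply: (le_trans (ler_normD _ _)); apply: lerD.
    apply: (le_trans h); rewrite ler_wpM2l// ler_sqr ?nnegrE ?addr_ge0//.
    by rewrite lerD2r.
  rewrite normrM mulrAC ler_pM//; apply: (le_trans q).
  rewrite ler_wpM2l ?invr_ge0 ?(ltW s00)//.
  by rewrite -[X in X <= _]real_normK ?num_real// ler_sqr ?nnegrE ?addr_ge0// lerDl.
- apply: smooth_boundedM; first exact: Cinfb_sigmoid.
  apply: smooth_boundedZ; elim: (expr_diffq _) => [|p l IHl].
    rewrite (_ : (fun z => _) = fun=> 0); first exact: smooth_bounded_cst.
    by apply/funext => z; rewrite big_nil.
  rewrite (_ : (fun z => _) = fun z => ulim (TE p.1) (softplus s0 z.1) z.2 * ulim (TE p.2)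
    (softplus s0 z.1) z.2
     + \sum_(p <- l) ulim (TE p.1) (softplus s0 z.1) z.2 * ulim (TE p.2) (softplus s0 z.1) z.2).
    by apply: smooth_boundedD => //; apply: smooth_boundedM; exact: IH.
  by apply/funext => z; rewrite big_cons.
- exact: smooth_boundedZ.
Qed.

Let HI_near (P : nat -> nat -> Prop) : (forall k, U [set N | P k N]) ->
  forall n, U [set N | forall k, (k < n)%N -> P k N].
Proof.
move=> HP; elim=> [|n IH]; first by apply: filterE.
apply: filterS (filterI IH (HP n)) => N [/= h1 h2] k.
by rewrite ltnS leq_eqVlt => /orP[/eqP->|/h1].
Qed.

(** The Lipschitz bound in [y], uniform in [N], upgrades pointwise convergence along [U] to locally
    uniform convergence by way of a finite grid of step [dl]. *)
Lemma unif_conv tau t x A e : 0 < A -> 0 < e -> U [set N | forall y, `|y - x| <= A ->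
  `|aN tau y N t - ulim tau t y| <= e].
Proof.
move=> A0 e0; have [K K0 hK] := obs_val_lip eta0 tau; have [L L0 hL] := ulim_lip_x tau.
pose dl := e / 3 / (K + L + 1).
have KL : 0 < K + L + 1 by rewrite ltr_wpDl// addr_ge0.
have dl0 : 0 < dl by rewrite !divr_gt0.
pose y k := x - A + k%:R * dl.
pose n := (Num.truncn (2 * A / dl)).+1.
have HP k : U [set N | `|aN tau (y k) N t - ulim tau t (y k)| <= e / 3].
  have e3 : 0 < e / 3 by rewrite divr_gt0.
  have Hc := @ulim_cvg tau t (y k); move/cvgrPdist_le : Hc => /(_ _ e3).
  by apply: filterS => N /=; rewrite distrC.
apply: filterS (HI_near HP n) => N /= hN z hz.
pose k := Num.truncn ((z - (x - A)) / dl).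
have z0 : 0 <= (z - (x - A)) / dl.
  by move: hz; rewrite ler_norml => /andP[? ?]; rewrite divr_ge0 ?(ltW dl0)//; lra.
have /andP[k1 k2] := truncn_itv z0.
have kn : (k < n)%N.
  rewrite ltnS; apply: le_truncn; rewrite ler_pM2r ?invr_gt0//.
  by move: hz; rewrite ler_norml => /andP[? ?]; lra.
have dz : `|z - y k| <= dl.
  rewrite ler_pdivlMr// in k1; rewrite ltr_pdivrMr// in k2.
  rewrite -/k -natr1 mulrDl mul1r in k1 k2.
  by rewrite /y ler_norml; apply/andP; split; lra.
have h1 := hN k kn.
have h2 : `|aN tau z N t - aN tau (y k) N t| <= K * dl.
  rewrite /obs_avg part_avgB; apply: part_avg_bound; first by rewrite mulr_ge0// ltW.
  move=> v; apply: (le_trans (hK _ _)); rewrite ler_wpM2l//.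
  by rewrite opprB addrA subrK.
have h3 : `|ulim tau t z - ulim tau t (y k)| <= L * dl.
  by apply: (le_trans (hL _ _ _)); rewrite ler_wpM2l.
have h4 : (K + L + 1) * dl = e / 3 by rewrite /dl mulrC divfK// gt_eqF.
move: h1 h2 h3; rewrite !ler_norml => /andP[? ?] /andP[? ?] /andP[? ?].
by apply/andP; split; lra.
Qed.

Let itg (f : R -> R) x := mu.-integrable `]0, +oo[ (EFin \o (fun h => sdiff f x h / h ^+ 2)).

Let D0 : measurable (`]0, +oo[%classic : set (measurableTypeR R)).
Proof. exact: measurable_itv. Qed.

Let HTZ f x c : itg f x -> itg (fun y => c * f y) x /\ fold_Htilde (fun y => c * f y) x = c *
  fold_Htilde f x.
Proof.
move=> fi; split.
  rewrite /itg (_ : (fun h => _) = fun h => c * (sdiff f x h / h ^+ 2)).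
    exact: (@integrableZl _ _ _ mu _ D0 c _ fi).
  by apply/funext => h; rewrite mulrA; congr (_ / _); rewrite /sdiff; ring.
have <- := @RintegralZl _ _ _ mu `]0, +oo[%classic _ c D0 fi.
by apply: eq_Rintegral => h _; rewrite mulrA; congr (_ / _); rewrite /sdiff; ring.
Qed.

Let HTD f g x : itg f x -> itg g x ->
  itg (fun y => f y + g y) x /\ fold_Htilde (fun y => f y + g y) x = fold_Htilde f x + fold_Htilde
    g x.
Proof.
move=> fi gi; have E : (fun h => sdiff (fun y => f y + g y) x h / h ^+ 2) =
    fun h => sdiff f x h / h ^+ 2 + sdiff g x h / h ^+ 2.
  by apply/funext => h; rewrite -mulrDl; congr (_ / _); rewrite /sdiff; ring.
split; first by rewrite /itg E; exact: (@integrableD _ _ _ mu _ D0 _ _ fi gi).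
by rewrite /fold_Htilde E -RintegralD.
Qed.

Lemma itg_Theta x (c : R) : itg (fun y => Theta eta (y - c)) x.
Proof.
apply: (integrable_sdiff (M := 1) (K := 2 * (pi^-1 * 2 * eta ^- 2))) => //.
- move=> y; apply: (@continuous_comp _ _ _ (fun y => y - c) (Theta eta)).
    by apply: cvgB; [exact: cvg_id|exact: cvg_cst].
  exact: continuous_Theta.
- by move=> y; exact: Theta_norm.
- move=> h; rewrite Theta_sdE; exact: sdiff_quad (Theta_quad eta0 _) h.
Qed.

Lemma fold_Htilde_avg N t x :
  itg (fun y => aN TT y N t) x /\ fold_Htilde (fun y => aN TT y N t) x = aN (TE EQ) x N t.
Proof.
have [] : itg (fun y => \sum_(i < N) Theta eta (y - lam i t)) x /\
   fold_Htilde (fun y => \sum_(i < N) Theta eta (y - lam i t)) x = \sum_(i < N) conj_poisson eta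
     (x - lam i t).
  elim: (index_enum _) => [|i s IH].
    rewrite (_ : (fun y => _) = fun=> 0 * Theta eta 0); last first.
      by apply/funext => y; rewrite big_nil mul0r.
    have I := itg_Theta x 0.
    have [] := HTZ 0 I; rewrite big_nil mul0r.
    rewrite (_ : (fun y => 0 * _) = fun=> 0 * Theta eta 0) => [? ->|]; first by split.
    by apply/funext => y; rewrite !mul0r.
  case: IH => I E; have [] := HTD (itg_Theta x (lam i t)) I.
  rewrite E fold_Htilde_Theta// big_cons => I' E'.
  rewrite (_ : (fun y => \sum_(j <- i :: s) _) = fun y => Theta eta (y - lam i t) +
    \sum_(j <- s) Theta eta (y - lam j t)) //.
  by apply/funext => y; rewrite big_cons.
by move=> I E; have [] := HTZ N%:R^-1 I; rewrite E.
Qed.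

Lemma ulim_continuous tau t : continuous (ulim tau t).
Proof.
move=> x; have [K K0 hK] := ulim_lip_x tau.
apply/cvgrPdist_le => e e0; near=> y; apply: (le_trans (hK _ _ _)).
have : `|x - y| <= e / (K + 1).
  by near: y; apply: cvgr_dist_le => //; rewrite divr_gt0// ltr_wpDl.
rewrite ler_pdivlMr ?ltr_wpDl// => h; have := normr_ge0 (x - y); nra.
Unshelve. all: by end_near. Qed.

Lemma ulim_norm1 t x : `|ulim TT t x| <= 1.
Proof.
apply: (limU_norm (a := fun N => aN TT x N t)); first exact: ulim_cvg.
move=> e e0; near=> N; apply: (@le_trans _ _ 1); last by rewrite lerDl ltW.
by apply: part_avg_bound => // y; exact: Theta_norm.
Unshelve. all: by end_near. Qed.

(** The operator passes to the limit by [small_fold]: the second differences are bounded and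
    quadratic uniformly in [N], and close to their limit for bounded [h] by [unif_conv]. *)
Lemma fold_Htilde_ulim t x : fold_Htilde (ulim TT t) x = ulim (TE EQ) t x.
Proof.
have [K K0 hK] := ulim_quad_x TT; have [K' K'0 hK'] := obs_val_quad eta0 TT.
have sH h : `|sdiff (ulim TT t) x h| <= 2 * K * h ^+ 2 := sdiff_quad (hK t x) h.
have sA N h : `|sdiff (fun y => aN TT y N t) x h| <= 2 * K' * h ^+ 2.
  apply: (@sdiff_quad _ _ _ (obs_coef TT * aN (TE EA) x N t)) => {}h.
  rewrite /obs_avg part_avgB !part_avgZ part_avgB; apply: part_avg_bound;
    first by rewrite mulr_ge0// sqr_ge0.
  by move=> y; rewrite (_ : x + h - y = x - y + h); [exact: hK'|ring].
have cA N : continuous (fun y => aN TT y N t).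
  move=> y; apply: cvgM; first exact: cvg_cst.
  elim: (index_enum _) => [|i s IH].
    by under eq_cvg do rewrite big_nil; rewrite big_nil; exact: cvg_cst.
  under eq_cvg do rewrite big_cons; rewrite big_cons.
  apply: cvgD; last exact: IH.
  apply: (@continuous_comp _ _ _ (fun y => y - lam i t) (Theta eta)).
    by apply: cvgB; [exact: cvg_id|exact: cvg_cst].
  exact: continuous_Theta.
have A1 N y : `|aN TT y N t| <= 1 by apply: part_avg_bound => // z; exact: Theta_norm.
have cv : aN (TE EQ) x N t @[N --> U] --> fold_Htilde (ulim TT t) x.
  apply/cvgrPdist_le => e e0.
  have [d d0 hd] := small_fold 2 (2 * K + 2 * K') e0.
  have id0 : 0 < d^-1 by rewrite invr_gt0.
  have d4 : 0 < d / 4 by rewrite divr_gt0.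
  apply: filterS (unif_conv TT t x id0 d4) => N /= hN.
  have [iA <-] := fold_Htilde_avg N t x.
  have iH : itg (ulim TT t) x.
    exact: (integrable_sdiff (@ulim_continuous TT t) (ulim_norm1 t) sH).
  rewrite /fold_Htilde -RintegralB//.
  under eq_Rintegral do rewrite -mulrBl.
  apply: hd.
  - by apply: measurable_funB; apply: measurable_sdiff => //; exact: ulim_continuous.
  - move=> h; apply: (le_trans (ler_normB _ _)).
    have := sdiff_le4 x h (ulim_norm1 t); have := sdiff_le4 x h (A1 N); lra.
  - move=> h; apply: (le_trans (ler_normB _ _)); rewrite [leRHS]mulrDl.
    by apply: lerD; [exact: sH|exact: sA].
  - move=> h h0 hh; have E0 := hN x _; rewrite subrr normr0 in E0.
    have := E0 (ltW id0); have := hN (x + h); have := hN (x - h).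
    rewrite (addrC x h) addrK (addrC x (- h)) addrK normrN (ger0_norm (ltW h0)).
    move=> /(_ hh) e1 /(_ hh) e2 e3; rewrite /sdiff (addrC x h) (addrC x (- h)).
    move: e1 e2 e3; rewrite !ler_norml => /andP[? ?] /andP[? ?] /andP[? ?].
    by apply/andP; split; lra.
by apply/esym; apply: (cvg_lim (@Rhausdorff R) cv).
Qed.

(** For [TT] the divided difference of [EA] consists of two symmetric products, so the drift is
    exactly [- pi^-1] times the limits of [EA] and [EQ]: minus the slope times the value of the
    operator given by [fold_Htilde_ulim]. *)
Lemma ulim_smooth_solution : smooth_solution (fun z => ulim TT z.1 z.2) (fun z => ulim_drift TT
  z.1 z.2)
  (fun z => pi^-1 * ulim (TE EA) z.1 z.2).
Proof.
have p0 : 0 <= pi^-1 :> R by rewrite invr_ge0 pi_ge0.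
have [M M0 hM] := ulim_bound (TE EA); have [M' M'0 hM'] := ulim_bound (TE EQ).
have [C C0 hC] := ulim_time TT; have [K K0 hK] := ulim_quad_x TT.
have [L L0 hL] := ulim_lip_x TT.
have csH : classical_solution (fun z => ulim TT z.1 z.2) (fun z => ulim_drift TT z.1 z.2)
    (fun z => pi^-1 * ulim (TE EA) z.1 z.2).
  split.
  - move=> [t x]/= t0; apply: (is_derive_quad_loc (C := C) t0) => h ht.
    have th : 0 <= t + h by move: ht; rewrite ler_norml => /andP[? ?]; lra.
    have [_] := hC t (t + h) x (ltW t0) th.
    by rewrite (addrC t h) addrK (addrC h).
  - by move=> [t x]/= t0; apply: (is_derive_quad (C := K)) => h _; exact: hK.
  - move=> [t x]/= t0; rewrite mulr_ge0//.
    apply: (limU_le (a := fun=> 0) (b := fun N => aN (TE EA) x N t)).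
    + exact: cvg_cst.
    + exact: ulim_cvg.
    + near=> N; rewrite /obs_avg /part_avg mulr_ge0 ?invr_ge0// sumr_ge0// => i _.
      by have [_ _ /ltW] := poisson_conj_poisson_den (x - lam i t) eta0.
  - by exists 1 => // z _; exact: ulim_norm1.
  - by exists (2 * K) => [|[t x] h /= t0]; [rewrite mulr_ge0|exact: sdiff_quad (hK t x) h].
  - move=> [t x] /= t0.
    apply/cvgrPdist_le => e e0; near=> z.
    have z0 : 0 < z.1.
      by near: z; apply: (@cvgr_gt _ _ _ _ (fun z : R * R => z.1) t cvg_fst 0 t0).
    have zx : `|(t, x) - z| <= e / (C + L + 1).
      near: z; apply: (@cvgr_dist_le _ (R * R)%type) => //.
      by rewrite divr_gt0// ltr_wpDl// addr_ge0.
    rewrite ler_pdivlMr ?ltr_wpDl ?addr_ge0// in zx.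
    have n1 : `|t - z.1| <= `|(t, x) - z| by rewrite [leRHS]prod_normE/= le_max lexx.
    have n2 : `|x - z.2| <= `|(t, x) - z| by rewrite [leRHS]prod_normE/= le_max lexx orbT.
    rewrite (_ : _ - _ = (ulim TT t x - ulim TT z.1 x) + (ulim TT z.1 x - ulim TT z.1 z.2));
      last by ring.
    have [h1 _] := hC z.1 t x (ltW z0) (ltW t0); have h2 := hL z.1 x z.2.
    apply: (le_trans (ler_normD _ _)); apply: (le_trans (lerD h1 h2)).
    apply: le_trans zx; have := normr_ge0 ((t, x) - z).
    have := ler_wpM2l C0 n1; have := ler_wpM2l L0 n2; lra.
  - move=> [t x] /= t0; rewrite /fold_Htilde_x/= fold_Htilde_ulim /ulim_drift /= !big_cons big_nil
    /=.
    by move: (pi^-1) => p; field.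
split => //.
- move=> s0 s00 n; exact: smooth_bounded_ulim s00 n TT.
- exists (pi^-1 * M + M' + C); first by rewrite !addr_ge0// mulr_ge0.
  split=> [[t x]/= t0|t t' x t0 t'0 /=].
    split.
      rewrite -addrA; apply: (@le_trans _ _ (pi^-1 * M)); last by rewrite lerDl addr_ge0.
      by rewrite ler_wpM2l//; apply: le_trans (hM t x); exact: ler_norm.
    rewrite /fold_Htilde_x/= fold_Htilde_ulim; apply: (le_trans (hM' t x)).
    by rewrite addrAC lerDr addr_ge0// mulr_ge0.
  have [h1 _] := hC t' t x t'0 t0; apply: (le_trans h1).
  by rewrite ler_wpM2r// lerDr addr_ge0// mulr_ge0.
Unshelve. all: by end_near. Qed.

End limit.

(** * Pathwise expansions of the particle averages *)
Section Rintegral_dist.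
Context {d} {T : measurableType d} {R : realType}.
Variable mu : {measure set T -> \bar R}.

Lemma ae_le_Rintegral (A : set T) (f g : T -> R) : measurable A ->
  mu.-integrable A (EFin \o f) -> mu.-integrable A (EFin \o g) ->
  (forall x, A x -> 0 <= f x) -> (forall x, A x -> 0 <= g x) ->
  {ae mu, forall x, A x -> f x <= g x} ->
  \int[mu]_(x in A) f x <= \int[mu]_(x in A) g x.
Proof.
move=> mA fi gi f0 g0 fg; rewrite /Rintegral fine_le//.
- exact: (integrable_fin_num mA fi).
- exact: (integrable_fin_num mA gi).
apply: ae_ge0_le_integral => //.
- by case/integrableP : fi.
- by case/integrableP : gi.
Qed.

Lemma Rintegral_dist (A : set T) (f g k : T -> R) : measurable A ->
  mu.-integrable A (EFin \o f) -> mu.-integrable A (EFin \o g) ->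
  mu.-integrable A (EFin \o k) -> (forall x, A x -> 0 <= k x) ->
  {ae mu, forall x, A x -> `|f x - g x| <= k x} ->
  `|\int[mu]_(x in A) f x - \int[mu]_(x in A) g x| <= \int[mu]_(x in A) k x.
Proof.
move=> mA fi gi ki k0 fgk; rewrite -RintegralB//.
have ii : mu.-integrable A (EFin \o (fun x => f x - g x)).
  exact: (integrableB mA fi gi).
apply: (le_trans (le_normr_Rintegral mA ii)).
apply: ae_le_Rintegral => //.
exact: (integrable_abse ii).
Qed.

End Rintegral_dist.

Section itv_integral.
Context {R : realType}.
Local Notation mu := (@lebesgue_measure R).
Variable g : R -> R.
Hypothesis gi : forall t : R, 0 <= t -> mu.-integrable `[0, t] (EFin \o g).

Definition itv_int (s t : R) : R := \int[mu]_(r in `]s, t]) g r.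

Lemma itv_intE (s t : R) : 0 <= s -> s <= t ->
  \int[mu]_(r in `[0, t]) g r - \int[mu]_(r in `[0, s]) g r = itv_int s t.
Proof.
by move=> s0 st; apply: Rintegral_itvB; [apply: gi; lra|rewrite bnd_simp|rewrite bnd_simp].
Qed.

Lemma integrable_itv (s t : R) : 0 <= s -> s <= t -> mu.-integrable `]s, t] (EFin \o g).
Proof.
move=> s0 st; apply: (@integrableS _ _ _ mu `[0, t]%classic) => //.
- by move=> x /=; rewrite !in_itv/= => /andP[a b]; apply/andP; split; lra.
- by apply: gi; lra.
Qed.

End itv_integral.

Lemma integrable_cst_itv {R : realType} (c s t : R) :
  lebesgue_measure.-integrable `]s, t] (EFin \o (fun=> c)).
Proof.
apply: (@measurable_bounded_integrable _ _ _ _ (fun=> c)) => //.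
- by rewrite /= lebesgue_measure_itv/=; case: ifP => //; rewrite ltry.
- by exists `|c|; split => // x cx y _ /=; exact: ltW.
Qed.

Lemma Rintegral_cst_itv {R : realType} (c s t : R) : s <= t ->
  \int[lebesgue_measure]_(r in `]s, t]) c = c * (t - s).
Proof.
move=> st; rewrite Rintegral_cst//= lebesgue_measure_itv/=.
case: ifPn => //=; rewrite ?lte_fin -?leNgt => h.
have -> : t = s by apply/eqP; rewrite eq_le h.
by rewrite subrr mulr0.
Qed.

(** * The symmetrized drift and the time regularity of averages *)

Section particle.
Context {R : realType}.
Local Notation mu := (@lebesgue_measure R).
Variable lam : forall N : nat, 'I_N -> R -> R.
Variable eta : R.
Hypothesis eta0 : 0 < eta.

Definition particle_drift N (i : 'I_N) s : R :=
  N%:R^-1 * \sum_(j < N | j != i) (lam i s - lam j s)^-1.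

Definition particle_obs_drift tau x N s : R := N%:R^-1 *
  \sum_(i < N) - (obs_coef tau * expr_eval eta (obs_deriv tau) (x - lam i s)) * particle_drift i s.

(** Exchanging [i] and [j] in one of two copies of the double sum produces divided differences,
    where [lam i s - lam j s] cancels. Completing the sum to all pairs gives products of averages;
    the added diagonal is the second term. *)
Lemma particle_obs_driftE tau x N s : (forall i j : 'I_N, i != j -> lam i s != lam j s) ->
  particle_obs_drift tau x N s = obs_drift lam eta tau x N s + obs_coef tau / 2 * (N%:R^-1 *
    part_avg lam N s (fun y => \sum_(p <- expr_diffq (obs_deriv tau)) expr_eval eta p.1 (x - y) *
      expr_eval eta p.2 (x - y))).
Proof.
move=> ne; pose w i := x - lam (N := N) i s; pose e := obs_deriv tau.
pose Q i j := \sum_(p <- expr_diffq e) expr_eval eta p.1 (w i) * expr_eval eta p.2 (w j).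
pose S := \sum_(i < N) \sum_(j < N | j != i) expr_eval eta e (w i) * (lam i s - lam j s)^-1.
have S2 : S + S = \sum_(i < N) \sum_(j < N | j != i) Q i j.
  have -> : S + S = S + \sum_(i < N) \sum_(j < N | j != i) expr_eval eta e (w j) * (lam j s - lam
    i s)^-1.
    congr (S + _); rewrite /S (exchange_big_dep xpredT)//=.
    by apply: eq_bigr => i _; apply: eq_bigl => j; rewrite eq_sym.
  rewrite /S -big_split; apply: eq_bigr => i _; rewrite -big_split.
  apply: eq_bigr => j ji /=; rewrite /Q.
  have h : lam i s - lam j s != 0 by rewrite subr_eq0 ne// eq_sym.
  have := @expr_diffqE R eta eta0 e (w i) (w j).
  rewrite (_ : w j - w i = lam i s - lam j s); last by rewrite /w; ring.
  move=> E; apply: (mulfI h); rewrite -E -(opprB (lam i s)) invrN.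
  by rewrite mulrDr mulrN [in X in _ + X]mulrN mulrCA mulfV// mulr1 mulrCA mulfV// mulr1.
have SQ : \sum_(i < N) \sum_(j < N | j != i) Q i j =
    \sum_(p <- expr_diffq e) (\sum_(i < N) expr_eval eta p.1 (w i)) * (\sum_(i < N) expr_eval eta
      p.2 (w i))
    - \sum_(i < N) Q i i.
  apply/eqP; rewrite -subr_eq opprK -big_split; apply/eqP.
  transitivity (\sum_(i < N) \sum_(j < N) Q i j).
    by apply: eq_bigr => i _; rewrite [RHS](bigD1 i)//= addrC.
  rewrite /Q; under eq_bigr do rewrite exchange_big; rewrite exchange_big.
  apply: eq_bigr => p _ /=; rewrite mulr_suml.
  by apply: eq_bigr => i _; rewrite mulr_sumr.
have -> : particle_obs_drift tau x N s = - obs_coef tau * N%:R^-1 ^+ 2 * S.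
  rewrite /particle_obs_drift /particle_drift /S !mulr_sumr; apply: eq_bigr => i _.
  rewrite -[in RHS]mulr_sumr -/(w i) -/e; ring.
have -> : S = (\sum_(i < N) \sum_(j < N | j != i) Q i j) / 2.
  by rewrite -S2; field.
rewrite SQ /obs_drift /obs_avg /part_avg -/e.
under [in RHS]eq_bigr do rewrite mulrACA; rewrite -mulr_sumr.
by rewrite /Q; move: (N%:R^-1 : R) => n; field.
Qed.

Lemma obs_drift_bound tau : exists2 M, 0 <= M & forall x N s, `|obs_drift lam eta tau x N s| <= M.
Proof.
suff [M M0 hM] : exists2 M, 0 <= M & forall x N s,
  `|\sum_(p <- expr_diffq (obs_deriv tau)) obs_avg lam eta (TE p.1) x N s * obs_avg lam eta (TE
    p.2) x N s| <= M.
  exists (`|obs_coef tau / 2| * M) => [|x N s]; first by rewrite mulr_ge0.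
  by rewrite /obs_drift normrM normrN; apply: ler_wpM2l.
elim: (expr_diffq _) => [|p l [M M0 hM]].
  by exists 0 => // x N s; rewrite big_nil normr0.
have [A A0 hA] := obs_val_bound eta0 (TE p.1); have [B B0 hB] := obs_val_bound eta0 (TE p.2).
exists (A * B + M) => [|x N s]; first by rewrite addr_ge0// mulr_ge0.
rewrite big_cons (le_trans (ler_normD _ _))// lerD//.
by rewrite normrM ler_pM//; apply: part_avg_bound.
Qed.

Lemma particle_obs_drift_close tau : exists2 M, 0 <= M & forall x N s,
  (forall i j : 'I_N, i != j -> lam i s != lam j s) ->
  `|particle_obs_drift tau x N s - obs_drift lam eta tau x N s| <= N%:R^-1 * M.
Proof.
suff [M M0 hM] : exists2 M, 0 <= M & forall w : R,
    `|\sum_(p <- expr_diffq (obs_deriv tau)) expr_eval eta p.1 w * expr_eval eta p.2 w| <= M.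
  exists (`|obs_coef tau / 2| * M) => [|x N s ne]; first by rewrite mulr_ge0.
  rewrite particle_obs_driftE// addrAC subrr add0r normrM [leRHS]mulrCA; apply: ler_wpM2l => //.
  rewrite normrM ger0_norm ?invr_ge0//; apply: ler_wpM2l; rewrite ?invr_ge0//.
  exact: part_avg_bound.
elim: (expr_diffq _) => [|p l [M M0 hM]].
  by exists 0 => // x; rewrite big_nil normr0.
have [A A0 hA] := obs_val_bound eta0 (TE p.1); have [B B0 hB] := obs_val_bound eta0 (TE p.2).
exists (A * B + M) => [|x]; first by rewrite addr_ge0// mulr_ge0.
rewrite big_cons (le_trans (ler_normD _ _))// lerD//.
by rewrite normrM; apply: ler_pM => //; [exact: hA|exact: hB].
Qed.

Hypothesis gdi : forall tau x N (t : R), 0 <= t ->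
  mu.-integrable `[0, t] (EFin \o particle_obs_drift tau x N).
Hypothesis nocoll : forall N, {ae mu, forall s : R, 0 <= s ->
  forall i j : 'I_N, i != j -> lam i s != lam j s}.
Hypothesis H1 : forall tau (q : rat) (T eps : R), 0 < eps -> \forall N \near \oo,
  forall t, 0 <= t <= T -> `|obs_avg lam eta tau (ratr q) N t - obs_avg lam eta tau (ratr q) N 0
    - \int[mu]_(s in `[0, t]) particle_obs_drift tau (ratr q) N s| <= eps.

Let incr tau (q : rat) (T eps : R) : 0 < eps -> \forall N \near \oo,
  forall s t : R, 0 <= s -> s <= t -> t <= T -> `|obs_avg lam eta tau (ratr q) N t -
    obs_avg lam eta tau (ratr q) N s - itv_int (particle_obs_drift tau (ratr q) N) s t| <= eps.
Proof.
move=> e0; have e2 : 0 < eps / 2 by rewrite divr_gt0.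
apply: filterS (H1 tau q T e2) => N hN s t s0 st tT.
have h1 := hN s; have h2 := hN t.
rewrite -(itv_intE (gdi tau (ratr q) N) s0 st).
have {h1} := h1 _; have {h2} := h2 _.
rewrite (le_trans s0 st) tT s0 (le_trans st tT) => /(_ isT) h2 /(_ isT) h1.
move: h1 h2; rewrite !ler_norml => /andP[? ?] /andP[? ?].
by apply/andP; split; lra.
Qed.

Let near_drift tau : exists2 M, 0 <= M & forall x N (s t c D : R), 0 <= s -> s <= t -> 0 <= D ->
  (forall r, s < r <= t -> `|obs_drift lam eta tau x N r - c| <= D) ->
  `|itv_int (particle_obs_drift tau x N) s t - (t - s) * c| <= (N%:R^-1 * M + D) * (t - s).
Proof.
have [M M0 hM] := particle_obs_drift_close tau; exists M => // x N s t c D s0 st D0 h.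
rewrite (mulrC _ c) -Rintegral_cst_itv// -[leRHS]Rintegral_cst_itv//.
have k0 : 0 <= N%:R^-1 * M + D by rewrite addr_ge0// mulr_ge0// invr_ge0.
apply: Rintegral_dist => //.
- exact: (integrable_itv (gdi tau x N) s0 st).
- exact: integrable_cst_itv.
- exact: integrable_cst_itv.
apply: (@filterS _ _ (ae_filter_ringOfSetsType mu) _ _ _ (nocoll N)) => r /= ne;
  rewrite in_itv/= => /andP[sr rt].
rewrite -(subrK (obs_drift lam eta tau x N r) (particle_obs_drift tau x N r)) -addrA.
apply: (le_trans (ler_normD _ _)); apply: lerD; last by apply: h; rewrite sr rt.
apply: hM => i j; apply: ne; exact: (le_trans s0 (ltW sr)).
Qed.

Let time_lip tau : exists2 C, 0 <= C & forall (q : rat) (T eps : R), 0 < eps ->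
  \forall N \near \oo, forall s t : R, 0 <= s <= T -> 0 <= t <= T ->
   `|obs_avg lam eta tau (ratr q) N t - obs_avg lam eta tau (ratr q) N s| <= C * `|t - s| + eps.
Proof.
have [D D0 hD] := obs_drift_bound tau; have [M M0 hM] := near_drift tau.
exists (M + D) => [|q T eps e0]; first by rewrite addr_ge0.
apply: filterS2 (nbhs_infty_ge 1) (incr tau q T e0) => N /= N1 hN.
suff W (s t : R) : 0 <= s <= T -> 0 <= t <= T -> s <= t ->
    `|obs_avg lam eta tau (ratr q) N t - obs_avg lam eta tau (ratr q) N s| <= (M + D) * `|t - s| +
      eps.
  move=> s t hs ht; have [st|/ltW ts] := leP s t; first exact: W.
  by rewrite distrC (distrC t); exact: W.
move=> /andP[s0 sT] /andP[t0 tT] st.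
have := hN s t s0 st tT.
have H0 r : s < r <= t -> `|obs_drift lam eta tau (ratr q) N r - 0| <= D by rewrite subr0.
have := hM (ratr q) N s t 0 D s0 st D0 H0; rewrite mulr0 subr0.
have Ni : N%:R^-1 * M <= M by rewrite ler_piMl// invf_le1// ?ler1n// ltr0n.
have ts0 : 0 <= t - s by rewrite subr_ge0.
rewrite (ger0_norm ts0).
have := ler_wpM2r ts0 Ni.
rewrite !ler_norml => Nt /andP[? ?] /andP[? ?]; apply/andP; split; lra.
Qed.

Let obs_drift_lip tau : exists2 C, 0 <= C & forall (q : rat) (T eps : R), 0 < eps ->
  \forall N \near \oo, forall s t : R, 0 <= s <= T -> 0 <= t <= T ->
   `|obs_drift lam eta tau (ratr q) N t - obs_drift lam eta tau (ratr q) N s| <= C * `|t - s| + eps.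
Proof.
suff [C C0 hC] : exists2 C, 0 <= C & forall (q : rat) (T eps : R), 0 < eps ->
  \forall N \near \oo, forall s t : R, 0 <= s <= T -> 0 <= t <= T ->
   `|\sum_(p <- expr_diffq (obs_deriv tau)) obs_avg lam eta (TE p.1) (ratr q) N t * obs_avg lam
     eta (TE p.2) (ratr q) N t
    - \sum_(p <- expr_diffq (obs_deriv tau)) obs_avg lam eta (TE p.1) (ratr q) N s * obs_avg lam
      eta (TE p.2) (ratr q) N s|
   <= C * `|t - s| + eps.
  pose k : R := `|obs_coef tau / 2|; have k0 : 0 <= k by exact: normr_ge0.
  exists (k * C) => [|q T eps e0]; first by rewrite mulr_ge0.
  have e1 : 0 < eps / (k + 1) by rewrite divr_gt0// ltr_wpDl.
  apply: filterS (hC q T _ e1) => N h s t hs ht.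
  rewrite /obs_drift -mulrBr normrM normrN.
  apply: (le_trans (ler_wpM2l k0 (h s t hs ht))); rewrite mulrDr mulrA lerD2l.
  by rewrite mulrCA ler_piMr ?(ltW e0)// ler_pdivrMr ?ltr_wpDl// mul1r lerDl.
elim: (expr_diffq _) => [|p l [C C0 hC]].
  exists 0 => // q T eps e0; apply: nearW => N s t _ _.
  by rewrite !big_nil subrr normr0 mul0r add0r ltW.
have [A A0 hA] := obs_val_bound eta0 (TE p.1); have [B B0 hB] := obs_val_bound eta0 (TE p.2).
have [K K0 hK] := time_lip (TE p.1); have [L L0 hL] := time_lip (TE p.2).
exists (K * B + A * L + C) => [|q T eps e0]; first by rewrite !addr_ge0// mulr_ge0.
have e1 : 0 < eps / (A + B + 1) by rewrite divr_gt0// ltr_wpDl// addr_ge0.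
have e2 : 0 < eps / (A + B + 1) by rewrite divr_gt0// ltr_wpDl// addr_ge0.
near=> N => s t hs ht; rewrite !big_cons opprD addrACA.
have h3 : forall s t : R, 0 <= s <= T -> 0 <= t <= T ->
  `|\sum_(p <- l) obs_avg lam eta (TE p.1) (ratr q) N t * obs_avg lam eta (TE p.2) (ratr q) N t
    - \sum_(p <- l) obs_avg lam eta (TE p.1) (ratr q) N s * obs_avg lam eta (TE p.2) (ratr q) N s|
   <= C * `|t - s| + eps / (A + B + 1) by near: N; exact: hC.
have h1 : forall s t : R, 0 <= s <= T -> 0 <= t <= T ->
   `|obs_avg lam eta (TE p.1) (ratr q) N t - obs_avg lam eta (TE p.1) (ratr q) N s| <=
   K * `|t - s| + eps / (A + B + 1) by near: N; exact: hK.
have h2 : forall s t : R, 0 <= s <= T -> 0 <= t <= T ->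
   `|obs_avg lam eta (TE p.2) (ratr q) N t - obs_avg lam eta (TE p.2) (ratr q) N s| <=
   L * `|t - s| + eps / (A + B + 1) by near: N; exact: hL.
have {}h1 := h1 s t hs ht; have {}h2 := h2 s t hs ht; have {}h3 := h3 s t hs ht.
have b1 r : `|obs_avg lam eta (TE p.1) (ratr q) N r| <= A by exact: part_avg_bound.
have b2 r : `|obs_avg lam eta (TE p.2) (ratr q) N r| <= B by exact: part_avg_bound.
set a := obs_avg lam eta (TE p.1) (ratr q) N in h1 b1 *.
set b := obs_avg lam eta (TE p.2) (ratr q) N in h2 b2 *.
have -> : a t * b t - a s * b s = (a t - a s) * b t + a s * (b t - b s) by ring.
have E : eps = B * (eps / (A + B + 1)) + A * (eps / (A + B + 1)) + eps / (A + B + 1).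
  by field; rewrite gt_eqF// ltr_wpDl// addr_ge0.
rewrite [in leRHS]E.
have -> : (K * B + A * L + C) * `|t - s| + (B * (eps / (A + B + 1)) + A * (eps / (A + B + 1)) +
  eps / (A + B + 1))
  = (K * `|t - s| + eps / (A + B + 1)) * B + A * (L * `|t - s| + eps / (A + B + 1))
    + (C * `|t - s| + eps / (A + B + 1)) by ring.
apply: (le_trans (ler_normD _ _)); apply: lerD => //.
apply: (le_trans (ler_normD _ _)); rewrite (normrM (a t - a s)) (normrM (a s)); apply: lerD.
  exact: (ler_pM (normr_ge0 _) (normr_ge0 _) h1 (b2 t)).
exact: (ler_pM (normr_ge0 _) (normr_ge0 _) (b1 s) h2).
Unshelve. all: by end_near. Qed.

(** A bootstrap: the bounded drift makes the averages Lipschitz in time up to [eps], then the drift,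
    a polynomial in averages, is Lipschitz too, and freezing it at one end of an interval costs a
    quadratic remainder. *)
Lemma limit_dynamics_of_drift : limit_dynamics lam eta.
Proof.
move=> tau; have [K K0 hK] := time_lip tau; have [L L0 hL] := obs_drift_lip tau.
have [M M0 hM] := near_drift tau.
exists (K + L) => [|q T eps e0]; first by rewrite addr_ge0.
(* The drift is controlled up to [eps / 3 / T1] because this error is integrated over an interval of
   length at most [T1], which is positive whatever [T] is. *)
pose T1 := `|T| + 1; have T0 : 0 < T1 by rewrite ltr_wpDl.
have e4 : 0 < eps / 3 by rewrite divr_gt0.
have eT : 0 < eps / 3 / T1 by rewrite !divr_gt0.
near=> N => s t hs ht.
have h1 : forall s t : R, 0 <= s <= T -> 0 <= t <= T ->
   `|obs_avg lam eta tau (ratr q) N t - obs_avg lam eta tau (ratr q) N s| <= K * `|t - s| + eps.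
  by near: N; exact: hK.
have h2 : forall s t : R, 0 <= s -> s <= t -> t <= T -> `|obs_avg lam eta tau (ratr q) N t -
    obs_avg lam eta tau (ratr q) N s - itv_int (particle_obs_drift tau (ratr q) N) s t| <= eps / 3.
  by near: N; exact: incr.
have h3 : forall s t : R, 0 <= s <= T -> 0 <= t <= T ->
   `|obs_drift lam eta tau (ratr q) N t - obs_drift lam eta tau (ratr q) N s| <= L * `|t - s| +
     eps / 3 / T1.
  by near: N; exact: hL.
have NM : N%:R^-1 * M <= eps / 3 / T1.
  have N0 : (0 < N)%N by near: N; exact: nbhs_infty_gt.
  rewrite mulrC ler_pdivrMr ?ltr0n// -ler_pdivrMl//; near: N; exact: nbhs_infty_ger.
split.
  apply: (le_trans (h1 s t hs ht)); rewrite lerD2r mulrDl lerDl mulr_ge0//.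
have W (a b c : R) : 0 <= a -> a <= b -> b <= T -> 0 <= c <= T -> a <= c <= b ->
    `|obs_avg lam eta tau (ratr q) N b - obs_avg lam eta tau (ratr q) N a -
      (b - a) * obs_drift lam eta tau (ratr q) N c| <= L * (b - a) ^+ 2 + eps.
  move=> a0 ab bT hc /andP[ac cb].
  have D0 : 0 <= L * (b - a) + eps / 3 / T1.
    by rewrite addr_ge0 ?(ltW eT)// mulr_ge0// subr_ge0.
  have H0 r : a < r <= b -> `|obs_drift lam eta tau (ratr q) N r -
      obs_drift lam eta tau (ratr q) N c| <= L * (b - a) + eps / 3 / T1.
    move=> /andP[ar rb].
    apply: (le_trans (h3 c r hc _)); first by apply/andP; split; lra.
    rewrite lerD2r; apply: ler_wpM2l => //.
    by rewrite ler_norml; apply/andP; split; lra.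
  have := hM (ratr q) N a b (obs_drift lam eta tau (ratr q) N c) _ a0 ab D0 H0.
  have := h2 a b a0 ab bT.
  have bT1 : b - a <= T1 by rewrite /T1; have := ler_norm T; lra.
  have q1 : (N%:R^-1 * M + (L * (b - a) + eps / 3 / T1)) * (b - a) <=
      L * (b - a) ^+ 2 + (eps / 3 + eps / 3).
    rewrite mulrDl mulrDl addrCA expr2 mulrA lerD2l.
    have X (z : R) : 0 <= z -> z <= eps / 3 / T1 -> z * (b - a) <= eps / 3.
      move=> z0 hz; rewrite ler_pdivlMr// in hz; apply: le_trans hz.
      exact: ler_wpM2l.
    by apply: lerD; apply: X => //; [rewrite mulr_ge0// invr_ge0|exact: ltW].
  rewrite !ler_norml => /andP[? ?] /andP[? ?]; apply/andP; split; lra.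
have [/andP[s0 sT] /andP[t0 tT]] := (hs, ht).
have q0 : 0 <= K * (t - s) ^+ 2 by rewrite mulr_ge0// sqr_ge0.
have [st|/ltW ts] := leP s t.
  have := W s t s s0 st tT hs; rewrite lexx st => /(_ isT) h.
  by apply: (le_trans h); rewrite lerD2r mulrDl lerDr.
have := W t s s t0 ts sT hs; rewrite lexx ts => /(_ isT) h.
rewrite (_ : _ - _ - _ = - (obs_avg lam eta tau (ratr q) N s - obs_avg lam eta tau (ratr q) N t -
   (s - t) * obs_drift lam eta tau (ratr q) N s)); last by ring.
by rewrite normrN; apply: (le_trans h); rewrite -(opprB t s) sqrrN lerD2r mulrDl lerDr.
Unshelve. all: by end_near. Qed.

End particle.

Section unif.
Context {R : realType}.

Lemma within_ball (f : R -> R) (x e : R) : {within `[0, +oo[, continuous f} ->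
  0 <= x -> 0 < e -> exists2 r, 0 < r & forall y, 0 <= y -> `|y - x| < r -> `|f y - f x| <= e.
Proof.
move=> fc x0 e0; have X : (`[0, +oo[%classic : set R) x by rewrite /= in_itv/= x0.
move/subspace_continuousP : fc => /(_ x X) fcx.
move/cvgrPdist_le : fcx => /(_ e e0).
move=> -[r /= r0 hr]; exists r => // y y0 yx.
have Y : (`[0, +oo[%classic : set R) y by rewrite /= in_itv/= y0.
by rewrite distrC; apply: hr => //=; rewrite distrC.
Qed.

Lemma unif_within (f : R -> R) (T e : R) : {within `[0, +oo[, continuous f} -> 0 < e ->
  exists2 dl, 0 < dl & forall s t, 0 <= s <= T -> 0 <= t <= T -> `|t - s| <= dl ->
    `|f t - f s| <= e.
Proof.
move=> fc e0; have e2 : 0 < e / 2 by rewrite divr_gt0.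
have K := @segment_compact R 0 T.
have /compact_near_coveringP K' := K.
have [] := K' _ (0 : R)^'+ (fun dl s => forall t, 0 <= s -> 0 <= t ->
  `|t - s| <= dl -> `|f t - f s| <= e) _.
  move=> x; rewrite /= in_itv/= => /andP[x0 xT].
  have [r r0 hr] := within_ball fc x0 e2.
  have r2 : 0 < r / 2 by rewrite divr_gt0.
  exists ([set y | `|y - x| < r / 2], [set y | y < r / 2]).
    split => /=; first by exists (r / 2) => // y /=; rewrite distrC.
    exact: nbhs_right_lt.
  move=> -[s dl]/= [sx dr] t s0 t0 ts.
  have a1 : `|f s - f x| <= e / 2 by apply: hr => //; lra.
  have a2 : `|f t - f x| <= e / 2.
    apply: hr => //; rewrite -(subrK s t) -addrA.
    by apply: (le_lt_trans (ler_normD _ _)); lra.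
  by move: a1 a2; rewrite !ler_norml => /andP[? ?] /andP[? ?]; apply/andP; split; lra.
move=> dl /= dl0 hd; exists (dl / 2); first by rewrite divr_gt0.
move=> s t /andP[s0 sT] /andP[t0 tT] ts.
have d2 : 0 < dl / 2 by rewrite divr_gt0.
apply: (hd (dl / 2)) => //=; last by rewrite in_itv/= s0 sT.
by rewrite sub0r normrN gtr0_norm// ltr_pdivrMr// ltr_pMr// ltr1n.
Qed.

Lemma within_continuous (f : R -> R) : continuous f -> {within `[0, +oo[, continuous f}.
Proof. exact: continuous_subspaceT. Qed.

End unif.

(** * Second-order expansion of one path along a mesh *)

Section path.
Context {R : realType}.
Local Notation mu := (@lebesgue_measure R).
Variables (f f' : R -> R) (K K' : R).
Hypothesis K0 : 0 <= K.
Hypothesis fq : forall y h, `|f (y + h) - f y - h * f' y| <= K * h ^+ 2.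
Hypothesis f'b : forall y, `|f' y| <= K'.
Hypothesis f'l : forall y z, `|f' y - f' z| <= K * `|y - z|.
Variables (lam b g : R -> R) (x c : R).
Hypothesis c0 : 0 <= c.
Hypothesis lc : {within `[0, +oo[, continuous lam}.
Hypothesis bc : {within `[0, +oo[, continuous b}.
Hypothesis gi : forall t, 0 <= t -> mu.-integrable `[0, t] (EFin \o g).
Hypothesis lamE : forall t, 0 <= t -> lam t = x + \int[mu]_(s in `[0, t]) g s + c * b t.

Lemma f'_continuous : continuous f'.
Proof.
move=> y; apply/cvgrPdist_le => e e0; near=> z; apply: (le_trans (f'l _ _)).
have : `|y - z| <= e / (K + 1).
  by near: z; apply: cvgr_dist_le => //; rewrite divr_gt0// ltr_wpDl.
rewrite ler_pdivlMr ?ltr_wpDl// => h; have := normr_ge0 (y - z); nra.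
Unshelve. all: by end_near. Qed.

Lemma fg_integrable (t : R) : 0 <= t ->
  mu.-integrable `[0, t] (EFin \o (fun s => f' (lam s) * g s)).
Proof.
move=> t0; have mA : measurable (`[0, t]%classic : set (measurableTypeR R)).
  exact: measurable_itv.
apply: (integrableMr mA _ _ (gi t0)) => [|]; last first.
  by exists K'; split; [exact: num_real|move=> z Kz s _ /=; apply: (le_trans (f'b _)); exact: ltW].
apply: (@measurableT_comp _ _ _ _ _ _ f').
  by apply: continuous_measurable_fun; exact: f'_continuous.
apply: subspace_continuous_measurable_fun => //.
by apply: continuous_subspaceW lc => s /=; rewrite !in_itv/= => /andP[-> _].
Qed.

Lemma absg_integrable (t : R) : 0 <= t -> mu.-integrable `[0, t] (EFin \o (fun s => `|g s|)).
Proof. by move=> t0; exact: integrable_abse (gi t0). Qed.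

(** A Taylor expansion takes the place of the Ito formula. All terms containing the drift increment
    are at most [om] times the variation of the drift over the step; of the rest there remain the
    linear noise term and the square of the noise increment. *)
Lemma path_step (T om : R) (s t : R) : 0 <= om -> 0 <= s -> s <= t ->
  (forall r, s <= r -> r <= t -> `|lam r - lam s| <= om) -> `|b t - b s| <= om ->
  `|f (lam t) - f (lam s) - itv_int (fun r => f' (lam r) * g r) s t - c * (f' (lam s) * (b t - b
    s))|
  <= (K + 2 * K * (1 + c)) * om * itv_int (fun r => `|g r|) s t + 2 * K * (c ^+ 2 * (b t - b s) ^+
    2).
Proof.
move=> om0 s0 st hlam hb; have t0 := le_trans s0 st.
have gst : lam t - lam s = itv_int g s t + c * (b t - b s).
  by rewrite -(itv_intE gi s0 st) !lamE//; ring.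
set A := itv_int g s t in gst *; set V := itv_int _ s t; set db := b t - b s in hb gst *.
have mA : measurable (`]s, t]%classic : set (measurableTypeR R)) by exact: measurable_itv.
have gst' := integrable_itv gi s0 st.
have ast' := integrable_itv absg_integrable s0 st.
have AV : `|A| <= itv_int (fun r => `|g r|) s t by exact: le_normr_Rintegral.
have Aom : `|A| <= (1 + c) * om.
  rewrite (_ : A = (lam t - lam s) - c * db); last by rewrite gst; ring.
  rewrite [leRHS]mulrDl mul1r (le_trans (ler_normB _ _))// lerD ?hlam//.
  by rewrite normrM (ger0_norm c0) ler_wpM2l.
have D1 : `|V - f' (lam s) * A| <= K * om * itv_int (fun r => `|g r|) s t.
  rewrite /V /A /itv_int -[X in `|_ - X|]RintegralZl// -[leRHS]RintegralZl//.
  have k0 : 0 <= K * om by rewrite mulr_ge0.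
  apply: Rintegral_dist => //.
  - exact: (integrable_itv fg_integrable s0 st).
  - exact: (@integrableZl _ _ _ mu _ mA (f' (lam s)) _ gst').
  - exact: (@integrableZl _ _ _ mu _ mA (K * om) _ ast').
  - by move=> r _; rewrite mulr_ge0.
  - apply: aeW => r /=; rewrite in_itv/= => /andP[sr rt].
    rewrite -mulrBl normrM ler_wpM2r//; apply: (le_trans (f'l _ _)).
    by rewrite ler_wpM2l// hlam// ltW.
have D2 := fq (lam s) (lam t - lam s).
rewrite (addrC (lam s)) subrK gst in D2.
have D3 : K * (A + c * db) ^+ 2 <= 2 * K * (1 + c) * om * itv_int (fun r => `|g r|) s t
    + 2 * K * (c ^+ 2 * db ^+ 2).
  have h1 : (A + c * db) ^+ 2 <= 2 * A ^+ 2 + 2 * (c ^+ 2 * db ^+ 2).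
    by have := sqr_ge0 (A - c * db); nra.
  have h2 : A ^+ 2 <= (1 + c) * om * itv_int (fun r => `|g r|) s t.
    by rewrite -[leLHS]real_normK ?num_real// expr2 ler_pM.
  have := ler_wpM2l K0 h1; have := ler_wpM2l K0 h2; lra.
rewrite (_ : _ - _ - _ - _ = (f (lam t) - f (lam s) - (A + c * db) * f' (lam s))
   - (V - f' (lam s) * A)); last by ring.
apply: (le_trans (ler_normB _ _)).
have := lerD (le_trans D2 D3) D1; lra.
Qed.

Definition mesh (T : R) n k : R := T * (k%:R / n%:R).

Definition noise_sum T n k := \sum_(l < k) f' (lam (mesh T n l)) * (b (mesh T n l.+1) - b (mesh T
  n l)).
Definition quad_var T n := \sum_(l < n) (b (mesh T n l.+1) - b (mesh T n l)) ^+ 2.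

Lemma mesh_ge0 T n k : 0 <= T -> 0 <= mesh T n k.
Proof. by move=> T0; rewrite /mesh mulr_ge0// divr_ge0. Qed.

Lemma mesh_le T n k : 0 <= T -> (k <= n)%N -> mesh T n k <= T.
Proof.
move=> T0; rewrite /mesh; case: n => [|n] kn; first by rewrite invr0 !mulr0.
by rewrite ler_piMr// ler_pdivrMr ?ltr0n// mul1r ler_nat.
Qed.

Lemma meshS T n k : mesh T n k.+1 = mesh T n k + T / n%:R.
Proof. by rewrite /mesh -natr1; ring. Qed.

(** The steps telescope up to the mesh point [k], and the noise term of the last, incomplete step is
    at most [c * K' * om]. Apart from the quadratic variation, the whole error carries a factor
    [om], which vanishes as the mesh is refined. *)
Lemma path_mesh (T om dl t : R) n k : 0 <= T -> 0 <= om ->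
  (forall s t, 0 <= s <= T -> 0 <= t <= T -> `|t - s| <= dl -> `|lam t - lam s| <= om) ->
  (forall s t, 0 <= s <= T -> 0 <= t <= T -> `|t - s| <= dl -> `|b t - b s| <= om) ->
  T / n%:R <= dl -> (k <= n)%N -> mesh T n k <= t -> t - mesh T n k <= dl -> t <= T ->
  `|f (lam t) - f (lam 0) - \int[mu]_(r in `[0, t]) (f' (lam r) * g r) - c * noise_sum T n k| <=
  ((K + 2 * K * (1 + c)) * \int[mu]_(r in `[0, T]) `|g r| + c * K' + 2 * K * c ^+ 2 * om) * om
  + 2 * K * (c ^+ 2 * quad_var T n).
Proof.
pose Q T n k := \sum_(l < k) c ^+ 2 * (b (mesh T n l.+1) - b (mesh T n l)) ^+ 2.
have -> : c ^+ 2 * quad_var T n = Q T n n by rewrite /Q -mulr_sumr.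
move=> T0 om0 hl hb Tn kn kt tk tT.
have step s u : 0 <= s -> s <= u -> u <= T -> u - s <= dl ->
  `|f (lam u) - f (lam s) - itv_int (fun r => f' (lam r) * g r) s u - c * (f' (lam s) * (b u - b
    s))|
  <= (K + 2 * K * (1 + c)) * om * itv_int (fun r => `|g r|) s u + 2 * K * (c ^+ 2 * (b u - b s) ^+
    2).
  move=> s0 su uT us; have sT : 0 <= s <= T by rewrite s0 (le_trans su).
  apply: path_step => // [r sr ru|].
    apply: hl => //; first by apply/andP; split; lra.
    by rewrite ger0_norm ?subr_ge0//; lra.
  apply: hb => //; first by apply/andP; split; lra.
  by rewrite ger0_norm ?subr_ge0.
have P : forall l, (l <= n)%N -> `|f (lam (mesh T n l)) - f (lam 0) -
    \int[mu]_(r in `[0, mesh T n l]) (f' (lam r) * g r) - c * noise_sum T n l| <=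
    (K + 2 * K * (1 + c)) * om * \int[mu]_(r in `[0, mesh T n l]) `|g r| + 2 * K * Q T n l.
  elim=> [|l IH] ln.
    rewrite /mesh mul0r mulr0 /noise_sum /Q !big_ord0 !mulr0 set_itv1 !Rintegral_set1.
    by rewrite subrr !subr0 normr0 mulr0 addr0.
  have s0 := @mesh_ge0 T n l T0; have uT := mesh_le T0 ln.
  have su : mesh T n l <= mesh T n l.+1 by rewrite meshS lerDl divr_ge0.
  have us : mesh T n l.+1 - mesh T n l <= dl by rewrite meshS addrAC subrr add0r.
  have := step _ _ s0 su uT us; have := IH (ltnW ln).
  rewrite -(itv_intE fg_integrable s0 su) -(itv_intE absg_integrable s0 su).
  rewrite /noise_sum /Q !big_ord_recr/= -/(noise_sum T n l) -/(Q T n l) => h1 h2.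
  apply: le_trans (le_trans (lerD h1 h2) _); last by lra.
  by apply: le_trans (ler_normD _ _); rewrite le_eqVlt; apply/orP; left; apply/eqP; congr (`|_|);
    ring.
have s0 := @mesh_ge0 T n k T0.
have h1 := P k kn; have h2 := step _ _ s0 kt tT tk.
have t0 := le_trans s0 kt.
move: h2; rewrite -(itv_intE fg_integrable s0 kt) -(itv_intE absg_integrable s0 kt) => h2.
have gT : \int[mu]_(r in `[0, t]) `|g r| <= \int[mu]_(r in `[0, T]) `|g r|.
  rewrite -subr_ge0 (itv_intE absg_integrable t0 tT); exact: Rintegral_ge0.
have QT : Q T n k <= Q T n n.
  rewrite /Q (big_ord_widen n (fun l => c ^+ 2 * (b (mesh T n l.+1) - b (mesh T n l)) ^+ 2) kn).
  rewrite big_mkcond /=; apply: ler_sum => l _; case: ifP => // _.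
  by rewrite mulr_ge0// sqr_ge0.
have bom : `|b t - b (mesh T n k)| <= om.
  apply: hb; rewrite ?s0 ?t0 ?mesh_le//.
  by rewrite ger0_norm ?subr_ge0.
have bom2 : (b t - b (mesh T n k)) ^+ 2 <= om ^+ 2.
  by rewrite -[leLHS]real_normK ?num_real// ler_sqr ?nnegrE.
have h3 : `|c * (f' (lam (mesh T n k)) * (b t - b (mesh T n k)))| <= c * (K' * om).
  by rewrite !normrM (ger0_norm c0); apply: ler_wpM2l => //; apply: ler_pM.
have k1 : 0 <= (K + 2 * K * (1 + c)) * om by rewrite mulr_ge0// addr_ge0// !mulr_ge0// addr_ge0.
have k2 : 0 <= 2 * K * c ^+ 2 by rewrite !mulr_ge0.
have k3 : 0 <= 2 * K by rewrite mulr_ge0.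
have a1 := ler_wpM2l k1 gT; have a2 := ler_wpM2l k2 bom2; have a3 := ler_wpM2l k3 QT.
rewrite (_ : _ - _ - _ - _ = (f (lam (mesh T n k)) - f (lam 0) -
    \int[mu]_(r in `[0, mesh T n k]) (f' (lam r) * g r) - c * noise_sum T n k) +
   (f (lam t) - f (lam (mesh T n k)) -
       (\int[mu]_(r in `[0, t]) (f' (lam r) * g r) -
        \int[mu]_(r in `[0, mesh T n k]) (f' (lam r) * g r)) -
       c * (f' (lam (mesh T n k)) * (b t - b (mesh T n k)))) +
   c * (f' (lam (mesh T n k)) * (b t - b (mesh T n k)))); last by ring.
apply: (le_trans (ler_normD _ _)); apply: le_trans (lerD (ler_normD _ _) (lexx _)) _.
apply: (le_trans (lerD (lerD h1 h2) h3)).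
clear h1 h2 h3 P step bom bom2 gT QT hl hb k1 k2 k3 s0 t0.
lra.
Qed.

End path.

Section average.
Context {R : realType}.
Local Notation mu := (@lebesgue_measure R).
Variables (f f' : R -> R) (K K' : R).
Hypotheses (K0 : 0 <= K) (K'0 : 0 <= K').
Hypothesis fq : forall y h, `|f (y + h) - f y - h * f' y| <= K * h ^+ 2.
Hypothesis f'b : forall y, `|f' y| <= K'.
Hypothesis f'l : forall y z, `|f' y - f' z| <= K * `|y - z|.
Variables (N : nat) (lam b g : 'I_N -> R -> R) (x : 'I_N -> R) (c : R).
Hypothesis c0 : 0 <= c.
Hypothesis lc : forall i, {within `[0, +oo[, continuous (lam i)}.
Hypothesis bc : forall i, {within `[0, +oo[, continuous (b i)}.
Hypothesis gi : forall i t, 0 <= t -> mu.-integrable `[0, t] (EFin \o g i).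
Hypothesis lamE : forall i t, 0 <= t ->
  lam i t = x i + \int[mu]_(s in `[0, t]) g i s + c * b i t.

Let mean (u : 'I_N -> R) := N%:R^-1 * \sum_(i < N) u i.

Let meanD u v : mean (fun i => u i + v i) = mean u + mean v.
Proof. by rewrite /mean big_split mulrDr. Qed.

Let meanZ a u : mean (fun i => a * u i) = a * mean u.
Proof. by rewrite /mean -mulr_sumr mulrCA. Qed.

Let mean_le u v : (forall i, u i <= v i) -> mean u <= mean v.
Proof. by move=> uv; rewrite /mean ler_wpM2l ?invr_ge0// ler_sum. Qed.

Let mean_norm u : `|mean u| <= mean (fun i => `|u i|).
Proof.
rewrite /mean normrM ger0_norm ?invr_ge0//; apply: ler_wpM2l; rewrite ?invr_ge0//.
exact: ler_norm_sum.
Qed.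

Lemma unif_seq (h : 'I_N -> R -> R) (T e : R) : (forall i, {within `[0, +oo[, continuous (h i)}) ->
  0 < e -> exists2 dl, 0 < dl & forall i s t, 0 <= s <= T -> 0 <= t <= T ->
   `|t - s| <= dl -> `|h i t - h i s| <= e.
Proof.
move=> hc e0; have /choice[dl hd] : forall i, exists dl, 0 < dl /\ forall s t, 0 <= s <= T ->
    0 <= t <= T -> `|t - s| <= dl -> `|h i t - h i s| <= e.
  by move=> i; have [dl d0 hd] := unif_within T (hc i) e0; exists dl.
exists (\big[Num.min/1]_(i < N) dl i).
  by apply/bigmin_gtP; split => // i _; have [] := hd i.
move=> i s t hs ht hst; have [_] := hd i; apply => //.
by apply: (le_trans hst); exact: bigmin_le_cond.
Qed.

(** The moduli of continuity depend on the paths, so the mesh is chosen after them. It is therefore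
    enough that arbitrarily fine meshes satisfy the noise bounds, with an [eps] that does not depend
    on the mesh; [2 * K] accounts for the quadratic variation and 1 for the noise sum. *)
Lemma mean_path (T eps : R) : 0 < T -> 0 < eps ->
  (forall n0, exists2 n, (n0 <= n)%N &
    c ^+ 2 * mean (fun i => quad_var (b i) T n) <= eps /\
    forall k, (k <= n)%N -> c * `|mean (fun i => noise_sum f' (lam i) (b i) T n k)| <= eps) ->
  forall t, 0 <= t <= T -> `|mean (fun i => f (lam i t)) - mean (fun i => f (lam i 0)) -
    mean (fun i => \int[mu]_(s in `[0, t]) (f' (lam i s) * g i s))| <= (2 * K + 1) * eps.
Proof.
move=> T0 eps0 H t /andP[t0 tT]; apply/ler_addgt0Pr => e e0.
pose V := mean (fun i => (K + 2 * K * (1 + c)) * \int[mu]_(r in `[0, T]) `|g i r| + c * K'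
  + 2 * K * c ^+ 2).
have V0 : 0 <= V.
  rewrite /V /mean mulr_ge0 ?invr_ge0// sumr_ge0// => i _.
  rewrite !addr_ge0 ?mulr_ge0// ?Rintegral_ge0// ?addr_ge0// ?mulr_ge0// ?addr_ge0//.
pose om := Num.min 1 (e / (V + 1)).
have om0 : 0 < om by rewrite lt_min ltr01/= divr_gt0// ltr_wpDl.
have om1 : om <= 1 by rewrite ge_min lexx.
have omV : om * V <= e.
  have : om <= e / (V + 1) by rewrite ge_min lexx orbT.
  rewrite ler_pdivlMr ?ltr_wpDl// mulrDr mulr1 => h; have := ltW om0; lra.
have [d1 d10 h1] := unif_seq T lc om0; have [d2 d20 h2] := unif_seq T bc om0.
pose dl := Num.min d1 d2; have dl0 : 0 < dl by rewrite lt_min d10.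
have [n nn [hq hm]] := H (Num.truncn (T / dl)).+1.
have n0 : (0 < n)%N by exact: leq_trans nn.
have Tn : T / n%:R <= dl.
  rewrite ler_pdivrMr ?ltr0n// mulrC -ler_pdivrMr//.
  apply: (le_trans (ltW (truncnS_gt _))); by rewrite ler_nat.
pose k := Num.truncn (t * n%:R / T).
have /andP[k1 k2] := @truncn_itv _ (t * n%:R / T) (divr_ge0 (mulr_ge0 t0 (ler0n _ _)) (ltW T0)).
have nR : 0 < n%:R :> R by rewrite ltr0n.
have kn : (k <= n)%N.
  rewrite -(ler_nat R); apply: (le_trans k1); rewrite ler_pdivrMr// mulrC.
  by rewrite ler_wpM2l// ltW.
have kt : mesh T n k <= t.
  move: k1; rewrite -/k ler_pdivlMr// => k1.
  by rewrite /mesh mulrA ler_pdivrMr// mulrC.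
have tk : t - mesh T n k <= dl.
  apply: le_trans Tn; rewrite lerBlDr addrC -meshS /mesh mulrA ler_pdivlMr//.
  by move: k2; rewrite -/k ltr_pdivrMr// mulrC => /ltW; rewrite (mulrC T).
have P i : `|f (lam i t) - f (lam i 0) - \int[mu]_(r in `[0, t]) (f' (lam i r) * g i r)
    - c * noise_sum f' (lam i) (b i) T n k| <=
    om * ((K + 2 * K * (1 + c)) * \int[mu]_(r in `[0, T]) `|g i r| + c * K'
  + 2 * K * c ^+ 2) + 2 * K * (c ^+ 2 * quad_var (b i) T n).
  have hl s u : 0 <= s <= T -> 0 <= u <= T -> `|u - s| <= dl -> `|lam i u - lam i s| <= om.
    by move=> hs hu hsu; apply: h1 => //; apply: (le_trans hsu); rewrite ge_min lexx.
  have hb s u : 0 <= s <= T -> 0 <= u <= T -> `|u - s| <= dl -> `|b i u - b i s| <= om.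
    by move=> hs hu hsu; apply: h2 => //; apply: (le_trans hsu); rewrite ge_min lexx orbT.
  have lci : {within `[0, +oo[, continuous (lam i)} by exact: lc.
  have := @path_mesh R f f' K K' K0 fq f'b f'l (lam i) (b i) (g i) (x i) c c0
     lci (gi i) (lamE i) T om dl t n k (ltW T0) (ltW om0) hl hb Tn kn kt tk tT.
  move/le_trans; apply.
  rewrite lerD2r mulrC ler_wpM2l ?(ltW om0)// lerD2l ler_piMr// !mulr_ge0//.
have := mean_le P; rewrite meanD !meanZ -/V => {}P.
have {}P := le_trans (mean_norm _) P.
have hm' := hm k kn.
rewrite (_ : _ - _ - _ = mean (fun i => f (lam i t) - f (lam i 0) -
    \int[mu]_(r in `[0, t]) (f' (lam i r) * g i r) - c * noise_sum f' (lam i) (b i) T n k) +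
    c * mean (fun i => noise_sum f' (lam i) (b i) T n k)); last first.
  rewrite -meanZ -meanD.
  transitivity (mean (fun i => (f (lam i t) + (- 1) * f (lam i 0)) +
     (- 1) * \int[mu]_(r in `[0, t]) (f' (lam i r) * g i r))).
    by rewrite !meanD !meanZ; ring.
  by congr mean; apply/funext => i; ring.
apply: (le_trans (ler_normD _ _)); rewrite [X in _ + X]normrM (ger0_norm c0).
have k2' : 0 <= 2 * K by rewrite mulr_ge0.
have := ler_wpM2l k2' hq.
clear H; lra.
Qed.

End average.

(** * Moment bounds for the noise *)
Section product.
Context {d} {T : measurableType d} {R : realType} (P : probability T R).
Variables (Y Z : T -> R).
Hypotheses (mY : measurable_fun setT Y) (mZ : measurable_fun setT Z).
Hypothesis ind : forall A B : set R, measurable A -> measurable B ->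
  P (Y @^-1` A `&` Z @^-1` B) = (P (Y @^-1` A) * P (Z @^-1` B))%E.

Let YZ (w : T) : R * R := (Y w, Z w).
Let mYZ : measurable_fun setT YZ.
Proof. exact/measurable_fun_pair. Qed.

Let Y' : {mfun T >-> R} := HB.pack Y (isMeasurableFun.Build _ _ _ _ _ mY).
Let Z' : {mfun T >-> R} := HB.pack Z (isMeasurableFun.Build _ _ _ _ _ mZ).
Let YZ' : {mfun T >-> (R * R)%type} := HB.pack YZ (isMeasurableFun.Build _ _ _ _ _ mYZ).

Let PY : probability R R := distribution P Y'.
Let PZ : probability R R := distribution P Z'.
Let PYZ : probability (R * R)%type R := distribution P YZ'.

Let law_prod X : measurable X -> (PY \x PZ)%E X = PYZ X.
Proof. by apply: product_measure_unique => A B mA mB; exact: ind. Qed.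

(** Independence says that the joint law is the product of the marginal laws ([law_prod]), and
    Fubini's theorem factors the integral. *)
Lemma indep_Rintegral : P.-integrable setT (EFin \o Y) -> P.-integrable setT (EFin \o Z) ->
  P.-integrable setT (EFin \o (fun w => Y w * Z w)) /\
  \int[P]_w (Y w * Z w) = \int[P]_w Y w * \int[P]_w Z w.
Proof.
move=> iY iZ.
have mf : measurable_fun setT (fun z : R * R => (z.1 * z.2)%:E).
  by apply/measurable_EFinP; exact: measurable_funM.
have mid : measurable_fun setT (fun y : R => y%:E) by exact/measurable_EFinP.
have i1 : PY.-integrable setT (fun y : R => y%:E).
  exact: integrable_pushforward.
have i2 : PZ.-integrable setT (fun y : R => y%:E).
  exact: integrable_pushforward.
have ip : (PY \x PZ)%E.-integrable setT (fun z : R * R => (z.1 * z.2)%:E).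
  apply/(integrable12ltyP _ _ mf) => /=.
  under eq_integral => y _.
    under eq_integral do rewrite normrM EFinM.
    rewrite ge0_integralZl//; last by apply: measurableT_comp.
    over.
  rewrite ge0_integralZr//.
  - rewrite lte_mul_pinfty//.
    + exact: integral_ge0.
    + by rewrite ge0_fin_numE//; [case/integrableP : i1|exact: integral_ge0].
    + by case/integrableP : i2.
  - by apply: measurableT_comp.
  - exact: integral_ge0.
have iYZ : PYZ.-integrable setT (fun z : R * R => (z.1 * z.2)%:E).
  case/integrableP : ip => _; rewrite (eq_measure_integral PYZ); last first.
    by move=> A mA _; exact: law_prod.
  by move=> h; apply/integrableP.
have iP : P.-integrable setT (EFin \o (fun w => Y w * Z w)).
  case/integrableP : iYZ => _; rewrite ge0_integral_pushforward//.
    move=> h; apply/integrableP; split => //.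
    by apply/measurable_EFinP; exact: measurable_funM.
  by apply: measurableT_comp.
split => //.
rewrite /Rintegral.
transitivity (fine (\int[PYZ]_z (z.1 * z.2)%:E)).
  by rewrite integral_pushforward.
rewrite (eq_measure_integral (PY \x PZ)%E); last first.
  by move=> A mA _; exact/esym/law_prod.
rewrite -integral12_prod_meas1//= /fubini_F /=.
under eq_integral => y _.
  under eq_integral do rewrite EFinM.
  rewrite integralZl//.
  over.
rewrite /= -(fineK (integrable_fin_num measurableT i2)) integralZr// fineM//.
- by rewrite !integral_pushforward.
- exact: (integrable_fin_num measurableT i1).
Qed.

(** Integrate over the value of [Y] first: the section is then a ball of fixed radius for [Z], of
    probability at most [b] whatever its centre. *)
Lemma indep_small_ball (r b : R) :
  (forall v, (P (Z @^-1` [set x | (`|v - x| <= r)%R]) <= b%:E)%E) ->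
  (P [set w | (`|Y w - Z w| <= r)%R] <= b%:E)%E.
Proof.
move=> H; pose A : set (R * R)%type := [set z | `|z.1 - z.2| <= r].
have mA : measurable A.
  have mf : measurable_fun setT (fun z : R * R => `|z.1 - z.2|).
    by apply: measurableT_comp => //; exact: measurable_funB.
  rewrite (_ : A = setT `&` (fun z : R * R => `|z.1 - z.2|) @^-1` `]-oo, r]%classic).
    by apply: mf => //; exact: measurable_itv.
  by rewrite setTI; apply/seteqP; split => z /=; rewrite in_itv.
have -> : P [set w | (`|Y w - Z w| <= r)%R] = PYZ A by [].
rewrite -law_prod//.
apply: (@le_trans _ _ (\int[PY]_x (cst b%:E) x)%E).
  apply: ge0_le_integral => //; first exact: measurable_fun_xsection.
  move=> x _ /=; apply: le_trans (H x).
  rewrite (_ : xsection A x = [set y | (`|x - y| <= r)%R])//.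
  by apply/seteqP; split => y /=; rewrite /xsection/= inE.
by rewrite integral_cst//= probability_setT mule1.
Qed.

End product.

Section normal.
Context {R : realType}.
Local Notation mu := (@lebesgue_measure R).

(** The Radon-Nikodym derivative of the normal law is determined only almost everywhere; it is
    identified with [normal_pdf] because both have the same integral over every measurable set. *)
Lemma ge0_integral_normal_prob (m s : R) (f : R -> \bar R) :
  (forall x, 0 <= f x)%E -> measurable_fun setT f ->
  (\int[normal_prob m s]_x f x = \int[mu]_x (f x * (normal_pdf m s x)%:E))%E.
Proof.
move=> f0 mf; pose nu : {finite_measure set (measurableTypeR R) -> \bar R} := normal_prob m s.
have dom : nu `<< mu by exact: normal_prob_dominates.
rewrite -(Radon_Nikodym_SigmaFinite.change_of_variables dom)//.
have iN : mu.-integrable setT (fun x => (normal_pdf m s x)%:E).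
  exact: integrable_normal_pdf.
apply: ae_eq_integral => //.
- apply: emeasurable_funM => //.
  by apply: measurable_int; exact: Radon_Nikodym_SigmaFinite.f_integrable.
- by apply: emeasurable_funM => //; case/integrableP : iN.
apply: ae_eqe_mul2l; apply: integral_ae_eq => //.
- exact: Radon_Nikodym_SigmaFinite.f_integrable.
- by case/integrableP : iN.
- by move=> A _ mA; rewrite -Radon_Nikodym_SigmaFinite.f_integral.
Qed.

Lemma normal_prob_sym (s : R) (A : set R) : s != 0 -> measurable A ->
  normal_prob 0 s (-%R @^-1` A) = normal_prob 0 s A.
Proof.
move=> s0 mA; rewrite /normal_prob.
have mpdf : measurable_fun setT (fun x => (normal_pdf 0 s x)%:E).
  by apply/measurable_EFinP; exact: measurable_normal_pdf.
transitivity (\int[pushforward mu (-%R : measurableTypeR R -> measurableTypeR R)]_(x in A)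
    (normal_pdf 0 s x)%:E)%E.
  rewrite ge0_integral_pushforward//.
  - by apply: eq_integral => x _ /=; rewrite /normal_pdf (negbTE s0) /normal_fun !subr0 sqrrN.
  - exact: measurable_funTS.
  - by move=> x _; rewrite lee_fin normal_pdf_ge0.
apply: eq_measure_integral => B mB _.
transitivity (mu ((fun h => 0 - h) @^-1` B)); last exact: lebesgue_measure_reflect.
by rewrite /= /pushforward; congr (mu _); apply/seteqP; split => x /=; rewrite sub0r.
Qed.

Lemma normal_prob_ball (s v r : R) : 0 < s -> 0 <= r ->
  (normal_prob 0 s [set x | (`|v - x| <= r)%R] <= (2 * r / s)%:E)%E.
Proof.
move=> s0 r0; have s1 : s != 0 by rewrite gt_eqF.
rewrite (_ : [set x | _] = `[v - r, v + r]%classic); last first.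
  apply/seteqP; split => x /=; rewrite in_itv/= ler_norml.
    by move=> /andP[? ?]; apply/andP; split; lra.
  by move=> /andP[? ?]; apply/andP; split; lra.
rewrite /normal_prob.
apply: (@le_trans _ _ (\int[mu]_(x in `[(v - r)%R, (v + r)%R]) (normal_peak s)%:E)%E).
  apply: ge0_le_integral => //.
  - by move=> x _; rewrite lee_fin normal_pdf_ge0.
  - by apply/measurable_EFinP; apply: measurable_funTS; exact: measurable_normal_pdf.
  - by move=> x _; rewrite lee_fin normal_pdf_ub.
rewrite integral_cst//= lebesgue_measure_itv/=.
have p1 : normal_peak s <= s^-1.
  rewrite /normal_peak lef_pV2 ?posrE// ?sqrtr_gt0; last first.
    by rewrite mulrn_wgt0// mulr_gt0// ?exprn_gt0// pi_gt0.
  rewrite -[leLHS](ger0_norm (ltW s0)) -sqrtr_sqr ler_sqrt; last first.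
    by apply: mulrn_wge0; apply: mulr_ge0; [exact: sqr_ge0|exact: pi_ge0].
  rewrite -mulrnAr ler_peMr ?sqr_ge0//; have := @pi_ge2 R; lra.
case: ifP => _; last first.
  by rewrite mule0 lee_fin; apply: divr_ge0; [rewrite mulr_ge0|exact: ltW].
rewrite -EFinD -EFinM lee_fin mulrC (_ : v + r - (v - r) = 2 * r); last by ring.
by rewrite ler_wpM2l// mulr_ge0.
Qed.

(** Half of the Gaussian exponent is spent on bounding [g]; the other half is, up to its peak, the
    density of variance [2 * s ^+ 2], whose integral is 1. The ratio of the two peaks is [sqrt 2],
    rounded up to 2. *)
Lemma normal_mom (s c : R) (g : R -> R) : 0 < s -> measurable_fun setT g ->
  (forall x, 0 <= g x) -> (forall x, g x * expR (- (x ^+ 2 / (4 * s ^+ 2))) <= c) ->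
  (\int[normal_prob 0 s]_x (g x)%:E <= (2 * c)%:E)%E.
Proof.
move=> s0 mg g0 gc; have s1 : s != 0 by rewrite gt_eqF.
have c0 : 0 <= c by apply: le_trans (gc 0); rewrite mulr_ge0// expR_ge0.
rewrite ge0_integral_normal_prob//; last exact/measurable_EFinP.
pose s' := s * Num.sqrt 2.
have s'0 : s' != 0 by rewrite mulf_neq0// gt_eqF// sqrtr_gt0.
have mpdf : measurable_fun setT (fun x => (normal_pdf 0 s' x)%:E).
  by apply/measurable_EFinP; exact: measurable_normal_pdf.
have -> : (2 * c)%:E = (\int[mu]_x ((2 * c)%:E * (normal_pdf 0 s' x)%:E))%E.
  rewrite ge0_integralZl// ?lee_fin ?mulr_ge0//; last first.
    by move=> x _; rewrite lee_fin normal_pdf_ge0.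
  by rewrite integral_normal_pdf mule1.
apply: ge0_le_integral => //.
- by move=> x _; rewrite -EFinM lee_fin mulr_ge0// normal_pdf_ge0.
- apply: emeasurable_funM; apply/measurable_EFinP => //; exact: measurable_normal_pdf.
- by apply: emeasurable_funM.
move=> x _; rewrite -!EFinM lee_fin /normal_pdf (negbTE s1) (negbTE s'0) /normal_fun !subr0.
have s'2 : s' ^+ 2 = 2 * s ^+ 2 by rewrite /s' exprMn sqr_sqrtr// mulrC.
have pk : normal_peak s <= 2 * normal_peak s'.
  rewrite /normal_peak s'2 (_ : 2 * s ^+ 2 * pi *+ 2 = 2 * (s ^+ 2 * pi *+ 2)); last by ring.
  have A0 : 0 < s ^+ 2 * pi *+ 2 by rewrite mulrn_wgt0// mulr_gt0 ?pi_gt0// exprn_gt0.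
  set A := s ^+ 2 * pi *+ 2 in A0 *.
  have ab : Num.sqrt (2 * A) <= 2 * Num.sqrt A.
    rewrite -{2}[2]ger0_norm// -sqrtr_sqr -sqrtrM ?sqr_ge0// ler_sqrt; last first.
      by rewrite mulr_ge0 ?sqr_ge0// ltW.
    by rewrite ler_pM2r//; lra.
  have a0 : 0 < Num.sqrt A by rewrite sqrtr_gt0.
  have b0 : 0 < Num.sqrt (2 * A) by rewrite sqrtr_gt0 mulr_gt0.
  by rewrite -[X in X <= _]mul1r ler_pdivrMr// mulrAC ler_pdivlMr// mul1r.
have ex : expR (- x ^+ 2 / (s ^+ 2 *+ 2)) =
    expR (- (x ^+ 2 / (4 * s ^+ 2))) * expR (- x ^+ 2 / (s' ^+ 2 *+ 2)).
  by rewrite -expRD s'2; congr expR; field.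
rewrite ex; set E := expR (- (_ / _)); set F := expR _.
have F0 : 0 <= F by exact: expR_ge0.
have := gc x; rewrite -/E => gE.
have k0 : 0 <= normal_peak s by exact: normal_peak_ge0.
rewrite (_ : g x * _ = normal_peak s * (g x * E) * F); last by ring.
rewrite (_ : 2 * c * _ = 2 * normal_peak s' * c * F); last by ring.
by apply: ler_wpM2r => //; apply: ler_pM => //; rewrite mulr_ge0// expR_ge0.
Qed.

End normal.

Section gaussian.
Context {d} {T : measurableType d} {R : realType} (P : probability T R).
Variables (X : T -> R) (s : R).
Hypotheses (s0 : 0 < s) (mX : measurable_fun setT X).
Hypothesis lawX : forall Y : set R, measurable Y -> P (X @^-1` Y) = normal_prob 0 s Y.

Let X' : {mfun T >-> measurableTypeR R} :=
  HB.pack X (isMeasurableFun.Build _ _ T (measurableTypeR R) X mX).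

Let E_law (g : R -> R) : measurable_fun setT g -> (forall x, 0 <= g x) ->
  (\int[P]_w (g (X w))%:E = \int[normal_prob 0 s]_x (g x)%:E)%E.
Proof.
move=> mg g0; transitivity (\int[distribution P X']_x (g x)%:E)%E.
  rewrite ge0_integral_distribution//; exact/measurable_EFinP.
by apply: eq_measure_integral => A mA _; exact: lawX.
Qed.

Let mXn n : measurable_fun setT (fun w => X w ^+ n).
Proof. exact: measurable_funX. Qed.

Let E4 : (\int[P]_w (X w ^+ 4)%:E <= (128 * s ^+ 4)%:E)%E.
Proof.
rewrite (E_law (g := fun x => x ^+ 4)); [|exact: measurable_funX|by move=> x;
  exact: exprn_even_ge0].
rewrite (_ : 128 * _ = 2 * (64 * s ^+ 4)); last by rewrite mulrA -natrM.
apply: normal_mom => [//| | |].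
- exact: measurable_funX.
- by move=> x; exact: exprn_even_ge0.
(* In terms of [u], the fourth power is [16 * s ^+ 4 * u ^+ 2], and [u ^+ 2 <= 4 * expR u]; this
   gives 64, which [normal_mom] doubles. *)
move=> x; pose u := x ^+ 2 / (4 * s ^+ 2).
have s1 : s != 0 by rewrite gt_eqF.
have -> : x ^+ 4 = 16 * s ^+ 4 * u ^+ 2 by rewrite /u; field.
rewrite -/u expRN ler_pdivrMr ?expR_gt0//.
have u0 : 0 <= u by rewrite divr_ge0 ?sqr_ge0// mulr_ge0// sqr_ge0.
have : (1 + u / 2) <= expR (u / 2) by exact: expR_ge1Dx.
have -> : expR u = expR (u / 2) * expR (u / 2) by rewrite -expRD; congr expR; field.
set e := expR _ => ue; have s4 : 0 <= s ^+ 4 by rewrite exprn_ge0// ltW.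
have : u ^+ 2 <= 4 * (e * e) by nra.
by move=> /(ler_wpM2l s4); lra.
Qed.

Let E2 : (\int[P]_w (X w ^+ 2)%:E <= (8 * s ^+ 2)%:E)%E.
Proof.
rewrite (E_law (g := fun x => x ^+ 2)); [|exact: measurable_funX|by move=> x; exact: sqr_ge0].
rewrite (_ : 8 * _ = 2 * (4 * s ^+ 2)); last by rewrite mulrA -natrM.
apply: normal_mom => [//| | |].
- exact: measurable_funX.
- by move=> x; exact: sqr_ge0.
move=> x; pose u := x ^+ 2 / (4 * s ^+ 2).
have s1 : s != 0 by rewrite gt_eqF.
rewrite [X in X * expR _](_ : _ = 4 * s ^+ 2 * u); last by rewrite /u; field.
rewrite -/u expRN ler_pdivrMr ?expR_gt0//.
have s2 : 0 <= 4 * s ^+ 2 by rewrite mulr_ge0 ?sqr_ge0.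
apply: ler_wpM2l => //; have := @expR_ge1Dx R u; lra.
Qed.

Lemma gauss_integrable n : (n <= 4)%N -> P.-integrable setT (EFin \o (fun w => X w ^+ n)).
Proof.
move=> n4; apply/integrableP; split; first exact/measurable_EFinP.
apply: (@le_lt_trans _ _ (\int[P]_w (1 + (X w ^+ 4)%:E))%E).
  apply: ge0_le_integral => //.
  - by apply/measurable_EFinP; apply: measurableT_comp.
  - by apply: emeasurable_funD => //; exact/measurable_EFinP.
  move=> w _; rewrite /= -EFinD lee_fin normrX.
  have -> : X w ^+ 4 = `|X w| ^+ 4 by rewrite -normrX ger0_norm// exprn_even_ge0.
  have [h|h] := leP `|X w| 1.
    by apply: (@le_trans _ _ 1); [rewrite exprn_ile1|rewrite lerDl exprn_ge0].
  by apply: (@le_trans _ _ (`|X w| ^+ 4)); [apply: ler_weXn2l => //; exact: ltW|rewrite lerDr].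
rewrite ge0_integralD//; last 2 first.
- by move=> w _; rewrite lee_fin exprn_even_ge0.
- exact/measurable_EFinP.
rewrite (_ : (\int[P]__ 1 = 1)%E); last by rewrite integral_cst//= mul1e probability_setT.
rewrite lte_add_pinfty ?ltry//.
by apply: (le_lt_trans E4); rewrite ltry.
Qed.

Let E_odd n : odd n -> (n <= 4)%N -> \int[P]_w (X w ^+ n) = 0.
Proof.
move=> on n4.
have mn : measurable_fun setT (fun x : R => (x ^+ n)%:E).
  by apply/measurable_EFinP; exact: measurable_funX.
have mN : measurable_fun setT (fun w => - X w) by exact: measurableT_comp.
pose N' : {mfun T >-> measurableTypeR R} :=
  HB.pack (fun w => - X w) (isMeasurableFun.Build _ _ T (measurableTypeR R) _ mN).
have iN : P.-integrable setT (EFin \o (fun w => (- X w) ^+ n)).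
  rewrite (_ : (fun w => _) = (fun w => - (X w ^+ n))).
    exact: (integrableN (gauss_integrable n4)).
  by apply/funext => w; rewrite exprNn -signr_odd on expr1 mulN1r.
have : (\int[P]_w (X w ^+ n)%:E = \int[P]_w ((- X w) ^+ n)%:E)%E.
  transitivity (\int[distribution P X']_x (x ^+ n)%:E)%E.
    by rewrite integral_distribution//; exact: gauss_integrable.
  transitivity (\int[distribution P N']_x (x ^+ n)%:E)%E; last first.
    by rewrite integral_distribution.
  apply: eq_measure_integral => A mA _.
  rewrite [RHS](_ : _ = P (X @^-1` (-%R @^-1` A)))//.
  rewrite lawX; last by rewrite -[_ @^-1` _]setTI; exact: oppr_measurable.
  by rewrite [LHS](_ : _ = P (X @^-1` A))// lawX// normal_prob_sym// gt_eqF.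
move=> E; have : \int[P]_w (X w ^+ n) = \int[P]_w ((- X w) ^+ n) by rewrite /Rintegral E.
have -> : \int[P]_w ((- X w) ^+ n) = \int[P]_w (- 1 * X w ^+ n).
  by apply: eq_Rintegral => w _; rewrite exprNn -signr_odd on expr1.
rewrite RintegralZl//; last exact: gauss_integrable.
lra.
Qed.

Lemma gauss_moments : [/\ \int[P]_w X w = 0, \int[P]_w (X w ^+ 2) <= 8 * s ^+ 2,
  \int[P]_w (X w ^+ 3) = 0 & \int[P]_w (X w ^+ 4) <= 128 * s ^+ 4].
Proof.
split; [exact: (@E_odd 1)| |exact: E_odd|].
- rewrite -lee_fin /Rintegral fineK; first exact: E2.
  exact: (integrable_fin_num measurableT (gauss_integrable (n := 2) isT)).
- rewrite -lee_fin /Rintegral fineK; first exact: E4.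
  exact: (integrable_fin_num measurableT (gauss_integrable (n := 4) isT)).
Qed.

End gaussian.

Section rv.
Context {d} {T : measurableType d} {R : realType} (P : probability T R).

Lemma le_integrable_fun (f g : T -> R) : measurable_fun setT f ->
  P.-integrable setT (EFin \o g) -> (forall w, `|f w| <= g w) ->
  P.-integrable setT (EFin \o f).
Proof.
move=> mf itv_int fg; apply: (le_integrable measurableT _ _ itv_int).
- exact/measurable_EFinP.
- by move=> w _; rewrite /= lee_fin; apply: le_trans (ler_norm _).
Qed.

Lemma integrable_cstP (c : R) : P.-integrable setT (EFin \o (fun=> c)).
Proof.
apply: (@measurable_bounded_integrable _ _ _ P (fun=> c)) => //.
- by rewrite /= probability_setT ltry.
- by exists `|c|; split => // x cx y _ /=; exact: ltW.
Qed.

Lemma integrableD_fun (f g : T -> R) : P.-integrable setT (EFin \o f) ->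
  P.-integrable setT (EFin \o g) -> P.-integrable setT (EFin \o (fun w => f w + g w)).
Proof. by move=> fi gi; exact: (@integrableD _ _ _ P _ measurableT _ _ fi gi). Qed.

Lemma integrableZ_fun (a : R) (f : T -> R) : P.-integrable setT (EFin \o f) ->
  P.-integrable setT (EFin \o (fun w => a * f w)).
Proof. by move=> fi; exact: (@integrableZl _ _ _ P _ measurableT a _ fi). Qed.

Lemma Rintegral_cstP (c : R) : \int[P]_w c = c.
Proof. by rewrite Rintegral_cst//= probability_setT mulr1. Qed.

Lemma markov_real (Y : T -> R) (a c : R) : P.-integrable setT (EFin \o Y) -> 0 < a ->
  (forall w, 0 <= Y w) -> \int[P]_w Y w <= c -> (P [set w | (a < Y w)%R] <= (c / a)%:E)%E.
Proof.
move=> iY a0 Y0 Yc; have mY : measurable_fun setT Y.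
  by apply/measurable_EFinP; case/integrableP : iY.
have mA : measurable [set w | a < Y w].
  rewrite (_ : [set w | _] = setT `&` Y @^-1` `]a, +oo[%classic).
    by apply: mY => //; exact: measurable_itv.
  by rewrite setTI; apply/seteqP; split => w /=; rewrite in_itv/= andbT.
have fin : P [set w | a < Y w] \is a fin_num by exact: fin_num_measure.
rewrite -(fineK fin) lee_fin ler_pdivlMr// mulrC; apply: le_trans Yc.
have -> : a * fine (P [set w | a < Y w]) = \int[P]_(w in [set w | a < Y w]) a.
  by rewrite Rintegral_cst.
have iYA : P.-integrable [set w | a < Y w] (EFin \o Y) by exact: integrableS iY.
apply: (@le_trans _ _ (\int[P]_(w in [set w | a < Y w]) Y w)).
  apply: le_Rintegral => // [|w /ltW//].
  exact: integrableS (integrable_cstP a).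
rewrite /Rintegral fine_le//.
- exact: (integrable_fin_num mA iYA).
- exact: (integrable_fin_num measurableT iY).
- apply: ge0_subset_integral => //; first exact/measurable_EFinP.
  by move=> w _; rewrite lee_fin.
Qed.

End rv.

(** * Adapted functions and discrete stochastic integrals *)

Section filtration.
Context {d} {T : measurableType d} {R : realType} (P : probability T R).
Variable Fil : R -> set (set T).
Hypothesis HF : standard_filtration P Fil.

Definition adapted_fun t (Y : T -> R) := forall A : set R, measurable A -> Fil t (Y @^-1` A).

(** Reads adaptedness as measurability for the sigma-algebra [Fil t], so that the closure properties
    of measurable functions become available. *)
Lemma adapted_funP t Y : 0 <= t -> adapted_fun t Y <->
  measurable_fun setT (Y : g_sigma_algebraType (Fil t) -> R).
Proof.
move=> t0; have [h _ _ _] := HF; have [sa _] := h t t0.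
have E : <<s Fil t >> = Fil t by exact: sigma_algebra_id.
split => [mY _ A mA|mY A mA].
  by rewrite setTI /measurable/= E; exact: mY.
have := mY measurableT A mA.
by rewrite setTI /measurable/= E.
Qed.

Lemma adapted_fun_measurable t Y : 0 <= t -> adapted_fun t Y -> measurable_fun setT Y.
Proof.
move=> t0 mY _ A mA; rewrite setTI; have [h _ _ _] := HF; have [_ sub] := h t t0.
by apply: sub; exact: mY.
Qed.

Lemma adapted_fun_mono s t Y : 0 <= s -> s <= t -> adapted_fun s Y -> adapted_fun t Y.
Proof. by move=> s0 st mY A mA; have [_ h _ _] := HF; apply: (h s t s0 st); exact: mY. Qed.

Lemma adapted_fun_comp t Y (g : R -> R) : measurable_fun setT g -> adapted_fun t Y -> adapted_fun
  t (g \o Y).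
Proof. by move=> mg mY A mA; rewrite comp_preimage; apply: mY; rewrite -[_ @^-1` _]setTI;
  exact: mg. Qed.

Lemma adapted_fun_cst t c : 0 <= t -> adapted_fun t (fun=> c).
Proof. by move=> t0; apply/adapted_funP. Qed.

Lemma adapted_funD t Y Z : 0 <= t -> adapted_fun t Y -> adapted_fun t Z -> adapted_fun t (fun w =>
  Y w + Z w).
Proof. by move=> t0 /(adapted_funP _ t0) mY /(adapted_funP _ t0) mZ; apply/adapted_funP => //;
  exact: measurable_funD. Qed.

Lemma adapted_funB t Y Z : 0 <= t -> adapted_fun t Y -> adapted_fun t Z -> adapted_fun t (fun w =>
  Y w - Z w).
Proof. by move=> t0 /(adapted_funP _ t0) mY /(adapted_funP _ t0) mZ; apply/adapted_funP => //;
  exact: measurable_funB. Qed.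

Lemma adapted_funM t Y Z : 0 <= t -> adapted_fun t Y -> adapted_fun t Z -> adapted_fun t (fun w =>
  Y w * Z w).
Proof. by move=> t0 /(adapted_funP _ t0) mY /(adapted_funP _ t0) mZ; apply/adapted_funP => //;
  exact: measurable_funM. Qed.

Lemma adapted_funX t Y n : 0 <= t -> adapted_fun t Y -> adapted_fun t (fun w => Y w ^+ n).
Proof. by move=> t0 /(adapted_funP _ t0) mY; apply/adapted_funP => //; exact: measurable_funX. Qed.

Lemma adapted_fun_sum t (I : Type) (r : seq I) (Q : pred I) (Y : I -> T -> R) : 0 <= t ->
  (forall i, Q i -> adapted_fun t (Y i)) -> adapted_fun t (fun w => \sum_(i <- r | Q i) Y i w).
Proof.
move=> t0 mY; elim: r => [|i r IH].
  rewrite (_ : (fun w => _) = fun=> 0); first exact: adapted_fun_cst.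
  by apply/funext => w; rewrite big_nil.
case Qi : (Q i); last first.
  rewrite (_ : (fun w => _) = fun w => \sum_(j <- r | Q j) Y j w)//.
  by apply/funext => w; rewrite big_cons Qi.
rewrite (_ : (fun w => _) = fun w => Y i w + \sum_(j <- r | Q j) Y j w).
  by apply: adapted_funD => //; exact: mY.
by apply/funext => w; rewrite big_cons Qi.
Qed.

Section brownian.
Variable B : R -> T -> R.
Hypothesis HB : brownian_motion P Fil B.

Lemma adapted_increment s t u : 0 <= s -> s <= t -> t <= u -> adapted_fun u (increment B s t).
Proof.
have [aB _ _ _ _] := HB; move=> s0 st tu; have t0 := le_trans s0 st.
apply: adapted_funB; first exact: le_trans tu.
- by apply: (adapted_fun_mono t0 tu); exact: aB.
- by apply: (adapted_fun_mono s0 (le_trans st tu)); exact: aB.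
Qed.

Lemma increment_moments s t : 0 <= s -> s < t ->
 (forall n, (n <= 4)%N -> P.-integrable setT (EFin \o (fun w => increment B s t w ^+ n))) /\
  [/\ \int[P]_w increment B s t w = 0, \int[P]_w (increment B s t w ^+ 2) <= 8 * (t - s),
  \int[P]_w (increment B s t w ^+ 3) = 0 & \int[P]_w (increment B s t w ^+ 4) <= 128 * (t - s) ^+
    2].
Proof.
move=> s0 st; have [_ _ _ law _] := HB; have ts : 0 < t - s by rewrite subr_gt0.
have mX : measurable_fun setT (increment B s t).
  have t0 := le_trans s0 (ltW st).
  by apply: (adapted_fun_measurable t0); exact: (adapted_increment s0 (ltW st)).
have q0 : 0 < Num.sqrt (t - s) by rewrite sqrtr_gt0.
split; first by move=> n n4; exact: (gauss_integrable q0 mX (law s t s0 st) n4).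
have := gauss_moments q0 mX (law s t s0 st).
by rewrite (exprM _ 2 2) sqr_sqrtr// ltW.
Qed.

Lemma increment_indep s t n Y : 0 <= s -> s < t -> (n <= 4)%N -> adapted_fun s Y ->
  P.-integrable setT (EFin \o Y) ->
  P.-integrable setT (EFin \o (fun w => Y w * increment B s t w ^+ n)) /\
  \int[P]_w (Y w * increment B s t w ^+ n) = \int[P]_w Y w * \int[P]_w (increment B s t w ^+ n).
Proof.
move=> s0 st n4 mY iY; have [_ _ _ _ ind] := HB.
have t0 := le_trans s0 (ltW st).
have mX : measurable_fun setT (increment B s t).
  by apply: (adapted_fun_measurable t0); exact: (adapted_increment s0 (ltW st)).
have [iX _] := increment_moments s0 st.
apply: indep_Rintegral => //; last exact: iX.
- exact: (adapted_fun_measurable s0).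
- exact: measurable_funX.
move=> A C mA mC.
have mg : measurable_fun setT (fun x : R => x ^+ n) by exact: measurable_funX.
have -> : (fun w => increment B s t w ^+ n) @^-1` C = increment B s t @^-1` ((fun x => x ^+ n)
  @^-1` C) by [].
apply: ind => //; first exact: mY.
by rewrite -[X in measurable X]setTI; exact: mg.
Qed.

Section transform.
Variables (u : nat -> R) (h K : R) (c : nat -> T -> R).
Hypotheses (u0 : forall k, 0 <= u k) (h0 : 0 < h) (uS : forall k, u k.+1 = u k + h).
Hypotheses (K0 : 0 <= K) (cm : forall k, adapted_fun (u k) (c k)) (cK : forall k w, `|c k w| <= K).

(** The discrete stochastic integral of the predictable integrand [c], a martingale transform. *)
Definition mtransform k w := \sum_(l < k) c l w * increment B (u l) (u l.+1) w.

Let u_mono k l : (k <= l)%N -> u k <= u l.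
Proof.
elim: l => [|l IH]; first by rewrite leqn0 => /eqP->.
by rewrite leq_eqVlt => /predU1P[->//|]; rewrite ltnS => /IH h1;
  rewrite uS (le_trans h1)// lerDl ltW.
Qed.

Lemma adapted_mtransform k : adapted_fun (u k) (mtransform k).
Proof.
apply: adapted_fun_sum => // i _; apply: adapted_funM => //.
  by apply: (adapted_fun_mono _ _ (cm i)) => //; exact: u_mono (ltnW (ltn_ord i)).
by apply: adapted_increment => //; apply: u_mono => //; exact: ltn_ord.
Qed.

(** In the expansion of the powers of [S + c * X], the increment [X] is independent of the past and
    its odd moments vanish. The fourth moment then grows by at most
    [(384 * k + 128) * K ^+ 4 * h ^+ 2] at step [k], where 384 is [6 * 8 * 8]; the increments of
    [192 * k ^+ 2] dominate this. *)
Lemma mtransform_moments k : [/\ P.-integrable setT (EFin \o (fun w => mtransform k w ^+ 4)),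
  \int[P]_w (mtransform k w ^+ 2) <= 8 * K ^+ 2 * h * k%:R &
  \int[P]_w (mtransform k w ^+ 4) <= 192 * K ^+ 4 * h ^+ 2 * k%:R ^+ 2].
Proof.
elim: k => [|k [iS S2 S4]].
  have E n : (fun w => mtransform 0 w ^+ n.+1) = fun=> 0.
    by apply/funext => w; rewrite /mtransform big_ord0 expr0n.
  rewrite (E 3%N) (E 1%N) !Rintegral_cstP expr0n/= !mulr0; split => //.
  exact: integrable_cstP.
set X := increment B (u k) (u k.+1); set S := mtransform k in iS S2 S4.
have kk : u k < u k.+1 by rewrite uS ltrDl.
have mS : measurable_fun setT S by apply: (adapted_fun_measurable (u0 k));
  exact: adapted_mtransform.
have mc : measurable_fun setT (c k) by exact: (adapted_fun_measurable (u0 k)).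
have [iX [X1 X2 X3 X4]] := increment_moments (u0 k) kk.
have uh : u k.+1 - u k = h by rewrite uS addrAC subrr add0r.
rewrite uh -/X in X2; rewrite uh -/X in X4.
have i14 : P.-integrable setT (EFin \o (fun w => 1 + S w ^+ 4)).
  by apply: integrableD_fun => //; exact: integrable_cstP.
have iSc j m : (j <= 4)%N -> P.-integrable setT (EFin \o (fun w => S w ^+ j * c k w ^+ m)).
  move=> j4; apply: (@le_integrable_fun _ _ _ _ _ (fun w => K ^+ m * (1 + S w ^+ 4))).
  - by apply: measurable_funM; exact: measurable_funX.
  - exact: integrableZ_fun.
  - move=> w; rewrite normrM !normrX mulrC; apply: ler_pM; rewrite ?exprn_ge0//.
      by apply: lerXn2r; rewrite ?nnegrE.
    have -> : S w ^+ 4 = `|S w| ^+ 4 by rewrite -normrX ger0_norm// exprn_even_ge0.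
    have [h1|h1] := leP `|S w| 1.
      by apply: (@le_trans _ _ 1); [rewrite exprn_ile1|rewrite lerDl exprn_ge0].
    by apply: (@le_trans _ _ (`|S w| ^+ 4)); [apply: ler_weXn2l => //; exact: ltW|rewrite lerDr].
have ScX j m n : (j <= 4)%N -> (n <= 4)%N ->
    P.-integrable setT (EFin \o (fun w => S w ^+ j * c k w ^+ m * X w ^+ n)) /\
    \int[P]_w (S w ^+ j * c k w ^+ m * X w ^+ n) =
    \int[P]_w (S w ^+ j * c k w ^+ m) * \int[P]_w (X w ^+ n).
  move=> j4 n4; apply: increment_indep => //; last exact: iSc.
  by apply: adapted_funM => //; apply: adapted_funX => //; exact: adapted_mtransform.
have [i22 e22] := @ScX 2 2 2 isT isT; have [i11 e11] := @ScX 1 1 1 isT isT.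
have [i02 e02] := @ScX 0 2 2 isT isT; have [i04 e04] := @ScX 0 4 4 isT isT.
have [i31 e31] := @ScX 3 1 1 isT isT; have [i13 e13] := @ScX 1 3 3 isT isT.
have X0n n : 0 <= \int[P]_w (X w ^+ n.*2).
  by apply: Rintegral_ge0 => w _; rewrite exprn_even_ge0// odd_double.
have cb m : `|\int[P]_w (S w ^+ 0 * c k w ^+ m)| <= K ^+ m.
  rewrite -[leRHS](Rintegral_cstP P); apply: (le_trans (le_normr_Rintegral measurableT (iSc 0 m
    isT))).
  apply: le_Rintegral => //; first exact: integrable_abse (iSc 0 m isT).
    exact: integrable_cstP.
  by move=> w _; rewrite expr0 mul1r normrX; apply: lerXn2r; rewrite ?nnegrE.
have i2 : P.-integrable setT (EFin \o (fun w => S w ^+ 2)).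
  by have := iSc 2 0 isT; under eq_fun do rewrite expr0 mulr1.
have cS : \int[P]_w (S w ^+ 2 * c k w ^+ 2) <= K ^+ 2 * \int[P]_w (S w ^+ 2).
  rewrite -RintegralZl//; apply: le_Rintegral => //; first exact: iSc.
    exact: integrableZ_fun.
  move=> w _; rewrite mulrC; apply: ler_wpM2r; first exact: sqr_ge0.
  by rewrite -[leLHS]real_normK ?num_real//; apply: lerXn2r; rewrite ?nnegrE.
have E2 : (fun w => mtransform k.+1 w ^+ 2) = fun w => S w ^+ 2 + 2 * (S w ^+ 1 * c k w ^+ 1 * X w
  ^+ 1)
    + S w ^+ 0 * c k w ^+ 2 * X w ^+ 2.
  by apply/funext => w; rewrite /mtransform big_ord_recr/= -/(mtransform k w) -/S -/X; ring.
have E4 : (fun w => mtransform k.+1 w ^+ 4) = fun w => S w ^+ 4 + 4 * (S w ^+ 3 * c k w ^+ 1 * X w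
  ^+ 1)
    + 6 * (S w ^+ 2 * c k w ^+ 2 * X w ^+ 2) + 4 * (S w ^+ 1 * c k w ^+ 3 * X w ^+ 3)
    + S w ^+ 0 * c k w ^+ 4 * X w ^+ 4.
  by apply/funext => w; rewrite /mtransform big_ord_recr/= -/(mtransform k w) -/S -/X; ring.
have X1' : \int[P]_w (X w ^+ 1) = 0 by [].
split.
- by rewrite E4; do !apply: integrableD_fun => //; apply: integrableZ_fun.
- rewrite E2 !RintegralD//; do ?[apply: integrableD_fun => //]; do ?[exact: integrableZ_fun].
  rewrite RintegralZl// e11 e02 X1' !mulr0 addr0 -[k.+1%:R]natr1 mulrDr mulr1.
  apply: lerD => //; apply: (@le_trans _ _ (K ^+ 2 * (8 * h))); last by lra.
  apply: (le_trans (ler_norm _)); rewrite normrM (ger0_norm (X0n 1%N)).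
  exact: ler_pM (normr_ge0 _) (X0n 1%N) (cb 2%N) X2.
rewrite E4 !RintegralD//; do ?[do !apply: integrableD_fun => //]; do ?[exact: integrableZ_fun].
rewrite !RintegralZl// e31 e22 e13 e04 X1' X3 !mulr0 !addr0.
have q1 : 6 * (\int[P]_w (S w ^+ 2 * c k w ^+ 2) * \int[P]_w (X w ^+ 2)) <=
    384 * K ^+ 4 * h ^+ 2 * k%:R.
  have k2 : 0 <= K ^+ 2 by exact: sqr_ge0.
  have a1 : \int[P]_w (S w ^+ 2 * c k w ^+ 2) <= K ^+ 2 * (8 * K ^+ 2 * h * k%:R).
    by apply: (le_trans cS); exact: ler_wpM2l.
  have a2 : 0 <= \int[P]_w (S w ^+ 2 * c k w ^+ 2).
    by apply: Rintegral_ge0 => w _; rewrite mulr_ge0// sqr_ge0.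
  have := ler_pM a2 (X0n 1%N) a1 X2.
  by rewrite (_ : 384 * _ * _ * _ = 6 * (K ^+ 2 * (8 * K ^+ 2 * h * k%:R) * (8 * h)));
    [rewrite ler_pM2l|ring].
have q2 : \int[P]_w (S w ^+ 0 * c k w ^+ 4) * \int[P]_w (X w ^+ 4) <= 128 * K ^+ 4 * h ^+ 2.
  rewrite (_ : 128 * _ * _ = K ^+ 4 * (128 * h ^+ 2)); last by ring.
  apply: (le_trans (ler_norm _)); rewrite normrM (ger0_norm (X0n 2%N)).
  exact: ler_pM (normr_ge0 _) (X0n 2%N) (cb 4%N) X4.
have q3 : 0 <= K ^+ 4 * h ^+ 2 by rewrite mulr_ge0 ?exprn_ge0// ltW.
apply: (le_trans (lerD (lerD S4 q1) q2)).
rewrite -[k.+1%:R]natr1; move: (k%:R : R) => kr; lra.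
Qed.

End transform.
End brownian.
End filtration.

(** * Borel-Cantelli and the probabilities of bad meshes *)

Section borel_cantelli.
Context {d} {T : measurableType d} {R : realType} (P : probability T R).

(* As the bound does not depend on the mesh index [n], the event that all but
   finitely many [E l n] occur has probability at most [p l]: the meshes need not
   be controlled simultaneously. *)
Lemma borel_cantelli_liminf (E : nat -> nat -> set T) (p : nat -> R) (M : R) :
  (forall l n, measurable (E l n)) -> (forall l n, (P (E l n) <= (p l)%:E)%E) ->
  (forall n, \sum_(0 <= l < n) p l <= M) ->
  {ae P, forall w, \forall l \near \oo, forall n0, exists2 n, (n0 <= n)%N & ~ E l n w}.
Proof.
move=> mE PE pM.
have p0 l : 0 <= p l by rewrite -lee_fin (le_trans _ (PE l 0%N)).
pose C l n0 := \bigcap_(n in [set n | (n0 <= n)%N]) E l n.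
have mC l n0 : measurable (C l n0) by apply: bigcap_measurableType => n _; exact: mE.
pose F l := \bigcup_n0 C l n0.
have mF l : measurable (F l) by exact: bigcup_measurable.
have PF l : (P (F l) <= (p l)%:E)%E.
  have cv : P (C l n) @[n --> \oo] --> P (F l).
    apply: nondecreasing_cvg_mu => //; first exact: bigcup_measurable.
    by move=> a b ab; apply/subsetPset => w Cw n /= bn; apply: Cw => /=; exact: leq_trans bn.
  have <- := cvg_lim (@ereal_hausdorff R) cv.
  apply: lime_le; first by apply/cvg_ex; exists (P (F l)).
  apply: nearW => n; apply: le_trans (PE l n); apply: le_measure; rewrite ?inE//.
  by move=> w; apply => /=.
have : P (lim_sup_set F) = 0%E.
  apply: lim_sup_set_cvg0 => //; apply: (@le_lt_trans _ _ M%:E); last exact: ltry.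
  apply: lime_le; first exact: is_cvg_nneseries.
  apply: nearW => n; apply: (@le_trans _ _ (\sum_(0 <= l < n) (p l)%:E)%E).
    by apply: lee_sum => l _; exact: PF.
  by rewrite sumEFin lee_fin.
move=> PF0; exists (lim_sup_set F); split => //.
  apply: bigcap_measurableType => // n _; exact: bigcup_measurable.
move=> w /= nw n _; apply: contrapT => H; apply: nw.
exists n => // l /= nl n0; apply: contrapT => H'; apply: H; exists l => //=.
exists n0 => // k /= nk; apply: contrapT => H''; apply: H'; by exists k.
Qed.

Lemma sum_inv_sqr (n : nat) : \sum_(0 <= l < n) (l.+1%:R ^+ 2)^-1 <= 2 :> R.
Proof.
case: n => [|n]; first by rewrite big_nil.
suff : \sum_(0 <= l < n.+1) (l.+1%:R ^+ 2)^-1 <= 2 - n.+1%:R^-1 :> R.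
  by move=> h; apply: (le_trans h); rewrite gerBl invr_ge0.
elim: n => [|n IH]; first by rewrite big_nat1 expr1n invr1; lra.
rewrite big_nat_recr//=; apply: (le_trans (lerD IH (lexx _))).
have a0 : 0 < n.+1%:R :> R by rewrite ltr0n.
rewrite -[n.+2%:R]natr1; move: (n.+1%:R : R) a0 => a a0.
have a1 : 0 < a + 1 by lra.
have -> : 2 - (a + 1)^-1 = 2 - a^-1 + (a * (a + 1))^-1.
  by field; rewrite !gt_eqF.
rewrite lerD2l lef_pV2 ?posrE ?exprn_gt0 ?mulr_gt0//.
by rewrite expr2 ler_pM2r//; lra.
Qed.

Lemma sum_half (n : nat) : \sum_(0 <= l < n) 2^-1 ^+ l <= 2 :> R.
Proof.
suff : \sum_(0 <= l < n) 2^-1 ^+ l = 2 - 2 * 2^-1 ^+ n :> R.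
  by move=> ->; rewrite gerBl mulr_ge0// exprn_ge0.
elim: n => [|n IH]; first by rewrite big_nil expr0; lra.
by rewrite big_nat_recr//= IH exprS; field.
Qed.

End borel_cantelli.

Section mean_ineq.
Context {R : realType}.

Definition mean (N : nat) (x : 'I_N -> R) : R := N%:R^-1 * \sum_(i < N) x i.

Lemma mean_sqr N (x : 'I_N -> R) : mean x ^+ 2 <= mean (fun i => x i ^+ 2).
Proof.
case: N x => [|N] x; first by rewrite /mean !big_ord0 !mulr0 expr0n.
set m := mean x.
have : 0 <= mean (fun i => (x i - m) ^+ 2).
  by rewrite /mean mulr_ge0// ?invr_ge0// sumr_ge0// => i _; exact: sqr_ge0.
have n0 : N.+1%:R != 0 :> R by rewrite pnatr_eq0.
suff -> : mean (fun i => (x i - m) ^+ 2) = mean (fun i => x i ^+ 2) - m ^+ 2 by rewrite subr_ge0.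
rewrite /mean; under eq_bigr do rewrite sqrrB.
rewrite !big_split sumrN /= sumr_const card_ord -[m ^+ 2 *+ _]mulr_natl.
under [X in _ - X]eq_bigr do rewrite -mulrnAr.
rewrite -mulr_suml.
have -> : \sum_(i < N.+1) x i = N.+1%:R * m by rewrite /m /mean mulrA mulfV// mul1r.
by rewrite expr2; field.
Qed.

Lemma mean_pow4 N (x : 'I_N -> R) : mean x ^+ 4 <= mean (fun i => x i ^+ 4).
Proof.
rewrite (exprM _ 2 2) (_ : (fun i => x i ^+ 4) = fun i => (x i ^+ 2) ^+ 2); last first.
  by apply/funext => i; rewrite -exprM.
apply: le_trans (mean_sqr _).
by rewrite ler_sqr ?nnegrE ?sqr_ge0 ?(le_trans _ (mean_sqr _)) ?sqr_ge0// mean_sqr.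
Qed.

Lemma sum_sqr n (x : 'I_n -> R) : (\sum_(i < n) x i) ^+ 2 <= n%:R * \sum_(i < n) x i ^+ 2.
Proof.
case: n x => [|n] x; first by rewrite !big_ord0 mulr0 expr0n.
have n0 : n.+1%:R != 0 :> R by rewrite pnatr_eq0.
have := mean_sqr x; rewrite /mean exprMn => h.
have n2 : 0 <= n.+1%:R ^+ 2 :> R by exact: sqr_ge0.
have := ler_wpM2l n2 h; rewrite mulrA -exprMn mulfV// expr1n mul1r expr2 => h'.
by apply: (le_trans h'); rewrite mulrA mulfK.
Qed.

End mean_ineq.

Section mesh_events.
Context {d} {T : measurableType d} {R : realType} (P : probability T R).
Variable Fil : R -> set (set T).
Hypothesis HF : standard_filtration P Fil.
Variables (N : nat) (B : 'I_N -> R -> T -> R).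
Hypothesis HB : forall i, brownian_motion P Fil (B i).
Variables (T0 : R) (n : nat).
Hypotheses (T00 : 0 < T0) (n0 : (0 < n)%N).

Let u k := mesh T0 n k.
Let h := T0 / n%:R.
Let h0 : 0 < h. Proof. by rewrite divr_gt0// ltr0n. Qed.
Let u0 k : 0 <= u k. Proof. exact: mesh_ge0 (ltW T00). Qed.
Let uS k : u k.+1 = u k + h. Proof. exact: meshS. Qed.
Let hn : h * n%:R = T0. Proof. by rewrite /h divfK// pnatr_eq0 -lt0n. Qed.

Lemma integrable_mean (Y : 'I_N -> T -> R) (C : R) : 0 <= C ->
  (forall i, P.-integrable setT (EFin \o Y i)) ->
  (forall i, \int[P]_w Y i w <= C) ->
  P.-integrable setT (EFin \o (fun w => mean (fun i => Y i w))) /\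
  \int[P]_w mean (fun i => Y i w) <= C.
Proof.
move=> C0 iY YC.
have [is_ es] : P.-integrable setT (EFin \o (fun w => \sum_(i < N) Y i w)) /\
    \int[P]_w \sum_(i < N) Y i w = \sum_(i < N) \int[P]_w Y i w.
  elim: (index_enum _) => [|i s [IH1 IH2]].
    rewrite big_nil (_ : (fun w => _) = fun=> 0); last by apply/funext => w; rewrite big_nil.
    by rewrite Rintegral_cstP; split => //; exact: integrable_cstP.
  rewrite big_cons -IH2 (_ : (fun w => _) = fun w => Y i w + \sum_(j <- s) Y j w); last first.
    by apply/funext => w; rewrite big_cons.
  by rewrite RintegralD//; split => //; exact: integrableD_fun.
split; first exact: integrableZ_fun.
rewrite /mean RintegralZl// es; case: N Y iY YC {is_ es} => [|N'] Y iY YC.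
  by rewrite big_ord0 mulr0.
rewrite ler_pdivrMl ?ltr0n//; apply: (le_trans (ler_sum _ (fun i _ => YC i))).
by rewrite sumr_const card_ord mulr_natl.
Qed.

(** By Cauchy-Schwarz the squared quadratic variation is at most [n] times the sum of the fourth
    powers, whose mean is at most [n * (n * (128 * h ^+ 2)) = 128 * T0 ^+ 2]. The bound is thus
    independent of the mesh. *)
Lemma quad_var_event (e : R) : 0 < e -> exists A : set T, [/\ measurable A,
  (P A <= (128 * T0 ^+ 2 / e ^+ 2)%:E)%E &
  forall w, ~ A w -> mean (fun i => quad_var (fun t => B i t w) T0 n) <= e].
Proof.
move=> e0.
pose Y i w := n%:R * \sum_(l < n) increment (B i) (u l) (u l.+1) w ^+ 4.
have ul l : u l < u l.+1 by rewrite uS ltrDl.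
have [iY EY] : P.-integrable setT (EFin \o (fun w => mean (fun i => Y i w))) /\
  \int[P]_w mean (fun i => Y i w) <= 128 * T0 ^+ 2.
  apply: integrable_mean => [|i|i].
  - by rewrite mulr_ge0// sqr_ge0.
  - apply: integrableZ_fun; elim: (index_enum _) => [|l s IH].
      rewrite (_ : (fun w => _) = fun=> 0); last by apply/funext => w; rewrite big_nil.
      exact: integrable_cstP.
    rewrite (_ : (fun w => _) = fun w => increment (B i) (u l) (u l.+1) w ^+ 4 +
      \sum_(j <- s) increment (B i) (u j) (u j.+1) w ^+ 4); last first.
      by apply/funext => w; rewrite big_cons.
    apply: integrableD_fun => //.
    by have [h1 _] := increment_moments HF (HB i) (u0 l) (ul l); exact: (h1 4%N).
  - have [is_ es] : P.-integrable setT (EFin \o (fun w => \sum_(l < n) increment (B i) (u l) (u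
    l.+1) w ^+ 4))
      /\ \int[P]_w (\sum_(l < n) increment (B i) (u l) (u l.+1) w ^+ 4) <= \sum_(l < n) (128 * h
        ^+ 2).
      elim: (index_enum _) => [|l s [IH1 IH2]].
        rewrite big_nil (_ : (fun w => _) = fun=> 0); last by apply/funext => w; rewrite big_nil.
        by rewrite Rintegral_cstP; split => //; exact: integrable_cstP.
      rewrite big_cons (_ : (fun w => _) = fun w => increment (B i) (u l) (u l.+1) w ^+ 4 +
        \sum_(j <- s) increment (B i) (u j) (u j.+1) w ^+ 4); last first.
        by apply/funext => w; rewrite big_cons.
      have [h1 [_ _ _ h4]] := increment_moments HF (HB i) (u0 l) (ul l).
      rewrite RintegralD//; last exact: (h1 4%N).
      split; first by apply: integrableD_fun => //; exact: (h1 4%N).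
      by apply: lerD => //; apply: (le_trans h4); rewrite uS addrAC subrr add0r.
    rewrite RintegralZl//; apply: (@le_trans _ _ (n%:R * \sum_(l < n) (128 * h ^+ 2))).
      exact: ler_wpM2l.
    by rewrite sumr_const card_ord -mulr_natl -hn le_eqVlt; apply/orP; left; apply/eqP; ring.
have Y0 w : 0 <= mean (fun i => Y i w).
  rewrite /mean mulr_ge0 ?invr_ge0// sumr_ge0// => i _; rewrite mulr_ge0// sumr_ge0// => l _.
  exact: exprn_even_ge0.
have e2 : 0 < e ^+ 2 by exact: exprn_gt0.
exists [set w | e ^+ 2 < mean (fun i => Y i w)]; split.
- have mY : measurable_fun setT (fun w => mean (fun i => Y i w)).
    by apply/measurable_EFinP; case/integrableP : iY.
  rewrite (_ : [set w | _] = setT `&` (fun w => mean (fun i => Y i w)) @^-1` `]e ^+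
    2, +oo[%classic).
    by apply: mY => //; exact: measurable_itv.
  by rewrite setTI; apply/seteqP; split => w /=; rewrite in_itv/= andbT.
- exact: markov_real.
move=> w /= /negP; rewrite -leNgt => hw.
have Q0 : 0 <= mean (fun i => quad_var (fun t => B i t w) T0 n).
  by rewrite /mean mulr_ge0 ?invr_ge0// sumr_ge0// => i _; rewrite sumr_ge0// => l _;
    exact: sqr_ge0.
rewrite -ler_sqr ?nnegrE ?(ltW e0)//; apply: le_trans hw.
apply: (le_trans (mean_sqr _)); rewrite /mean ler_wpM2l ?invr_ge0//.
apply: ler_sum => i _; apply: (le_trans (sum_sqr _)).
rewrite /Y ler_wpM2l//; apply: ler_sum => l _.
by rewrite -exprM.
Qed.

Variables (a : 'I_N -> nat -> T -> R) (K : R).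
Hypotheses (K0 : 0 <= K) (am : forall i k, adapted_fun Fil (u k) (a i k)).
Hypothesis (aK : forall i k w, `|a i k w| <= K).

Let M k w := mean (fun i => mtransform (B i) u (a i) k w).

(** A maximal inequality by stopping. Multiplying the integrands by the adapted indicator [G], that
    no average up to the current index has exceeded [e], freezes the sum at the first index [k0]
    where it does. The fourth moment of the stopped sum at time [n] therefore controls all [k <= n];
    particles are averaged by convexity. *)
Lemma mtransform_event (e : R) : 0 < e -> exists A : set T, [/\ measurable A,
  (P A <= (192 * K ^+ 4 * T0 ^+ 2 / e ^+ 4)%:E)%E &
  forall w, ~ A w -> forall k, (k <= n)%N -> `|M k w| <= e].
Proof.
move=> e0.
pose G l w : R := \prod_(j < l.+1) (if `|M j w| <= e then 1 else 0).
have G01 l w : (G l w == 0) || (G l w == 1).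
  rewrite /G; elim/big_rec: _ => [|j x _ /orP[]/eqP->]; first by rewrite eqxx orbT.
    by rewrite mulr0 eqxx.
  by case: ifP => _; rewrite ?mul0r ?mul1r eqxx ?orbT.
have u_mono k l : (k <= l)%N -> u k <= u l.
  elim: l => [|l IH]; first by rewrite leqn0 => /eqP->.
  rewrite leq_eqVlt => /predU1P[->//|]; rewrite ltnS => /IH h1.
  by rewrite uS (le_trans h1)// lerDl ltW.
have fM k : adapted_fun Fil (u k) (M k).
  have := adapted_funM HF (u0 k) (adapted_fun_cst HF (N%:R^-1) (u0 k)); apply.
  apply: (adapted_fun_sum HF) => // i _.
  exact: (adapted_mtransform HF (HB i) u0 h0 uS (am i)).
have fG l : adapted_fun Fil (u l) (G l).
  have ind : measurable_fun setT (fun x : R => if `|x| <= e then 1 else 0 : R).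
    rewrite (_ : (fun x => _) = \1_(`[- e, e]%classic)).
      by apply: measurable_indic; exact: measurable_itv.
    apply/funext => x; rewrite indicE; case: ifPn => h1.
      by rewrite mem_set//= in_itv/= -ler_norml.
    by rewrite memNset//= in_itv/= -ler_norml; exact/negP.
  apply/(adapted_funP HF) => //; apply: measurable_prod => j _.
  have /(adapted_funP HF (M j) (u0 l)) : adapted_fun Fil (u l) (M j).
    by apply: (adapted_fun_mono HF (u0 j)); [apply: u_mono; rewrite -ltnS;
      exact: ltn_ord|exact: fM].
  by move=> mM; exact: (measurableT_comp ind mM).
pose a' i l w := G l w * a i l w.
have fa' i k : adapted_fun Fil (u k) (a' i k) by apply: (adapted_funM HF).
have a'K i k w : `|a' i k w| <= K.
  rewrite /a' normrM; case/orP : (G01 k w) => /eqP->; rewrite ?normr0 ?mul0r//.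
  by rewrite normr1 mul1r.
have mom i := mtransform_moments HF (HB i) u0 h0 uS K0 (fa' i) (a'K i) n.
have [iY EY] : P.-integrable setT (EFin \o (fun w => mean (fun i => mtransform (B i) u (a' i) n w
  ^+ 4))) /\
  \int[P]_w mean (fun i => mtransform (B i) u (a' i) n w ^+ 4) <= 192 * K ^+ 4 * T0 ^+ 2.
  apply: integrable_mean => [|i|i].
  - by rewrite !mulr_ge0// ?exprn_ge0// ltW.
  - by have [] := mom i.
  - have [_ _] := mom i => /le_trans; apply.
    by rewrite -mulrA -exprMn hn.
have Y0 w : 0 <= mean (fun i => mtransform (B i) u (a' i) n w ^+ 4).
  by rewrite /mean mulr_ge0 ?invr_ge0// sumr_ge0// => i _; exact: exprn_even_ge0.
have e4 : 0 < e ^+ 4 by exact: exprn_gt0.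
exists [set w | e ^+ 4 < mean (fun i => mtransform (B i) u (a' i) n w ^+ 4)]; split.
- have mY : measurable_fun setT (fun w => mean (fun i => mtransform (B i) u (a' i) n w ^+ 4)).
    by apply/measurable_EFinP; case/integrableP : iY.
  rewrite (_ : [set w | _] = setT `&` (fun w => mean (fun i => mtransform (B i) u (a' i) n w ^+ 4))
      @^-1` `]e ^+ 4, +oo[%classic).
    by apply: mY => //; exact: measurable_itv.
  by rewrite setTI; apply/seteqP; split => w /=; rewrite in_itv/= andbT.
- exact: markov_real.
move=> w /= /negP; rewrite -leNgt => hw.
have {hw} hw := le_trans (mean_pow4 _) hw.
pose D l := mean (fun i => a i l w * increment (B i) (u l) (u l.+1) w).
have ME k : M k w = \sum_(l < k) D l.
  rewrite /M /mean /mtransform exchange_big/= mulr_sumr.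
  by apply: eq_bigr => l _.
have M'E : mean (fun i => mtransform (B i) u (a' i) n w) = \sum_(l < n) G l w * D l.
  rewrite /mean /mtransform exchange_big/= mulr_sumr.
  apply: eq_bigr => l _; rewrite /D /mean mulrCA; congr (_ * _); rewrite mulr_sumr.
  by apply: eq_bigr => i _; rewrite /a' mulrA.
apply: contrapT => /existsNP[k /not_implyP[kn /negP]]; rewrite -ltNge => hk.
have ex : exists k, e < `|M k w| by exists k.
pose k0 := ex_minn ex.
have [hk0 k0min] : e < `|M k0 w| /\ forall j, e < `|M j w| -> (k0 <= j)%N.
  by rewrite /k0; case: ex_minnP.
have k0n : (k0 <= n)%N by exact: leq_trans (k0min k hk) kn.
have G1 l : (l < k0)%N -> G l w = 1.
  move=> lk; rewrite /G big1// => j _; case: ifPn => //; rewrite -ltNge => /k0min.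
  by move=> kj; have := leq_ltn_trans kj (ltn_ord j); rewrite ltnS leqNgt lk.
have G0 l : (k0 <= l)%N -> G l w = 0.
  move=> kl; rewrite /G (bigD1 (Ordinal (kl : (k0 < l.+1)%N)))//=.
  by rewrite leNgt hk0 mul0r.
have E : mean (fun i => mtransform (B i) u (a' i) n w) = M k0 w.
  rewrite M'E ME (big_ord_widen n _ k0n) [RHS]big_mkcond; apply: eq_bigr => l _.
  by case: ifPn => lk; [rewrite G1 ?mul1r|rewrite G0 ?mul0r// leqNgt].
move: hw; rewrite E leNgt => /negP; apply.
have -> : M k0 w ^+ 4 = `|M k0 w| ^+ 4 by rewrite -normrX ger0_norm// exprn_even_ge0.
by rewrite ltr_pXn2r ?nnegrE ?(ltW e0).
Qed.

End mesh_events.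

Fixpoint expr_encode (e : expr) : GenTree.tree unit :=
  match e with
  | EA => GenTree.Node 0 [::] | EQ => GenTree.Node 1 [::] | E1 => GenTree.Node 2 [::]
  | EN a => GenTree.Node 3 [:: expr_encode a]
  | EP a b => GenTree.Node 4 [:: expr_encode a; expr_encode b]
  | EM a b => GenTree.Node 5 [:: expr_encode a; expr_encode b]
  end.

Fixpoint expr_decode (t : GenTree.tree unit) : expr :=
  match t with
  | GenTree.Node 0 _ => EA | GenTree.Node 1 _ => EQ
  | GenTree.Node 3 [:: a] => EN (expr_decode a)
  | GenTree.Node 4 [:: a; b] => EP (expr_decode a) (expr_decode b)
  | GenTree.Node 5 [:: a; b] => EM (expr_decode a) (expr_decode b)
  | _ => E1
  end.

Lemma expr_encodeK : cancel expr_encode expr_decode.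
Proof. by elim=> //= [a -> | a -> b -> | a -> b ->]. Qed.

HB.instance Definition _ := Countable.copy expr (can_type expr_encodeK).

Definition observable_encode (tau : observable) : option expr := if tau is TE e then Some e else
  None.
Definition observable_decode (o : option expr) : observable := if o is Some e then TE e else TT.
Lemma observable_encodeK : cancel observable_encode observable_decode. Proof. by case. Qed.
HB.instance Definition _ := Countable.copy observable (can_type observable_encodeK).

Section ae_countable.
Context {d} {T : measurableType d} {R : realType} (mu : {measure set T -> \bar R}).

Lemma ae_countable (I : countType) (Q : I -> T -> Prop) :
  (forall i, {ae mu, forall w, Q i w}) -> {ae mu, forall w, forall i, Q i w}.
Proof.
move=> H; pose Q' n w := if unpickle n is Some i then Q i w else True.
have : {ae mu, forall w, forall n, Q' n w}.
  apply/ae_foralln => n; rewrite /Q'; case: unpickle => [i|]; first exact: H.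
  exact: aeW.
move=> [Z [mZ Z0 hZ]]; exists Z; split => // w nw; apply: hZ => /= H'; apply: nw => i.
by have := H' (pickle i); rewrite /Q' pickleK.
Qed.

Lemma ae_and (Q Q' : T -> Prop) : {ae mu, forall w, Q w} -> {ae mu, forall w, Q' w} ->
  {ae mu, forall w, Q w /\ Q' w}.
Proof.
move=> H H'; suff : {ae mu, forall w, forall b : bool, if b then Q w else Q' w}.
  by move=> [Z [mZ Z0 hZ]]; exists Z; split => // w nw; apply: hZ => /= h; apply: nw;
     split; [exact: (h true)|exact: (h false)].
by apply: ae_countable => -[].
Qed.

Lemma ae_imply (Q Q' : T -> Prop) : (forall w, Q w -> Q' w) -> {ae mu, forall w, Q w} ->
  {ae mu, forall w, Q' w}.
Proof.
by move=> QQ' [Z [mZ Z0 hZ]]; exists Z; split => // w nw; apply: hZ => /= /QQ'.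
Qed.

End ae_countable.

(** * Almost sure evolution of the averages *)

Section dyson.
Context {R : realType} {d : measure_display} {T : measurableType d}.
Variables (P : probability T R) (Fil : R -> set (set T)).
Variable x : forall N : nat, 'I_N -> R.
Variables (B lam : forall N : nat, 'I_N -> R -> T -> R).
Hypothesis HF : standard_filtration P Fil.
Hypothesis HB : forall (N : nat) (i : 'I_N), brownian_motion P Fil (B i).
Hypothesis HS : forall N : nat, (0 < N)%N -> dyson_solution P Fil (@x N) (@B N) (@lam N).
Local Notation mu := (@lebesgue_measure R).

Definition path w N i t := @lam N i t w.

Definition good_path w := forall N (i : 'I_N),
  [/\ {within `[0, +oo[, continuous (path w i)},
      {within `[0, +oo[, continuous (fun t => B i t w)},
      forall t, 0 <= t -> mu.-integrable `[0, t] (EFin \o particle_drift (path w) i) &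
      forall t, 0 <= t -> path w i t = x i + \int[mu]_(s in `[0, t]) particle_drift (path w) i s
        + 2 / Num.sqrt N%:R * B i t w].

Lemma ae_good_path : {ae P, forall w, good_path w}.
Proof.
apply: ae_countable => N; apply: ae_countable => i.
have N0 : (0 < N)%N by exact: leq_ltn_trans (ltn_ord i).
have [_ cl sde] := HS N0; have [_ cB _ _ _] := HB i.
have := ae_and (cl i) (ae_and cB sde); apply: ae_imply => w [cw [bw s]].
by split => // t t0; have [] := s i t t0.
Qed.

Lemma obs_val_regularity (eta : R) tau (q : R) : 0 < eta ->
  exists K K', [/\ 0 <= K, 0 <= K',
    forall y h, `|obs_val eta tau (q - (y + h)) - obs_val eta tau (q - y) -
      h * - (obs_coef tau * expr_eval eta (obs_deriv tau) (q - y))| <= K * h ^+ 2,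
    forall y, `|- (obs_coef tau * expr_eval eta (obs_deriv tau) (q - y))| <= K' &
    forall y z, `|- (obs_coef tau * expr_eval eta (obs_deriv tau) (q - y)) -
      - (obs_coef tau * expr_eval eta (obs_deriv tau) (q - z))| <= K * `|y - z|].
Proof.
move=> eta0; have [K K0 hK] := obs_val_quad eta0 tau.
have [K' K'0 hK'] := expr_eval_bound eta0 (obs_deriv tau).
have [L L0 hL] := obs_val_lip eta0 (TE (obs_deriv tau)).
have t0 := @obs_coef_ge0 R tau.
exists (K + obs_coef tau * L), (obs_coef tau * K'); split.
- by rewrite addr_ge0// mulr_ge0.
- by rewrite mulr_ge0.
- move=> y h; apply: (@le_trans _ _ (K * h ^+ 2)); last first.
    by rewrite ler_wpM2r ?sqr_ge0// lerDl mulr_ge0.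
  by have := hK (q - y) (- h); rewrite sqrrN mulrN mulNr opprD addrA.
- by move=> y; rewrite normrN normrM (ger0_norm t0) ler_wpM2l.
move=> y z; rewrite -opprD normrN -mulrBr normrM (ger0_norm t0).
apply: (@le_trans _ _ (obs_coef tau * (L * `|y - z|))).
  rewrite ler_wpM2l//; apply: (le_trans (hL _ _)); rewrite ler_wpM2l//.
  by rewrite (_ : q - y - (q - z) = - (y - z)) ?normrN//; ring.
by rewrite mulrA ler_wpM2r// lerDr.
Qed.

Lemma particle_obs_drift_integral w (eta : R) tau q N (t : R) : good_path w -> 0 < eta -> 0 <= t ->
  mu.-integrable `[0, t] (EFin \o particle_obs_drift (path w) eta tau q N) /\
  \int[mu]_(s in `[0, t]) particle_obs_drift (path w) eta tau q N s = mean (fun i : 'I_N =>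
    \int[mu]_(s in `[0, t]) (- (obs_coef tau * expr_eval eta (obs_deriv tau) (q - path w i s)) *
      particle_drift (path w) i s)).
Proof.
move=> gw eta0 t0.
have mA : measurable (`[0, t]%classic : set (measurableTypeR R)) by exact: measurable_itv.
have [K [K' [K0 K'0 hq hb hl]]] := obs_val_regularity tau q eta0.
pose F (i : 'I_N) s := - (obs_coef tau * expr_eval eta (obs_deriv tau) (q - path w i s)) *
  particle_drift (path w) i s.
have iF i : mu.-integrable `[0, t] (EFin \o F i).
  have [cl cb gi _] := gw N i.
  exact: (fg_integrable K0 hb hl cl gi t0).
have [is_ es] : mu.-integrable `[0, t] (EFin \o (fun s => \sum_(i < N) F i s)) /\
    \int[mu]_(s in `[0, t]) (\sum_(i < N) F i s) = \sum_(i < N) \int[mu]_(s in `[0, t]) F i s.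
  elim: (index_enum _) => [|i s [IH1 IH2]].
    rewrite big_nil (_ : (fun s => _) = fun=> 0); last by apply/funext => s; rewrite big_nil.
    by rewrite Rintegral_cst// mul0r; split => //; exact: integrable0.
  rewrite big_cons -IH2 (_ : (fun r => \sum_(j <- i :: s) F j r) = fun r => F i r + \sum_(j <- s)
    F j r); last first.
    by apply/funext => r; rewrite big_cons.
  rewrite RintegralD//; split => //.
  exact: (@integrableD _ _ _ mu _ mA _ _ (iF i) IH1).
split; first exact: (@integrableZl _ _ _ mu _ mA (N%:R^-1) _ is_).
by rewrite /mean -es -RintegralZl.
Qed.

(** Both bad events, the squared noise coefficient entering one and the coefficient itself the
    other, have probability proportional to the fourth power of [2 / sqrt N], that is to
    [16 / N ^+ 2]. The constant [C] depends neither on the number of particles nor on the mesh. *)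
Lemma mesh_event (N : nat) (eta : R) tau (q : R) (T0 eps : R) : 0 < eta -> 0 < T0 -> 0 < eps ->
  exists C, forall N n, exists A, [/\ measurable A,
    (P A <= (C * (N.+1%:R ^+ 2)^-1)%:E)%E & forall w, ~ A w ->
    (2 / Num.sqrt N.+1%:R) ^+ 2 * mean (fun i : 'I_N.+1 => quad_var (fun t => B i t w) T0 n.+1) <=
      eps /\
    forall k, (k <= n.+1)%N -> 2 / Num.sqrt N.+1%:R *
      `|mean (fun i : 'I_N.+1 => noise_sum (fun y => - (obs_coef tau * expr_eval eta (obs_deriv
        tau) (q - y)))
         (path w i) (fun t => B i t w) T0 n.+1 k)| <= eps].
Proof.
move=> eta0 T00 e0; have [K [K' [K0 K'0 hq hb hl]]] := obs_val_regularity tau q eta0.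
exists (16 * (128 * T0 ^+ 2 / eps ^+ 2 + 192 * K' ^+ 4 * T0 ^+ 2 / eps ^+ 4)) => M n.
pose c : R := 2 / Num.sqrt M.+1%:R.
have c0 : 0 < c by rewrite divr_gt0// sqrtr_gt0 ltr0n.
have c4 : c ^+ 4 = 16 / M.+1%:R ^+ 2.
  rewrite /c expr_div_n (exprM _ 2 2) (exprM (Num.sqrt _) 2 2) sqr_sqrtr//.
  by congr (_ / _); rewrite -natrX -natrX.
have ec2 : 0 < eps / c ^+ 2 by rewrite divr_gt0// exprn_gt0.
have ec : 0 < eps / c by rewrite divr_gt0.
have [A1 [mA1 PA1 hA1]] := quad_var_event HF (@HB M.+1) T00 (isT : (0 < n.+1)%N) ec2.
pose a (i : 'I_M.+1) k w := - (obs_coef tau * expr_eval eta (obs_deriv tau) (q - lam i (mesh T0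
  n.+1 k) w)).
have am (i : 'I_M.+1) k : adapted_fun Fil (mesh T0 n.+1 k) (a i k).
  have m0 := @mesh_ge0 R T0 n.+1 k (ltW T00).
  have mf : measurable_fun setT (fun y : R => - (obs_coef tau * expr_eval eta (obs_deriv tau) (q -
    y))).
    by apply: continuous_measurable_fun; exact: (f'_continuous K0 hl).
  have [al _ _] := @HS M.+1 isT.
  by apply: (adapted_fun_comp mf); exact: al.
have aK (i : 'I_M.+1) k w : `|a i k w| <= K' by exact: hb.
have [A2 [mA2 PA2 hA2]] := mtransform_event HF (@HB M.+1) T00 (isT : (0 < n.+1)%N) K'0 am aK ec.
exists (A1 `|` A2); split.
- exact: measurableU.
- apply: (le_trans (measureU2 _ _ _)) => //; apply: (le_trans (leeD PA1 PA2)).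
  rewrite -EFinD lee_fin le_eqVlt; apply/orP; left; apply/eqP.
  move: c4 c0; move: (c) => b c4 b0.
  have M0 : M.+1%:R != 0 :> R by rewrite pnatr_eq0.
  have -> : 128 * T0 ^+ 2 / (eps / b ^+ 2) ^+ 2 = 128 * T0 ^+ 2 / eps ^+ 2 * b ^+ 4.
    by field; rewrite !gt_eqF.
  have -> : 192 * K' ^+ 4 * T0 ^+ 2 / (eps / b) ^+ 4 = 192 * K' ^+ 4 * T0 ^+ 2 / eps ^+ 4 * b ^+ 4.
    by field; rewrite !gt_eqF.
  by rewrite c4; ring.
move=> w nA; have n1 : ~ A1 w by move=> h; apply: nA; left.
have n2 : ~ A2 w by move=> h; apply: nA; right.
rewrite -/c; split.
  by rewrite mulrC -ler_pdivlMr ?exprn_gt0//; exact: hA1.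
by move=> k kn; rewrite mulrC -ler_pdivlMr//; exact: (hA2 w n2 k kn).
Qed.

(** For every large [N], [borel_cantelli_liminf] supplies arbitrarily fine meshes outside the bad
    events, which is exactly the hypothesis of [mean_path]. *)
Lemma ae_avg_limit (eta : R) tau (q : R) (T0 eps : R) : 0 < eta -> 0 < T0 -> 0 < eps ->
  {ae P, forall w, \forall N \near \oo, forall t, 0 <= t <= T0 ->
    `|obs_avg (path w) eta tau q N t - obs_avg (path w) eta tau q N 0 -
      \int[mu]_(s in `[0, t]) particle_obs_drift (path w) eta tau q N s| <= eps}.
Proof.
move=> eta0 T00 e0; have [K [K' [K0 K'0 hq hb hl]]] := obs_val_regularity tau q eta0.
have e1 : 0 < eps / (2 * K + 1) by rewrite divr_gt0// ltr_wpDl// mulr_ge0.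
have [C hC] := mesh_event 0 tau q eta0 T00 e1.
have C0 : 0 <= C.
  have [A [_ PA _]] := hC 0%N 0%N; rewrite expr1n invr1 mulr1 in PA.
  by rewrite -lee_fin (le_trans _ PA).
have /choice[E hE] : forall Nn : nat * nat, exists A, [/\ measurable A,
    (P A <= (C * (Nn.1.+1%:R ^+ 2)^-1)%:E)%E & forall w, ~ A w ->
    (2 / Num.sqrt Nn.1.+1%:R) ^+ 2 * mean (fun i : 'I_Nn.1.+1 => quad_var (fun t => B i t w) T0
      Nn.2.+1) <= eps / (2 * K + 1) /\
    forall k, (k <= Nn.2.+1)%N -> 2 / Num.sqrt Nn.1.+1%:R *
      `|mean (fun i : 'I_Nn.1.+1 => noise_sum (fun y => - (obs_coef tau * expr_eval eta (obs_deriv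
        tau) (q - y)))
         (path w i) (fun t => B i t w) T0 Nn.2.+1 k)| <= eps / (2 * K + 1)].
  by case=> N n; exact: hC.
have := @borel_cantelli_liminf _ _ _ P (fun N n => E (N, n)) (fun N => C * (N.+1%:R ^+ 2)^-1) (C *
  2).
case/(_ _ _ _)/wrap => [N n|N n|n|bc].
- by have [] := hE (N, n).
- by have [] := hE (N, n).
- by rewrite -mulr_sumr ler_wpM2l// sum_inv_sqr.
have := ae_and ae_good_path bc; apply: ae_imply => w [gw [N0 _ hN0]].
exists N0.+1 => // -[//|N] /= N0N t ht.
have := @mean_path R (fun y => obs_val eta tau (q - y)) (fun y => - (obs_coef tau * expr_eval eta
  (obs_deriv tau) (q - y)))
  K K' K0 K'0 hq hb hl N.+1 (@path w N.+1) (fun i t => B i t w) (@particle_drift R (path w) N.+1)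
    (@x N.+1)
  (2 / Num.sqrt N.+1%:R).
have c0 : 0 <= 2 / Num.sqrt N.+1%:R :> R by rewrite divr_ge0// sqrtr_ge0.
move=> /(_ c0 (fun i => let: And4 h _ _ _ := gw N.+1 i in h)
  (fun i => let: And4 _ h _ _ := gw N.+1 i in h) (fun i => let: And4 _ _ h _ := gw N.+1 i in h)
  (fun i => let: And4 _ _ _ h := gw N.+1 i in h) T0 _ T00 e1) H.
have eE : (2 * K + 1) * (eps / (2 * K + 1)) = eps.
  by rewrite mulrC divfK// gt_eqF// ltr_wpDl// mulr_ge0.
have {H} := H _ t ht; rewrite eE.
have [t0 _] := andP ht; have [_ ->] := particle_obs_drift_integral tau q N.+1 gw eta0 t0.
rewrite /mean.
apply => n0; have [n n0n nE] := hN0 N N0N n0.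
have [_ _ /(_ w nE)h] := hE (N, n).
by exists n.+1 => //; exact: leqW.
Qed.

Lemma ae_all_avg_limits : {ae P, forall w, forall (m : nat) tau (q : rat) (T0 eps : R), 0 < eps ->
  \forall N \near \oo, forall t, 0 <= t <= T0 ->
    `|obs_avg (path w) m.+1%:R^-1 tau (ratr q) N t - obs_avg (path w) m.+1%:R^-1 tau (ratr q) N 0 -
      \int[mu]_(s in `[0, t]) particle_obs_drift (path w) m.+1%:R^-1 tau (ratr q) N s| <= eps}.
Proof.
have H : {ae P, forall w, forall (m : nat) tau (q : rat) (a k : nat), \forall N \near \oo,
  forall t, 0 <= t <= a.+1%:R ->
    `|obs_avg (path w) m.+1%:R^-1 tau (ratr q) N t - obs_avg (path w) m.+1%:R^-1 tau (ratr q) N 0 -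
      \int[mu]_(s in `[0, t]) particle_obs_drift (path w) m.+1%:R^-1 tau (ratr q) N s| <=
        k.+1%:R^-1}.
  do 5!(apply: ae_countable => ?).
  by apply: ae_avg_limit; rewrite ?invr_gt0 ltr0n.
apply: ae_imply H => w H m tau q T0 eps e0.
have := H m tau q (Num.truncn T0) (Num.truncn eps^-1).
apply: filterS => N h t /andP[t0 tT]; apply: le_trans (h t _) _.
  by rewrite t0 (le_trans tT)// ltW// truncnS_gt.
by rewrite invf_ple ?posrE// ?ltr0n// ltW// truncnS_gt.
Qed.

End dyson.

Lemma geometric_small {R : realType} (q K e : R) : 0 <= q -> q < 1 -> 0 < e ->
  \forall l \near \oo, K * q ^+ l <= e.
Proof.
move=> q0 q1 e0; have q2 : `|q| < 1 by rewrite ger0_norm.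
have : K * q ^+ l @[l --> \oo] --> K * 0 by apply: cvgM; [exact: cvg_cst|exact: cvg_expr].
by rewrite mulr0 => /cvgr_le; apply.
Qed.

(** * Zeros of a path of finite variation plus noise *)

Section null.
Context {R : realType}.
Local Notation mu := (@lebesgue_measure R).

Lemma ext_continuous (f : R -> R) : {within `[0, +oo[, continuous f} ->
  continuous (fun s : R => f (Num.max s 0)).
Proof.
move=> fc s; apply/cvgrPdist_le => e e0.
have m0 (u : R) : 0 <= Num.max u 0 by rewrite le_max lexx orbT.
have [r r0 hr] := within_ball fc (m0 s) e0.
near=> u; rewrite distrC; apply: hr => //.
have us : `|s - u| < r by near: u; apply: cvgr_dist_lt.
apply: le_lt_trans us; rewrite distrC.
have [s0|s0] := leP s 0; have [u0|u0] := leP u 0; rewrite ?subrr ?normr0 ?normr_ge0 ?subr0 ?sub0r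
  ?normrN//.
- by rewrite distrC [leRHS]ger0_norm; [rewrite ger0_norm; lra|lra].
- by rewrite [leRHS]ger0_norm; [rewrite ger0_norm; lra|lra].
Unshelve. all: by end_near. Qed.

(** The total length of the cells of width [w] that are selected by [Q]. *)
Definition cells (w : R) n (Q : nat -> bool) : R := w * \sum_(k < n) (Q k)%:R.

Lemma cell_cover (w : R) n (Q : nat -> bool) : 0 < w ->
  exists C : set (measurableTypeR R), [/\ measurable C, (mu C <= (cells w n Q)%:E)%E &
    forall s, 0 <= s < w * n%:R ->
    (forall k, (k < n)%N -> w * k%:R <= s < w * k.+1%:R -> Q k) -> C s].
Proof.
move=> w0.
pose I k : set (measurableTypeR R) := if Q k then `[w * k%:R, w * k.+1%:R[%classic else set0.
have mI k : measurable (I k).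
  by rewrite /I; case: ifP => _ //; exact: measurable_itv.
exists (\big[setU/set0]_(k < n) I k); split.
- exact: bigsetU_measurable.
- apply: (@le_trans _ _ (\sum_(k < n) mu (I k))%E); first exact: Boole_inequality.
  rewrite /cells mulr_sumr -sumEFin; apply: lee_sum => k _.
  rewrite /I; case: ifP => _; last by rewrite measure0 mulr0.
  rewrite mulr1 lebesgue_measure_itv/=; case: ifP => _; last by rewrite lee_fin ltW.
  by rewrite -EFinD lee_fin -natr1 mulrDr mulr1 addrAC subrr add0r.
move=> s /andP[s0 sn] sQ.
pose k := Num.truncn (s / w).
have /andP[k1 k2] := truncn_itv (divr_ge0 s0 (ltW w0)).
rewrite ler_pdivlMr// mulrC in k1; rewrite ltr_pdivrMr// mulrC in k2.
have kn : (k < n)%N.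
  rewrite -(ltr_nat R) -(ltr_pM2l w0); exact: le_lt_trans k1 sn.
rewrite -bigcup_mkord; exists k => //=.
by rewrite /I (sQ k kn) ?k1 ?k2//= in_itv/= k1 k2.
Qed.

Variables (Y b v : R -> R) (c : R).
Hypotheses (c0 : 0 < c) (Yc : continuous Y) (bc : continuous b).
Hypothesis v_mono : forall s t : R, 0 <= s -> s <= t -> v s <= v t.
Hypothesis hY : forall s t : R, 0 <= s -> s <= t ->
  `|Y t - Y s - c * (b t - b s)| <= v t - v s.

(** The threshold [r] lies between the time step [h] and the Brownian scale [sqrt h]: both ratios
    [h / r] and [r / sqrt h] equal [2^-1 ^+ l], so both exceptional sets become small, and the
    probabilities are summable. *)
Definition hstep l : R := 16^-1 ^+ l.
Definition rstep l : R := 8^-1 ^+ l.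
Local Notation h := hstep.
Local Notation r := rstep.

(** Only finitely many increments are inspected, which makes this an event with a computable
    probability. The threshold is [2 * r l] rather than [r l] to absorb the oscillation of the
    increment within a cell. *)
Definition small_incr (T m l n : nat) := cells (T.+1%:R / n.+1%:R) n.+1
    (fun k => `|b (mesh T.+1%:R n.+1 k + h l) - b (mesh T.+1%:R n.+1 k)| <= 2 * r l) <= m.+1%:R^-1.

Hypothesis hb : forall T m : nat, \forall l \near \oo, forall n0, exists2 n, (n0 <= n)%N &
  small_incr T m l n.

Let h0 l : 0 < h l. Proof. by rewrite exprn_gt0. Qed.
Let r0 l : 0 < r l. Proof. by rewrite exprn_gt0. Qed.

Let small_b (T m : nat) : \forall l \near \oo,
  exists C : set (measurableTypeR R), [/\ measurable C, (mu C <= (m.+1%:R^-1)%:E)%E &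
    forall s : R, 0 <= s < T.+1%:R -> `|b (s + h l) - b s| <= r l -> C s].
Proof.
apply: filterS (hb T m) => l hl.
have Tp : 0 < T.+1%:R :> R by rewrite ltr0n.
have wc : {within `[0, +oo[, continuous (fun s : R => b (s + h l) - b s)}.
  apply: continuous_subspaceT => s; apply: cvgB; last exact: bc.
  apply: (@continuous_comp _ _ _ (fun s : R => s + h l) b); last exact: bc.
  by apply: cvgD; [exact: cvg_id|exact: cvg_cst].
have [dl dl0 hdl] := unif_within T.+1%:R wc (r0 l).
have [n nn hn] := hl (Num.truncn (T.+1%:R / dl)).
have w0 : 0 < T.+1%:R / n.+1%:R :> R by rewrite divr_gt0// ltr0n.
have wdl : T.+1%:R / n.+1%:R <= dl.
  rewrite ler_pdivrMr ?ltr0n// mulrC -ler_pdivrMr//.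
  by apply: (le_trans (ltW (truncnS_gt _))); rewrite ler_nat.
have meshE k : T.+1%:R / n.+1%:R * k%:R = mesh T.+1%:R n.+1 k :> R.
  by rewrite /mesh mulrAC mulrA.
have [C [mC PC hC]] := cell_cover n.+1
  (fun k => `|b (mesh T.+1%:R n.+1 k + h l) - b (mesh T.+1%:R n.+1 k)| <= 2 * r l) w0.
exists C; split => //; first by apply: (le_trans PC); rewrite lee_fin.
move=> s /andP[s0 sT] sr; apply: hC; first by rewrite s0 divfK// pnatr_eq0.
move=> k kn; rewrite !meshE meshS => /andP[k1 k2].
have m0 := @mesh_ge0 R T.+1%:R n.+1 k (ltW Tp).
have mT := mesh_le (ltW Tp) (ltnW kn).
have hd : `|b (mesh T.+1%:R n.+1 k + h l) - b (mesh T.+1%:R n.+1 k) - (b (s + h l) - b s)| <= r l.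
  apply: hdl; rewrite ?s0 ?m0 ?mT ?(ltW sT)//.
  rewrite distrC ger0_norm ?subr_ge0//; apply: le_trans wdl.
  by rewrite lerBlDl ltW.
move: hd sr; rewrite !ler_norml => /andP[? ?] /andP[? ?]; apply/andP; split; lra.
Qed.

(** A time at which [v] grows by more than [c * r l] within [h l] lies in a cell such that [v] grows
    by that much over this cell and the next one. Telescoping bounds the number of such cells; the
    factor 2 is due to the overlap of these windows. *)
Let small_v (T : nat) l : exists C : set (measurableTypeR R), [/\ measurable C,
    (mu C <= (2 * (v T.+2%:R - v 0) / c * 2^-1 ^+ l)%:E)%E &
    forall s : R, 0 <= s < T.+1%:R -> c * r l < v (s + h l) - v s -> C s].
Proof.
pose n := (T.+1 * 16 ^ l)%N.
have hn : h l * n%:R = T.+1%:R.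
  by rewrite /n /hstep natrM natrX mulrCA -exprMn mulVf// expr1n mulr1.
pose V k := v (h l * k%:R).
have V_mono k m : (k <= m)%N -> V k <= V m.
  move=> km; apply: v_mono; first by rewrite mulr_ge0// ltW.
  by rewrite ler_pM2l// ler_nat.
have [C [mC PC hC]] := cell_cover n (fun k => c * r l < V k.+2 - V k) (h0 l).
exists C; split => //.
- apply: (le_trans PC); rewrite lee_fin /cells.
  have cr : 0 < c * r l by rewrite mulr_gt0.
  have tele m : \sum_(k < m) (V k.+2 - V k) = V m.+1 + V m - V 1%N - V 0%N.
    elim: m => [|m IH]; first by rewrite big_ord0; ring.
    by rewrite big_ord_recr/= IH; ring.
  have q1 : c * r l * \sum_(k < n) (c * r l < V k.+2 - V k)%R%:R <= 2 * (v T.+2%:R - v 0).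
    apply: (@le_trans _ _ (\sum_(k < n) (V k.+2 - V k))).
      rewrite mulr_sumr; apply: ler_sum => k _; case: ltP => hk; first by rewrite mulr1 ltW.
      rewrite mulr0 subr_ge0; exact: V_mono (leqW (leqnSn k)).
    rewrite tele; have a1 := V_mono 0%N 1%N isT; have a2 := V_mono n n.+1 (leqnSn n).
    have a3 : V n.+1 <= v T.+2%:R.
      apply: v_mono; first by rewrite mulr_ge0// ltW.
      rewrite -natr1 mulrDr hn mulr1 -[T.+2%:R]natr1 lerD2l.
      by rewrite /hstep exprn_ile1 ?invr_ge0// invf_le1// ler1n.
    have a4 : V 0%N = v 0 by rewrite /V mulr0.
    lra.
  have -> : h l = c * r l * (2^-1 ^+ l / c).
    have -> : h l = r l * 2^-1 ^+ l by rewrite /hstep /rstep -exprMn; congr (_ ^+ _); field.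
    by field; rewrite gt_eqF.
  rewrite mulrAC; apply: le_trans (ler_wpM2r _ q1) _; last by rewrite mulrA mulrAC.
  by rewrite divr_ge0 ?(ltW c0)// exprn_ge0.
move=> s /andP[s0 sT] sr; apply: hC; first by rewrite hn s0.
move=> k kn /andP[k1 k2]; apply: (lt_le_trans sr).
have b1 : V k <= v s by apply: v_mono => //; rewrite mulr_ge0// ltW.
have b2 : v (s + h l) <= V k.+2.
  apply: v_mono; first by rewrite addr_ge0// ltW.
  by rewrite -[k.+2%:R]natr1 mulrDr mulr1 lerD2r ltW.
lra.
Qed.

(* If [Y] vanishes at [s] and at [s + h_l], then [b (s + h_l) - b s] is at most
   [(v (s + h_l) - v s) / c], which is below [r_l = h_l^(3/4)] except on a set of
   measure [O(h_l / r_l)]; but the increments of [b] are rarely that small. Hence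
   the zero set is almost disjoint from its small translates, so it is null. *)
Lemma null_of_increments (T : nat) :
  mu ([set s | 0 <= s < T.+1%:R /\ Y s = 0] : set (measurableTypeR R)) = 0%E.
Proof.
set Z := [set s | _].
have mE (f : R -> R) (A : set R) : continuous f -> measurable A ->
    measurable (f @^-1` A : set (measurableTypeR R)).
  move=> fc mA; have mf : measurable_fun setT f by exact: continuous_measurable_fun.
  by rewrite -[X in measurable X]setTI; exact: mf.
have mZ : measurable (Z : set (measurableTypeR R)).
  rewrite (_ : Z = `[0%R, T.+1%:R[%classic `&` Y @^-1` [set 0]).
    by apply: measurableI; [exact: measurable_itv|exact: mE].
  by apply/seteqP; split => s; rewrite /Z /= in_itv.
(* By uniform continuity, [|Y|] is small on small translates of the zero set. Where [Y] is small
   without vanishing, the set [W k] takes over, and its measure tends to 0 because the sets decrease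
   to the empty set. *)
pose W k : set (measurableTypeR R) := [set s | [/\ 0 <= s < T.+2%:R, `|Y s| <= k.+1%:R^-1 & Y s <>
  0]].
have mW k : measurable (W k).
  rewrite (_ : W k = `[0%R, T.+2%:R[%classic `&` (Y @^-1` `[- k.+1%:R^-1, k.+1%:R^-1] `&` Y @^-1`
    ~` [set 0])).
    apply: measurableI; first exact: measurable_itv.
    apply: measurableI; first by apply: mE => //; exact: measurable_itv.
    by apply: mE => //; exact: measurableC.
  apply/seteqP; split => s; rewrite /W /= !in_itv/= ler_norml.
    by case=> a1 a2 a3.
  by case=> a1 [a2 a3].
have W0 : mu (W k) @[k --> \oo] --> 0%E.
  rewrite -(measure0 mu) (_ : set0 = \bigcap_k W k).
    apply: nonincreasing_cvg_mu => //.
    - apply: (@le_lt_trans _ _ (mu `[0%R, T.+2%:R[%classic)).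
        apply: le_measure; rewrite ?inE; [exact: mW|exact: measurable_itv|].
        by move=> s [s0 _ _] /=; rewrite in_itv.
      by rewrite lebesgue_measure_itv/=; case: ifP; rewrite ?ltry.
    - exact: bigcap_measurableType.
    move=> k m km; apply/subsetPset => s [a1 a2 a3]; split => //; apply: (le_trans a2).
    by rewrite lef_pV2 ?posrE ?ltr0n// ler_nat.
  apply/seteqP; split => // s Ws; have [_ _ Ys] := Ws 0%N I.
  have Y0 : 0 < `|Y s| by rewrite normr_gt0; exact/eqP.
  have [_ + _] := Ws (Num.truncn `|Y s|^-1) I.
  rewrite leNgt => /negP; apply.
  by rewrite invf_plt ?posrE// truncnS_gt.
apply/eqP; rewrite eq_le measure_ge0 andbT; apply/lee_addgt0Pr => e e0; rewrite add0e.
have e3 : 0 < e / 3 by rewrite divr_gt0.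
have [k hk] : exists k, (mu (W k) <= (e / 3)%:E)%E.
  apply: contrapT => /forallNP nW.
  have L : ((e / 3)%:E <= lim (mu (W k) @[k --> \oo]))%E.
    apply: lime_ge; first by apply/cvg_ex; exists 0%E.
    by apply: nearW => k; rewrite ltW// ltNge; exact/negP.
  by move: L; rewrite (cvg_lim (@ereal_hausdorff R) W0) lee_fin leNgt e3.
have ki : 0 < k.+1%:R^-1 :> R by rewrite invr_gt0.
have [dl dl0 hdl] := unif_within T.+2%:R (within_continuous Yc) ki.
pose K := 2 * (v T.+2%:R - v 0) / c.
have H : \forall l \near \oo, exists Zh : set (measurableTypeR R), (mu Zh <= (e / 3 + e / 3)%:E)%E
  /\
    [/\ measurable Zh, h l <= dl & forall s, Z s -> Y (s + h l) = 0 -> Zh s].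
  near=> l.
  have [C [mC PC hC]] : exists C : set (measurableTypeR R), [/\ measurable C,
    (mu C <= ((Num.truncn (e / 3)^-1).+1%:R^-1)%:E)%E &
    forall s : R, 0 <= s < T.+1%:R -> `|b (s + h l) - b s| <= r l -> C s].
    by near: l; exact: small_b.
  have [C' [mC' PC' hC']] := small_v T l.
  exists (C `|` C'); split.
    apply: (le_trans (measureU2 _ _ _)) => //; rewrite EFinD; apply: leeD.
      apply: (le_trans PC); rewrite lee_fin invf_ple ?posrE ?ltr0n//.
      by rewrite ltW// truncnS_gt.
    apply: (le_trans PC'); rewrite lee_fin -/K.
    by near: l; apply: geometric_small => //; rewrite ?invr_ge0// invf_lt1// ltr1n.
  split; first exact: measurableU.
    by rewrite -[h l]mul1r; near: l; apply: geometric_small => //;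
      rewrite ?invr_ge0// invf_lt1// ltr1n.
  move=> s [sT Ys] Ysh; have /andP[s0 _] := sT.
  have sh : s <= s + h l by rewrite lerDl ltW.
  have := hY s0 sh; rewrite Ys Ysh subrr sub0r normrN normrM (gtr0_norm c0) => hv.
  have [hr|hr] := leP `|b (s + h l) - b s| (r l); first by left; exact: hC.
  right; apply: hC' => //; apply: lt_le_trans hv; by rewrite ltr_pM2l.
have [l [Zh [PZh [mZh hl hZh]]]] := filter_ex H.
have hl1 : h l <= 1 by rewrite /hstep exprn_ile1 ?invr_ge0// invf_le1// ler1n.
(* A point of the translate of [Z] by [h l] is either again a zero, so that the original point lies
   in [Zh], or it lies in [W k]. *)
rewrite -(lebesgue_measure_shift (- h l) mZ).
apply: (@le_trans _ _ (mu ((fun s => - h l + s) @^-1` Zh `|` W k))).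
  have mC : measurable ((fun s => - h l + s) @^-1` Zh : set (measurableTypeR R)).
    rewrite -[X in measurable X]setTI.
    have mf : measurable_fun setT (fun s : measurableTypeR R => - h l + s : measurableTypeR R).
      by apply: measurable_funD.
    exact: mf.
  apply: le_measure; rewrite ?inE//.
  - by apply: mE => // s; apply: cvgD; [exact: cvg_cst|exact: cvg_id].
  - exact: measurableU.
  move=> s [/= /andP[s0 sT] Ys].
  have hp := h0 l.
  have [Ys0|Ys0] := eqVneq (Y s) 0.
    left => /=; apply: hZh; first by split => //; rewrite s0.
    by rewrite addrC addNKr.
  right; split; last exact/eqP.
    by rewrite -[T.+2%:R]natr1; apply/andP; split; lra.
  have := hdl (- h l + s) s; rewrite Ys subr0; apply.
  - by rewrite s0 (le_trans (ltW sT))// ler_nat.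
  - by rewrite -[T.+2%:R]natr1; apply/andP; split; lra.
  - by rewrite opprD opprK addrC addrNK ger0_norm// ltW.
have mC : measurable ((fun s => - h l + s) @^-1` Zh : set (measurableTypeR R)).
  rewrite -[X in measurable X]setTI.
  have mf : measurable_fun setT (fun s : measurableTypeR R => - h l + s : measurableTypeR R).
    by apply: measurable_funD.
  exact: mf.
apply: (le_trans (measureU2 _ _ _)) => //.
apply: (@le_trans _ _ (mu Zh + mu (W k))%E).
  by apply: leeD => //; rewrite -[leRHS](lebesgue_measure_shift (- h l) mZh).
rewrite (_ : e = e / 3 + e / 3 + e / 3); last by field.
by rewrite EFinD; apply: leeD.
Unshelve. all: by end_near. Qed.

End null.

(** * Collisions *)
Section collisions.
Context {R : realType} {d : measure_display} {T : measurableType d}.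
Variables (P : probability T R) (Fil : R -> set (set T)).
Hypothesis HF : standard_filtration P Fil.
Variables (N : nat) (B : 'I_N -> R -> T -> R).
Hypothesis HB : forall i : 'I_N, brownian_motion P Fil (B i).
Hypothesis HI : independent_processes P B.
Variables (i j : 'I_N).
Hypothesis ij : i != j.
Local Notation mu := (@lebesgue_measure R).

Lemma sigma_increment k (s t : R) (A : set R) : 0 <= s -> 0 <= t -> measurable A ->
  sigma_process (B k) (increment (B k) s t @^-1` A).
Proof.
move=> s0 t0 mA; pose G := [set A' | exists t (Y : set R),
  [/\ 0 <= t, measurable Y & A' = B k t @^-1` Y]].
have mB u : 0 <= u -> measurable_fun setT (B k u : g_sigma_algebraType G -> R).
  move=> u0 _ Y mY; rewrite setTI; apply: sub_sigma_algebra.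
  by exists u, Y.
have mI : measurable_fun setT (increment (B k) s t : g_sigma_algebraType G -> R).
  by apply: measurable_funB; exact: mB.
by have := mI measurableT A mA; rewrite setTI.
Qed.

Lemma increment_ball (s t r : R) : 0 <= s -> s < t -> 0 <= r ->
  (P [set w | (`|increment (B i) s t w - increment (B j) s t w| <= r)%R] <=
    (2 * r / Num.sqrt (t - s))%:E)%E.
Proof.
move=> s0 st r0; have t0 := le_trans s0 (ltW st).
have mI k : measurable_fun setT (increment (B k) s t).
  by apply: (adapted_fun_measurable HF t0); exact: (adapted_increment HF (HB k) s0 (ltW st)).
have q0 : 0 < Num.sqrt (t - s) by rewrite sqrtr_gt0 subr_gt0.
apply: indep_small_ball => // [A C mA mC|v].
  pose E k := if k == i then increment (B i) s t @^-1` A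
    else if k == j then increment (B j) s t @^-1` C else setT.
  have := HI (E := E); rewrite (_ : \bigcap_k E k = increment (B i) s t @^-1` A `&` increment (B
    j) s t @^-1` C); last first.
    apply/seteqP; split => w.
      move=> Ew; split; [have := Ew i I; rewrite /E eqxx//|have := Ew j I].
      by rewrite /E eqxx eq_sym (negbTE ij).
    move=> [wA wC] k _; rewrite /E; case: eqP => // _; by case: eqP.
  rewrite (bigD1 i)//= (bigD1 j) 1?eq_sym//= big1 => [->|k /andP[ki kj]].
  - by rewrite /E !eqxx eq_sym (negbTE ij) mule1.
  - move=> k; rewrite /E; case: eqP => [->|_]; first exact: sigma_increment.
    case: eqP => [->|_]; first exact: sigma_increment.
    rewrite (_ : setT = increment (B k) s t @^-1` setT)//; exact: sigma_increment.
  - by rewrite /E (negbTE ki) (negbTE kj) probability_setT.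
have [_ _ _ law _] := HB j.
rewrite law//; last first.
  rewrite (_ : [set x | _] = `[v - r, v + r]%classic); first exact: measurable_itv.
  apply/seteqP; split => x /=; rewrite in_itv/= ler_norml.
    by move=> /andP[? ?]; apply/andP; split; lra.
  by move=> /andP[? ?]; apply/andP; split; lra.
exact: normal_prob_ball.
Qed.

Definition noise_diff (w : T) (s : R) : R := B i (Num.max s 0) w - B j (Num.max s 0) w.

(** By [increment_ball] each increment is small with probability at most [4 * rstep l / sqrt (hstep
    l) = 4 * 2^-1 ^+ l], so the expected length of the selected cells has a summable bound that is
    independent of the mesh; then Markov and Borel-Cantelli. *)
Lemma ae_small_incr (a m : nat) : {ae P, forall w, \forall l \near \oo, forall n0,
  exists2 n, (n0 <= n)%N & small_incr (noise_diff w) a m l n}.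
Proof.
pose bad (l n : nat) : set T := [set w | m.+1%:R^-1 < cells (a.+1%:R / n.+1%:R : R) n.+1
    (fun k => `|noise_diff w (mesh a.+1%:R n.+1 k + hstep l) - noise_diff w (mesh a.+1%:R n.+1 k)|
      <= 2 * rstep l)].
pose p l : R := 4 * a.+1%:R * m.+1%:R * 2^-1 ^+ l.
have a0 : 0 < a.+1%:R :> R by rewrite ltr0n.
have m0 : 0 < m.+1%:R^-1 :> R by rewrite invr_gt0.
have plane_bounded l n : measurable (bad l n) /\ (P (bad l n) <= (p l)%:E)%E.
  have h0 : 0 < hstep l :> R by rewrite exprn_gt0.
  have r0 : 0 < rstep l :> R by rewrite exprn_gt0.
  pose u k := @mesh R a.+1%:R n.+1 k.
  have u0 k : 0 <= u k by exact: mesh_ge0 (ltW a0).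
  pose A k : set T := [set w | `|increment (B i) (u k) (u k + hstep l) w
      - increment (B j) (u k) (u k + hstep l) w| <= 2 * rstep l].
  have uh k : u k < u k + hstep l by rewrite ltrDl.
  have mA k : measurable (A k).
    have t0 : 0 <= u k + hstep l by rewrite addr_ge0// ltW.
    have mI q : measurable_fun setT (increment (B q) (u k) (u k + hstep l)).
      by apply: (adapted_fun_measurable HF t0); exact: (adapted_increment HF (HB q) (u0 k) (ltW
        (uh k))).
    have mf : measurable_fun setT (fun w => `|increment (B i) (u k) (u k + hstep l) w
      - increment (B j) (u k) (u k + hstep l) w|).
      by apply: measurableT_comp => //; exact: measurable_funB.
    rewrite (_ : A k = setT `&` (fun w => `|increment (B i) (u k) (u k + hstep l) w
      - increment (B j) (u k) (u k + hstep l) w|) @^-1` `]-oo, 2 * rstep l]%classic).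
      by apply: mf => //; exact: measurable_itv.
    by rewrite setTI; apply/seteqP; split => z /=; rewrite in_itv.
  pose C w : R := a.+1%:R / n.+1%:R * \sum_(k < n.+1) \1_(A k) w.
  have -> : bad l n = [set w | m.+1%:R^-1 < C w].
    suff CE w : cells (a.+1%:R / n.+1%:R : R) n.+1
        (fun k => `|noise_diff w (u k + hstep l) - noise_diff w (u k)| <= 2 * rstep l) = C w.
      by apply/seteqP; split => w; rewrite /bad /= CE.
    rewrite /cells /C; congr (_ * _); apply: eq_bigr => k _.
    rewrite indicE; congr (nat_of_bool _)%:R.
    have E : noise_diff w (u k + hstep l) - noise_diff w (u k) = increment (B i) (u k) (u k +
      hstep l) w
        - increment (B j) (u k) (u k + hstep l) w.
      by rewrite /noise_diff !max_l ?u0 ?addr_ge0 ?u0 ?(ltW h0)// /increment; ring.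
    by rewrite E; apply/idP/idP; rewrite inE.
  have iA k : P.-integrable setT (EFin \o (\1_(A k) : T -> R)).
    exact: integrable_indic.
  have [is_ es] : P.-integrable setT (EFin \o (fun w => \sum_(k < n.+1) \1_(A k) w : R)) /\
     \int[P]_w (\sum_(k < n.+1) \1_(A k) w) <= \sum_(k < n.+1) (2 * (2 * rstep l) / Num.sqrt
       (hstep l)).
    elim: (index_enum _) => [|k s [IH1 IH2]].
      rewrite big_nil (_ : (fun w => _) = fun=> 0); last by apply/funext => w; rewrite big_nil.
      by rewrite Rintegral_cstP; split => //; exact: integrable_cstP.
    rewrite big_cons (_ : (fun w => _) = fun w => \1_(A k) w + \sum_(j <- s) \1_(A j) w);
      last first.
      by apply/funext => w; rewrite big_cons.
    rewrite RintegralD//; split; first exact: integrableD_fun.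
    apply: lerD => //; rewrite -lee_fin /Rintegral fineK; last exact: (integrable_fin_num
      measurableT (iA k)).
    rewrite integral_indic// setIT.
    have := increment_ball (u0 k) (uh k) (mulr_ge0 (ler0n R 2) (ltW r0)).
    by rewrite addrAC subrr add0r.
  have iC : P.-integrable setT (EFin \o C) by exact: integrableZ_fun.
  have C0 w : 0 <= C w by rewrite mulr_ge0 ?divr_ge0// sumr_ge0.
  have EC : \int[P]_w C w <= 4 * a.+1%:R * 2^-1 ^+ l.
    rewrite /C RintegralZl//; apply: (@le_trans _ _ (a.+1%:R / n.+1%:R *
      \sum_(k < n.+1) (2 * (2 * rstep l) / Num.sqrt (hstep l)))).
      by rewrite ler_wpM2l// divr_ge0.
    set z : R := 2 * (2 * rstep l) / _.
    have -> : a.+1%:R / n.+1%:R * \sum_(k < n.+1) z = a.+1%:R * z.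
      by rewrite sumr_const card_ord -[z *+ _]mulr_natl; field; rewrite addrC natr1 pnatr_eq0.
    rewrite /z.
    have -> : Num.sqrt (hstep l) = 4^-1 ^+ l :> R.
      have q0 : 0 <= 4^-1 ^+ l :> R by rewrite exprn_ge0// invr_ge0.
      rewrite -[RHS]ger0_norm// -sqrtr_sqr; congr Num.sqrt.
      by rewrite /hstep -exprM mulnC exprM; congr (_ ^+ _); field.
    have -> : rstep l = 2^-1 ^+ l * 4^-1 ^+ l :> R.
      by rewrite /rstep -exprMn; congr (_ ^+ _); field.
    rewrite le_eqVlt; apply/orP; left; apply/eqP.
    have q0 : 4^-1 ^+ l != 0 :> R by rewrite expf_neq0// invr_eq0.
    by field.
  split.
    have mC : measurable_fun setT C by apply/measurable_EFinP; case/integrableP : iC.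
    rewrite (_ : [set w | _] = setT `&` C @^-1` `]m.+1%:R^-1, +oo[%classic).
      by apply: mC => //; exact: measurable_itv.
    by rewrite setTI; apply/seteqP; split => w /=; rewrite in_itv/= andbT.
  apply: le_trans (markov_real iC m0 C0 EC) _.
  by rewrite lee_fin /p invrK mulrAC.
have bc := @borel_cantelli_liminf _ _ _ P bad p (4 * a.+1%:R * m.+1%:R * 2)
  (fun l n => (plane_bounded l n).1) (fun l n => (plane_bounded l n).2).
have {}bc := bc _; apply: ae_imply (bc _) => [w|n]; last first.
  by rewrite -mulr_sumr ler_wpM2l// sum_half.
apply: filterS => l h n0; have [n n0n nb] := h n0; exists n => //.
by rewrite /small_incr leNgt; apply/negP.
Qed.

End collisions.

Section nocoll.
Context {R : realType} {d : measure_display} {T : measurableType d}.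
Variables (P : probability T R) (Fil : R -> set (set T)).
Variable x : forall N : nat, 'I_N -> R.
Variables (B lam : forall N : nat, 'I_N -> R -> T -> R).
Hypothesis HF : standard_filtration P Fil.
Hypothesis HB : forall (N : nat) (i : 'I_N), brownian_motion P Fil (B i).
Hypothesis HI : forall N : nat, (0 < N)%N -> independent_processes P (@B N).
Hypothesis HS : forall N : nat, (0 < N)%N -> dyson_solution P Fil (@x N) (@B N) (@lam N).
Local Notation mu := (@lebesgue_measure R).

(** The difference of two particles is a path of finite variation, as the drifts are integrable,
    plus a multiple of the difference of their Brownian motions. The function [v] is the sum of the
    two total variations, as [null_of_increments] requires. *)
Lemma good_nocoll w N (i j : 'I_N) : good_path x B lam w -> i != j ->
  (forall a m, \forall l \near \oo, forall n0, exists2 n, (n0 <= n)%N &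
     small_incr (noise_diff (@B N) i j w) a m l n) ->
  {ae mu, forall s : R, 0 <= s -> path lam w i s != path lam w j s}.
Proof.
move=> gw ij hb; have N0 : (0 < N)%N by exact: leq_ltn_trans (ltn_ord i).
pose Y s : R := path lam w i (Num.max s 0) - path lam w j (Num.max s 0).
have [li bi gi ei] := gw N i; have [lj bj gj ej] := gw N j.
have Yc : continuous Y.
  by move=> s; apply: cvgB; [exact: (ext_continuous li)|exact: (ext_continuous lj)].
have bc : continuous (noise_diff (@B N) i j w).
  by move=> s; apply: cvgB; [exact: (ext_continuous bi)|exact: (ext_continuous bj)].
have c0 : 0 < 2 / Num.sqrt N%:R :> R by rewrite divr_gt0// sqrtr_gt0 ltr0n.
pose v t : R := \int[mu]_(s in `[0, t]) `|particle_drift (path lam w) i s|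
  + \int[mu]_(s in `[0, t]) `|particle_drift (path lam w) j s|.
have vE s t : 0 <= s -> s <= t -> v t - v s = itv_int (fun r => `|particle_drift (path lam w) i
  r|) s t
    + itv_int (fun r => `|particle_drift (path lam w) j r|) s t.
  move=> s0 st; rewrite -(itv_intE (absg_integrable gi) s0 st) -(itv_intE (absg_integrable gj) s0
    st).
  by rewrite /v; ring.
have vm s t : 0 <= s -> s <= t -> v s <= v t.
  by move=> s0 st; rewrite -subr_ge0 vE// addr_ge0// Rintegral_ge0.
have hY s t : 0 <= s -> s <= t ->
    `|Y t - Y s - 2 / Num.sqrt N%:R * (noise_diff (@B N) i j w t - noise_diff (@B N) i j w s)| <=
      v t - v s.
  move=> s0 st; have t0 := le_trans s0 st.
  rewrite vE// (_ : _ - _ = itv_int (particle_drift (path lam w) i) s t - itv_int (particle_drift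
    (path lam w) j) s t).
    apply: (le_trans (ler_normB _ _)); apply: lerD; apply: le_normr_Rintegral.
    - exact: measurable_itv.
    - exact: integrable_itv.
    - exact: measurable_itv.
    - exact: integrable_itv.
  rewrite -(itv_intE gi s0 st) -(itv_intE gj s0 st) /Y /noise_diff !max_l// !ei// !ej//; ring.
have H := null_of_increments c0 Yc bc vm hY hb.
have : {ae mu, forall s, forall a : nat, 0 <= s < a.+1%:R -> Y s <> 0}.
  apply: ae_countable => a.
  exists [set s | 0 <= s < a.+1%:R /\ Y s = 0]; split; last first.
    by move=> s /= /not_implyP[h /contrapT].
  - exact: H.
    rewrite (_ : [set s | _] = `[0%R, a.+1%:R[%classic `&` Y @^-1` [set 0]).
      apply: measurableI; first exact: measurable_itv.
      have mf : measurable_fun setT Y by exact: continuous_measurable_fun.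
      by rewrite -[X in measurable X]setTI; exact: mf.
    by apply/seteqP; split => s /=; rewrite in_itv.
apply: ae_imply => s h s0; apply/eqP => E.
apply: (h (Num.truncn s)); first by rewrite s0 truncnS_gt.
by rewrite /Y max_l// E subrr.
Qed.

Lemma ae_nocoll : {ae P, forall w, forall N, {ae mu, forall s : R, 0 <= s ->
  forall i j : 'I_N, i != j -> path lam w i s != path lam w j s}}.
Proof.
have H : {ae P, forall w, forall N (i j : 'I_N) (a m : nat), i != j ->
    \forall l \near \oo, forall n0, exists2 n, (n0 <= n)%N & small_incr (noise_diff (@B N) i j w)
      a m l n}.
  apply: ae_countable => N; apply: ae_countable => i; apply: ae_countable => j.
  apply: ae_countable => a; apply: ae_countable => m.
  have [_|ij] := eqVneq i j; first exact: aeW.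
  have N0 : (0 < N)%N by exact: leq_ltn_trans (ltn_ord i).
  exact: ae_imply (ae_small_incr HF (@HB N) (HI N0) ij a m).
have := ae_and (ae_good_path HB HS) H; apply: ae_imply => w [gw hw] N.
have : {ae mu, forall s : R, forall i j : 'I_N, 0 <= s -> i != j -> path lam w i s != path lam w j
  s}.
  apply: ae_countable => i; apply: ae_countable => j.
  have [_|ij] := eqVneq i j; first by apply: aeW.
  apply: ae_imply (good_nocoll gw ij _) => [s h s0 _|a m]; first exact: h.
  exact: hw.
by apply: ae_imply => s h s0 i j; exact: h.
Qed.

Lemma ae_limit_dynamics : {ae P, forall w, good_path x B lam w /\ forall m : nat, limit_dynamics
  (path lam w) m.+1%:R^-1}.
Proof.
have := ae_and (ae_good_path HB HS) (ae_and ae_nocoll (ae_all_avg_limits HF HB HS)).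
apply: ae_imply => w [gw [nc H1]]; split => // m.
have m0 : 0 < m.+1%:R^-1 :> R by rewrite invr_gt0.
apply: limit_dynamics_of_drift => //; last exact: H1.
by move=> tau y N t t0; have [] := particle_obs_drift_integral tau y N gw m0 t0.
Qed.

End nocoll.

(** * From smoothed to unsmoothed distribution functions *)

Section tails.
Context {R : realType}.

(** On positive [s] the function [atan s + s^-1] is nonincreasing, and it tends to [pi / 2]. *)
Lemma atan_tail (u : R) : 0 < u -> pi / 2 - atan u <= u^-1.
Proof.
move=> u0; rewrite lerBlDr.
apply: (ler_cvg_to (@cvgy_atan R) (cvg_cst (u^-1 + atan u))).
near=> v; have uv : u < v by near: v; apply: nbhs_pinfty_gt; exact: num_real.
have v0 := lt_trans u0 uv.
have D (y : R) : 0 < y -> is_derive y 1 (fun s : R => atan s + s^-1)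
    ((1 + y ^+ 2)^-1 + (- 1 / y ^+ 2)).
  move=> y0; have y1 : y != 0 by rewrite gt_eqF.
  exact: (is_derive1D (is_derive1_atan y) (@is_derive1V R (fun s => s) y 1 y1 (is_derive1_id y))).
have D' (y : R) : y \in `]u, v[ -> is_derive y 1 (fun s : R => atan s + s^-1)
    ((1 + y ^+ 2)^-1 + (- 1 / y ^+ 2)).
  by rewrite in_itv/= => /andP[uy _]; apply: D; exact: lt_trans uy.
have [|c] := MVT uv D'.
  apply: derivable_within_continuous => y; rewrite in_itv/= => /andP[uy _].
  by have [] := D y (lt_le_trans u0 uy).
rewrite in_itv/= => /andP[uc _] E; have c0 := lt_trans u0 uc.
have : ((1 + c ^+ 2)^-1 + - 1 / c ^+ 2) * (v - u) <= 0.
  rewrite mulr_le0_ge0 ?subr_ge0 ?(ltW uv)// mulN1r subr_le0 lef_pV2 ?posrE ?exprn_gt0//.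
    by rewrite lerDr.
  by rewrite ltr_wpDr// exprn_ge0// ltW.
rewrite -E => h; have i0 : 0 < v^-1 by rewrite invr_gt0.
lra.
Unshelve. all: by end_near. Qed.

Variable eta : R.
Hypothesis eta0 : 0 < eta.

Lemma Theta_ge (dl w : R) : 0 < dl -> dl <= w -> 1 - eta / dl <= Theta eta w.
Proof.
move=> d0 dw; have w0 := lt_le_trans d0 dw.
have := atan_tail (divr_gt0 w0 eta0); rewrite invf_div => h.
have p1 : 1 <= pi :> R by have := @pi_ge2 R; lra.
have p0 : 0 < pi :> R by exact: pi_gt0.
have q : eta / w <= eta / dl by rewrite ler_pM2l// lef_pV2.
rewrite /Theta.
have q0 : 0 <= eta / dl by rewrite divr_ge0// ltW.
have i1 : pi^-1 <= 1 :> R by rewrite invf_le1.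
have i0 : 0 < pi^-1 :> R by rewrite invr_gt0.
have h2 : pi / 2 - eta / dl <= atan (w / eta) by lra.
have h3 : pi^-1 * (pi / 2 - eta / dl) <= pi^-1 * atan (w / eta) by rewrite ler_pM2l.
have h4 : pi^-1 * (eta / dl) <= eta / dl by rewrite ler_piMl.
have h5 : pi^-1 * (pi / 2) = 2^-1 :> R by move: (pi : R) p0 => p p0; field; rewrite gt_eqF.
move: h3; rewrite mulrBr h5; lra.
Qed.

Lemma ThetaN w : Theta eta (- w) = 1 - Theta eta w.
Proof. by rewrite /Theta mulNr atanN mulrN; lra. Qed.

Lemma Theta_le (dl w : R) : 0 < dl -> w <= - dl -> Theta eta w <= eta / dl.
Proof.
move=> d0 wd; rewrite -[w]opprK ThetaN.
have := @Theta_ge dl (- w) d0; rewrite lerNr => /(_ wd); lra.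
Qed.

Lemma Theta_step (dl x y : R) : 0 < dl ->
  Theta eta (x - dl - y) - eta / dl <= (y <= x)%R%:R <= Theta eta (x + dl - y) + eta / dl.
Proof.
move=> d0; have q0 : 0 <= eta / dl by rewrite divr_ge0// ltW.
have /andP[a1 a2] := Theta_bound eta (x - dl - y).
have /andP[b1 b2] := Theta_bound eta (x + dl - y).
case: (leP y x) => yx /=; apply/andP; split; try lra.
- have h : 1 - eta / dl <= Theta eta (x + dl - y) by apply: Theta_ge => //; lra.
  lra.
- have h : Theta eta (x - dl - y) <= eta / dl by apply: Theta_le => //; lra.
  lra.
Qed.

Lemma Theta_mono (w w' : R) : w <= w' -> Theta eta w <= Theta eta w'.
Proof.
move=> ww; rewrite /Theta lerD2l ler_pM2l ?invr_gt0 ?pi_gt0//; apply: le_atan.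
by rewrite ler_pM2r// invr_gt0.
Qed.

End tails.

Section shift.
Context {R : realType}.
Variables (a k : R).
Implicit Types f : R * R -> R.

Definition shift f := fun z : R * R => f (z.1, z.2 + a).

Lemma sdiff_shift (f : R -> R) x h : sdiff (fun y => f (y + a) + k) x h = sdiff f (x + a) h.
Proof. by rewrite /sdiff (addrAC x h) (addrAC x (- h)); ring. Qed.

Lemma fold_Htilde_shift (f : R -> R) x : fold_Htilde (fun y => f (y + a) + k) x = fold_Htilde f (x
  + a).
Proof. by rewrite /fold_Htilde; under eq_Rintegral do rewrite sdiff_shift. Qed.

Lemma shift_cont (z : R * R) : {for z, continuous (fun z : R * R => (z.1, z.2 + a))}.
Proof.
apply/cvgrPdist_lt => e e0; near=> z'.
have : `|z - z'| < e by near: z'; exact: (@cvgr_dist_lt _ (R * R)%type).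
rewrite [X in X < _ -> _](_ : _ = Num.max `|z.1 - z'.1| `|z.2 - z'.2|)// => h.
rewrite [X in X < _](_ : _ = Num.max `|z.1 - z'.1| `|z.2 + a - (z'.2 + a)|)//.
by rewrite opprD addrACA subrr addr0.
Unshelve. all: by end_near. Qed.

Lemma classical_solution_shift f ft fx : classical_solution f ft fx ->
  classical_solution (fun z => shift f z + k) (shift ft) (shift fx).
Proof.
case=> dt dx pos [M M0 hM] [K K0 hK] cont eqn; split.
- move=> z z0; have := is_derive1D (dt (z.1, z.2 + a) z0) (is_derive1_cst k z.1); rewrite addr0;
  exact.
- move=> z z0; have da : is_derive z.2 1 (fun y : R => y + a) (1 + 0) by exact: is_derive1D
  (is_derive1_id _) (is_derive1_cst a _).
  apply: (is_derive_eq (is_derive1D (is_derive1_compose da (dx (z.1, z.2 + a) z0)) (is_derive1_cst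
    k z.2))).
  by rewrite !addr0 mulr1.
- by move=> z z0; exact: (pos (z.1, z.2 + a)).
- exists (M + `|k|) => [|z z0]; first by rewrite addr_ge0.
  by rewrite (le_trans (ler_normD _ _))// lerD// hM.
- by exists K => // z h z0; rewrite (sdiff_shift (fun y => f (z.1, y))); exact: (hK (z.1, z.2 + a)).
- move=> z z0; apply: cvgD; last exact: cvg_cst.
  apply: (@continuous_comp _ _ _ (fun z : R * R => (z.1, z.2 + a)) f).
    exact: shift_cont.
  exact: cont.
- by move=> z z0; rewrite /fold_Htilde_x (fold_Htilde_shift (fun y => f (z.1, y)));
  exact: (eqn (z.1, z.2 + a) z0).
Qed.

Lemma smooth_bounded_shift n f : smooth_bounded n f -> smooth_bounded n (shift f).
Proof.
elim: n f => [|n IH] f [[M hM] H]; split; try by exists M => z; exact: hM.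
  by [].
have [gt [gx [[C q] st sx]]] := H; exists (shift gt), (shift gx); split; [|exact: IH|exact: IH].
exists C => z v v1 v2; have := q (z.1, z.2 + a) v v1 v2.
by rewrite /shift (_ : (z.1, z.2 + a) + v = ((z + v).1, (z + v).2 + a))//; congr pair;
  rewrite addrAC.
Qed.

Lemma smooth_solution_shift f ft fx : smooth_solution f ft fx ->
  smooth_solution (fun z => shift f z + k) (shift ft) (shift fx).
Proof.
case=> c sm [C C0 [h1 h2]]; split.
- exact: classical_solution_shift.
- move=> s0 s00 n; apply: smooth_boundedD; last exact: smooth_bounded_cst.
  exact: (smooth_bounded_shift (sm s0 s00 n)).
exists C => //; split.
  move=> z z0; rewrite /fold_Htilde_x (fold_Htilde_shift (fun y => f (z.1, y)));
    exact: (h1 (z.1, z.2 + a)).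
by move=> t t' x t0 t'0; rewrite /shift/= opprD addrACA subrr addr0; exact: h2.
Qed.

End shift.

Section planar.
Context {R : realType}.

(** Measurability for the product sigma-algebra: the function is the infimum of the cones of slope
    [C] above its values at rational points, so the set is a countable union of sublevel sets of
    cones. *)
Lemma lip_lt_measurable (g : R * R -> R) (C a : R) : 0 <= C ->
  (forall z z', `|g z - g z'| <= C * (`|z.1 - z'.1| + `|z.2 - z'.2|)) ->
  measurable ([set z | g z < a] : set (R * R)%type).
Proof.
move=> C0 gC.
pose S (p q : rat) : set (R * R)%type :=
  [set z | g (ratr p, ratr q) + C * (`|z.1 - ratr p| + `|z.2 - ratr q|) < a].
have mS p q : measurable (S p q).
  have mf : measurable_fun setT (fun z : R * R =>
      g (ratr p, ratr q) + C * (`|z.1 - ratr p| + `|z.2 - ratr q|)).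
    apply: measurable_funD => //; apply: measurable_funM => //.
    by apply: measurable_funD; apply: measurableT_comp => //; apply: measurable_funB.
  rewrite (_ : S p q = setT `&` (fun z : R * R =>
      g (ratr p, ratr q) + C * (`|z.1 - ratr p| + `|z.2 - ratr q|)) @^-1` `]-oo, a[%classic).
    by apply: mf => //; exact: measurable_itv.
  by rewrite setTI; apply/seteqP; split => z /=; rewrite in_itv.
rewrite (_ : [set z | _] = \bigcup_(p in [set: rat]) \bigcup_(q in [set: rat]) S p q).
  by apply: bigcupT_measurable_rat => p; exact: bigcupT_measurable_rat.
apply/seteqP; split => [[t x] /= h|[t x] [p _ [q _]]]; last first.
  rewrite /S /= => h; apply: le_lt_trans h.
  rewrite -lerBlDl; apply: (le_trans (ler_norm _)); exact: gC.
pose e := (a - g (t, x)) / (4 * (C + 1)).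
have C1 : 0 < C + 1 by rewrite ltr_wpDl.
have e0 : 0 < e by rewrite divr_gt0 ?mulr_gt0// subr_gt0.
have [|p] := @rat_in_itvoo R t (t + e); first by rewrite ltrDl.
rewrite in_itv/= => /andP[p1 p2].
have [|q] := @rat_in_itvoo R x (x + e); first by rewrite ltrDl.
rewrite in_itv/= => /andP[q1 q2].
exists p => //; exists q => //; rewrite /S/=.
have hp : `|t - ratr p| <= e by rewrite distrC ger0_norm; lra.
have hq : `|x - ratr q| <= e by rewrite distrC ger0_norm; lra.
have := gC (ratr p, ratr q) (t, x); rewrite /= (distrC (ratr p)) (distrC (ratr q)) => h'.
have : (C + 1) * (4 * e) = a - g (t, x) by rewrite /e; field; rewrite gt_eqF.
have n1 := normr_ge0 (t - ratr p); have n2 := normr_ge0 (x - ratr q).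
have k1 := ler_wpM2l C0 (lerD hp hq).
move: h'; rewrite ler_norml => /andP[_ h']; nra.
Qed.

End planar.

(** * The solution and its uniqueness *)
Section semicontinuity.
Context {R : realType}.
Implicit Types (G : R * R -> R) (z : R * R).

Definition lsc_on G := forall z a, halfplane z -> a < G z ->
  exists2 W, nbhs z W & forall y, W y -> halfplane y -> a < G y.

(** Points outside the half-plane are isolated in the subspace topology, so semicontinuity imposes
    nothing there. *)
Lemma lscP G : lsc G <-> lsc_on G.
Proof.
split => [lG z a z0 az|lG z a az].
  have [|W zW hW] := lG z a; first by rewrite lte_fin.
  have hz : halfplane z := z0.
  move: zW; rewrite /nbhs/= => zW.
  have : within halfplane (nbhs z) W by rewrite nbhs_subspace_in.
  move=> zW'; exists [set y | halfplane y -> W y]; first exact: zW'.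
  by move=> y Wy y0; rewrite -lte_fin; apply: hW; exact: Wy.
rewrite lte_fin in az; have [z0|z0] := pselect (halfplane z).
  have [W zW hW] := lG z a z0 az.
  exists (W `&` halfplane).
    rewrite /nbhs/= -nbhs_subspace_in//; apply: filterS zW => y Wy y0; split => //.
  by move=> y [Wy y0]; rewrite lte_fin; exact: hW.
exists [set z]; first by rewrite /nbhs/= -nbhs_subspace_out.
by move=> y ->; rewrite lte_fin.
Qed.

Section envelope.
Variables (G : R * R -> R) (M : R).
Hypothesis GM : forall z, halfplane z -> `|G z| <= M.

Let L z := limf_einf (fun y => (G y)%:E) (within halfplane (nbhs z)).

Let limf_ge z c : halfplane z ->
  (exists2 W, nbhs z W & forall y, W y -> halfplane y -> c <= G y) -> (c%:E <= L z)%E.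
Proof.
move=> z0 [W zW hW]; rewrite /L /limf_einf leeNr limf_esupE.
apply: ge_ereal_inf.
exists (ereal_sup ((\- (fun y => (G y)%:E))%E @` (W `&` halfplane))).
  by exists (W `&` halfplane) => //; apply: filterS zW => y.
apply: ge_ereal_sup => _ [y [Wy y0] <-] /=.
by rewrite lee_fin lerN2; exact: hW.
Qed.

Let limf_le z c : halfplane z ->
  (forall W, nbhs z W -> exists y, [/\ W y, halfplane y & G y <= c]) -> (L z <= c%:E)%E.
Proof.
move=> z0 H; rewrite /L /limf_einf leeNl limf_esupE.
apply: le_ereal_inf_tmp => _ [W zW <-].
have [y [Wy y0 Gy]] := H _ zW.
apply: ereal_sup_ge; exists (- (G y)%:E)%E; first by exists y => //; exact: Wy.
by rewrite leeN2 lee_fin.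
Qed.

Let Lfin z : halfplane z -> L z \is a fin_num.
Proof.
move=> z0; rewrite fin_numElt; apply/andP; split.
  apply: (@lt_le_trans _ _ (- M)%:E); first exact: ltNyr.
  apply: limf_ge => //; exists setT; first exact: filterT.
  by move=> y _ y0; have := GM y0; rewrite ler_norml => /andP[].
apply: (@le_lt_trans _ _ M%:E); last exact: ltry.
apply: limf_le => // W zW; exists z; split => //; first exact: nbhs_singleton.
by apply: (le_trans (ler_norm _)); exact: GM.
Qed.

Lemma env_ge z c : halfplane z ->
  (exists2 W, nbhs z W & forall y, W y -> halfplane y -> c <= G y) -> c <= lsc_env G z.
Proof. by move=> z0 h; rewrite -lee_fin /lsc_env fineK ?Lfin//; exact: limf_ge. Qed.

Lemma env_le z c : halfplane z ->
  (forall W, nbhs z W -> exists y, [/\ W y, halfplane y & G y <= c]) -> lsc_env G z <= c.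
Proof. by move=> z0 h; rewrite -lee_fin /lsc_env fineK ?Lfin//; exact: limf_le. Qed.

Lemma env_near z a : halfplane z -> a < lsc_env G z ->
  exists2 W, nbhs z W & forall y, W y -> halfplane y -> a < G y.
Proof.
move=> z0; rewrite -lte_fin /lsc_env fineK ?Lfin// -/(L z).
rewrite /L /limf_einf lteNr limf_esupE => /ereal_inf_lt[_ [W zW <-] h].
exists [set y | halfplane y -> W y] => // y Wy y0.
have : (- (G y)%:E <= ereal_sup ((\- (fun y => (G y)%:E))%E @` W))%E.
  by apply: ereal_sup_ubound; exists y => //; exact: Wy.
by move=> /le_lt_trans /(_ h); rewrite lteN2 lte_fin.
Qed.

Lemma env_le_self z : halfplane z -> lsc_env G z <= G z.
Proof. by move=> z0; apply: env_le => // W zW; exists z; split => //; exact: nbhs_singleton. Qed.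

Lemma env_bound z : halfplane z -> `|lsc_env G z| <= M.
Proof.
move=> z0; rewrite ler_norml; apply/andP; split.
  apply: env_ge => //; exists setT; first exact: filterT.
  by move=> y _ y0; have := GM y0; rewrite ler_norml => /andP[].
by apply: (le_trans (env_le_self z0)); apply: (le_trans (ler_norm _)); exact: GM.
Qed.

Lemma shift_near (z : R * R) (b : R) W : nbhs (z.1, z.2 + b) W ->
  nbhs z [set y : R * R | W (y.1, y.2 + b)].
Proof. by move=> zW; exact: (@shift_cont R b z _ zW). Qed.

Lemma env_mono t x y : (forall s, 0 <= s -> {homo (fun x => G (s, x)) : x y / x <= y}) ->
  0 <= t -> x <= y -> lsc_env G (t, x) <= lsc_env G (t, y).
Proof.
move=> Gm t0 xy; rewrite leNgt; apply/negP => h.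
pose c := (lsc_env G (t, x) + lsc_env G (t, y)) / 2.
have [W xW hW] : exists2 W, nbhs (t, x) W & forall y, W y -> halfplane y -> c < G y.
  by apply: env_near => //; rewrite /c; lra.
have : c <= lsc_env G (t, y).
  apply: env_ge => //; exists [set z : R * R | W (z.1, z.2 + (x - y))].
    by apply: shift_near => /=; rewrite addrC subrK.
  move=> [s v] /= Wz s0; apply: ltW; apply: lt_le_trans (hW _ Wz s0) _.
  by apply: Gm => //; lra.
rewrite /c; lra.
Qed.

End envelope.
End semicontinuity.

(** * The envelopes of a family of smooth solutions *)

Section family.
Context {R : realType}.
Local Notation mu := (@lebesgue_measure R).
Variables (h ht hx : nat -> R * R -> R) (mu0 : {measure set R -> \bar R}) (M : R -> R).
Let eta m : R := m.+1%:R^-1.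
Hypothesis hN : forall m, smooth_solution (h m) (ht m) (hx m).
Hypothesis hmono : forall m t x y, 0 <= t -> x <= y -> h m (t, x) <= h m (t, y).
Hypothesis hlip : forall m, exists2 C, 0 <= C & forall z z', halfplane z -> halfplane z' ->
  `|h m z - h m z'| <= C * (`|z.1 - z'.1| + `|z.2 - z'.2|).
Hypothesis hb : forall m z, halfplane z -> `|h m z| <= 1.
Hypothesis hil : forall m m' t x dl dl', 0 <= t -> 0 < dl -> 0 < dl' ->
  h m (t, x - dl) - eta m / dl <= h m' (t, x + dl') + eta m' / dl'.
Hypothesis hM : forall x, mu0 `]-oo, x]%classic = (M x)%:E.
Hypothesis hi : forall m x dl, 0 < dl ->
  h m (0, x - dl) - eta m / dl <= M x <= h m (0, x + dl) + eta m / dl.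

Let eta0 m : 0 < eta m. Proof. by rewrite invr_gt0. Qed.

Let eta_small e : 0 < e -> exists m, eta m <= e.
Proof.
move=> e0; exists (Num.truncn e^-1).
by rewrite /eta invf_ple ?posrE ?ltr0n// ltW// truncnS_gt.
Qed.

(* [up] and [lo] are classical solutions on both sides of the sought solution;
   every [up] is above every [lo], and their gap vanishes up to a shift. *)
Definition up m dl (z : R * R) : R := h m (z.1, z.2 + dl) + eta m / dl.
Definition lo m dl (z : R * R) : R := h m (z.1, z.2 - dl) - eta m / dl.

Definition Fsol z : R := inf [set r | exists m dl, 0 < dl /\ r = up m dl z].
Definition Vsol z : R := sup [set r | exists m dl, 0 < dl /\ r = lo m dl z].

Let q0 m dl : 0 < dl -> 0 <= eta m / dl.
Proof. by move=> d0; rewrite divr_ge0// ltW. Qed.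

Lemma F_le z m dl : halfplane z -> 0 < dl -> Fsol z <= up m dl z.
Proof.
move=> z0 d0; apply: ge_inf; last by exists m, dl.
exists (-1) => _ [m' [dl' [d'0 ->]]]; have := @hb m' (z.1, z.2 + dl') z0.
by have := q0 m' d'0; rewrite ler_norml /up => ? /andP[? _]; lra.
Qed.

Lemma F_ge z c : (forall m dl, 0 < dl -> c <= up m dl z) -> c <= Fsol z.
Proof.
move=> H; apply: lb_le_inf; first by exists (up 0 1 z), 0%N, 1.
by move=> _ [m [dl [d0 ->]]]; exact: H.
Qed.

Lemma V_ge z m dl : halfplane z -> 0 < dl -> lo m dl z <= Vsol z.
Proof.
move=> z0 d0; apply: ub_le_sup; last by exists m, dl.
exists 1 => _ [m' [dl' [d'0 ->]]]; have := @hb m' (z.1, z.2 - dl') z0.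
by have := q0 m' d'0; rewrite ler_norml /lo => ? /andP[_ ?]; lra.
Qed.

Lemma V_le z c : (forall m dl, 0 < dl -> lo m dl z <= c) -> Vsol z <= c.
Proof.
move=> H; apply: ge_sup; first by exists (lo 0 1 z), 0%N, 1.
by move=> _ [m [dl [d0 ->]]]; exact: H.
Qed.

Lemma V_le_F z : halfplane z -> Vsol z <= Fsol z.
Proof.
move=> z0; apply: F_ge => m dl d0; apply: V_le => m' dl' d'0.
exact: hil.
Qed.

(** With shift [a / 2], the upper function at [x - a] and the lower one at [x] both evaluate [h m]
    at [x - a / 2]; they differ by [4 * eta m / a], which is arbitrarily small. *)
Lemma F_shift_le t x a : 0 <= t -> 0 < a -> Fsol (t, x - a) <= Vsol (t, x).
Proof.
move=> t0 a0; apply/ler_addgt0Pr => e e0.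
have [m hm] : exists m, eta m <= e * a / 4 by apply: eta_small; rewrite divr_gt0// mulr_gt0.
have a2 : 0 < a / 2 by rewrite divr_gt0.
have h1 := @F_le (t, x - a) m (a / 2) t0 a2.
have h2 := @V_ge (t, x) m (a / 2) t0 a2.
move: h1 h2; rewrite /up /lo /= (_ : x - a + a / 2 = x - a / 2); last by field.
have : eta m / (a / 2) <= e / 2.
  by rewrite ler_pdivrMr// (_ : e / 2 * (a / 2) = e * a / 4)//; field.
lra.
Qed.

Lemma F_mono t x y : 0 <= t -> x <= y -> Fsol (t, x) <= Fsol (t, y).
Proof.
move=> t0 xy; apply: F_ge => m dl d0.
apply: (le_trans (@F_le (t, x) m dl t0 d0)).
by rewrite lerD2r; apply: hmono => //=; rewrite lerD2r.
Qed.

Lemma V_mono t x y : 0 <= t -> x <= y -> Vsol (t, x) <= Vsol (t, y).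
Proof.
move=> t0 xy; apply: V_le => m dl d0; apply: le_trans (@V_ge (t, y) m dl t0 d0).
by rewrite lerD2r; apply: hmono => //=; rewrite lerD2r.
Qed.

Lemma F_bound z : halfplane z -> `|Fsol z| <= 2.
Proof.
move=> z0; rewrite ler_norml; apply/andP; split.
  apply: F_ge => m dl d0; have := @hb m (z.1, z.2 + dl) z0.
  by have := q0 m d0; rewrite ler_norml /up => ? /andP[? _]; lra.
apply: (le_trans (@F_le z 0 1 z0 ltr01)); have := @hb 0 (z.1, z.2 + 1) z0.
by rewrite /up /eta !invr1 mulr1 ler_norml => /andP[_ ?]; lra.
Qed.

Let lip_near m b z e : halfplane z -> 0 < e ->
  exists2 W, nbhs z W & forall y, W y -> halfplane y -> `|h m (y.1, y.2 + b) - h m (z.1, z.2 + b)|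
    < e.
Proof.
move=> z0 e0; have [C C0 hC] := hlip m.
have r0 : 0 < e / (2 * (C + 1)) by rewrite divr_gt0// mulr_gt0// ltr_wpDl.
exists [set y | `|z - y| < e / (2 * (C + 1))].
  by apply/(@nbhs_normP _ (R * R)%type); exists (e / (2 * (C + 1))).
move=> y /= zy y0; apply: le_lt_trans (hC (y.1, y.2 + b) (z.1, z.2 + b) y0 z0) _.
rewrite /= opprD addrACA subrr addr0.
have n1 : `|y.1 - z.1| <= `|z - y| by rewrite distrC [leRHS]prod_normE/= le_max lexx.
have n2 : `|y.2 - z.2| <= `|z - y| by rewrite distrC [leRHS]prod_normE/= le_max lexx orbT.
have C1 : 0 < C + 1 by rewrite ltr_wpDl.
rewrite ltr_pdivlMr ?mulr_gt0// in zy.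
have := ler_wpM2l C0 (lerD n1 n2); have := normr_ge0 (z - y); lra.
Qed.

Lemma F_usc z a : halfplane z -> Fsol z < a ->
  exists2 W, nbhs z W & forall y, W y -> halfplane y -> Fsol y < a.
Proof.
move=> z0 Fa; have [|r [m [dl [d0 ->]]] ra] := inf_lt _ Fa; first by exists (up 0 1 z), 0%N, 1.
have [|W zW hW] := @lip_near m dl z (a - up m dl z) z0; first by rewrite subr_gt0.
exists W => // y Wy y0; apply: le_lt_trans (F_le m y0 d0) _.
have := hW y Wy y0; rewrite ltr_norml => /andP[_]; rewrite /up; lra.
Qed.

Lemma V_lsc z a : halfplane z -> a < Vsol z ->
  exists2 W, nbhs z W & forall y, W y -> halfplane y -> a < Vsol y.
Proof.
move=> z0 Fa; have [|r [m [dl [d0 ->]]] ra] := sup_gt _ Fa; first by exists (lo 0 1 z), 0%N, 1.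
have [|W zW hW] := @lip_near m (- dl) z (lo m dl z - a) z0; first by rewrite subr_gt0.
exists W => // y Wy y0; apply: lt_le_trans (V_ge m y0 d0).
have := hW y Wy y0; rewrite ltr_norml => /andP[+ _]; rewrite /lo; lra.
Qed.

Lemma near_left (z : R * R) W (b : R) : nbhs z W -> 0 < b -> exists a, [/\ 0 < a, a <= b & W
  (z.1, z.2 - a)].
Proof.
move=> zW b0.
move/(@nbhs_normP _ (R * R)%type) : zW => -[r r0 hr].
exists (Num.min b (r / 2)); have r2 : 0 < r / 2 by rewrite divr_gt0.
have m0 : 0 < Num.min b (r / 2) by rewrite lt_min b0.
split => //; first by rewrite ge_min lexx.
apply: hr; rewrite /ball_/=.
rewrite [X in X < _](_ : _ = Num.max `|z.1 - z.1| `|z.2 - (z.2 - Num.min b (r / 2))|)//.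
rewrite subrr normr0 (_ : z.2 - (z.2 - _) = Num.min b (r / 2)); last by ring.
rewrite max_r// gtr0_norm//.
by apply: (@le_lt_trans _ _ (r / 2)); [rewrite ge_min lexx orbT|lra].
Qed.

Lemma near_right (z : R * R) W (b : R) : nbhs z W -> 0 < b -> exists a, [/\ 0 < a, a <= b & W
  (z.1, z.2 + a)].
Proof.
move=> zW b0.
move/(@nbhs_normP _ (R * R)%type) : zW => -[r r0 hr].
exists (Num.min b (r / 2)); have r2 : 0 < r / 2 by rewrite divr_gt0.
have m0 : 0 < Num.min b (r / 2) by rewrite lt_min b0.
split => //; first by rewrite ge_min lexx.
apply: hr; rewrite /ball_/=.
rewrite [X in X < _](_ : _ = Num.max `|z.1 - z.1| `|z.2 - (z.2 + Num.min b (r / 2))|)//.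
rewrite subrr normr0 (_ : z.2 - (z.2 + _) = - Num.min b (r / 2)); last by ring.
rewrite normrN max_r// gtr0_norm//.
by apply: (@le_lt_trans _ _ (r / 2)); [rewrite ge_min lexx orbT|lra].
Qed.

(** Just to the left of [z], [Fsol] is at most [Vsol z] by [F_shift_le], which bounds the envelope
    from above. Conversely [Vsol] is lower semicontinuous and below [Fsol]. *)
Lemma lsc_envF z : halfplane z -> lsc_env Fsol z = Vsol z.
Proof.
move=> z0; apply/eqP; rewrite eq_le; apply/andP; split.
  apply: (env_le F_bound) => // W zW.
  have [a [a0 _ Wa]] := near_left zW ltr01.
  exists (z.1, z.2 - a); split => //.
  by case: z z0 {zW Wa} => t x t0; exact: F_shift_le.
rewrite leNgt; apply/negP => lt.
pose c := (lsc_env Fsol z + Vsol z) / 2; have cV : c < Vsol z by rewrite /c; lra.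
suff : c <= lsc_env Fsol z by rewrite /c; lra.
apply: (env_ge F_bound) => //.
have [W zW hW] := V_lsc z0 cV; exists W => // y Wy y0.
by rewrite ltW// (lt_le_trans (hW y Wy y0))// V_le_F.
Qed.

Lemma F_subsolution : subsolution Fsol.
Proof.
split.
  apply/lscP => z a z0 az; have [|W zW hW] := @F_usc z (- a) z0; first by rewrite ltrNr.
  by exists W => // y Wy y0; rewrite ltrNr; exact: hW.
move=> phi sphi cphi z0 z00 mx; rewrite -[Eplus phi z0]mul1r.
apply: (viscosity_stability (s := 1) (C := 2) (F := Fsol)) => //; first by left.
  by move=> z zh zz; rewrite !mul1r; exact: mx.
(* The choice [eta m <= dl ^+ 2] makes the additive error [eta m / dl] at most [dl]. It occurs once
   in the upper and once in the lower function, hence the constant [C = 2]. *)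
move=> dl d0 d1; have [m hm] : exists m, eta m <= dl ^+ 2 by apply: eta_small; rewrite exprn_gt0.
have hd : eta m / dl <= dl by rewrite ler_pdivrMr// -expr2.
exists (fun z => shift dl (h m) z + eta m / dl), (shift dl (ht m)), (shift dl (hx m)); split.
- by apply: classical_solution_shift; exact: smooth_classical (hN m).
- by move=> z zh; rewrite !mul1r; exact: F_le.
move=> [t x] zh; rewrite !mul1r mulr1 /shift /=.
have h1 := @V_ge (t, x + 2 * dl) m dl zh d0; have h2 := @V_le_F (t, x + 2 * dl) zh.
move: h1; rewrite /lo /= (_ : x + 2 * dl - dl = x + dl); last by ring.
lra.
Qed.

Lemma F_supersolution : supersolution (lsc_env Fsol).
Proof.
split.
  apply/lscP => z a z0; rewrite lsc_envF// => az; have [W zW hW] := V_lsc z0 az.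
  by exists W => // y Wy y0; rewrite lsc_envF//; exact: hW.
move=> phi sphi cphi z0 z00 mn; rewrite -oppr_le0 -mulN1r.
apply: (viscosity_stability (s := -1) (C := 2) (F := Vsol)) => //; first by right.
  move=> z zh zz; rewrite !mulN1r ltrN2; have := mn z zh zz.
  by rewrite !lsc_envF//; exact: ltW.
move=> dl d0 d1; have [m hm] : exists m, eta m <= dl ^+ 2 by apply: eta_small; rewrite exprn_gt0.
have hd : eta m / dl <= dl by rewrite ler_pdivrMr// -expr2.
exists (fun z => shift (- dl) (h m) z + - (eta m / dl)), (shift (- dl) (ht m)), (shift (- dl) (hx
  m)); split.
- by apply: classical_solution_shift; exact: smooth_classical (hN m).
- by move=> z zh; rewrite !mulN1r lerN2; exact: V_ge.
move=> [t x] zh; rewrite !mulN1r /shift /=.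
have zh' : halfplane (t, x + 2 * -1 * dl) by [].
have h1 := @F_le (t, x + 2 * -1 * dl) m dl zh' d0; have h2 := V_le_F zh'.
move: h1; rewrite /up /= (_ : x + 2 * -1 * dl + dl = x - dl); last by ring.
lra.
Qed.

(** By [F_shift_le] a given rational lies strictly between [Vsol] and [Fsol] at one abscissa at
    most, so the two functions differ on a countable set. *)
Lemma F_eq_V_ae t : 0 <= t -> {ae mu, forall x, Vsol (t, x) = Fsol (t, x)}.
Proof.
move=> t0.
have H : {ae mu, forall x, forall q : rat, ~ (Vsol (t, x) < ratr q < Fsol (t, x))}.
  apply: ae_countable => q.
  have [[x hx']|nx] := pselect (exists x, Vsol (t, x) < ratr q < Fsol (t, x)).
    exists [set x]; split => //; first exact: lebesgue_measure_set1.
    move=> y /= /contrapT hy; have [xy|yx|//] := ltgtP x y.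
      have := @F_shift_le t y (y - x) t0; rewrite subr_gt0 => /(_ xy).
      rewrite (_ : y - (y - x) = x); last by ring.
      by move: hx' hy => /andP[_ a] /andP[b _]; lra.
    have := @F_shift_le t x (x - y) t0; rewrite subr_gt0 => /(_ yx).
    rewrite (_ : x - (x - y) = y); last by ring.
    by move: hx' hy => /andP[b _] /andP[_ a]; lra.
  by apply: aeW => x hx'; apply: nx; exists x.
apply: ae_imply H => x H; apply/eqP; rewrite eq_le (@V_le_F (t, x) t0)/= leNgt.
apply/negP => lt; have [q] := rat_in_itvoo lt; rewrite in_itv/=; exact: H.
Qed.

Lemma V_le_M x : Vsol (0, x) <= M x.
Proof. by apply: V_le => m dl d0; have /andP[] := @hi m x dl d0. Qed.

Lemma M_le_F x : M x <= Fsol (0, x).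
Proof. by apply: F_ge => m dl d0; have /andP[] := @hi m x dl d0. Qed.

Lemma F_solves : solves_Cauchy mu0 Fsol.
Proof.
split.
- exists 2; split; first exact: num_real.
  by move=> y hy z zh; apply: (le_trans (F_bound zh)); exact: ltW.
- split; first by move=> t t0 x y; exact: F_mono.
  by split; [exact: F_subsolution|exact: F_supersolution].
split.
  apply: ae_imply (F_eq_V_ae (lexx 0)) => x E; rewrite hM; congr EFin.
  by apply/eqP; rewrite eq_le M_le_F -E V_le_M.
apply: ae_imply (F_eq_V_ae (lexx 0)) => x E; rewrite hM lsc_envF; last exact: lexx.
by congr EFin; apply/eqP; rewrite eq_le V_le_M E M_le_F.
Qed.

Lemma ae_point (Q : R -> Prop) x y : x < y -> {ae mu, forall z, Q z} ->
  exists z, x < z < y /\ Q z.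
Proof.
move=> xy [A [mA A0 QA]]; apply: contrapT => no.
have : (mu `]x, y[%classic <= mu A)%E.
  apply: le_measure; [by rewrite inE; exact: measurable_itv|by rewrite inE|].
  move=> z /=; rewrite in_itv/= => zxy; apply: QA => /= Qz; apply: no.
  by exists z.
rewrite A0 lebesgue_measure_itv/= lte_fin xy -EFinB lee_fin; lra.
Qed.

(** The initial condition holds only almost everywhere, so [x] has to be moved to a nearby good
    point and the displacement [a] is taken off [dl]. This bounds the resulting increase of the
    additive error. *)
Let gap m dl e : 0 < dl -> 0 < e -> exists2 b, 0 < b < dl &
  forall a, 0 < a -> a < b -> eta m / (dl - a) <= eta m / dl + e.
Proof.
move=> d0 e0; have p0 : 0 < eta m + e * dl by rewrite addr_gt0// mulr_gt0.
exists (e * dl ^+ 2 / (2 * (eta m + e * dl))).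
  rewrite divr_gt0 ?mulr_gt0 ?exprn_gt0//= ltr_pdivrMr ?mulr_gt0//.
  have := mulr_gt0 e0 (exprn_gt0 2 d0); have := mulr_gt0 d0 (eta0 m); nra.
move=> a a0; rewrite ltr_pdivlMr ?mulr_gt0// => ab.
have ad : a < dl.
  rewrite ltNge; apply/negP => da.
  have h1 : dl * (2 * (eta m + e * dl)) <= a * (2 * (eta m + e * dl)).
    by rewrite ler_wpM2r// mulr_ge0// ltW.
  have := mulr_gt0 e0 (exprn_gt0 2 d0); have := mulr_gt0 d0 (eta0 m).
  by rewrite expr2 in ab *; nra.
rewrite ler_pdivrMr ?subr_gt0// (_ : (eta m / dl + e) * (dl - a) =
  eta m + (e * dl ^+ 2 - a * (eta m + e * dl)) / dl); last first.
  by field; rewrite gt_eqF.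
by rewrite lerDl divr_ge0 ?ltW//; have := mulr_gt0 a0 p0; lra.
Qed.

Section uniqueness.
Variables (G : R * R -> R) (K : R).
Hypothesis GK : forall z, halfplane z -> `|G z| <= K.
Hypothesis Gm : forall t, 0 <= t -> {homo (fun x => G (t, x)) : x y / x <= y}.
Hypothesis Gsub : subsolution G.
Hypothesis Gsup : supersolution (lsc_env G).
Hypothesis Gi : initial_condition mu0 G.

Let G_usc z a : halfplane z -> G z < a ->
  exists2 V, nbhs z V & forall y, V y -> halfplane y -> G y < a.
Proof.
move=> zh az; have /lscP Gl := Gsub.1.
have [|W zW hW] := Gl z (- a) zh; first by rewrite ltrN2.
by exists W => // y Wy yh; rewrite -ltrN2; exact: hW.
Qed.

(** Compare [G] with each upper function. At time 0, monotonicity bounds [G] at [x] by its value at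
    a good point slightly to the right, where it equals [M]. *)
Lemma sub_le_F z : halfplane z -> G z <= Fsol z.
Proof.
case: z => t x t0; apply: F_ge => m dl d0.
rewrite -[leLHS]mul1r -[leRHS]mul1r.
apply: (@viscosity_comparison R 1 K G (up m dl) (shift dl (ht m)) (shift dl (hx m))) => //.
- by left.
- exact: smooth_solution_shift.
- move=> z a zh; rewrite mul1r => za; have [W zW hW] := G_usc zh za.
  by exists W => // y Wy yh; rewrite mul1r; exact: hW.
- move=> phi sphi cphi z0 z00 mx; rewrite mul1r; apply: Gsub.2 => // z zh zz.
  by have := mx z zh zz; rewrite !mul1r.
move=> {x t0}x; rewrite !mul1r; apply/ler_addgt0Pr => e e0.
have [b /andP[b0 bd] hb'] := gap m d0 e0.
have [|y [/andP[xy yb]]] := @ae_point (fun x => (G (0, x))%:E = mu0 `]-oo, x]%classic) x (x + b) _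
  Gi.1.
  by rewrite ltrDl.
rewrite hM => -[Gy].
have a0 : 0 < y - x by rewrite subr_gt0.
have ab : y - x < b by rewrite ltrBlDl.
apply: (le_trans (Gm (lexx 0) (ltW xy))); rewrite Gy.
have da : 0 < dl - (y - x) by lra.
have /andP[_] := hi m y da.
rewrite /up/= (_ : y + (dl - (y - x)) = x + dl); last by ring.
by have := hb' _ a0 ab; lra.
Qed.

Lemma V_le_super z : halfplane z -> Vsol z <= lsc_env G z.
Proof.
case: z => t x t0; apply: V_le => m dl d0.
suff : -1 * lsc_env G (t, x) <= -1 * lo m dl (t, x) by rewrite !mulN1r lerN2.
apply: (@viscosity_comparison R (-1) K (lsc_env G) (lo m dl) (shift (- dl) (ht m)) (shift (- dl)
  (hx m))) => //.
- by right.
- exact: smooth_solution_shift.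
- by move=> z zh; exact: env_bound.
- move=> z a zh za; have /lscP Gl := Gsup.1.
  have [|W zW hW] := Gl z (- a) zh; first by lra.
  by exists W => // y Wy yh; have := hW y Wy yh; lra.
- move=> phi sphi cphi z0 z00 mx; rewrite mulN1r oppr_le0; apply: Gsup.2 => // z zh zz.
  by have := mx z zh zz; rewrite !mulN1r ltrN2.
move=> {x t0}x; rewrite !mulN1r lerN2; apply/ler_addgt0Pr => e e0.
have [b /andP[b0 bd] hb'] := gap m d0 e0.
have [|y [/andP[yb xy]]] := @ae_point (fun x => (lsc_env G (0, x))%:E = mu0 `]-oo, x]%classic) (x
  - b) x _ Gi.2.
  by rewrite ltrBlDr ltrDl.
rewrite hM => -[Gy].
have a0 : 0 < x - y by rewrite subr_gt0.
have ab : x - y < b by lra.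
have := env_mono GK Gm (lexx 0) (ltW xy); rewrite Gy.
have da : 0 < dl - (x - y) by lra.
have /andP[+ _] := hi m y da.
rewrite /lo/= (_ : y - (dl - (x - y)) = x - dl); last by ring.
by have := hb' _ a0 ab; lra.
Qed.

(** To the right of [x], [G] dominates its envelope, which dominates [Vsol], and this dominates
    [Fsol] at [x] by [F_shift_le]. Upper semicontinuity of [G] brings the inequality back to [x]. *)
Lemma F_le_sub z : halfplane z -> Fsol z <= G z.
Proof.
case: z => t x t0; rewrite leNgt; apply/negP => lt.
have [W zW hW] := G_usc (z := (t, x)) t0 lt.
have [a [a0 _ /= Wa']] := near_right zW ltr01.
have := hW _ Wa' t0.
have := @F_shift_le t (x + a) a t0 a0; rewrite addrK.
have := @V_le_super (t, x + a) t0; have := env_le_self GK (z := (t, x + a)) t0.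
lra.
Qed.

End uniqueness.

Lemma F_unique G : solves_Cauchy mu0 G -> forall t y, 0 <= t -> G (t, y) = Fsol (t, y).
Proof.
move=> [[K [_ hK]] [Gm [Gsub Gsup]] Gi] t y t0.
have GK z : halfplane z -> `|G z| <= K + 1 by move=> zh; apply: (hK (K + 1)) => //; rewrite ltrDl.
by apply/eqP; rewrite eq_le (sub_le_F GK Gm Gsub Gi)//= (F_le_sub GK Gm Gsub Gsup Gi).
Qed.

Lemma F_eq_V_ae_plane : {ae (mu \x mu)%E, forall z : R * R, 0 <= z.1 -> Vsol z = Fsol z}.
Proof.
have /choice[mm hm] : forall k, exists m, eta m <= (k.+1%:R^-1) ^+ 2.
  by move=> k; apply: eta_small; rewrite exprn_gt0// invr_gt0.
(* Slice by slice the claim is [F_eq_V_ae], but the exceptional set of the plane needs a measurable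
   cover. The Lipschitz functions [g k] dominate the gap [Fsol - Vsol], so [A] contains every point
   where the gap is positive; negative times are sent to 0. *)
pose g k (z : R * R) : R := up (mm k) k.+1%:R^-1 (Num.max z.1 0, z.2) - lo (mm k) k.+1%:R^-1
  (Num.max z.1 0, z.2).
have d0 k : 0 < k.+1%:R^-1 :> R by rewrite invr_gt0.
pose A : set (R * R) := \bigcup_(j in [set: nat]) \bigcap_(k in [set: nat]) ~` [set z | g k z <
  j.+1%:R^-1].
have mA : measurable (A : set (measurableTypeR R * measurableTypeR R)).
  apply: bigcupT_measurable => j; apply: bigcapT_measurable => k; apply: measurableC.
  have [C C0 hC] := hlip (mm k).
  apply: (@lip_lt_measurable R (g k) (C + C)); first by rewrite addr_ge0.
  move=> z z'; have m0 (a : R) : 0 <= Num.max a 0 by rewrite le_max lexx orbT.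
  have mm0 : `|Num.max z.1 0 - Num.max z'.1 0| <= `|z.1 - z'.1|.
    rewrite /Num.max; case: ltP => [z0|z0]; case: ltP => [z0'|z0'].
    - by rewrite subrr normr0.
    - by rewrite ler_norml; have := ler_norm (z.1 - z'.1); have := ler_normr (z.1 - z'.1) (z'.1 -
      z.1); have := ler_norm (z'.1 - z.1); rewrite distrC => ? ? ?; apply/andP; split; lra.
    - by have := ler_norm (z.1 - z'.1) => ?; rewrite ler_norml; apply/andP; split; lra.
    - by [].
  have h1 := hC (Num.max z.1 0, z.2 + k.+1%:R^-1) (Num.max z'.1 0, z'.2 + k.+1%:R^-1) (m0 _) (m0 _).
  have h2 := hC (Num.max z.1 0, z.2 - k.+1%:R^-1) (Num.max z'.1 0, z'.2 - k.+1%:R^-1) (m0 _) (m0 _).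
  rewrite /= (_ : z.2 + k.+1%:R^-1 - (z'.2 + k.+1%:R^-1) = z.2 - z'.2) in h1; last by ring.
  rewrite /= (_ : z.2 - k.+1%:R^-1 - (z'.2 - k.+1%:R^-1) = z.2 - z'.2) in h2; last by ring.
  have h3 := ler_wpM2l C0 mm0; rewrite /g/up/lo/=.
  rewrite (_ : _ - _ = (h (mm k) (Num.max z.1 0, z.2 + k.+1%:R^-1) - h (mm k) (Num.max z'.1
    0, z'.2 + k.+1%:R^-1))
   - (h (mm k) (Num.max z.1 0, z.2 - k.+1%:R^-1) - h (mm k) (Num.max z'.1 0, z'.2 - k.+1%:R^-1)));
     last by ring.
  by apply: (le_trans (ler_normB _ _)); lra.
exists A; split => //.
  rewrite /product_measure1/= integral0_eq// => t _ /=.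
  have t0 : 0 <= Num.max t 0 by rewrite le_max lexx orbT.
  have [D [mD D0 hD]] := F_eq_V_ae t0.
  apply: (@subset_measure0 _ _ _ mu _ D) => //; first exact: measurable_xsection.
  move=> x; rewrite /xsection/= inE => -[j _ hj]; apply: hD => /= VF.
  pose s := Num.max t 0; have s0 : halfplane (s, x) by [].
  (* Where [Vsol] and [Fsol] agree, some [g k] is below [6 * e]: semicontinuity costs [e] on each
     side, and the additive error, at most [e], enters four times. *)
  pose e : R := j.+1%:R^-1 / 8; have e0 : 0 < e by rewrite divr_gt0// invr_gt0.
  have [|W1 z1 h1] := @F_usc (s, x) (Fsol (s, x) + e) s0; first by rewrite ltrDl.
  have [|W2 z2 h2] := @V_lsc (s, x) (Vsol (s, x) - e) s0; first by rewrite ltrBlDr ltrDl.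
  have [a [a0 _ /= Wa]] := near_right z1 ltr01.
  have [b [b0 _ /= Wb]] := near_left z2 ltr01.
  have [k hk] : exists k, eta k <= Num.min e (Num.min (a / 2) (b / 2)).
    by apply: eta_small; rewrite !lt_min e0/= !divr_gt0.
  move: hk; rewrite !le_min => /and3P[ke ka kb].
  apply: (hj k) => //=; rewrite /g -/s -/(eta k).
  have := h1 _ Wa s0; have := h2 _ Wb s0; rewrite VF -/s => Vb Fa.
  have Fm := @F_mono s (x + eta k + eta k) (x + a) s0.
  have Vm := @V_mono s (x - b) (x - eta k - eta k) s0.
  have f1 := @V_ge (s, x + eta k + eta k) (mm k) (eta k) s0 (eta0 k).
  have f2 := @F_le (s, x - eta k - eta k) (mm k) (eta k) s0 (eta0 k).
  have f3 := @V_le_F (s, x + eta k + eta k) s0.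
  have f4 := @V_le_F (s, x - eta k - eta k) s0.
  have hd : eta (mm k) / eta k <= eta k by rewrite ler_pdivrMr// -expr2 hm.
  move: f1 f2; rewrite /lo/up/= addrK subrK.
  have := Fm _; have := Vm _.
  move=> /(_ ltac:(lra)) Vm' /(_ ltac:(lra)) Fm' f1 f2.
  have -> : j.+1%:R^-1 = 8 * e by rewrite /e mulrC divfK.
  rewrite -/(eta k); clearbody e; lra.
move=> z /= /not_implyP[z0 ne].
have lt : Vsol z < Fsol z by rewrite lt_neqAle V_le_F// andbT; apply/eqP.
have [j hj] : exists j, j.+1%:R^-1 <= Fsol z - Vsol z by apply: eta_small; rewrite subr_gt0.
exists j => // k _ /=; apply/negP; rewrite -leNgt; apply: (le_trans hj).
rewrite /g max_l//; case: z z0 {ne lt hj} => t x t0 /=.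
by rewrite lerB ?F_le ?V_ge.
Qed.

End family.

Section empirical_integral.
Context {R : realType}.

Lemma empirical_integral N (x : 'I_N -> R) (f : R -> R) : measurable_fun setT f ->
  (forall y, 0 <= f y) ->
  (\int[empirical_measure x]_y (f y)%:E)%E = (N%:R^-1 * \sum_(i < N) f (x i))%:E.
Proof.
case: N x => [|n] x mf f0.
  rewrite big_ord0 mulr0.
  rewrite (@eq_measure_integral _ _ _ _ mzero); first by rewrite integral_measure_zero.
  by move=> A mA _; rewrite -[LHS]/(empirical_measure x A) /empirical_measure big_ord0 mule0.
have c0 : 0 <= n.+1%:R^-1 :> R by rewrite invr_ge0.
pose m_ (k : nat) : {measure set R -> \bar R} := \d_(x (inord k)).
have mf' : measurable_fun setT (EFin \o f) by exact/measurable_EFinP.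
rewrite (@eq_measure_integral _ _ _ _ (mscale (NngNum c0) (msum m_ n.+1))); last first.
  move=> A mA _; rewrite /empirical_measure/= /mscale/= /msum/= /m_.
  by congr (_ * _)%E; apply: eq_bigr => i _; rewrite inord_val.
rewrite ge0_integral_mscale//; last by move=> y _; rewrite lee_fin.
rewrite (@ge0_integral_measure_sum _ _ _ m_)//; last by move=> y _; rewrite lee_fin.
rewrite EFinM -sumEFin; congr (_ * _)%E; apply: eq_bigr => i _.
by rewrite integral_dirac// diracT mul1e inord_val.
Qed.

End empirical_integral.

Section envelopes.
Context {R : realType}.
Variables (G G' : R * R -> R) (M M' : R).
Hypothesis GM : forall z, halfplane z -> `|G z| <= M.
Hypothesis GM' : forall z, halfplane z -> `|G' z| <= M'.

Lemma lsc_env_le z : (forall z, halfplane z -> G z <= G' z) -> halfplane z ->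
  lsc_env G z <= lsc_env G' z.
Proof.
move=> GG z0; rewrite leNgt; apply/negP => h.
pose c := (lsc_env G z + lsc_env G' z) / 2.
have [|W zW hW] := @env_near R G M GM z c z0; first by rewrite /c; lra.
have : c <= lsc_env G' z.
  apply: (env_ge GM') => //; exists W => // y Wy y0.
  by apply: ltW; apply: lt_le_trans (hW y Wy y0) _; exact: GG.
rewrite /c; lra.
Qed.

End envelopes.

(** * Empirical distribution functions along one sample path *)

Section onepath.
Context {R : realType}.
Local Notation mu := (@lebesgue_measure R).
Variables (x : forall N, 'I_N -> R) (mu0 : {measure set R -> \bar R}).
Hypothesis Hw : weakly_converges (fun N => empirical_measure (@x N)) mu0.

Lemma initial_limit (f : R -> R) : continuous f -> (forall y, 0 <= f y <= 1) ->
  (N%:R^-1 * \sum_(i < N) f (@x N i))%:E @[N --> \oo] --> (\int[mu0]_y (f y)%:E)%E.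
Proof.
move=> cf fb; have f0 y : 0 <= f y by have /andP[] := fb y.
have bf : bounded_fun f.
  exists 1; split; first exact: num_real.
  move=> c c1 y _ /=; rewrite ger0_norm//; apply: le_trans (ltW c1).
  by have /andP[] := fb y.
have := Hw cf bf; apply: cvg_trans; apply: near_eq_cvg; near=> N.
by rewrite empirical_integral//; exact: continuous_measurable_fun.
Unshelve. all: by end_near. Qed.

(** Testing weak convergence against the constant 1 shows that no mass is lost in the limit. *)
Lemma limit_measure_setT : mu0 setT = 1%E.
Proof.
have := @initial_limit (fun=> 1) (fun z => @cvg_cst _ _ _ _ _).
have -> : (\int[mu0]_y (1%:E : \bar R))%E = mu0 setT by rewrite integral_cst// mul1e.
move=> h; have {}h : (N%:R^-1 * \sum_(i < N) 1)%:E @[N --> \oo] --> mu0 setT by apply: h => y;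
  rewrite ler01 lexx.
apply: (cvg_unique (@ereal_hausdorff R) h).
apply: cvg_near_cst; near=> N; congr EFin.
rewrite sumr_const card_ord -mulr_natl mulr1 mulVf// pnatr_eq0 -lt0n.
by near: N; exists 1%N.
Unshelve. all: by end_near. Qed.

Let mI y : measurable (`]-oo, y]%classic : set R).
Proof. exact: measurable_itv. Qed.

Definition cdf0 y : R := fine (mu0 `]-oo, y]%classic).

Lemma cdf0E y : mu0 `]-oo, y]%classic = (cdf0 y)%:E.
Proof.
rewrite /cdf0 fineK// ge0_fin_numE//; apply: (@le_lt_trans _ _ (mu0 setT)).
  by apply: le_measure; rewrite ?inE.
by rewrite limit_measure_setT ltry.
Qed.

Lemma Theta_01 eta (w : R) : 0 <= Theta eta w <= 1.
Proof.
have := atan_gtNpi2 (w / eta); have := atan_ltpi2 (w / eta); rewrite /Theta => h1 h2.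
have p0 := @pi_gt0 R; rewrite mulrC.
have a1 : atan (w / eta) / pi < 1 / 2 by rewrite ltr_pdivrMr//; lra.
have a2 : - (1 / 2) < atan (w / eta) / pi by rewrite ltr_pdivlMr//; lra.
by apply/andP; split; lra.
Qed.

Lemma Theta_cont eta : 0 < eta -> continuous (@Theta R eta).
Proof.
move=> eta0 w; apply: differentiable_continuous; apply/derivable1_diffP.
by have [] := is_derive_Theta w eta0.
Qed.

Lemma Theta_int eta y : 0 < eta -> exists2 r, (\int[mu0]_z (Theta eta (y - z))%:E)%E = r%:E &
  N%:R^-1 * \sum_(i < N) Theta eta (y - @x N i) @[N --> \oo] --> r.
Proof.
move=> eta0; have := @initial_limit (fun z => Theta eta (y - z)).
have c : continuous (fun z => Theta eta (y - z)).
  move=> z; apply: (@continuous_comp _ _ _ (fun z => y - z) (Theta eta)).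
    by apply: cvgB; [exact: cvg_cst|exact: cvg_id].
  exact: Theta_cont.
move=> /(_ c (fun z => Theta_01 eta _)); set I := (\int[mu0]_z _)%E => h.
have Ifin : I \is a fin_num.
  rewrite ge0_fin_numE.
    apply: (@le_lt_trans _ _ (\int[mu0]_z 1%:E)%E); last by rewrite integral_cst// mul1e
      limit_measure_setT ltry.
    apply: ge0_le_integral => //.
    - by move=> z _; rewrite lee_fin; have /andP[] := Theta_01 eta (y - z).
    - by apply/measurable_EFinP; exact: continuous_measurable_fun.
    - by move=> z _; rewrite lee_fin; have /andP[] := Theta_01 eta (y - z).
  by apply: integral_ge0 => z _; rewrite lee_fin; have /andP[] := Theta_01 eta (y - z).
exists (fine I); first by rewrite fineK.
by move: h; rewrite -{1}(fineK Ifin) => /fine_cvg.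
Qed.

Lemma Theta_int_bounds eta y dl r : 0 < eta -> 0 < dl ->
  ((\int[mu0]_z (Theta eta (y - dl - z))%:E)%E = r%:E -> r - eta / dl <= cdf0 y) /\
  ((\int[mu0]_z (Theta eta (y + dl - z))%:E)%E = r%:E -> cdf0 y <= r + eta / dl).
Proof.
move=> eta0 d0; have q0 : 0 <= eta / dl by rewrite divr_ge0// ltW.
have mT (a : R) : measurable_fun setT (fun z : R => (Theta eta (a - z))%:E).
  apply/measurable_EFinP; apply: continuous_measurable_fun => z.
  apply: (@continuous_comp _ _ _ (fun z => a - z) (Theta eta)).
    by apply: cvgB; [exact: cvg_cst|exact: cvg_id].
  exact: Theta_cont.
have T0 (a z : R) : (0 <= (Theta eta (a - z))%:E)%E by rewrite lee_fin;
  have /andP[] := Theta_01 eta (a - z).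
have mc : measurable_fun (setT : set R) (fun=> (eta / dl)%:E : \bar R) by [].
have mi : measurable_fun setT (fun z : R => (\1_(`]-oo, y]%classic : set R) z)%:E : \bar R).
  by apply/measurable_EFinP; exact: measurable_indic.
have i0 z : (0 <= (\1_(`]-oo, y]%classic : set R) z)%:E :> \bar R)%E by rewrite lee_fin.
have c0 (z : R) : (0 <= (eta / dl)%:E)%E by rewrite lee_fin.
have iE z : \1_(`]-oo, y]%classic : set R) z = (z <= y)%R%:R :> R.
  by rewrite indicE; congr (nat_of_bool _)%:R; apply/idP/idP; rewrite inE/= in_itv.
have Ic : (\int[mu0]_z (eta / dl)%:E = (eta / dl)%:E)%E by rewrite integral_cst//
  limit_measure_setT mule1.
have Ii : (\int[mu0]_z (\1_(`]-oo, y]%classic : set R) z)%:E = (cdf0 y)%:E)%E.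
  by rewrite integral_indic// setIT cdf0E.
split => rE.
- rewrite lerBlDr -lee_fin EFinD -rE -Ii -Ic -ge0_integralD//.
  apply: ge0_le_integral => //; first exact: emeasurable_funD.
  move=> z _; rewrite -EFinD lee_fin iE.
  by have /andP[+ _] := Theta_step eta0 y z d0; rewrite lerBlDr.
rewrite -lee_fin EFinD -rE -Ii -Ic -ge0_integralD//.
apply: ge0_le_integral => //; first exact: emeasurable_funD.
by move=> z _; rewrite -EFinD lee_fin iE; have /andP[] := Theta_step eta0 y z d0.
Qed.

Section path.
Variable lam : forall N : nat, 'I_N -> R -> R.
Hypothesis lam0 : forall N (i : 'I_N), lam i 0 = x i.
Hypothesis lamD : forall m, limit_dynamics lam m.+1%:R^-1.

Let eta m : R := m.+1%:R^-1.
Let eta0 m : 0 < eta m. Proof. by rewrite invr_gt0. Qed.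

Definition ecdf (z : R * R) (N : nat) : R := empirical_cdf (fun i => @lam N i z.1) z.2.

Lemma ecdf_avg z N : ecdf z N = part_avg lam N z.1 (fun y => (y <= z.2)%R%:R).
Proof.
rewrite /ecdf /empirical_cdf /part_avg; congr (_ * _).
by rewrite -sum1_card natr_sum big_mkcond/=; apply: eq_bigr => i _; rewrite inE; case: ifP.
Qed.

Lemma part_avg_mono N t f g : (forall y, f y <= g y) -> part_avg lam N t f <= part_avg lam N t g.
Proof. by move=> fg; rewrite /part_avg ler_wpM2l ?invr_ge0//; apply: ler_sum. Qed.

Lemma part_avg_addc N t f c : 0 <= c -> part_avg lam N t (fun y => f y + c) <= part_avg lam N t f
  + c.
Proof.
move=> c0; rewrite -lerBlDl part_avgB; apply: (le_trans (ler_norm _)).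
by apply: part_avg_bound => // y; rewrite addrAC subrr add0r ger0_norm.
Qed.

Lemma ecdf_bounds m N t y dl : 0 < dl ->
  obs_avg lam (eta m) TT (y - dl) N t - eta m / dl <= ecdf (t, y) N <=
  obs_avg lam (eta m) TT (y + dl) N t + eta m / dl.
Proof.
move=> d0; have q0 : 0 <= eta m / dl by rewrite divr_ge0// ltW.
rewrite ecdf_avg/=; apply/andP; split.
  rewrite lerBlDr; apply: le_trans (part_avg_addc _ _ _ q0); apply: part_avg_mono => z.
  by have /andP[+ _] := Theta_step (eta0 m) y z d0; rewrite lerBlDr.
apply: le_trans (part_avg_addc _ _ _ q0); apply: part_avg_mono => z.
by have /andP[] := Theta_step (eta0 m) y z d0.
Qed.

Lemma ecdf_norm z N : `|ecdf z N| <= 1.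
Proof. by rewrite ecdf_avg; apply: part_avg_bound => // y; case: (y <= z.2);
  rewrite ?normr1 ?normr0 ?ler01. Qed.

Section ultra.
Variables (U : set_system nat) (UU : UltraFilter U) (Uoo : \oo `<=` U).

Let pU : ProperFilter U := ultra_proper.

Definition hU m (z : R * R) : R := ulim lam U (eta m) TT z.1 z.2.
Definition FU := Fsol hU.
Definition VU := Vsol hU.

Let hU_cvg m t y : obs_avg lam (eta m) TT y N t @[N --> U] --> hU m (t, y).
Proof. exact: ulim_cvg. Qed.

Let h_N m : smooth_solution (hU m) (fun z => ulim_drift lam U (eta m) TT z.1 z.2)
  (fun z => pi^-1 * ulim lam U (eta m) (TE EA) z.1 z.2).
Proof. exact: (ulim_smooth_solution UU Uoo (eta0 m) (lamD m)). Qed.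

Let h_mono m t y y' : 0 <= t -> y <= y' -> hU m (t, y) <= hU m (t, y').
Proof.
move=> _ yy; refine (@limU_le R U UU Uoo _ _ _ _ (@hU_cvg m t y) (@hU_cvg m t y') _).
by apply: nearW => N; apply: part_avg_mono => z; apply: Theta_mono => //; lra.
Qed.

Let h_lip m : exists2 C, 0 <= C & forall z z', halfplane z -> halfplane z' ->
  `|hU m z - hU m z'| <= C * (`|z.1 - z'.1| + `|z.2 - z'.2|).
Proof.
have [C C0 hC] := ulim_time UU Uoo (eta0 m) (lamD m) TT.
have [K K0 hK] := ulim_lip_x lam UU Uoo (eta0 m) TT.
exists (C + K); first exact: addr_ge0.
move=> [t y] [t' y'] t0 t'0; rewrite /hU/=.
rewrite (_ : _ - _ = (ulim lam U (eta m) TT t y - ulim lam U (eta m) TT t' y) +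
  (ulim lam U (eta m) TT t' y - ulim lam U (eta m) TT t' y')); last by ring.
apply: (le_trans (ler_normD _ _)).
have [h1 _] := hC t' t y t'0 t0; have h2 := hK t' y y'.
have := mulr_ge0 C0 (normr_ge0 (y - y')); have := mulr_ge0 K0 (normr_ge0 (t - t')).
lra.
Qed.

Let h_b m z : halfplane z -> `|hU m z| <= 1.
Proof. by move=> _; exact: ulim_norm1. Qed.

Let ecdf_lim z l m dl : ecdf z N @[N --> U] --> l -> 0 < dl ->
  hU m (z.1, z.2 - dl) - eta m / dl <= l <= hU m (z.1, z.2 + dl) + eta m / dl.
Proof.
case: z => t y zl d0; apply/andP; split.
  refine (@limU_le R U UU Uoo _ _ _ _ (cvgB (@hU_cvg m t (y - dl)) (cvg_cst (eta m / dl))) zl _).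
  by apply: nearW => N; have /andP[] := ecdf_bounds m N t y d0.
refine (@limU_le R U UU Uoo _ _ _ _ zl (cvgD (@hU_cvg m t (y + dl)) (cvg_cst (eta m / dl))) _).
by apply: nearW => N; have /andP[] := ecdf_bounds m N t y d0.
Qed.

(** Both sides are compared with the limit along [U] of the empirical distribution function, in
    which neither of the two scales occurs. *)
Let h_il m m' t y dl dl' : 0 <= t -> 0 < dl -> 0 < dl' ->
  hU m (t, y - dl) - eta m / dl <= hU m' (t, y + dl') + eta m' / dl'.
Proof.
move=> _ d0 d'0; have c : ecdf (t, y) N @[N --> U] --> lim (ecdf (t, y) N @[N --> U]).
  exact: (@ultra_bounded_cvg R U UU (ecdf (t, y)) 1 (ecdf_norm (t, y))).
have /andP[h1 _] := ecdf_lim m c d0; have /andP[_ h2] := ecdf_lim m' c d'0.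
exact: le_trans h1 h2.
Qed.

Let h_i m y dl : 0 < dl ->
  hU m (0, y - dl) - eta m / dl <= cdf0 y <= hU m (0, y + dl) + eta m / dl.
Proof.
move=> d0.
have hE a : (\int[mu0]_z (Theta (eta m) (a - z))%:E)%E = (hU m (0, a))%:E.
  have [r -> rl] := Theta_int a (eta0 m); congr EFin.
  refine (@cvg_unique _ (@Rhausdorff R) _ _ r _ _ (@hU_cvg m 0 a)).
  apply: cvg_trans; last exact: (cvg_trans (cvg_app _ Uoo) rl).
  apply: near_eq_cvg; near=> N; rewrite /obs_avg/part_avg; congr (_ * _).
  by apply: eq_bigr => i _; rewrite lam0.
have [h1 _] := Theta_int_bounds y (hU m (0, y - dl)) (eta0 m) d0.
have [_ h2] := Theta_int_bounds y (hU m (0, y + dl)) (eta0 m) d0.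
by rewrite h1// h2.
Unshelve. all: by end_near. Qed.

Lemma FU_solves : solves_Cauchy mu0 FU.
Proof. exact: (F_solves h_N h_mono h_lip h_b h_il cdf0E h_i). Qed.

Lemma FU_unique G : solves_Cauchy mu0 G -> forall t y, 0 <= t -> G (t, y) = FU (t, y).
Proof. exact: (F_unique h_N h_b cdf0E h_i). Qed.

Lemma FU_bound z : halfplane z -> `|FU z| <= 2.
Proof. exact: (F_bound h_b). Qed.

Lemma FU_env z : halfplane z -> lsc_env FU z = VU z.
Proof. exact: (lsc_envF h_lip h_b h_il). Qed.

Lemma FU_ae : {ae (mu \x mu)%E, forall z : R * R, 0 <= z.1 -> VU z = FU z}.
Proof. exact: (F_eq_V_ae_plane h_mono h_lip h_b h_il). Qed.

Lemma ecdf_between z l : halfplane z -> ecdf z N @[N --> U] --> l -> VU z <= l <= FU z.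
Proof.
move=> z0 zl; apply/andP; split.
  by apply: V_le => m dl d0; have /andP[] := ecdf_lim m zl d0.
by apply: F_ge => m dl d0; have /andP[] := ecdf_lim m zl d0.
Qed.

End ultra.

(* A failure of convergence would be witnessed by an ultrafilter avoiding a
   neighbourhood of [F z], whose limit nevertheless is squeezed between [VU] and [FU]. *)
Lemma ecdf_cvg (F : R * R -> R) z : solves_Cauchy mu0 F -> halfplane z ->
  lsc_env F z = F z -> ecdf z N @[N --> \oo] --> F z.
Proof.
move=> SF z0 EF; apply/cvgrPdist_lt => e e0.
pose A := [set N | `|F z - ecdf z N| < e]; apply: contrapT => nA.
have pF : ProperFilter (within (~` A) \oo).
  apply: Build_ProperFilter => h; apply: nA.
  have h' : \oo [set N | ~ A N -> False] by exact: h.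
  by move: h'; apply: filterS => N /contrapT.
have [U [UU Uw]] := ultraFilterLemma pF.
have Uoo : \oo `<=` U by move=> S hS; apply: Uw; apply: filterS hS => N.
have UA : U (~` A) by apply: Uw; exact: withinT.
have c : ecdf z N @[N --> U] --> lim (ecdf z N @[N --> U]).
  exact: (@ultra_bounded_cvg R U UU (ecdf z) 1 (ecdf_norm z)).
(* Uniqueness identifies [F], possibly built from another sample point and another ultrafilter, with
   the solution obtained along this [U]. *)
have FE y : halfplane y -> F y = FU U y by case: y => t y; exact: FU_unique.
have VE : VU U z = F z.
  rewrite -FU_env// -EF; have FB y : halfplane y -> `|F y| <= 2.
    by move=> hy; rewrite FE// FU_bound.
  by apply/eqP; rewrite eq_le !(@lsc_env_le _ _ _ 2 2)//;
    do ?[exact: FU_bound]; move=> y hy; rewrite FE.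
have := ecdf_between UU Uoo z0 c; rewrite VE -FE// -eq_le => /eqP E.
move: c; rewrite -E => /cvgrPdist_lt/(_ e e0) UA'.
have pU : ProperFilter U := ultra_proper.
by have [N [/= h1 h2]] := filter_ex (filterI UA UA'); exact: h1.
Qed.

End path.
End onepath.

Theorem theorem3 (R : realType) (d : measure_display) (T : measurableType d)
    (P : probability T R) (Fil : R -> set (set T))
    (x : forall N : nat, 'I_N -> R)
    (B lam : forall N : nat, 'I_N -> R -> T -> R)
    (mu0 : {measure set R -> \bar R}) :
  standard_filtration P Fil ->
  (forall (N : nat) (i j : 'I_N), (i < j)%N -> x N i < x N j) ->
  (forall (N : nat) (i : 'I_N), brownian_motion P Fil (B N i)) ->
  (forall N : nat, (0 < N)%N -> independent_processes P (B N)) ->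
  (forall N : nat, (0 < N)%N -> dyson_solution P Fil (x N) (B N) (lam N)) ->
  weakly_converges (fun N => empirical_measure (x N)) mu0 ->
  exists F : R * R -> R,
    [/\ solves_Cauchy mu0 F,
        (forall G : R * R -> R, solves_Cauchy mu0 G ->
          forall t y : R, 0 <= t -> G (t, y) = F (t, y)) &
        {ae P, forall w, {ae (lebesgue_measure \x lebesgue_measure)%E,
          forall z : R * R, 0 <= z.1 ->
          empirical_cdf (fun i => lam N i z.1 w) z.2 @[N --> \oo] --> F z}}].
Proof.
move=> HF xx HB HI HS Hw.
pose ok w := (forall N (i : 'I_N), path lam w i 0 = x N i) /\
  forall m : nat, limit_dynamics (path lam w) (m.+1%:R^-1 : R).
have aeok : {ae P, forall w, ok w}.
  have B0 : {ae P, forall w, forall N (i : 'I_N), B N i 0 w = 0}.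
    by apply: ae_countable => N; apply: ae_countable => i; have [] := HB N i.
  apply: ae_imply (ae_and (ae_limit_dynamics HF HB HI HS) B0) => w [[gw dw] b0]; split => // N i.
  have [_ _ _ /(_ 0 (lexx 0)) ->] := gw N i.
  by rewrite set_itv1 Rintegral_set1 b0 mulr0 !addr0.
(* One good sample point is enough to build [F]; it exists because the good event has probability
   1. *)
have [w0 [l0 d0]] : exists w, ok w.
  have [Z [mZ Z0 hZ]] := aeok; apply: contrapT => no.
  have : (P setT <= P Z)%E.
    by apply: le_measure; rewrite ?inE// => w _; apply: hZ => /= okw; apply: no; exists w.
  by rewrite probability_setT Z0 lee_fin ler10.
have [U [UU Uoo]] := ultraFilterLemma (F := \oo) _.
pose F := FU (path lam w0) U.
have SF : solves_Cauchy mu0 F by exact: (FU_solves Hw l0 d0 UU Uoo).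
exists F; split => //.
- by move=> G SG t y; exact: (FU_unique Hw l0 d0 UU Uoo SG).
apply: ae_imply aeok => w [lw dw].
(* The exceptional set is read off from [F] alone, so the same null set of the plane serves all good
   sample points [w]. *)
have [Z [mZ Z0 hZ]] := FU_ae d0 UU Uoo.
exists Z; split => // z nz; apply: hZ => /= E; apply: nz => z0; have {}E := E z0.
apply: (ecdf_cvg Hw lw dw SF z0).
by rewrite (FU_env d0 UU Uoo)// E.
Qed.
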